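(* Let the ground model $V$ satisfy $\mathsf{ZFC}+\mathsf{GCH}$, let $\aleph_2<\kappa\le\lambda$ be regular cardinals in $V$, and let $\mathcal I\in\{\mathcal N,\mathcal M,\mathcal K\}$. Each of the following is consistent, i.e. for each item there is a forcing extension of $V$ in which it holds: (1) $\mathfrak c^+=\mathfrak b(\neq^*_{\mathcal I})<\mathfrak d(\neq^*_{\mathcal I})=\kappa=2^{\mathfrak c}$. (2) $\mathfrak c^+<\mathfrak b(\leq^*_{\mathcal I})=\mathfrak d(\neq^*_{\mathcal I})=\kappa=2^{\mathfrak c}$. (3) If moreover $\kappa<\lambda$: $\mathfrak c^+<\mathfrak b(\leq^*_{\mathcal I})=\kappa<\mathfrak d(\leq^*_{\mathcal I})=\lambda=2^{\mathfrak c}$. (4) $\mathfrak c^+<\mathfrak b(\in^*_{\mathcal I})=\kappa=2^{\mathfrak c}$.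
   Context: $\mathfrak c=2^{\aleph_0}$. $\omega^\omega$ is Baire space with Lebesgue measure $\mu$: the (completed) Borel measure with $\mu(N_s)=\prod_{i<\mathrm{length}(s)}2^{-(s(i)+1)}$ for $s\in\omega^{<\omega}$, where $N_s=\{x\in\omega^\omega: s\subseteq x\}$. $\mathcal N$ is the ideal of $\mu$-null subsets of $\omega^\omega$, $\mathcal M$ the ideal of meager subsets of $\omega^\omega$, and $\mathcal K$ the ideal of subsets of $\omega^\omega$ contained in a $\sigma$-compact set. A slalom is a function $s:\omega\to[\omega]^{<\omega}$ with $|s(n)|\le n$ for all $n$; $\mathcal S$ is the set of slaloms. For $x,y\in\omega^\omega$ and $s\in\mathcal S$: $x\leq^* y$ iff $x(n)\le y(n)$ for all but finitely many $n$; $x\neq^* y$ iff $x(n)\ne y(n)$ for all but finitely many $n$; $x\in^* s$ iff $x(n)\in s(n)$ for all but finitely many $n$. For $\mathcal I\in\{\mathcal N,\mathcal M,\mathcal K\}$, $R\in\{\leq^*,\neq^*,\in^*\}$, $f:\omega^\omega\to\omega^\omega$ and $g:\omega^\omega\to\omega^\omega$ ($g:\omega^\omega\to\mathcal S$ if $R$ is $\in^*$), write $f R_{\mathcal I} g$ iff $\{x\in\omega^\omega:\neg\, f(x) R g(x)\}\in\mathcal I$. Then $\mathfrak b(R_{\mathcal I})$ is the least size of a set $A$ of functions $\omega^\omega\to\omega^\omega$ for which there is no $g:\omega^\omega\to\omega^\omega$ (no $g:\omega^\omega\to\mathcal S$ if $R$ is $\in^*$) with $f R_{\mathcal I} g$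 for all $f\in A$; and $\mathfrak d(R_{\mathcal I})$ is the least size of a set $A$ of functions $\omega^\omega\to\omega^\omega$ (functions $\omega^\omega\to\mathcal S$ if $R$ is $\in^*$) such that for every $g:\omega^\omega\to\omega^\omega$ there is $f\in A$ with $g R_{\mathcal I} f$. All these notions are evaluated in the forcing extension. *)

(* Defs.v *)
From Stdlib Require Import ClassicalEpsilon.

Set Implicit Arguments.
Unset Strict Implicit.
Unset Printing Implicit Defensive.

(** * Models of set theory *)

Record structure := Structure {
  carrier :> Type;
  mem : carrier -> carrier -> Prop;
  nonempty : inhabited carrier
}.

Notation "x ∈ y" := (mem x y) (at level 70, no associativity).

Definition ball {M : structure} (a : M) (P : M -> Prop) : Prop :=
  forall x, x ∈ a -> P x.
Definition bex {M : structure} (a : M) (P : M -> Prop) : Prop :=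
  exists x, x ∈ a /\ P x.

Notation "'∀' x .. y ∈ a , P" :=
  (ball a (fun x => .. (ball a (fun y => P)) ..))
  (at level 200, x binder, y binder, a at level 69, right associativity).
Notation "'∃' x .. y ∈ a , P" :=
  (bex a (fun x => .. (bex a (fun y => P)) ..))
  (at level 200, x binder, y binder, a at level 69, right associativity).

(** Set-theoretic notions are relativized to a structure [M]: apart from the
    axioms of ZFC and the definition of forcing extensions, all quantifiers below
    range over elements of [M].  [the] and [setof] denote elements of [M]; their
    value is arbitrary when no element of [M] satisfies the description. *)

Definition the {M : structure} (P : M -> Prop) : M := epsilon (nonempty M) P.

Definition setof {M : structure} (P : M -> Prop) : M :=
  the (fun b => forall x, x ∈ b <-> P x).

Definition subset {M : structure} (a b : M) : Prop := ∀ x ∈ a, x ∈ b.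
Notation "a ⊆ b" := (subset a b) (at level 70, no associativity).

Definition empty (M : structure) : M := setof (fun _ => False).
Definition upair {M : structure} (a b : M) : M := setof (fun x => x = a \/ x = b).
Definition opair {M : structure} (a b : M) : M := upair (upair a a) (upair a b).
Definition succ {M : structure} (a : M) : M := setof (fun x => x ∈ a \/ x = a).
Definition union {M : structure} (a : M) : M := setof (fun x => ∃ y ∈ a, x ∈ y).
Definition powerset {M : structure} (a : M) : M := setof (fun x => x ⊆ a).
Definition diff {M : structure} (a b : M) : M :=
  setof (fun x => x ∈ a /\ ~ x ∈ b).
Definition prod {M : structure} (a b : M) : M :=
  setof (fun z => ∃ x ∈ a, ∃ y ∈ b, z = opair x y).

Definition inductive {M : structure} (I : M) : Prop :=
  empty M ∈ I /\ ∀ x ∈ I, succ x ∈ I.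
Definition omega (M : structure) : M :=
  setof (fun n => forall I, inductive I -> n ∈ I).

(** ** ZFC *)

(** Formulas of the language of set theory, with de Bruijn indices. *)
Inductive formula :=
| FMem (i j : nat)
| FEq (i j : nat)
| FFalse
| FImp (p q : formula)
| FAll (p : formula).

Definition scons {T : Type} (x : T) (e : nat -> T) (n : nat) : T :=
  match n with O => x | S n => e n end.

Fixpoint sat {M : structure} (e : nat -> M) (p : formula) : Prop :=
  match p with
  | FMem i j => e i ∈ e j
  | FEq i j => e i = e j
  | FFalse => False
  | FImp p q => sat e p -> sat e q
  | FAll p => forall x, sat (scons x e) p
  end.

Definition extensional (M : structure) : Prop :=
  forall a b : M, (forall x, x ∈ a <-> x ∈ b) -> a = b.

Record ZFC (M : structure) : Prop := {
  ax_extensionality : extensional M;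
  ax_foundation : forall a : M,
    (exists x, x ∈ a) -> ∃ x ∈ a, forall y, y ∈ x -> ~ y ∈ a;
  ax_pairing : forall a b : M, exists c, forall x, x ∈ c <-> x = a \/ x = b;
  ax_union : forall a : M, exists b, forall x, x ∈ b <-> ∃ y ∈ a, x ∈ y;
  ax_powerset : forall a : M, exists b, forall x, x ∈ b <-> x ⊆ a;
  ax_infinity : exists I : M, inductive I;
  ax_separation : forall (p : formula) (e : nat -> M) (a : M),
    exists b, forall x, x ∈ b <-> x ∈ a /\ sat (scons x e) p;
  ax_replacement : forall (p : formula) (e : nat -> M) (a : M),
    (∀ x ∈ a, exists! y, sat (scons y (scons x e)) p) ->
    exists b, forall y, y ∈ b <-> ∃ x ∈ a, sat (scons y (scons x e)) p;
  ax_choice : forall a : M,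
    (∀ x ∈ a, exists z, z ∈ x) ->
    (∀ x y ∈ a, x <> y -> forall z, ~ (z ∈ x /\ z ∈ y)) ->
    exists c, ∀ x ∈ a, exists! z, z ∈ x /\ z ∈ c
}.

(** ** Functions and cardinals *)

Definition is_function {M : structure} (f a b : M) : Prop :=
  f ⊆ prod a b /\ ∀ x ∈ a, exists! y, opair x y ∈ f.
Definition funs {M : structure} (a b : M) : M := setof (fun f => is_function f a b).
Definition app {M : structure} (f x : M) : M := the (fun y => opair x y ∈ f).

Definition equinumerous {M : structure} (a b : M) : Prop :=
  ∃ f ∈ funs a b, ∀ y ∈ b, exists! x, x ∈ a /\ app f x = y.

Definition transitive {M : structure} (a : M) : Prop := ∀ x ∈ a, x ⊆ a.
Definition ordinal {M : structure} (a : M) : Prop :=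
  transitive a /\ ∀ x ∈ a, transitive x.

Definition ord_lt {M : structure} (a b : M) : Prop := a ∈ b.
Definition ord_le {M : structure} (a b : M) : Prop := a ∈ b \/ a = b.
Notation "a ≺ b" := (ord_lt a b) (at level 70, no associativity).
Notation "a ≼ b" := (ord_le a b) (at level 70, no associativity).

Definition is_cardinal {M : structure} (k : M) : Prop :=
  ordinal k /\ ∀ a ∈ k, ~ equinumerous a k.
Definition card {M : structure} (a : M) : M :=
  the (fun k => is_cardinal k /\ equinumerous a k).

Definition succ_card {M : structure} (k : M) : M :=
  the (fun l => (is_cardinal l /\ k ≺ l) /\
                forall m, is_cardinal m -> k ≺ m -> l ≼ m).
(** [exp2 k] is the cardinal 2^k. *)
Definition exp2 {M : structure} (k : M) : M := card (powerset k).
Definition aleph2 (M : structure) : M := succ_card (succ_card (omega M)).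
Definition continuum (M : structure) : M := exp2 (omega M).

Definition infinite_cardinal {M : structure} (k : M) : Prop :=
  is_cardinal k /\ omega M ≼ k.

Definition regular_cardinal {M : structure} (k : M) : Prop :=
  infinite_cardinal k /\
  ∀ a ∈ k, ∀ f ∈ funs a k, ∃ b ∈ k, ∀ x ∈ a, app f x ≺ b.

Definition GCH (M : structure) : Prop :=
  forall k : M, infinite_cardinal k -> exp2 k = succ_card k.

Definition finite {M : structure} (a : M) : Prop :=
  ∃ n ∈ omega M, equinumerous a n.

(** * Forcing extensions *)

(** Countable well-founded models of ZFC are, up to a unique isomorphism, the
    countable transitive models. *)
Record countable_transitive_model (M : structure) : Prop := {
  ctm_ZFC : ZFC M;
  ctm_well_founded : well_founded (@mem M);
  ctm_countable : exists enum : nat -> M, forall x, exists n, enum n = x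
}.

Definition forcing_notion {M : structure} (P le : M) : Prop :=
  (exists p, p ∈ P) /\ le ⊆ prod P P /\
  (∀ p ∈ P, opair p p ∈ le) /\
  (∀ p q r ∈ P, opair p q ∈ le -> opair q r ∈ le -> opair p r ∈ le).

Definition dense {M : structure} (P le D : M) : Prop :=
  D ⊆ P /\ ∀ p ∈ P, ∃ d ∈ D, opair d p ∈ le.

(** The generic filter is in general not an element of [M]. *)
Record generic_filter {M : structure} (P le : M) (G : M -> Prop) : Prop := {
  gf_subset : forall p, G p -> p ∈ P;
  gf_nonempty : exists p, G p;
  gf_upward : forall p q, G p -> opair p q ∈ le -> G q;
  gf_directed : forall p q, G p -> G q ->
    exists r, G r /\ opair r p ∈ le /\ opair r q ∈ le;
  gf_generic : forall D, dense P le D -> exists p, G p /\ p ∈ D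
}.

(** [ext] is V[G]: each of its elements is the value of a name in [V], where
    [val t = { val s | (s, p) ∈ t for some p in G }].  The map [incl] is the
    inclusion of [V] into V[G] as a transitive subclass.  When [V] is
    well-founded, these conditions determine [ext], [val] and [incl] up to a
    unique isomorphism. *)
Record forcing_extension (V : structure) := {
  fe_poset : V;
  fe_le : V;
  fe_generic : V -> Prop;
  ext :> structure;
  val : V -> ext;
  incl : V -> ext;
  fe_forcing_notion : forcing_notion fe_poset fe_le;
  fe_generic_filter : generic_filter fe_poset fe_le fe_generic;
  fe_extensional : extensional ext;
  fe_val : forall (t : V) (y : ext),
    y ∈ val t <-> exists s p, fe_generic p /\ opair s p ∈ t /\ y = val s;
  fe_val_surjective : forall y : ext, exists t, val t = y;
  fe_incl : forall (x : V) (y : ext),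
    y ∈ incl x <-> exists z, z ∈ x /\ y = incl z
}.

(** * Baire space *)

Definition baire (M : structure) : M := funs (omega M) (omega M).

(** [fin_seq s n] : [s] is a finite sequence of natural numbers of length [n]. *)
Definition fin_seq {M : structure} (s n : M) : Prop :=
  n ∈ omega M /\ s ∈ funs n (omega M).

Definition cone {M : structure} (s : M) : M := setof (fun x => x ∈ baire M /\ s ⊆ x).

Definition seq_union {M : structure} (F : M) : M :=
  setof (fun x => ∃ n ∈ omega M, x ∈ app F n).

Definition is_open {M : structure} (U : M) : Prop :=
  U ⊆ baire M /\ ∀ x ∈ U, exists s n, fin_seq s n /\ x ∈ cone s /\ cone s ⊆ U.

Definition closure {M : structure} (A : M) : M :=
  setof (fun x => x ∈ baire M /\
    forall U, is_open U -> x ∈ U -> exists y, y ∈ U /\ y ∈ A).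

Definition nowhere_dense {M : structure} (A : M) : Prop :=
  A ⊆ baire M /\ forall U, is_open U -> U ⊆ closure A -> U = empty M.

Definition compact {M : structure} (K : M) : Prop :=
  K ⊆ baire M /\
  forall C, (∀ U ∈ C, is_open U) -> K ⊆ union C ->
  exists D, D ⊆ C /\ finite D /\ K ⊆ union D.

Definition meager {M : structure} (A : M) : Prop :=
  ∃ F ∈ funs (omega M) (powerset (baire M)),
    (∀ n ∈ omega M, nowhere_dense (app F n)) /\ A = seq_union F.

Definition sigma_compact {M : structure} (A : M) : Prop :=
  ∃ F ∈ funs (omega M) (powerset (baire M)),
    (∀ n ∈ omega M, compact (app F n)) /\ A = seq_union F.

Definition in_sigma_compact {M : structure} (A : M) : Prop :=
  exists K, sigma_compact K /\ A ⊆ K.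

(** ** Lebesgue measure *)

Definition app2 {M : structure} (f x y : M) : M := app f (opair x y).

Definition lub {M : structure} (R le A b : M) : Prop :=
  (b ∈ R /\ ∀ x ∈ A, opair x b ∈ le) /\
  ∀ c ∈ R, (∀ x ∈ A, opair x c ∈ le) -> opair b c ∈ le.

(** Complete ordered fields of [M]; in a model of ZFC there is exactly one up to
    isomorphism in [M], the real line of [M]. *)
Record real_field {M : structure} := {
  R : M;
  add : M;
  mul : M;
  le : M;
  zero : M;
  one : M;
  add_fun : is_function add (prod R R) R;
  mul_fun : is_function mul (prod R R) R;
  le_rel : le ⊆ prod R R;
  zero_in : zero ∈ R;
  one_in : one ∈ R;
  addA : ∀ x y z ∈ R, app2 add x (app2 add y z) = app2 add (app2 add x y) z;
  addC : ∀ x y ∈ R, app2 add x y = app2 add y x;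
  add0 : ∀ x ∈ R, app2 add zero x = x;
  addN : ∀ x ∈ R, ∃ y ∈ R, app2 add x y = zero;
  mulA : ∀ x y z ∈ R, app2 mul x (app2 mul y z) = app2 mul (app2 mul x y) z;
  mulC : ∀ x y ∈ R, app2 mul x y = app2 mul y x;
  mul1 : ∀ x ∈ R, app2 mul one x = x;
  mulV : ∀ x ∈ R, x <> zero -> ∃ y ∈ R, app2 mul x y = one;
  mulD : ∀ x y z ∈ R,
    app2 mul x (app2 add y z) = app2 add (app2 mul x y) (app2 mul x z);
  one_neq0 : one <> zero;
  le_trans : ∀ x y z ∈ R,
    opair x y ∈ le -> opair y z ∈ le -> opair x z ∈ le;
  le_antisym : ∀ x y ∈ R, opair x y ∈ le -> opair y x ∈ le -> x = y;
  le_total : ∀ x y ∈ R, opair x y ∈ le \/ opair y x ∈ le;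
  le_add : ∀ x y z ∈ R,
    opair x y ∈ le -> opair (app2 add x z) (app2 add y z) ∈ le;
  le_mul : ∀ x y ∈ R,
    opair zero x ∈ le -> opair zero y ∈ le -> opair zero (app2 mul x y) ∈ le;
  complete : forall A, A ⊆ R -> (exists x, x ∈ A) ->
    (∃ b ∈ R, ∀ x ∈ A, opair x b ∈ le) -> exists b, lub R le A b
}.
Arguments real_field : clear implicits.

Definition sigma_algebra {M : structure} (S : M) : Prop :=
  S ⊆ powerset (baire M) /\ baire M ∈ S /\
  (∀ B ∈ S, diff (baire M) B ∈ S) /\
  (∀ F ∈ funs (omega M) S, seq_union F ∈ S).

Definition borel (M : structure) : M :=
  setof (fun B => forall S, sigma_algebra S ->
    (forall U, is_open U -> U ∈ S) -> B ∈ S).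

(** [a] is the sum of the series whose nth term is [f n], for nonnegative terms:
    the supremum of the partial sums. *)
Definition series_sum {M : structure} (K : real_field M) (f : M -> M) (a : M) : Prop :=
  ∃ S ∈ funs (omega M) (R K),
    app S (empty M) = zero K /\
    (∀ n ∈ omega M, app S (succ n) = app2 (add K) (app S n) (f n)) /\
    lub (R K) (le K) (setof (fun x => ∃ n ∈ omega M, x = app S n)) a.

(** [h n = 2^-(n+1)]. *)
Definition half_powers {M : structure} (K : real_field M) (h : M) : Prop :=
  let double x := app2 (add K) x x in
  h ∈ funs (omega M) (R K) /\
  double (app h (empty M)) = one K /\
  ∀ n ∈ omega M, double (app h (succ n)) = app h n.

(** [a] is the product of the [f i] for [i < n]. *)
Definition finite_product {M : structure} (K : real_field M) (f : M -> M) (n a : M)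
    : Prop :=
  ∃ p ∈ funs (omega M) (R K),
    app p (empty M) = one K /\
    (∀ i ∈ n, app p (succ i) = app2 (mul K) (app p i) (f i)) /\
    app p n = a.

Definition disjoint_seq {M : structure} (F : M) : Prop :=
  ∀ m n ∈ omega M, m <> n -> forall x, ~ (x ∈ app F m /\ x ∈ app F n).

Record lebesgue_measure {M : structure} (K : real_field M) (mu : M) : Prop := {
  mu_fun : mu ∈ funs (borel M) (R K);
  mu_ge0 : ∀ B ∈ borel M, opair (zero K) (app mu B) ∈ le K;
  mu_empty : app mu (empty M) = zero K;
  mu_additive : ∀ F ∈ funs (omega M) (borel M), disjoint_seq F ->
    series_sum K (fun n => app mu (app F n)) (app mu (seq_union F));
  mu_cone : forall h s n, half_powers K h -> fin_seq s n ->
    finite_product K (fun i => app h (app s i)) n (app mu (cone s))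
}.

(** Null sets of the completion of Lebesgue measure. *)
Definition null {M : structure} (A : M) : Prop :=
  exists (K : real_field M) (mu : M), lebesgue_measure K mu /\
  ∃ B ∈ borel M, A ⊆ B /\ app mu B = zero K.

(** * Higher dimensional cardinal characteristics *)

Inductive ideal_name := idealN | idealM | idealK.

Definition in_ideal {M : structure} (I : ideal_name) (A : M) : Prop :=
  match I with
  | idealN => null A
  | idealM => meager A
  | idealK => in_sigma_compact A
  end.

Definition slaloms (M : structure) : M :=
  setof (fun s =>
    s ∈ funs (omega M) (setof (fun a => a ⊆ omega M /\ finite a)) /\
    ∀ n ∈ omega M, card (app s n) ≼ n).

Inductive rel_name := leStar | neqStar | inStar.

Definition almost_all {M : structure} (P : M -> Prop) : Prop :=
  finite (setof (fun n => n ∈ omega M /\ ~ P n)).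

Definition rel {M : structure} (r : rel_name) (x y : M) : Prop :=
  match r with
  | leStar => almost_all (fun n => app x n ≼ app y n)
  | neqStar => almost_all (fun n => app x n <> app y n)
  | inStar => almost_all (fun n => app x n ∈ app y n)
  end.

Definition codomain (M : structure) (r : rel_name) : M :=
  match r with
  | leStar | neqStar => baire M
  | inStar => slaloms M
  end.

Definition rel_mod {M : structure} (I : ideal_name) (r : rel_name) (f g : M) : Prop :=
  in_ideal I (setof (fun x => x ∈ baire M /\ ~ rel r (app f x) (app g x))).

Definition unbounded {M : structure} (r : rel_name) (I : ideal_name) (A : M) : Prop :=
  A ⊆ funs (baire M) (baire M) /\
  ~ ∃ g ∈ funs (baire M) (codomain M r), ∀ f ∈ A, rel_mod I r f g.

Definition dominating {M : structure} (r : rel_name) (I : ideal_name) (A : M) : Prop :=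
  A ⊆ funs (baire M) (codomain M r) /\
  ∀ g ∈ funs (baire M) (baire M), ∃ f ∈ A, rel_mod I r g f.

Definition least_size {M : structure} (Q : M -> Prop) : M :=
  the (fun k => (exists A, Q A /\ card A = k) /\ forall A, Q A -> k ≼ card A).

Definition bnum (M : structure) (r : rel_name) (I : ideal_name) : M :=
  least_size (unbounded r I).
Definition dnum (M : structure) (r : rel_name) (I : ideal_name) : M :=
  least_size (dominating r I).

(* Main.v *)
From Stdlib Require Import ssreflect Lia ClassicalEpsilon FunctionalExtensionality PropExtensionality ZArith Reals Lra.
Require Import Defs.

(** Under CH everything reduces to functions from ω1 to ω1 modulo countable sets.  Each of the three ideals
    contains the countable sets and has a Luzin sequence y_d (d < ω1): every set of the ideal contains only
    countably many y_d.  (For the null ideal one needs that Lebesgue measure exists and is unique, so that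
    every null set lies in one of the ω1 many null G_δ sets coded by reals.)  Countably many reals are bounded
    by one real and caught by one slalom; hence F : ω1 → ω1 dominating g : ω1 → ω1 yields a function on the
    reals which bounds or catches, modulo countable sets, the one coded by g.  Conversely, let a fixed c : ω1 → ω1
    have unbounded fibers; if c(F(d)) = g(d) for unboundedly many d, then the function which F determines on the
    Luzin sequence via c fails to be ≤* or ≠* the one coded by g.

    The forcing adds functions f_a : ω1 → ω1 for a in K × L, where f_a is to dominate the functions with names
    from the conditions below a, that is, on the indices (j', l') with j' < j and l' < l for a = (j, l).  A
    condition consists of a countable partial function and of countably many promises to bound such a name.  It is
    σ-closed and has the ℵ2-chain condition, so CH and cardinals are preserved.  A family of fewer than K
    functions is dominated by some f_a, and if B is closed downwards and does not contain a, then f_a satisfies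
    c(f_a(d)) = g(d) < f_a(d) unboundedly often for all g with a name on B.  So fewer than L functions are
    escaped by a single f_a, and K many f_a (ℵ2 many if K = 1) suffice to escape all functions.  Item (1) uses K = 1 and
    L = κ, items (2) and (4) use K = L = κ, and item (3) uses K = κ and L = λ. *)

Set Implicit Arguments.
Unset Strict Implicit.
Unset Printing Implicit Defensive.
Set SsrOldRewriteGoalsOrder.

(** Separation and replacement are schemes over formulas, so each set formed inside a model needs a
    proof that its defining predicate is first order; [Df], [DT] and the hint base [df] automate
    these proofs. Ordering pairs of indices lets one family serve both cardinals: a bound on one
    coordinate alone already gives a set closed downwards, and an index outside it escapes what is
    named there, while dominating a name takes an index above its support in both coordinates. If
    [K] has one element, nothing lies below any index and promises concern ground model functions
    only. The order must not mention the forcing relation of the poset under construction. So a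
    promise carries its name as a small table of conditions and values, and extension is defined by
    recursion through such tables. Nullity refers to an arbitrary complete ordered field and measure
    of the model. A measure is constructed by computing in the outer reals along an embedding of a
    field built in the model; an arbitrary field comes with no embedding, so its measure is compared
    with the constructed one only through dyadic values. *)

Lemma not_all T (P : T -> Prop) : ~ (forall x, P x) -> exists x, ~ P x.
Proof. move=> H; apply: NNPP => N; apply: H => x; apply: NNPP => Nx; apply: N; by exists x. Qed.

Lemma pred_ext T (P Q : T -> Prop) : (forall x, P x <-> Q x) -> P = Q.
Proof. move=> H; apply: functional_extensionality => x; apply: propositional_extensionality; exact: H. Qed.

(** * Definable relations *)

Fixpoint ren (r : nat -> nat) (p : formula) : formula :=
  match p with
  | FMem i j => FMem (r i) (r j)
  | FEq i j => FEq (r i) (r j)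
  | FFalse => FFalse
  | FImp p q => FImp (ren r p) (ren r q)
  | FAll p => FAll (ren (fun n => match n with 0 => 0 | S n => S (r n) end) p)
  end.

Lemma sat_ren (M : structure) p : forall r (e e' : nat -> M),
  (forall n, e' (r n) = e n) -> (sat e p <-> sat e' (ren r p)).
Proof.
elim: p => [i j|i j||p IHp q IHq|p IH] r e e' H /=; rewrite ?H //.
- by move: (IHp r e e' H) (IHq r e e' H); tauto.
- split=> S x; [apply/(IH _ (scons x e))|apply/(IH _ _ (scons x e'))]; try exact: (S x);
  by case=> //= n; rewrite H.
Qed.

Arguments sat_ren {M} p r e e' _.

(** The length in the type separates the arguments of a definable predicate, which are the first [k]
    de Bruijn variables, from its parameters, which are all later ones. *)
Fixpoint tup (M : structure) (k : nat) : Type :=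
  match k with 0 => unit | S k => (M * tup M k)%type end.

Definition hd {M : structure} {k} (t : tup M (S k)) : M := fst t.
Definition tl {M : structure} {k} (t : tup M (S k)) : tup M k := snd t.

Fixpoint env {M : structure} k : tup M k -> (nat -> M) -> nat -> M :=
  match k with
  | 0 => fun _ c => c
  | S k => fun t c => scons (hd t) (env (tl t) c)
  end.

(* The sequence [c] supplies the parameters of the defining formula. *)
Definition Df {M : structure} k (P : tup M k -> Prop) : Prop :=
  exists p c, forall t, P t <-> sat (env t c) p.

(** The language has no function symbols, so definability of a term means definability of its
    graph. *)
Definition DT {M : structure} k (f : tup M k -> M) : Prop :=
  Df (k := S k) (fun t => hd t = f (tl t)).

Section Definability.
Context {M : structure}.
Implicit Types (k : nat).

Lemma env_ge k (t : tup M k) c n : env t c (k + n) = c n.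
Proof. by elim: k t => //= k IH t. Qed.

Lemma env_lt k (t : tup M k) c d n : n < k -> env t c n = env t d n.
Proof. elim: k t n => [|k IH] t [|n] //= H; try lia; apply: IH; lia. Qed.

Lemma Df_ext k (P Q : tup M k -> Prop) : (forall t, P t <-> Q t) -> Df Q -> Df P.
Proof. by move=> H [p [c E]]; exists p, c => t; rewrite H. Qed.

Lemma Df_ren k k' (g : tup M k' -> tup M k) r (P : tup M k -> Prop) :
  (forall t c n, env t c (r n) = env (g t) c n) -> Df P -> Df (fun t => P (g t)).
Proof.
move=> H [p [c E]]; exists (ren r p), c => t; rewrite E; apply: sat_ren => n; exact: H.
Qed.

Lemma Df_imp k (P Q : tup M k -> Prop) : Df P -> Df Q -> Df (fun t => P t -> Q t).
Proof.
move=> [p [c E]] [q [d F]].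
(* A formula has a single sequence of parameters: [c] is stored at its even and [d] at its odd
   positions. *)
pose m n := if Nat.even n then c (Nat.div2 n) else d (Nat.div2 n).
pose r b n := if Nat.ltb n k then n else k + (b + 2 * (n - k)).
exists (FImp (ren (r 0) p) (ren (r 1) q)), m => t /=.
rewrite E F.
suff [-> ->] : (sat (env t c) p <-> sat (env t m) (ren (r 0) p)) /\
  (sat (env t d) q <-> sat (env t m) (ren (r 1) q)) by [].
split; apply: sat_ren.
- move=> n; rewrite /r; case: PeanoNat.Nat.ltb_spec => H; first exact: env_lt.
  rewrite env_ge; replace n with (k + (n - k)) at 2 by lia; rewrite env_ge /m.
  by rewrite PeanoNat.Nat.even_mul [orb _ _]/= PeanoNat.Nat.div2_double.
- move=> n; rewrite /r; case: PeanoNat.Nat.ltb_spec => H; first exact: env_lt.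
  rewrite env_ge; replace n with (k + (n - k)) at 2 by lia; rewrite env_ge /m.
  rewrite PeanoNat.Nat.add_comm PeanoNat.Nat.even_add PeanoNat.Nat.even_mul /=.
  by replace (n - k + (n - k + 0) + 1) with (S (2 * (n - k))) by lia; rewrite PeanoNat.Nat.div2_succ_double.
Qed.

Lemma Df_all k (P : tup M k -> M -> Prop) :
  Df (k := S k) (fun t => P (tl t) (hd t)) -> Df (fun t => forall x, P t x).
Proof.
move=> [p [c E]]; exists (FAll p), c => t /=; split=> H x; first by apply/(E (x, t)).
by apply/(E (x, t))/H.
Qed.

Lemma Df_False k : Df (fun _ : tup M k => False).
Proof. by exists FFalse, (fun _ => epsilon (nonempty M) (fun _ => True)). Qed.

Lemma Df_not k (P : tup M k -> Prop) : Df P -> Df (fun t => ~ P t).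
Proof. move=> H; exact: (Df_imp H (Df_False k)). Qed.
Lemma Df_and k (P Q : tup M k -> Prop) : Df P -> Df Q -> Df (fun t => P t /\ Q t).
Proof.
move=> H K; apply: (Df_ext (Q := fun t => ~ (P t -> ~ Q t))); first by move=> t; tauto.
by apply: Df_not; apply: Df_imp => //; apply: Df_not.
Qed.
Lemma Df_or k (P Q : tup M k -> Prop) : Df P -> Df Q -> Df (fun t => P t \/ Q t).
Proof.
move=> H K; apply: (Df_ext (Q := fun t => (~ P t -> Q t))); first by move=> t; tauto.
by apply: Df_imp => //; apply: Df_not.
Qed.
Lemma Df_iff k (P Q : tup M k -> Prop) : Df P -> Df Q -> Df (fun t => P t <-> Q t).
Proof. by move=> H K; apply: Df_and; apply: Df_imp. Qed.
Lemma Df_ex k (P : tup M k -> M -> Prop) :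
  Df (k := S k) (fun t => P (tl t) (hd t)) -> Df (fun t => exists x, P t x).
Proof.
move=> H; apply: (Df_ext (Q := fun t => ~ forall x, ~ P t x)).
  move=> t; split=> [[x Hx] /(_ x)|/not_all[x /NNPP]] //; by exists x.
by apply: Df_not; apply: Df_all; apply: Df_not.
Qed.

Lemma DT_fst k : DT (k := S k) (fun t : tup M (S k) => hd t).
Proof. by exists (FEq 0 1), (fun _ => epsilon (nonempty M) (fun _ => True)). Qed.
Lemma DT_const k (a : M) : DT (fun _ : tup M k => a).
Proof.
exists (FEq 0 (S k)), (fun _ => a) => t /=.
by move: (env_ge (tl t) (fun _ => a) 0); rewrite PeanoNat.Nat.add_0_r => ->.
Qed.
Lemma DT_wk k (f : tup M k -> M) : DT f -> DT (k := S k) (fun t => f (tl t)).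
Proof.
move=> H; apply: (Df_ren (k := S k) (k' := S (S k)) (g := fun t => (hd t, tl (tl t)))
  (r := fun n => match n with 0 => 0 | S n => S (S n) end) _ H) => t c [|n] //.
Qed.
Lemma DT_wk2 k (f : tup M k -> M) : DT f -> DT (k := S (S k)) (fun t => f (tl (tl t))).
Proof. by move=> H; apply: (DT_wk (DT_wk H)). Qed.
Lemma DT_wk3 k (f : tup M k -> M) : DT f -> DT (k := S (S (S k))) (fun t => f (tl (tl (tl t)))).
Proof. by move=> H; apply: (DT_wk (DT_wk2 H)). Qed.
Lemma DT_wk4 k (f : tup M k -> M) : DT f -> DT (k := S (S (S (S k)))) (fun t => f (tl (tl (tl (tl t))))).
Proof. by move=> H; apply: (DT_wk (DT_wk3 H)). Qed.
Lemma DT_wk5 k (f : tup M k -> M) : DT f -> DT (k := S (S (S (S (S k))))) (fun t => f (tl (tl (tl (tl (tl t)))))).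
Proof. by move=> H; apply: (DT_wk (DT_wk4 H)). Qed.
Lemma DT_wk6 k (f : tup M k -> M) : DT f -> DT (k := S (S (S (S (S (S k)))))) (fun t => f (tl (tl (tl (tl (tl (tl t))))))).
Proof. by move=> H; apply: (DT_wk (DT_wk5 H)). Qed.
Lemma DT_wk7 k (f : tup M k -> M) : DT f -> DT (k := S (S (S (S (S (S (S k))))))) (fun t => f (tl (tl (tl (tl (tl (tl (tl t)))))))).
Proof. by move=> H; apply: (DT_wk (DT_wk6 H)). Qed.
Lemma DT_wk8 k (f : tup M k -> M) : DT f -> DT (k := (S (S (S (S (S (S (S (S k))))))))) (fun t => f (tl (tl (tl (tl (tl (tl (tl (tl t))))))))).
Proof. by move=> H; apply: (DT_wk (DT_wk7 H)). Qed.
Lemma DT_wk9 k (f : tup M k -> M) : DT f -> DT (k := (S (S (S (S (S (S (S (S (S k)))))))))) (fun t => f (tl (tl (tl (tl (tl (tl (tl (tl (tl t)))))))))).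
Proof. by move=> H; apply: (DT_wk (DT_wk8 H)). Qed.
Lemma DT_wk10 k (f : tup M k -> M) : DT f -> DT (k := (S (S (S (S (S (S (S (S (S (S k))))))))))) (fun t => f (tl (tl (tl (tl (tl (tl (tl (tl (tl (tl t))))))))))).
Proof. by move=> H; apply: (DT_wk (DT_wk9 H)). Qed.

Lemma Df_wk k (P : tup M k -> Prop) : Df P -> Df (k := S k) (fun t => P (tl t)).
Proof. by apply: (Df_ren (g := fun t : tup M (S k) => tl t) (r := S)). Qed.

(** Formulas have no terms to substitute; instead an existential quantifier names the value of
    [x]. *)
Lemma Df_sub1 k (P : tup M k -> M -> Prop) x :
  Df (k := S k) (fun t => P (tl t) (hd t)) -> DT x -> Df (fun t => P t (x t)).
Proof.
move=> H Hx; apply: (Df_ext (Q := fun t => exists a, a = x t /\ P t a)).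
  by move=> t; split=> [|[a [->]]] //; exists (x t).
by apply: Df_ex; apply: Df_and.
Qed.

Lemma Df_mem k (x y : tup M k -> M) : DT x -> DT y -> Df (fun t => x t ∈ y t).
Proof.
move=> Hx Hy; apply: (Df_sub1 (P := fun t a => a ∈ y t)) => //.
apply: (Df_sub1 (k := S k) (P := fun t a => hd t ∈ a)); last exact: DT_wk.
by exists (FMem 1 0), (fun _ => epsilon (nonempty M) (fun _ => True)).
Qed.
Lemma Df_eq k (x y : tup M k -> M) : DT x -> DT y -> Df (fun t => x t = y t).
Proof. move=> Hx Hy; exact: (Df_sub1 (P := fun t a => a = y t)). Qed.

Lemma DT_sub1 k (F : tup M k -> M -> M) x :
  DT (k := S k) (fun t => F (tl t) (hd t)) -> DT x -> DT (fun t => F t (x t)).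
Proof.
move=> H Hx; apply: (Df_sub1 (k := S k) (P := fun t a => hd t = F (tl t) a)); last exact: DT_wk.
apply: (Df_ren (k := S (S k)) (k' := S (S k)) (g := fun t => (hd (tl t), (hd t, tl (tl t))))
  (r := fun n => match n with 0 => 1 | 1 => 0 | n => n end) _ H) => t c [|[|n]] //.
Qed.

Lemma Df_ball k (a : tup M k -> M) P : DT a -> Df (k := S k) (fun t => P (tl t) (hd t)) ->
  Df (fun t => ball (a t) (P t)).
Proof. move=> Ha HP; apply: Df_all; apply: Df_imp => //; apply: Df_mem; [exact: DT_fst|exact: DT_wk]. Qed.
Lemma Df_bex k (a : tup M k -> M) P : DT a -> Df (k := S k) (fun t => P (tl t) (hd t)) ->
  Df (fun t => bex (a t) (P t)).
Proof. move=> Ha HP; apply: Df_ex; apply: Df_and => //; apply: Df_mem; [exact: DT_fst|exact: DT_wk]. Qed.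
Lemma Df_exu k P : Df (k := S k) (fun t => P (tl t) (hd t)) ->
  Df (fun t : tup M k => exists! x, P t x).
Proof.
move=> HP; apply: Df_ex; apply: Df_and => //; apply: Df_all; apply: Df_imp.
  apply: (Df_ren (k := S k) (k' := S (S k)) (g := fun t => (hd t, tl (tl t)))
  (r := fun n => match n with 0 => 0 | S n => S (S n) end) _ HP) => t c [|n] //.
by apply: Df_eq; [exact: (DT_wk (DT_fst k))|exact: DT_fst].
Qed.

(** Arguments that stay fixed move into the parameters, which is the form in which separation for
    one fixed tuple is applied. *)
Lemma Df_inst k (Q : tup M (S k) -> Prop) : Df Q -> forall t : tup M k, Df (k := 1) (fun u : tup M 1 => Q ((hd u, t) : tup M (S k))).
Proof. by move=> [p [c E]] t; exists p, (env t c) => u; rewrite E. Qed.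

Lemma Df_inst2 k (Q : tup M (S (S k)) -> Prop) : Df Q ->
  forall t : tup M k, Df (k := 2) (fun u : tup M 2 => Q ((hd u, (hd (tl u), t)) : tup M (S (S k)))).
Proof. by move=> [p [c E]] t; exists p, (env t c) => u; rewrite E. Qed.

Lemma Df_inst3 k (Q : tup M (S (S (S k))) -> Prop) : Df Q ->
  forall t : tup M k, Df (k := 3) (fun u : tup M 3 => Q ((hd u, (hd (tl u), (hd (tl (tl u)), t))) : tup M (S (S (S k))))).
Proof. by move=> [p [c E]] t; exists p, (env t c) => u; rewrite E. Qed.

Lemma Df_prop k (P : Prop) : Df (fun _ : tup M k => P).
Proof.
case: (classic P) => H; last by apply: Df_ext (Df_False k) => t; tauto.
by apply: Df_ext (Df_not (Df_False k)) => t; tauto.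
Qed.
End Definability.

Create HintDb df.
#[export] Hint Resolve Df_imp Df_all Df_False Df_not Df_and Df_or Df_iff Df_ex Df_mem Df_eq Df_ball Df_bex Df_exu DT_fst : df.
#[export] Hint Extern 0 (DT (fun _ => _)) => simple apply DT_const : df.
#[export] Hint Extern 0 (Df (fun _ => ?P)) => simple apply Df_prop : df.
Ltac df_leaf := first [ assumption | exact: DT_fst | simple apply DT_const
  | simple eapply DT_wk; solve [assumption|exact: DT_fst]
  | simple eapply DT_wk2; solve [assumption|exact: DT_fst]
  | simple eapply DT_wk3; solve [assumption|exact: DT_fst]
  | simple eapply DT_wk4; solve [assumption|exact: DT_fst]
  | simple eapply DT_wk5; solve [assumption|exact: DT_fst]
  | simple eapply DT_wk6; solve [assumption|exact: DT_fst]
  | simple eapply DT_wk7; solve [assumption|exact: DT_fst]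
  | simple eapply DT_wk8; solve [assumption|exact: DT_fst]
  | simple eapply DT_wk9; solve [assumption|exact: DT_fst]
  | simple eapply DT_wk10; solve [assumption|exact: DT_fst]
].
#[export] Hint Extern 1 (DT _) => df_leaf : df.
Ltac df := intros; cbv beta; auto 200 with df nocore.
Tactic Notation "bydf" := solve [df].

Lemma Df_subset {M : structure} k (x y : tup M k -> M) : DT x -> DT y -> Df (fun t => x t ⊆ y t).
Proof. rewrite /subset; bydf. Qed.
#[export] Hint Resolve Df_subset : df.

(** Choice is split off because its verification in the generic extension already uses the other
    axioms there. Foundation is strengthened to well-foundedness in the outer sense, which permits
    induction for arbitrary predicates. *)
Class ZFw (M : structure) : Prop := {
  zf_ext : extensional M;
  zf_pair : forall a b : M, exists c, forall x, x ∈ c <-> x = a \/ x = b;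
  zf_union : forall a : M, exists b, forall x, x ∈ b <-> ∃ y ∈ a, x ∈ y;
  zf_power : forall a : M, exists b, forall x, x ∈ b <-> x ⊆ a;
  zf_inf : exists I : M, inductive I;
  zf_sep : forall (p : formula) (e : nat -> M) (a : M),
    exists b, forall x, x ∈ b <-> x ∈ a /\ sat (scons x e) p;
  zf_repl : forall (p : formula) (e : nat -> M) (a : M),
    (∀ x ∈ a, exists! y, sat (scons y (scons x e)) p) ->
    exists b, forall y, y ∈ b <-> ∃ x ∈ a, sat (scons y (scons x e)) p;
  mem_wf : well_founded (@mem M)
}.
Class ZFCw (M : structure) : Prop := { ZFCw_ZFw :: ZFw M; ZFCw_ZFC : ZFC M }.
#[export] Hint Resolve ZFCw_ZFw : df.

Definition sep {M : structure} (a : M) (P : M -> Prop) : M := setof (fun x => x ∈ a /\ P x).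
Definition img {M : structure} (a : M) (F : M -> M) : M := setof (fun y => ∃ x ∈ a, y = F x).
Definition lam {M : structure} (a : M) (F : M -> M) : M := img a (fun x => opair x (F x)).
(* Unlike [app], this is definable without any assumption on [f]. *)
Definition ap {M : structure} (f x : M) : M :=
  union (sep (union (union f)) (fun y => opair x y ∈ f)).
Fixpoint nat_in (M : structure) (n : nat) : M :=
  match n with 0 => empty M | S n => succ (nat_in M n) end.
Definition inj {M : structure} (f a b : M) : Prop :=
  f ∈ funs a b /\ ∀ x y ∈ a, ap f x = ap f y -> x = y.
Definition lec {M : structure} (a b : M) : Prop := exists f, inj f a b.

(** * Basic set operations, functions and natural numbers inside a model *)

Section Basics.
Context {M : structure} {HM : ZFw M}.
Implicit Types (a b c x y z f g : M) (k : nat).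

Lemma ext a b : (forall x, x ∈ a <-> x ∈ b) -> a = b.
Proof. exact: zf_ext. Qed.

Lemma setofE (P : M -> Prop) : (exists b, forall x, x ∈ b <-> P x) -> forall x, x ∈ setof P <-> P x.
Proof. move=> H; exact: (epsilon_spec (nonempty M) (fun b => forall x, x ∈ b <-> P x) H). Qed.

Lemma sepE a (P : M -> Prop) : Df (k := 1) (fun t : tup M 1 => P (hd t)) ->
  forall x, x ∈ sep a P <-> x ∈ a /\ P x.
Proof.
move=> [p [c E]]; apply: setofE; have [b Hb] := zf_sep p c a.
exists b => x; rewrite Hb; have H : P x <-> sat (scons x c) p := E (x, tt); tauto.
Qed.
Lemma setof_sub a (P : M -> Prop) : Df (k := 1) (fun t : tup M 1 => P (hd t)) ->
  (forall x, P x -> x ∈ a) -> forall x, x ∈ setof P <-> P x.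
Proof.
move=> H Ha; apply: setofE; exists (sep a P) => x; rewrite sepE //.
by split=> [[]|Hx] //; split=> //; apply: Ha.
Qed.
Lemma imgE a (F : M -> M) : DT (k := 1) (fun t : tup M 1 => F (hd t)) ->
  forall y, y ∈ img a F <-> ∃ x ∈ a, y = F x.
Proof.
move=> [p [c E]]; apply: setofE.
have [x xa|b Hb] := zf_repl (p := p) (e := c) (a := a).
  by exists (F x); split=> [|y H]; [apply/(E (F x, (x, tt)))|symmetry; apply/(E (y, (x, tt)))].
exists b => y; rewrite Hb.
by split=> [[x [xa /(E (y, (x, tt)))]]|[x [xa /(E (y, (x, tt)))]]] H; exists x.
Qed.

Lemma DT_of k (f : tup M k -> M) (Q : tup M (S k) -> Prop) :
  (forall t y, y = f t <-> Q ((y, t) : tup M (S k))) -> Df Q -> DT f.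
Proof. move=> H; apply: Df_ext => -[y t]; exact: H. Qed.
(** By extensionality a set-valued term is definable as soon as membership in its value is. *)
Lemma DT_set k (f : tup M k -> M) (Q : tup M (S k) -> Prop) :
  (forall t x, x ∈ f t <-> Q ((x, t) : tup M (S k))) -> Df Q -> DT f.
Proof.
move=> H K; apply: (DT_of (Q := fun t => forall x, x ∈ hd t <-> Q ((x, tl t) : tup M (S k)))).
  by move=> t y; split=> [-> x|E]; [rewrite H|apply: ext => x; rewrite H; apply: E].
apply: Df_all; apply: Df_iff; first by df.
apply: (Df_ren (k' := S (S k)) (g := fun t : tup M (S (S k)) => (hd t, tl (tl t)) : tup M (S k))
  (r := fun n => match n with 0 => 0 | S n => S (S n) end) _ K) => t c [|n] //.
Qed.
Lemma DT_sep k (a : tup M k -> M) (P : tup M k -> M -> Prop) : DT a -> Df (k := S k) (fun t => P (tl t) (hd t)) ->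
  DT (fun t => sep (a t) (P t)).
Proof.
move=> Ha HP; apply: (DT_set (Q := fun t => hd t ∈ a (tl t) /\ P (tl t) (hd t))); last by df.
by move=> t x; rewrite sepE //; exact: (Df_inst HP t).
Qed.
Lemma DT_img k (a : tup M k -> M) (F : tup M k -> M -> M) : DT a -> DT (k := S k) (fun t => F (tl t) (hd t)) ->
  DT (fun t => img (a t) (F t)).
Proof.
move=> Ha HF; apply: (DT_set (Q := fun t => ∃ x ∈ a (tl t), hd t = F (tl t) x)).
  by move=> t x; rewrite imgE //; exact: (Df_inst2 HF t).
apply: Df_bex; first by df.
apply: (Df_ren (k := S (S k)) (k' := S (S k)) (g := fun t : tup M (S (S k)) => (hd (tl t), (hd t, tl (tl t))) : tup M (S (S k)))
  (r := fun n => match n with 0 => 1 | 1 => 0 | n => n end) _ HF) => t c [|[|n]] //.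
Qed.

Lemma emptyE x : x ∈ empty M <-> False.
Proof.
apply: (setofE (P := fun _ => False)).
have [I _] := zf_inf.
by exists (sep I (fun _ => False)) => z; rewrite sepE; [tauto|df].
Qed.
Lemma upairE a b x : x ∈ upair a b <-> x = a \/ x = b.
Proof. apply: setofE; exact: (zf_pair). Qed.
Lemma unionE a x : x ∈ union a <-> ∃ y ∈ a, x ∈ y.
Proof. apply: setofE; exact: (zf_union). Qed.
Lemma powersetE a x : x ∈ powerset a <-> x ⊆ a.
Proof. apply: setofE; exact: (zf_power). Qed.
Lemma succE a x : x ∈ succ a <-> x ∈ a \/ x = a.
Proof.
apply: setofE; exists (union (upair a (upair a a))) => z; rewrite unionE; split.
  by move=> [y [/upairE [->|->]]]; [left|move/upairE; tauto].
by case=> [H|->]; [exists a|exists (upair a a)]; rewrite !upairE; tauto.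
Qed.
Lemma DT_upair k (a b : tup M k -> M) : DT a -> DT b -> DT (fun t => upair (a t) (b t)).
Proof.
move=> Ha Hb; apply: (DT_set (Q := fun t => hd t = a (tl t) \/ hd t = b (tl t))); last by df.
by move=> t x; rewrite upairE.
Qed.
Lemma DT_opair k (a b : tup M k -> M) : DT a -> DT b -> DT (fun t => opair (a t) (b t)).
Proof. by move=> Ha Hb; apply: DT_upair; apply: DT_upair. Qed.
Lemma DT_union k (a : tup M k -> M) : DT a -> DT (fun t => union (a t)).
Proof.
move=> Ha; apply: (DT_set (Q := fun t => ∃ y ∈ a (tl t), hd t ∈ y)); last by df.
by move=> t x; rewrite unionE.
Qed.
Lemma DT_powerset k (a : tup M k -> M) : DT a -> DT (fun t => powerset (a t)).
Proof.
move=> Ha; apply: (DT_set (Q := fun t => hd t ⊆ a (tl t))); last by df.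
by move=> t x; rewrite powersetE.
Qed.
Lemma DT_succ k (a : tup M k -> M) : DT a -> DT (fun t => succ (a t)).
Proof.
move=> Ha; apply: (DT_set (Q := fun t => hd t ∈ a (tl t) \/ hd t = a (tl t))); last by df.
by move=> t x; rewrite succE.
Qed.
Hint Resolve DT_sep DT_img DT_upair DT_opair DT_union DT_powerset DT_succ : df.
Lemma diffE a b x : x ∈ diff a b <-> x ∈ a /\ ~ x ∈ b.
Proof. by apply: sepE; df. Qed.
Lemma DT_diff k (a b : tup M k -> M) : DT a -> DT b -> DT (fun t => diff (a t) (b t)).
Proof. by move=> Ha Hb; apply: DT_sep; df. Qed.

Lemma upair_l a b : a ∈ upair a b. Proof. by apply/upairE; left. Qed.
Lemma upair_r a b : b ∈ upair a b. Proof. by apply/upairE; right. Qed.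
Lemma upair_self a b c : upair a a = upair b c -> a = b /\ a = c.
Proof.
move=> E; generalize (upair_l b c); generalize (upair_r b c); rewrite -E !upairE.
by move=> [->|->] [->|->].
Qed.
Lemma opair_inj a b c d : opair a b = opair c d -> a = c /\ b = d.
Proof.
move=> E.
have : upair a a ∈ opair c d by rewrite -E; exact: upair_l.
have : upair a b ∈ opair c d by rewrite -E; exact: upair_r.
have : upair c d ∈ opair a b by rewrite E; exact: upair_r.
rewrite !upairE => H3 H2 H1.
have ac : a = c by case: H1 => /upair_self []; congruence.
subst c; split=> //.
have H4 : b = a \/ b = d by generalize (upair_r a b); case: H2 => ->; rewrite upairE; tauto.
have H5 : d = a \/ d = b by generalize (upair_r a d); case: H3 => ->; rewrite upairE; tauto.
by case: H4 => H4 //; case: H5 => H5; congruence.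
Qed.
Lemma prodE a b z : z ∈ prod a b <-> ∃ x ∈ a, ∃ y ∈ b, z = opair x y.
Proof.
apply: (setof_sub (a := powerset (powerset (union (upair a b)))) (P := fun z => ∃ x ∈ a, ∃ y ∈ b, z = opair x y)); first by df.
move=> u [x [xa [y [yb ->]]]]; rewrite powersetE => v /upairE E; rewrite powersetE => w wv.
rewrite unionE; have : w = x \/ w = y by case: E wv => ->; rewrite upairE; tauto.
by case=> ->; [exists a|exists b]; rewrite upairE; tauto.
Qed.
Lemma pair_prod a b x y : opair x y ∈ prod a b <-> x ∈ a /\ y ∈ b.
Proof.
rewrite prodE; split=> [[u [ua [v [vb /opair_inj[-> ->]]]]]|[? ?]] //.
by exists x; split=> //; exists y.
Qed.
Lemma DT_prod k (a b : tup M k -> M) : DT a -> DT b -> DT (fun t => prod (a t) (b t)).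
Proof.
move=> Ha Hb; apply: (DT_set (Q := fun t => ∃ x ∈ a (tl t), ∃ y ∈ b (tl t), hd t = opair x y)); last by df.
by move=> t x; rewrite prodE.
Qed.
Lemma DT_ap k (a b : tup M k -> M) : DT a -> DT b -> DT (fun t => ap (a t) (b t)).
Proof. by move=> Ha Hb; rewrite /ap; df. Qed.
Lemma DT_lam k (a : tup M k -> M) (F : tup M k -> M -> M) : DT a -> DT (k := S k) (fun t => F (tl t) (hd t)) ->
  DT (fun t => lam (a t) (F t)).
Proof. by move=> Ha HF; rewrite /lam; apply: DT_img => //; df. Qed.
Hint Resolve DT_diff DT_prod DT_ap DT_lam : df.
Lemma Df_is_function k (f a b : tup M k -> M) : DT f -> DT a -> DT b -> Df (fun t => is_function (f t) (a t) (b t)).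
Proof. by move=> *; rewrite /is_function; df. Qed.
Hint Resolve Df_is_function : df.
Lemma funsE f a b : f ∈ funs a b <-> is_function f a b.
Proof.
apply: (setof_sub (a := powerset (prod a b)) (P := fun f => is_function f a b)); first by df.
by move=> x [H _]; rewrite powersetE.
Qed.
Lemma DT_funs k (a b : tup M k -> M) : DT a -> DT b -> DT (fun t => funs (a t) (b t)).
Proof.
move=> Ha Hb; apply: (DT_set (Q := fun t => is_function (hd t) (a (tl t)) (b (tl t)))); last by df.
by move=> t x; rewrite funsE.
Qed.
Hint Resolve DT_funs : df.

Lemma ap_eq f a b x y : f ∈ funs a b -> opair x y ∈ f -> ap f x = y.
Proof.
move=> /funsE [fs ff] xy.
have [xa yb] : x ∈ a /\ y ∈ b by apply/pair_prod/fs.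
have [v [_ vu]] := ff x xa.
have S z : z ∈ sep (union (union f)) (fun y => opair x y ∈ f) <-> z = y.
  rewrite sepE; last by df.
  split=> [[_ H]|->]; first by rewrite -(vu z) // -(vu y).
  split=> //; rewrite unionE; exists (upair x y); split; last by rewrite upairE; right.
  by rewrite unionE; exists (opair x y); split=> //; rewrite upairE; right.
apply: ext => z; rewrite unionE; split=> [[w [/S ->]]|H] //; by exists y; rewrite S.
Qed.
Lemma ap_pair f a b x : f ∈ funs a b -> x ∈ a -> opair x (ap f x) ∈ f.
Proof. by move=> H xa; generalize (H); move=> /funsE [_ /(_ x xa) [v [vf _]]]; rewrite (ap_eq H vf). Qed.
Lemma ap_in f a b x : f ∈ funs a b -> x ∈ a -> ap f x ∈ b.
Proof. by move=> H xa; generalize (H); move=> /funsE [fs _]; generalize (ap_pair H xa); move=> /fs/pair_prod []. Qed.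
Lemma app_ap f a b x : f ∈ funs a b -> x ∈ a -> app f x = ap f x.
Proof.
move=> H xa; symmetry; apply: (ap_eq H).
apply: (epsilon_spec (nonempty M) (fun y => opair x y ∈ f)); exists (ap f x); exact: ap_pair H xa.
Qed.
Lemma fun_mem f a b z : f ∈ funs a b -> (z ∈ f <-> ∃ x ∈ a, z = opair x (ap f x)).
Proof.
move=> H; split=> [zf|[x [xa ->]]]; last exact: ap_pair H xa.
generalize (H); move=> /funsE [fs _]; generalize (fs z zf); move=> /prodE [x [xa [y [yb E]]]].
by exists x; split=> //; rewrite E -(ap_eq H (x := x) (y := y)) // -E.
Qed.
Lemma fun_ext f g a b c : f ∈ funs a b -> g ∈ funs a c -> (∀ x ∈ a, ap f x = ap g x) -> f = g.
Proof.
move=> H K E; apply: ext => z; rewrite (fun_mem z H) (fun_mem z K).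
by split=> [[x [xa ->]]|[x [xa ->]]]; exists x; split=> //; rewrite E.
Qed.
Lemma lamE a (F : M -> M) z : DT (k := 1) (fun t : tup M 1 => F (hd t)) -> (z ∈ lam a F <-> ∃ x ∈ a, z = opair x (F x)).
Proof. by move=> D; rewrite imgE; df. Qed.
Lemma lam_fun a b (F : M -> M) : DT (k := 1) (fun t : tup M 1 => F (hd t)) -> (∀ x ∈ a, F x ∈ b) -> lam a F ∈ funs a b.
Proof.
move=> D H; apply/funsE; split=> [z /(lamE _ _ D) [x [xa ->]]|x xa]; first by apply/pair_prod; split=> //; apply: H.
exists (F x); split=> [|y]; first by apply/lamE => //; exists x.
by move/(lamE _ _ D) => [u [ua /opair_inj [-> ->]]].
Qed.
Lemma ap_lam a (F : M -> M) x : DT (k := 1) (fun t : tup M 1 => F (hd t)) -> x ∈ a -> ap (lam a F) x = F x.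
Proof.
move=> D xa; apply: (ap_eq (a := a) (b := img a F)); last by apply/lamE => //; exists x.
by apply: lam_fun => // u ua; apply/imgE => //; exists u.
Qed.
Lemma lam_eta f a b : f ∈ funs a b -> lam a (ap f) = f.
Proof.
move=> H; apply: (fun_ext (a := a) (b := b) (c := b)) => //.
  by apply: lam_fun => [|x xa]; [df|apply: ap_in H xa].
by move=> x xa; rewrite ap_lam //; df.
Qed.
Lemma fun_codom f a b c : f ∈ funs a b -> (∀ x ∈ a, ap f x ∈ c) -> f ∈ funs a c.
Proof. by move=> H K; rewrite -(lam_eta H); apply: lam_fun => //; df. Qed.

Lemma mem_ind (P : M -> Prop) : (forall x, (∀ y ∈ x, P y) -> P x) -> forall x, P x.
Proof. by move=> H x; elim: (mem_wf x) => {}x _ IH; apply: H. Qed.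
Lemma mem_irr x : ~ x ∈ x.
Proof. by elim/mem_ind: x => x IH H; exact: (IH x H H). Qed.
Lemma mem_asym x y : x ∈ y -> ~ y ∈ x.
Proof. elim/mem_ind: x y => x IH y H K; exact: (IH y K x K H). Qed.

Lemma mem_min (P : M -> Prop) : (exists x, P x) -> exists x, P x /\ ∀ y ∈ x, ~ P y.
Proof.
move=> [x Px]; apply: NNPP => N; elim/mem_ind: x Px => x IH Px.
by apply: N; exists x; split=> // y yx Py; exact: (IH y yx Py).
Qed.

Lemma Df_inductive k (a : tup M k -> M) : DT a -> Df (fun t => inductive (a t)).
Proof. by move=> *; rewrite /inductive; df. Qed.
Hint Resolve Df_inductive : df.

(** Well-foundedness makes ω standard: removing from it a minimal element that is no numeral would
    leave a smaller inductive set, because any predecessor of that element is a numeral by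
    minimality. *)
Lemma omegaE x : x ∈ omega M <-> exists n, x = nat_in M n.
Proof.
have S : forall x, x ∈ omega M <-> forall I, inductive I -> x ∈ I.
  have [I HI] := zf_inf.
  apply: (setof_sub (a := I)); [df|by move=> u /(_ I HI)].
split=> [H|[n ->]]; last by apply/S => I [I0 IS]; elim: n => //= n IH; apply: IS.
apply: NNPP => N.
have [y [[yo Ny] ymin]] := mem_min (P := fun y => y ∈ omega M /\ ~ exists n, y = nat_in M n) (ex_intro _ x (conj H N)).
have: y ∈ sep (omega M) (fun z => z <> y).
  apply: (proj1 (S y) yo); split.
    rewrite sepE; last by df.
    split; first by apply/S => I [].
    by move=> E; apply: Ny; exists 0.
  move=> u; rewrite !sepE; try by df.
  move=> [uo uy]; split; first by apply/S => I HI; apply HI; apply: (proj1 (S u) uo).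
  move=> E; apply: (ymin u); first by rewrite -E succE; right.
  by split=> // -[n En]; apply: Ny; exists (Datatypes.S n); rewrite -E En.
by rewrite sepE; [case|df].
Qed.
Lemma nat_omega n : nat_in M n ∈ omega M. Proof. by apply/omegaE; exists n. Qed.
Lemma nat_mem m x : x ∈ nat_in M m <-> exists n, n < m /\ x = nat_in M n.
Proof.
elim: m x => [|m IH] x /=; first by rewrite emptyE; split=> // -[n []]; lia.
rewrite succE IH; split=> [[[n [H ->]]|->]|[n [H ->]]]; [exists n; split=> //; lia|exists m; split=> //; lia|].
have [H'|->] : n < m \/ n = m by lia.
  by left; exists n.
by right.
Qed.
Lemma nat_inj m n : nat_in M m = nat_in M n -> m = n.
Proof.
move=> E; have [H|[H|]] : m < n \/ n < m \/ m = n by lia.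
- by have: nat_in M m ∈ nat_in M n by [apply/nat_mem; exists m]; rewrite E => /mem_irr.
- by have: nat_in M n ∈ nat_in M m by [apply/nat_mem; exists n]; rewrite E => /mem_irr.
- by [].
Qed.
Lemma nat_lt m n : nat_in M m ∈ nat_in M n <-> m < n.
Proof. by rewrite nat_mem; split=> [[j [H /nat_inj ->]]|H] //; exists m. Qed.

Lemma lec_lam a b (F : M -> M) : DT (k := 1) (fun t : tup M 1 => F (hd t)) -> (∀ x ∈ a, F x ∈ b) ->
  (∀ x y ∈ a, F x = F y -> x = y) -> lec a b.
Proof.
move=> D H K; exists (lam a F); split; first exact: lam_fun.
by move=> x xa y ya; rewrite !ap_lam //; apply: K.
Qed.
Lemma lec_sub a b : a ⊆ b -> lec a b.
Proof. by move=> H; apply: (lec_lam (F := fun x => x)) => [|x /H|x _ y _] //; df. Qed.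
Lemma lec_refl a : lec a a. Proof. exact: lec_sub. Qed.
Lemma lec_trans a b c : lec a b -> lec b c -> lec a c.
Proof.
move=> [f [Hf If]] [g [Hg Ig]]; apply: (lec_lam (F := fun x => ap g (ap f x))); first by df.
  by move=> x xa; apply: ap_in Hg _; apply: ap_in Hf _.
move=> x xa y ya E; apply: If => //; apply: Ig => //; exact: ap_in Hf _.
Qed.
Lemma Df_inj k (f a b : tup M k -> M) : DT f -> DT a -> DT b -> Df (fun t => inj (f t) (a t) (b t)).
Proof. by move=> *; rewrite /inj; df. Qed.
Hint Resolve Df_inj : df.
Lemma Df_lec k (a b : tup M k -> M) : DT a -> DT b -> Df (fun t => lec (a t) (b t)).
Proof. by move=> *; rewrite /lec; df. Qed.
Lemma omega_ind (P : M -> Prop) : P (empty M) -> (∀ n ∈ omega M, P n -> P (succ n)) -> ∀ n ∈ omega M, P n.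
Proof. by move=> H0 HS x /omegaE [n ->]; elim: n => //= n IH; apply: HS => //; exact: nat_omega. Qed.
Lemma empty_omega : empty M ∈ omega M. Proof. exact: (nat_omega 0). Qed.
Lemma succ_omega n : n ∈ omega M -> succ n ∈ omega M.
Proof. by move=> /omegaE [m ->]; exact: (nat_omega (S m)). Qed.
End Basics.
#[export] Hint Resolve DT_sep DT_img DT_upair DT_opair DT_union DT_powerset DT_succ DT_diff DT_prod DT_ap DT_lam
  Df_is_function DT_funs Df_inductive Df_inj Df_lec : df.

(** * Composition of definable predicates and terms *)

Section Calls.
Context {M : structure} {HM : ZFw M}.
(* [g] forgets the first [m] variables. *)
Variables (k k' m : nat) (g : tup M k' -> tup M k).
Hypothesis Hg : forall t c n, env t c (m + n) = env (g t) c n.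

Lemma Df_call1 (P : tup M k -> M -> Prop) x :
  Df (k := S k) (fun t => P (tl t) (hd t)) -> DT x -> Df (fun t => P (g t) (x t)).
Proof.
move=> HP Hx; apply: (Df_sub1 (P := fun t a => P (g t) a)) => //.
apply: (Df_ren (k := S k) (k' := S k') (g := fun t : tup M (S k') => (hd t, g (tl t)) : tup M (S k))
  (r := fun n => match n with 0 => 0 | S n => S (m + n) end) _ HP) => t c [|n] //=; exact: Hg.
Qed.
Lemma DT_call1 (F : tup M k -> M -> M) x :
  DT (k := S k) (fun t => F (tl t) (hd t)) -> DT x -> DT (fun t => F (g t) (x t)).
Proof.
move=> HF Hx; apply: (DT_sub1 (F := fun t a => F (g t) a)) => //.
apply: (Df_ren (k := S (S k)) (k' := S (S k')) (g := fun t : tup M (S (S k')) => (hd t, (hd (tl t), g (tl (tl t)))) : tup M (S (S k)))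
  (r := fun n => match n with 0 => 0 | 1 => 1 | S (S n) => S (S (m + n)) end) _ HF) => t c [|[|n]] //=; exact: Hg.
Qed.
Lemma DT_call2 (F : tup M k -> M -> M -> M) x y :
  DT (k := S (S k)) (fun t => F (tl (tl t)) (hd (tl t)) (hd t)) -> DT x -> DT y -> DT (fun t => F (g t) (x t) (y t)).
Proof.
move=> HF Hx Hy; apply: (DT_sub1 (F := fun t a => F (g t) a (y t))) => //.
apply: (DT_sub1 (k := S k') (F := fun t b => F (g (tl t)) (hd t) b)); last exact: DT_wk.
apply: (Df_ren (k := S (S (S k))) (k' := S (S (S k'))) (g := fun t : tup M (S (S (S k'))) => (hd t, (hd (tl t), (hd (tl (tl t)), g (tl (tl (tl t)))))) : tup M (S (S (S k))))
  (r := fun n => match n with 0 => 0 | 1 => 1 | 2 => 2 | S (S (S n)) => S (S (S (m + n))) end) _ HF) => t c [|[|[|n]]] //=; exact: Hg.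
Qed.
Lemma Df_call2 (P : tup M k -> M -> M -> Prop) x y :
  Df (k := S (S k)) (fun t => P (tl (tl t)) (hd (tl t)) (hd t)) -> DT x -> DT y -> Df (fun t => P (g t) (x t) (y t)).
Proof.
move=> HF Hx Hy; apply: (Df_sub1 (P := fun t a => P (g t) a (y t))) => //.
apply: (Df_sub1 (k := S k') (P := fun t b => P (g (tl t)) (hd t) b)); last exact: DT_wk.
apply: (Df_ren (k := S (S k)) (k' := S (S k')) (g := fun t : tup M (S (S k')) => (hd t, (hd (tl t), g (tl (tl t)))) : tup M (S (S k)))
  (r := fun n => match n with 0 => 0 | 1 => 1 | S (S n) => S (S (m + n)) end) _ HF) => t c [|[|n]] //=; exact: Hg.
Qed.
End Calls.

Section ClosedCalls.
Context {M : structure} {HM : ZFw M}.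
Let Hg k (t : tup M k) c n : env t c (k + n) = env (tt : tup M 0) c n.
Proof. exact: env_ge. Qed.
Lemma Df_closed1 (P : M -> Prop) : Df (k := 1) (fun t : tup M 1 => P (hd t)) ->
  forall k (x : tup M k -> M), DT x -> Df (fun t => P (x t)).
Proof. move=> H k x Hx; exact: (Df_call1 (k := 0) (g := fun _ : tup M k => (tt : tup M 0)) (@Hg k) (P := fun _ => P) (x := x) H Hx). Qed.
Lemma DT_closed1 (F : M -> M) : DT (k := 1) (fun t : tup M 1 => F (hd t)) ->
  forall k (x : tup M k -> M), DT x -> DT (fun t => F (x t)).
Proof. move=> H k x Hx; exact: (DT_call1 (k := 0) (g := fun _ : tup M k => (tt : tup M 0)) (@Hg k) (F := fun _ => F) (x := x) H Hx). Qed.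
Lemma Df_closed2 (P : M -> M -> Prop) : Df (k := 2) (fun t : tup M 2 => P (hd (tl t)) (hd t)) ->
  forall k (x y : tup M k -> M), DT x -> DT y -> Df (fun t => P (x t) (y t)).
Proof. move=> H k x y Hx Hy; exact: (Df_call2 (k := 0) (g := fun _ : tup M k => (tt : tup M 0)) (@Hg k) (P := fun _ => P) (x := x) (y := y) H Hx Hy). Qed.
Lemma DT_closed2 (F : M -> M -> M) : DT (k := 2) (fun t : tup M 2 => F (hd (tl t)) (hd t)) ->
  forall k (x y : tup M k -> M), DT x -> DT y -> DT (fun t => F (x t) (y t)).
Proof. move=> H k x y Hx Hy; exact: (DT_call2 (k := 0) (g := fun _ : tup M k => (tt : tup M 0)) (@Hg k) (F := fun _ => F) (x := x) (y := y) H Hx Hy). Qed.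
End ClosedCalls.
Ltac df_closed := match goal with
  | D : @DT _ 1 (fun t => ?F (hd t)) |- @DT _ _ (fun t => ?F _) => simple apply (DT_closed1 D)
  | D : @Df _ 1 (fun t => ?F (hd t)) |- @Df _ _ (fun t => ?F _) => simple apply (Df_closed1 D)
  | D : @DT _ 2 (fun t => ?F (hd (tl t)) (hd t)) |- @DT _ _ (fun t => ?F _ _) => simple apply (DT_closed2 D)
  | D : @Df _ 2 (fun t => ?F (hd (tl t)) (hd t)) |- @Df _ _ (fun t => ?F _ _) => simple apply (Df_closed2 D)
  end.
#[export] Hint Extern 2 (DT _) => df_closed : df.
#[export] Hint Extern 2 (Df _) => df_closed : df.

Lemma repl {M : structure} {HM : ZFw M} (P : M -> M -> Prop) (a : M) :
  Df (k := 2) (fun t : tup M 2 => P (hd (tl t)) (hd t)) ->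
  (∀ x ∈ a, exists! y, P x y) -> exists b, forall y, y ∈ b <-> ∃ x ∈ a, P x y.
Proof.
move=> [p [c E]] H; have [x xa|b Hb] := zf_repl (p := p) (e := c) (a := a).
  have [y [Py U]] := H x xa; exists y; split; first exact: (proj1 (E (y, (x, tt))) Py).
  by move=> z /(E (z, (x, tt))); apply: U.
exists b => y; rewrite Hb; split=> -[x [xa /(E (y, (x, tt))) S]]; by exists x.
Qed.

(** * Recursion on the membership relation *)

Definition fun_on {M : structure} (f x : M) : Prop :=
  (∀ z ∈ f, ∃ y ∈ x, exists v, z = opair y v) /\ ∀ y ∈ x, exists! v, opair y v ∈ f.
(** Approximations to a function defined by recursion: with each pair, [R] contains the whole
    history [f] from which the value is computed. *)
Definition rec_set {M : structure} (F : M -> M -> M) (R : M) : Prop :=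
  ∀ z ∈ R, exists x v f, z = opair x v /\ f ⊆ R /\ fun_on f x /\ v = F x f.
Definition rec {M : structure} (F : M -> M -> M) (x : M) : M :=
  the (fun v => exists R, rec_set F R /\ opair x v ∈ R).

Section Recursion.
Context {M : structure} {HM : ZFw M}.
Lemma Df_fun_on k (f x : tup M k -> M) : DT f -> DT x -> Df (fun t => fun_on (f t) (x t)).
Proof. by move=> *; rewrite /fun_on; df. Qed.
Hint Resolve Df_fun_on : df.

Lemma Df_rec_set k (F : tup M k -> M -> M -> M) R :
  DT (k := S (S k)) (fun t => F (tl (tl t)) (hd (tl t)) (hd t)) -> DT R ->
  Df (fun t => rec_set (F t) (R t)).
Proof.
move=> HF HR; apply: Df_ball => //; do 3! apply: Df_ex.
do 3! (apply: Df_and; first by df).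
apply: Df_eq; first by df.
by apply: (DT_call2 (m := 4)) => //; df.
Qed.

Section Fixed.
Variable F : M -> M -> M.
Hypothesis HF : DT (k := 2) (fun t : tup M 2 => F (hd (tl t)) (hd t)).

Let DfR k (R : tup M k -> M) : DT R -> Df (fun t => rec_set F (R t)).
Proof.
move=> HR; apply: (Df_rec_set (F := fun _ => F)) => //.
by df.
Qed.
Hint Resolve DfR : df.

Lemma rec_unique R R' x v v' : rec_set F R -> rec_set F R' -> opair x v ∈ R -> opair x v' ∈ R' -> v = v'.
Proof.
move=> HR HR'; elim/mem_ind: x v v' => x IH v v'.
move=> /HR [u [w [f [/opair_inj [<- <-] [fR [[f1 f2] ->]]]]]].
move=> /HR' [u' [w' [f' [/opair_inj [<- <-] [fR' [[f1' f2'] ->]]]]]].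
congr (F x _); apply: ext => z; split=> zf.
- have [y [yx [a E]]] := f1 z zf; subst z; have [b [bf _]] := f2' y yx.
  by rewrite (IH y yx a b) //; [apply: fR|apply: fR'].
- have [y [yx [a E]]] := f1' z zf; subst z; have [b [bf _]] := f2 y yx.
  by rewrite -(IH y yx b a) //; [apply: fR|apply: fR'].
Qed.

Let above x R := rec_set F R /\ exists v, opair x v ∈ R.
Let least x R := above x R /\ forall R', above x R' -> R ⊆ R'.
Let Df_above k (x R : tup M k -> M) : DT x -> DT R -> Df (fun t => above (x t) (R t)).
Proof. move=> Hx HR; rewrite /above; df. Qed.
Hint Resolve Df_above : df.

(** Replacement requires unique witnesses. The least approximation with [x] in its domain is unique,
    so the histories of the elements of [x] can be collected without choice. *)
Let least_ex x : exists R, least x R.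
Proof.
elim/mem_ind: x => x IH.
have [|y yx|B HB] := repl (P := least) (a := x); first by rewrite /least; df.
  have [R HR] := IH y yx; exists R; split=> // R' HR'; apply: ext => z.
  by split=> H; [apply: (proj2 HR _ (proj1 HR'))|apply: (proj2 HR' _ (proj1 HR))].
pose U := union B.
have UR y R : y ∈ x -> least y R -> R ⊆ U.
  by move=> yx HR z zR; rewrite /U unionE; exists R; split=> //; apply/HB; exists y.
have gU : rec_set F U.
  move=> z /unionE [R [/HB [y [yx HR]] zR]].
  have [w [v [f [E [fR [ff vE]]]]]] := proj1 (proj1 HR) z zR.
  exists w, v, f; split=> //; split=> [u /fR|//]; exact: (UR y R yx HR u).
pose f := sep U (fun z => ∃ y ∈ x, exists v, z = opair y v).
have fE z : z ∈ f <-> z ∈ U /\ (∃ y ∈ x, exists v, z = opair y v) by apply: sepE; df.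
have ff : fun_on f x.
  split=> [z /fE []|y yx] //.
  have [R HR] := IH y yx; have [v vR] := proj2 (proj1 HR).
  pose proof (UR y R yx HR _ vR) as vU.
  exists v; split=> [|v' /fE [H _]]; first by apply/fE; split=> //; exists y; split=> //; exists v.
  exact: (rec_unique gU gU vU H).
pose R := union (upair U (upair (opair x (F x f)) (opair x (F x f)))).
have RE z : z ∈ R <-> z ∈ U \/ z = opair x (F x f).
  rewrite unionE; split=> [[y [/upairE [->|->]]]|[H|->]]; [by left|by move/upairE; tauto| |].
    by exists U; split=> //; apply: upair_l.
  by exists (upair (opair x (F x f)) (opair x (F x f))); split; [apply: upair_r|apply: upair_l].
have gR : above x R.
  split; last by exists (F x f); apply/RE; right.
  move=> z /RE [zU|->].
    have [w [v [g [E [gs H]]]]] := gU z zU; exists w, v, g; split=> //; split=> //.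
    by move=> u /gs ?; apply/RE; left.
  exists x, (F x f), f; split=> //; split; last by [].
  by move=> u /fE [? _]; apply/RE; left.
(* [m] is the part of [R] common to all approximations above [x]. By [rec_unique] they agree on
   histories, so [m] is itself an approximation. *)
pose m := sep R (fun z => forall R', above x R' -> z ∈ R').
have mE z : z ∈ m <-> z ∈ R /\ (forall R', above x R' -> z ∈ R') by apply: sepE; df.
exists m; split; last by move=> R' HR' z /mE [_ /(_ R' HR')].
split.
  move=> z /mE [zR zm]; have [w [v [g [E [gR' [gf vE]]]]]] := proj1 gR z zR.
  exists w, v, g; split=> //; split; last by split.
  move=> u ug; apply/mE; split; first exact: gR'.
  move=> R' HR'; have [w' [v' [g' [E' [gR'' [gf' _]]]]]] := proj1 HR' z (zm R' HR').
  have [y [yw [a Eu]]] := proj1 gf u ug; subst u.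
  move: E'; rewrite E => /opair_inj [Ew _]; subst w'.
  have [b [bg' _]] := proj2 gf' y yw.
  pose proof (gR'' _ bg') as Hb; by rewrite (rec_unique (proj1 gR) (proj1 HR') (gR' _ ug) Hb).
exists (F x f); apply/mE; split; first by apply/RE; right.
move=> R' HR'; have [v' Hv'] := proj2 HR'.
suff -> : F x f = v' by []; apply: (rec_unique (proj1 gR) (proj1 HR') _ Hv'); apply/RE; by right.
Qed.

Lemma rec_spec x : exists R, rec_set F R /\ opair x (rec F x) ∈ R.
Proof.
apply: (epsilon_spec (nonempty M) (fun v => exists R, rec_set F R /\ opair x v ∈ R)).
have [R [[gR [v Hv]] _]] := least_ex x; by exists v, R.
Qed.
Lemma rec_graph x v : v = rec F x <-> exists R, rec_set F R /\ opair x v ∈ R.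
Proof.
split=> [->|[R [gR H]]]; first exact: rec_spec.
have [R2 [gR2 H2]] := rec_spec x; exact: (rec_unique gR gR2 H H2).
Qed.
Let DTrec : DT (k := 1) (fun t : tup M 1 => rec F (hd t)).
Proof.
apply: (DT_of (Q := fun t : tup M 2 => exists R, rec_set F R /\ opair (hd (tl t)) (hd t) ∈ R)); last by df.
by move=> t y; rewrite rec_graph.
Qed.
Lemma recE x : rec F x = F x (lam x (rec F)).
Proof.
have [R [gR /gR [x' [v [f [/opair_inj [<- <-] [fR [[f1 f2] ->]]]]]]]] := rec_spec x.
congr (F x _); apply: ext => z; rewrite lamE //; split=> [zf|[y [yx ->]]].
  have [y [yx [v' E]]] := f1 z zf; exists y; split=> //; rewrite E; congr opair.
  by apply/rec_graph; exists R; split=> //; apply: fR; rewrite -E.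
have [v' [H _]] := f2 y yx; suff -> : rec F y = v' by [].
by symmetry; apply/rec_graph; exists R; split=> //; apply: fR.
Qed.
End Fixed.

Lemma DT_rec k (F : tup M k -> M -> M -> M) x :
  DT (k := S (S k)) (fun t => F (tl (tl t)) (hd (tl t)) (hd t)) -> DT x ->
  DT (fun t => rec (F t) (x t)).
Proof.
move=> HF Hx; apply: (DT_of (Q := fun t => exists R, rec_set (F (tl t)) R /\ opair (x (tl t)) (hd t) ∈ R)).
  move=> t y; rewrite rec_graph //; apply: Df_ext (Df_inst3 HF t) => u //.
apply: Df_ex; apply: Df_and; last by df.
apply: (Df_rec_set (F := fun t => F (tl (tl t)))); last by df.
by apply: (DT_call2 (k := k) (m := 4)) => //; df.
Qed.
Lemma DT_rec1 (F : M -> M -> M) k (x : tup M k -> M) :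
  DT (k := 2) (fun t : tup M 2 => F (hd (tl t)) (hd t)) -> DT x -> DT (fun t => rec F (x t)).
Proof.
move=> HF Hx; apply: (DT_rec (F := fun _ => F)) => //.
by df.
Qed.
End Recursion.
#[export] Hint Resolve Df_fun_on : df.

(** A case distinction on an outer proposition, written as a union so that it is definable whenever
    [P] is. *)
Definition ite {M : structure} (P : Prop) (a b : M) : M :=
  union (sep (upair a b) (fun z => (P /\ z = a) \/ (~ P /\ z = b))).
Definition pfst {M : structure} (p : M) : M := union (sep (union p) (fun x => exists y, p = opair x y)).
Definition psnd {M : structure} (p : M) : M := union (sep (union p) (fun y => exists x, p = opair x y)).
Definition cup {M : structure} (a b : M) : M := union (upair a b).
Definition cap {M : structure} (a b : M) : M := sep a (fun x => x ∈ b).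
Definition sing {M : structure} (a : M) : M := upair a a.
Definition ne {M : structure} (a : M) : Prop := exists x, x ∈ a.

Section More.
Context {M : structure} {HM : ZFCw M}.

Lemma DT_ite k (P : tup M k -> Prop) a b : Df P -> DT a -> DT b -> DT (fun t => ite (P t) (a t) (b t)).
Proof.
move=> HP Ha Hb; rewrite /ite; apply: DT_union; apply: DT_sep; first by df.
by apply: Df_or; apply: Df_and; try (apply: Df_not); try (exact: (Df_wk HP)); df.
Qed.
Lemma DT_pfst k (p : tup M k -> M) : DT p -> DT (fun t => pfst (p t)). Proof. by move=> H; rewrite /pfst; df. Qed.
Lemma DT_psnd k (p : tup M k -> M) : DT p -> DT (fun t => psnd (p t)). Proof. by move=> H; rewrite /psnd; df. Qed.
Lemma DT_cup k (a b : tup M k -> M) : DT a -> DT b -> DT (fun t => cup (a t) (b t)). Proof. by move=> *; rewrite /cup; df. Qed.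
Lemma DT_cap k (a b : tup M k -> M) : DT a -> DT b -> DT (fun t => cap (a t) (b t)). Proof. by move=> *; rewrite /cap; df. Qed.
Lemma DT_sing k (a : tup M k -> M) : DT a -> DT (fun t => sing (a t)). Proof. by move=> *; rewrite /sing; df. Qed.
Lemma Df_ne k (a : tup M k -> M) : DT a -> Df (fun t => ne (a t)). Proof. by move=> *; rewrite /ne; df. Qed.
Hint Resolve DT_ite DT_pfst DT_psnd DT_cup DT_cap DT_sing Df_ne : df.

Lemma cupE (a b x : M) : x ∈ cup a b <-> x ∈ a \/ x ∈ b.
Proof.
rewrite unionE; split=> [[y [/upairE [->|->]]]|[H|H]]; [by left|by right|exists a|exists b];
by rewrite upairE; tauto.
Qed.
Lemma capE (a b x : M) : x ∈ cap a b <-> x ∈ a /\ x ∈ b.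
Proof. by apply: sepE; df. Qed.
Lemma singE (a x : M) : x ∈ sing a <-> x = a.
Proof. rewrite upairE; tauto. Qed.
Lemma union_sing (a : M) : union (sing a) = a.
Proof. by apply: ext => x; rewrite unionE; split=> [[y [/singE ->]]|H] //; exists a; rewrite singE. Qed.
Lemma iteT (P : Prop) (a b : M) : P -> ite P a b = a.
Proof.
move=> p; rewrite -[RHS]union_sing; congr union; apply: ext => z; rewrite sepE; last by df.
by rewrite upairE singE; tauto.
Qed.
Lemma iteF (P : Prop) (a b : M) : ~ P -> ite P a b = b.
Proof.
move=> p; rewrite -[RHS]union_sing; congr union; apply: ext => z; rewrite sepE; last by df.
by rewrite upairE singE; tauto.
Qed.
Lemma pfstE (a b : M) : pfst (opair a b) = a.
Proof.
rewrite -[RHS]union_sing; congr union; apply: ext => z; rewrite sepE; last by df.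
rewrite singE; split=> [[_ [y /opair_inj []]]|->] //; split; last by exists b.
by rewrite unionE; exists (upair a b); split; [apply: upair_r|apply: upair_l].
Qed.
Lemma psndE (a b : M) : psnd (opair a b) = b.
Proof.
rewrite -[RHS]union_sing; congr union; apply: ext => z; rewrite sepE; last by df.
rewrite singE; split=> [[_ [y /opair_inj []]]|->] //; split; last by exists a.
by rewrite unionE; exists (upair a b); split; apply: upair_r.
Qed.
Lemma prod_eta (a b z : M) : z ∈ prod a b -> z = opair (pfst z) (psnd z) /\ pfst z ∈ a /\ psnd z ∈ b.
Proof. by move=> /prodE [x [xa [y [yb ->]]]]; rewrite pfstE psndE. Qed.
Lemma ap_uniq (f x y : M) : (forall z, opair x z ∈ f <-> z = y) -> ap f x = y.
Proof.
move=> H; rewrite -[RHS]union_sing; congr union; apply: ext => z; rewrite sepE; last by df.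
rewrite H singE; split=> [[]|->] //; split=> //.
rewrite unionE; exists (upair x y); split; last exact: upair_r.
by rewrite unionE; exists (opair x y); split; [apply/H|apply: upair_r].
Qed.
Lemma ne_not (a : M) : ~ ne a -> a = empty M.
Proof. by move=> H; apply: ext => x; rewrite emptyE; split=> // xa; apply: H; exists x. Qed.

(** The axiom is stated for disjoint families, so each [x] is replaced by [{x} × x]. *)
Lemma choice_fun (A : M) : exists g, ∀ x ∈ A, ne x -> ap g x ∈ x.
Proof.
pose B := img (sep A (@ne M)) (fun x => prod (sing x) x).
have BE z : z ∈ B <-> exists x, x ∈ A /\ ne x /\ z = prod (sing x) x.
  rewrite imgE; last by df.
  by split=> [[x [/sepE []]]|[x [xA [nx ->]]]]; [df|exists x|exists x; split=> //; rewrite sepE; df].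
have [z /BE [x [xA [[y yx] ->]]]|z zB w wB N u|c Hc] := ax_choice ZFCw_ZFC (a := B).
- by exists (opair x y); rewrite pair_prod singE.
- move: zB wB N => /BE [x [xA [nx ->]]] /BE [y [yA [ny ->]]] N.
  move=> [] /prodE [a [/singE -> [b [bx ->]]]] /prodE [a' [/singE -> [b' [_ /opair_inj [E _]]]]].
  by apply: N; rewrite E.
(* The transversal may contain unrelated sets. Only its pairs [(x, y)] with [y ∈ x] are kept, so
   that [ap] finds exactly one value at [x]. *)
- exists (sep c (fun z => exists x y, z = opair x y /\ y ∈ x)) => x xA nx.
  have [] := Hc (prod (sing x) x); first by apply/BE; exists x.
  move=> z [[/prodE [a [/singE -> [b [bx E]]]] zc] U]; subst z.
  rewrite (ap_uniq (y := b)) // => w; rewrite sepE; last by df.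
  split=> [[wc [x' [y' [/opair_inj [<- <-] wx]]]]|->]; last by split=> //; exists x, b.
  have /opair_inj [] // : opair x b = opair x w.
  by apply: U; split=> //; rewrite pair_prod singE.
Qed.

(** * Ordinals *)

Implicit Types a b c x y z : M.
Lemma Df_transitive k (a : tup M k -> M) : DT a -> Df (fun t => transitive (a t)). Proof. by move=> H; rewrite /transitive; df. Qed.
Hint Resolve Df_transitive : df.
Lemma Df_ordinal k (a : tup M k -> M) : DT a -> Df (fun t => ordinal (a t)). Proof. by move=> H; rewrite /ordinal; df. Qed.
Hint Resolve Df_ordinal : df.

Lemma ord_mem a x : ordinal a -> x ∈ a -> ordinal x.
Proof. move=> [T H] xa; split; first exact: H. by move=> y yx; apply: H; apply: (T x xa). Qed.
Lemma ord_tr a x y : ordinal a -> x ∈ a -> y ∈ x -> y ∈ a.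
Proof. by move=> [T _] xa yx; apply: (T x xa). Qed.
Lemma ord_total a b : ordinal a -> ordinal b -> a ∈ b \/ a = b \/ b ∈ a.
Proof.
elim/mem_ind: a b => a IH b; elim/mem_ind: b => b IHb Ha Hb.
case: (classic (a ∈ b)) => [|N1]; [by left|case: (classic (b ∈ a)) => [|N2]; first by tauto].
right; left; apply: ext => x; split=> H.
- have [//|[E|K]] := IH x H b (ord_mem Ha H) Hb; first by case: N2; rewrite -E.
  by case: N2; apply: ord_tr Ha H K.
- have [K|[E|//]] := IHb x H Ha (ord_mem Hb H); last by case: N1; rewrite E.
  by case: N1; apply: ord_tr Hb H K.
Qed.
Lemma ord_sub a b : ordinal a -> ordinal b -> (a ⊆ b <-> a ≼ b).
Proof.
move=> Ha Hb; split=> [H|[H|->] x xa] //; last exact: (ord_tr Hb H xa).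
by have [|[|/H/mem_irr]] := ord_total Ha Hb; [left|right|].
Qed.
Lemma ord_nle a b : ordinal a -> ordinal b -> ~ a ≼ b -> b ∈ a.
Proof. by move=> Ha Hb N; have [H|[H|//]] := ord_total Ha Hb; case: N; [left|right]. Qed.
Lemma ord_le_lt a b c : ordinal c -> a ≼ b -> b ∈ c -> a ∈ c.
Proof. by move=> Hc [H|->] // K; apply: ord_tr Hc K H. Qed.
Lemma ord_lt_le a b c : ordinal c -> a ∈ b -> b ≼ c -> a ∈ c.
Proof. by move=> Hc H [K|<-] //; apply: ord_tr Hc K H. Qed.
Lemma ord_le_tr a b c : ordinal c -> a ≼ b -> b ≼ c -> a ≼ c.
Proof. by move=> Hc [H|->] // K; left; apply: ord_lt_le Hc H K. Qed.
Lemma ord_le_anti a b : a ≼ b -> b ≼ a -> a = b.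
Proof. by move=> [H|->] // [/(mem_asym H)|]. Qed.
Lemma ord_nlt a b : ordinal a -> ordinal b -> ~ a ∈ b -> b ≼ a.
Proof. by move=> Ha Hb N; have [//|[->|H]] := ord_total Ha Hb; [right|left]. Qed.
Lemma ord_least (P : M -> Prop) : (exists x, ordinal x /\ P x) ->
  exists x, ordinal x /\ P x /\ forall y, ordinal y -> P y -> x ≼ y.
Proof.
move=> /(mem_min (P := fun x => ordinal x /\ P x)) [x [[Hx Px] mx]]; exists x; do !split=> //; try exact: (proj1 Hx); try exact: (proj2 Hx).
by move=> y Hy Py; apply: ord_nlt => // yx; apply: (mx y yx).
Qed.
Lemma ord_succ a : ordinal a -> ordinal (succ a).
Proof.
move=> H; split=> x /succE [xa|->]; try exact: (proj1 H); try exact: (proj1 (ord_mem H xa)).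
  by move=> y yx; apply/succE; left; apply: ord_tr H xa yx.
by move=> y ya; apply/succE; left.
Qed.
Lemma ord_union A : (∀ x ∈ A, ordinal x) -> ordinal (union A).
Proof.
move=> H; split=> x /unionE [y [yA xy]]; last exact: (proj1 (ord_mem (H y yA) xy)).
by move=> z zx; apply/unionE; exists y; split=> //; apply: ord_tr (H y yA) xy zx.
Qed.
Lemma ord_omega : ordinal (omega M).
Proof.
split=> x /omegaE [n ->] y /nat_mem [m [H ->]]; first exact: nat_omega.
by move=> z /nat_mem [j [K ->]]; apply/nat_mem; exists j; split=> //; lia.
Qed.
Lemma ord_nat n : ordinal (nat_in M n). Proof. exact: (ord_mem ord_omega (nat_omega n)). Qed.
Lemma no_ord_set b : ~ forall a, ordinal a -> a ∈ b.
Proof.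
move=> H; pose c := sep b (@ordinal M).
have cE a : a ∈ c <-> ordinal a by rewrite sepE; [split=> [[]|Ha] //; split=> //; apply: H|df].
apply: (mem_irr (x := c)); apply/cE; split=> x /cE Hx; last exact: (proj1 Hx).
by move=> y yx; apply/cE; apply: ord_mem Hx yx.
Qed.

(* [enum S ch] lists [S] along the ordinals, always choosing by [ch] among the remaining elements. *)
Definition enum (S : M) (ch : M -> M) : M -> M := rec (fun x f => ch (diff S (img x (ap f)))).
Section Enum.
Variables (S : M) (ch : M -> M).
Hypothesis Dch : DT (k := 1) (fun t : tup M 1 => ch (hd t)).
Hypothesis chS : forall Y, Y ⊆ S -> ne Y -> ch Y ∈ Y.
Let DF : DT (k := 2) (fun t : tup M 2 => ch (diff S (img (hd (tl t)) (ap (hd t))))).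
Proof. by df. Qed.
Lemma DT_enum k (x : tup M k -> M) : DT x -> DT (fun t => enum S ch (x t)).
Proof. by move=> H; apply: (DT_rec1 (F := fun x f => ch (diff S (img x (ap f))))). Qed.
Hint Resolve DT_enum : df.
Definition rest a := diff S (img a (enum S ch)).
Lemma restE a x : x ∈ rest a <-> x ∈ S /\ ~ ∃ b ∈ a, x = enum S ch b.
Proof. by rewrite diffE imgE; df. Qed.
Lemma enumE a : enum S ch a = ch (rest a).
Proof.
have L b : b ∈ a -> ap (lam a (enum S ch)) b = enum S ch b by move=> ba; apply: ap_lam; df.
rewrite {1}/enum recE // -/(enum S ch); congr ch; apply: ext => x; rewrite restE diffE imgE; last by df.
by split=> -[H N]; split=> // -[b [ba E]]; apply: N; exists b; split=> //; rewrite E L.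
Qed.
Lemma enum_rest a : ne (rest a) -> enum S ch a ∈ rest a.
Proof. by move=> H; rewrite enumE; apply: chS => // x /diffE []. Qed.
Lemma enum_inj a b : ne (rest a) -> b ∈ a -> enum S ch a <> enum S ch b.
Proof. by move=> /enum_rest /restE [_ N] ba E; apply: N; exists b. Qed.
(** Otherwise the listing would map all ordinals injectively into [S], and replacement along its
    inverse would collect them into a set. *)
Lemma enum_end : exists a, ordinal a /\ (∀ b ∈ a, ne (rest b)) /\ ~ ne (rest a).
Proof.
have [a [Ha [Na mx]]] : exists a, ordinal a /\ ~ ne (rest a) /\ forall y, ordinal y -> ~ ne (rest y) -> a ≼ y.
  apply: ord_least; apply: NNPP => N.
  have H a : ordinal a -> ne (rest a) by move=> Ha; apply: NNPP => K; apply: N; exists a.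
  have I a b : ordinal a -> ordinal b -> enum S ch a = enum S ch b -> a = b.
    move=> Ha Hb E; have [K|[//|K]] := ord_total Ha Hb.
      by case: (enum_inj (H b Hb) K).
    by case: (enum_inj (H a Ha) K).
  have [|x xa|B HB] := repl (P := fun x a => ordinal a /\ x = enum S ch a) (a := sep S (fun x => exists a, ordinal a /\ x = enum S ch a)); first by df.
    move: xa; rewrite sepE; last by df.
    by move=> [_ [a [Ha ->]]]; exists a; split=> // b [Hb]; apply: I.
  apply: (no_ord_set (b := B)) => a Ha; apply/HB; exists (enum S ch a); split=> //.
  rewrite sepE; last by df.
  by split; [have /restE [] := enum_rest (H a Ha)|exists a].
exists a; split=> //; split=> // b ba; apply: NNPP => /(mx b (ord_mem Ha ba)) [/(mem_asym ba)|E] //.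
by apply: (mem_irr (x := b)); rewrite -{2}E.
Qed.
End Enum.

(** * Cardinals *)

Definition bij (f a b : M) : Prop := inj f a b /\ ∀ y ∈ b, ∃ x ∈ a, ap f x = y.
Lemma eqpE a b : equinumerous a b <-> exists f, bij f a b.
Proof.
split=> [[f [Hf H]]|[f [[Hf I] S]]]; exists f.
  split; last by move=> y /H [x [[xa <-] _]]; exists x; split=> //; rewrite (app_ap Hf).
  split=> // x xa y ya E; have [z [_ U]] := H (ap f x) (ap_in Hf xa).
  by rewrite -(U x) ?(U y) //; split=> //; rewrite (app_ap Hf).
split=> // y yb; have [x [xa E]] := S y yb; exists x; split; first by rewrite (app_ap Hf).
by move=> z [za]; rewrite (app_ap Hf) // -E => /I ->.
Qed.
Lemma Df_eqp k (a b : tup M k -> M) : DT a -> DT b -> Df (fun t => equinumerous (a t) (b t)).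
Proof.
move=> Ha Hb; apply: (Df_ext (Q := fun t => exists f, bij f (a t) (b t))) => [t|]; first exact: eqpE.
by rewrite /bij; df.
Qed.
Hint Resolve Df_eqp : df.
Lemma eqp_lam a b (F : M -> M) : DT (k := 1) (fun t : tup M 1 => F (hd t)) -> (∀ x ∈ a, F x ∈ b) ->
  (∀ x y ∈ a, F x = F y -> x = y) -> (∀ y ∈ b, ∃ x ∈ a, F x = y) -> equinumerous a b.
Proof.
move=> D H I S; apply/eqpE; exists (lam a F); split; first split; first exact: lam_fun.
  by move=> x xa y ya; rewrite !ap_lam //; apply: I.
by move=> y /S [x [xa E]]; exists x; rewrite ap_lam.
Qed.
Lemma eqp_refl a : equinumerous a a.
Proof. by apply: (eqp_lam (F := fun x => x)) => [|x|x _ y _|y ya] //; [df|exists y]. Qed.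
Lemma eqp_trans a b c : equinumerous a b -> equinumerous b c -> equinumerous a c.
Proof.
move=> /eqpE [f [[Hf If] Sf]] /eqpE [g [[Hg Ig] Sg]].
apply: (eqp_lam (F := fun x => ap g (ap f x))); first by df.
- by move=> x xa; apply: (ap_in Hg); apply: (ap_in Hf).
- by move=> x xa y ya E; apply: If => //; apply: Ig => //; apply: (ap_in Hf).
- by move=> z /Sg [y [/Sf [x [xa <-]] <-]]; exists x.
Qed.
Lemma inj_inv f a b : inj f a b -> exists g, g ∈ funs (img a (ap f)) a /\ ∀ x ∈ a, ap g (ap f x) = x.
Proof.
move=> [Hf If]; pose G y := union (sep a (fun x => ap f x = y)).
have GE x : x ∈ a -> G (ap f x) = x.
  move=> xa; rewrite -[RHS]union_sing; congr union; apply: ext => z; rewrite sepE; last by df.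
  by rewrite singE; split=> [[za E]|->] //; apply: If.
have D : DT (k := 1) (fun t : tup M 1 => G (hd t)) by rewrite /G; df.
exists (lam (img a (ap f)) G); split=> [|x xa].
  by apply: lam_fun => // y; rewrite imgE; [move=> [x [xa ->]]; rewrite GE|df].
by rewrite ap_lam ?GE // imgE; [exists x|df].
Qed.
Lemma eqp_sym a b : equinumerous a b -> equinumerous b a.
Proof.
move=> /eqpE [f [If Sf]]; have [g [Hg gf]] := inj_inv If.
apply/eqpE; exists g; have E y : y ∈ b -> y ∈ img a (ap f).
  by move=> /Sf [x [xa <-]]; rewrite imgE; [exists x|df].
have gE y : y ∈ b -> ap g y ∈ a by move=> /E; apply: (ap_in Hg).
have Hb : b = img a (ap f).
  apply: ext => y; split=> [/E //|]; rewrite imgE; last by df.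
  by move=> [x [xa ->]]; apply: (ap_in (proj1 If)).
split; first split; first by rewrite Hb.
  by move=> y /Sf [x [xa <-]] z /Sf [w [wa <-]]; rewrite !gf // => ->.
by move=> x xa; exists (ap f x); rewrite gf //; split=> //; apply: (ap_in (proj1 If)).
Qed.
Lemma eqp_lec a b : equinumerous a b -> lec a b.
Proof. by move=> /eqpE [f [If _]]; exists f. Qed.

(* Cantor-Schröder-Bernstein, by the fixed point of X |-> a \ g[b \ f[X]] *)
Lemma csb a b : lec a b -> lec b a -> equinumerous a b.
Proof.
move=> [f [Hf If]] [g [Hg Ig]]; have [gi [Hgi giE]] := inj_inv (conj Hg Ig).
pose T X := diff a (img (diff b (img X (ap f))) (ap g)).
have TE X x : x ∈ T X <-> x ∈ a /\ ~ ∃ y ∈ b, (~ ∃ u ∈ X, y = ap f u) /\ x = ap g y.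
  rewrite diffE imgE; last by df.
  split=> -[xa N]; split=> //.
    by move=> [y [yb [Ny E]]]; apply: N; exists y; split=> //; apply/diffE; split=> //; rewrite imgE; df.
  by move=> [y [/diffE [yb Ny] E]]; apply: N; exists y; split=> //; split=> //; move: Ny; rewrite imgE; df.
pose X := union (sep (powerset a) (fun X => X ⊆ T X)).
have XE x : x ∈ X <-> exists Y, Y ⊆ a /\ Y ⊆ T Y /\ x ∈ Y.
  rewrite unionE; split=> [[Y [/sepE []]]|[Y [Ya [YT xY]]]]; first by rewrite /T; df.
    by rewrite powersetE => ? ? ?; exists Y.
  by exists Y; split=> //; rewrite sepE; [rewrite powersetE|rewrite /T; df].
have mono Y Z : Y ⊆ Z -> T Y ⊆ T Z.
  move=> H x /TE [xa N]; apply/TE; split=> // -[y [yb [Ny E]]]; apply: N; exists y; split=> //; split=> //.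
  by move=> [u [/H uZ E']]; apply: Ny; exists u.
have XT : X ⊆ T X.
  by move=> x /XE [Y [Ya [YT xY]]]; apply: (mono Y) (YT x xY) => z zY; apply/XE; exists Y.
have Xa : X ⊆ a by move=> x /XT /TE [].
have TX : T X ⊆ X by move=> x xT; apply/XE; exists (T X); split; [by move=> z /TE []|split=> //; apply: mono].
have out x : x ∈ a -> ~ x ∈ X -> ∃ y ∈ b, (~ ∃ u ∈ X, y = ap f u) /\ x = ap g y.
  by move=> xa xX; apply: NNPP => N; apply: xX; apply: TX; apply/TE.
pose h x := ite (x ∈ X) (ap f x) (ap gi x).
have h1 x : x ∈ X -> h x = ap f x by apply: iteT.
have h2 y : y ∈ b -> (~ ∃ u ∈ X, y = ap f u) -> ap g y ∈ a /\ h (ap g y) = y /\ ~ ap g y ∈ X.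
  move=> yb Ny; have N : ~ ap g y ∈ X by move=> /XT /TE [_]; case; exists y.
  by split; [apply: (ap_in Hg)|rewrite /h iteF ?giE].
apply: (eqp_lam (F := h)); first by rewrite /h; df.
- move=> x xa; case: (classic (x ∈ X)) => [xX|xX]; first by rewrite h1 //; apply: (ap_in Hf).
  by have [y [yb [Ny ->]]] := out x xa xX; have [_ [-> _]] := h2 y yb Ny.
- move=> x xa z za; case: (classic (x ∈ X)) => [xX|xX]; case: (classic (z ∈ X)) => [zX|zX].
  + by rewrite !h1 //; apply: If.
  + by have [y [yb [Ny ->]]] := out z za zX; have [_ [-> _]] := h2 y yb Ny; rewrite h1 // => E; case: Ny; exists x.
  + by have [y [yb [Ny ->]]] := out x xa xX; have [_ [-> _]] := h2 y yb Ny; rewrite h1 // => E; case: Ny; exists z.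
  + have [y [yb [Ny ->]]] := out x xa xX; have [w [wb [Nw ->]]] := out z za zX.
    by have [_ [-> _]] := h2 y yb Ny; have [_ [-> _]] := h2 w wb Nw => ->.
- move=> y yb; case: (classic (∃ u ∈ X, y = ap f u)) => [[u [uX ->]]|Ny].
    by exists u; split; [apply: Xa|apply: h1].
  by have [? [? _]] := h2 y yb Ny; exists (ap g y).
Qed.
End More.
#[export] Hint Resolve DT_ite DT_pfst DT_psnd DT_cup DT_cap DT_sing Df_ne Df_transitive Df_ordinal Df_eqp : df.

(** * Ranks and the collection principle *)

Section Collection.
Context {M : structure} {HM : ZFCw M}.
Definition rk : M -> M := rec (fun x f => union (img x (fun y => succ (ap f y)))).
Definition level : M -> M := rec (fun x f => union (img x (fun y => powerset (ap f y)))).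
Let DT_rk : DT (k := 1) (fun t : tup M 1 => rk (hd t)).
Proof. by apply: DT_rec1; df. Qed.
Let DT_level : DT (k := 1) (fun t : tup M 1 => level (hd t)).
Proof. by apply: DT_rec1; df. Qed.
Lemma rkE x z : z ∈ rk x <-> ∃ y ∈ x, z ∈ succ (rk y).
Proof.
have L y : y ∈ x -> ap (lam x rk) y = rk y by move=> yx; apply: ap_lam.
rewrite /rk recE; last by df.
rewrite -/rk unionE; split=> [[w []]|[y [yx H]]].
  by rewrite imgE; [move=> [y [yx ->]]; rewrite L //; exists y|df].
by exists (succ (rk y)); split=> //; rewrite imgE; [exists y; rewrite L|df].
Qed.
Lemma levelE x z : z ∈ level x <-> ∃ y ∈ x, z ⊆ level y.
Proof.
have L y : y ∈ x -> ap (lam x level) y = level y by move=> yx; apply: ap_lam.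
rewrite /level recE; last by df.
rewrite -/level unionE; split=> [[w []]|[y [yx H]]].
  by rewrite imgE; [move=> [y [yx ->]]; rewrite L // powersetE; exists y|df].
by exists (powerset (level y)); rewrite powersetE; split=> //; rewrite imgE; [exists y; rewrite L|df].
Qed.
Lemma rk_ord x : ordinal (rk x).
Proof.
elim/mem_ind: x => x IH.
have -> : rk x = union (img x (fun y => succ (rk y))).
  apply: ext => z; rewrite rkE unionE; split=> [[y [yx H]]|[w []]].
    by exists (succ (rk y)); split=> //; rewrite imgE; [exists y|df].
  by rewrite imgE; [move=> [y [yx ->]]; exists y|df].
apply: ord_union => y; rewrite imgE; last by df.
by move=> [z [zx ->]]; apply: ord_succ; apply: IH.
Qed.
Lemma sub_level x : x ⊆ level (rk x).
Proof.
elim/mem_ind: x => x IH y yx; apply/levelE; exists (rk y); split; last exact: IH.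
by apply/rkE; exists y; split=> //; apply/succE; right.
Qed.
(* Scott's trick: for each x only the witnesses of least rank are collected. *)
Lemma collect (P : M -> M -> Prop) a : Df (k := 2) (fun t : tup M 2 => P (hd (tl t)) (hd t)) ->
  exists B, ∀ x ∈ a, (exists y, P x y) -> ∃ y ∈ B, P x y.
Proof.
move=> D; pose Q x r := ordinal r /\ (exists y, P x y /\ rk y = r) /\ forall y, P x y -> r ≼ rk y.
have DQ : Df (k := 2) (fun t : tup M 2 => Q (hd (tl t)) (hd t)) by rewrite /Q /ord_le; df.
have [||B HB] := repl (P := Q) (a := sep a (fun x => exists y, P x y)) => //.
  move=> x; rewrite sepE; last by df.
  move=> [xa [y Pxy]].
  have [|r [Hr [H m]]] := ord_least (P := fun r => exists y, P x y /\ rk y = r).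
    by exists (rk y); split; [exact: rk_ord|exists y].
  exists r; split=> [|r' [Hr' [[y1 [P1 <-]] m']]].
    by split=> //; split=> // y' P'; apply: m; [exact: rk_ord|exists y'].
  move: H => [y0 [P0 E0]]; apply: ord_le_anti; last by rewrite -E0; apply: m'.
  by apply: m; [exact: rk_ord|exists y1].
exists (union (img B (fun r => powerset (level r)))) => x xa [y Pxy].
have xs : x ∈ sep a (fun x => exists y, P x y) by rewrite sepE; [split=> //; exists y|df].
have [|r [Hr [[y0 [P0 E0]] m]]] := ord_least (P := fun r => exists y, P x y /\ rk y = r).
  by exists (rk y); split; [exact: rk_ord|exists y].
exists y0; split=> //; apply/unionE; exists (powerset (level r)); split.
  rewrite imgE; last by df.
  exists r; split=> //; apply/HB; exists x; split=> //; split=> //; split; first by exists y0.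
  by move=> y' P'; apply: m; [exact: rk_ord|exists y'].
by apply/powersetE; rewrite -E0; exact: sub_level.
Qed.
End Collection.

Section Cardinals.
Context {M : structure} {HM : ZFCw M}.
Implicit Types a b c k x y z : M.

Lemma choice_fam a (Y : M -> M) : DT (k := 1) (fun t : tup M 1 => Y (hd t)) -> (∀ x ∈ a, ne (Y x)) ->
  exists c, ∀ x ∈ a, ap c x ∈ Y x.
Proof.
move=> D H; have [g Hg] := choice_fun (img a Y).
exists (lam a (fun x => ap g (Y x))) => x xa; rewrite ap_lam //.
  by apply: Hg; [rewrite imgE //; exists x|apply: H].
by apply: DT_ap; df.
Qed.
Lemma lec_img a (F : M -> M) : DT (k := 1) (fun t : tup M 1 => F (hd t)) -> lec (img a F) a.
Proof.
move=> D; have [|y|c Hc] := choice_fam (a := img a F) (Y := fun y => sep a (fun x => y = F x)).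
  by df.
  rewrite imgE // => -[x [xa E]]; exists x; rewrite sepE //; df.
have H y : y ∈ img a F -> ap c y ∈ a /\ y = F (ap c y).
  by move=> /Hc; rewrite sepE //; df.
apply: (lec_lam (F := ap c)); first by df.
  by move=> y /H [].
by move=> x /H [_ E] y /H [_ E']; rewrite {2}E {2}E' => ->.
Qed.
Lemma lec_fun_surj f a b c : f ∈ funs a b -> (∀ y ∈ c, ∃ x ∈ a, y = ap f x) -> lec c a.
Proof.
move=> Hf H; apply: (lec_trans (b := img a (ap f))); last by apply: lec_img; df.
by apply: lec_sub => y /H [x [xa ->]]; rewrite imgE; [exists x|df].
Qed.

Lemma wo S : exists a, ordinal a /\ equinumerous S a.
Proof.
have [g Hg] := choice_fun (powerset S).
have [||a [Ha [Hb Hc]]] := enum_end (S := S) (ch := ap g); first by df.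
  by move=> Y YS NY; apply: Hg => //; apply/powersetE.
exists a; split=> //; apply: eqp_sym.
have D : DT (k := 1) (fun t : tup M 1 => ap g (hd t)) by df.
have chS Y : Y ⊆ S -> ne Y -> ap g Y ∈ Y by move=> YS NY; apply: Hg => //; apply/powersetE.
apply: (eqp_lam (F := enum S (ap g))); first by apply: DT_enum; df.
- by move=> b /Hb /(enum_rest D chS); rewrite restE // => -[].
- move=> b ba d da E; have [K|[//|K]] := ord_total (ord_mem Ha ba) (ord_mem Ha da).
    by case: (enum_inj D chS (Hb d da) K).
  by case: (enum_inj D chS (Hb b ba) K).
- move=> y yS; apply: NNPP => N; apply: Hc; exists y; rewrite restE //; split=> //.
  by move=> [b [ba E]]; apply: N; exists b.
Qed.
Lemma cardinal_eq k (l : M) : is_cardinal k -> is_cardinal l -> equinumerous k l -> k = l.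
Proof.
move=> [Hk Nk] [Hl Nl] E; have [H|[//|H]] := ord_total Hk Hl; first by case: (Nl k H).
by case: (Nk l H); apply: eqp_sym.
Qed.
Lemma card_spec a : is_cardinal (card a) /\ equinumerous a (card a).
Proof.
apply: (epsilon_spec (nonempty M) (fun k => is_cardinal k /\ equinumerous a k)).
have [k [Hk [E mk]]] := ord_least (P := equinumerous a) (wo a).
exists k; split=> //; split=> // b bk E'.
have [/(mem_asym bk)|Ek] // := mk b (ord_mem Hk bk) (eqp_trans E (eqp_sym E')).
by apply: (mem_irr (x := b)); rewrite -{2}Ek.
Qed.
Lemma card_cardinal a : is_cardinal (card a). Proof. exact: (proj1 (card_spec a)). Qed.
Lemma card_ord a : ordinal (card a). Proof. exact: (proj1 (card_cardinal a)). Qed.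
Lemma card_eqp a : equinumerous a (card a). Proof. exact: (proj2 (card_spec a)). Qed.
Lemma card_unique a k : is_cardinal k -> equinumerous a k -> card a = k.
Proof. by move=> Hk E; apply: cardinal_eq => //; [apply: card_cardinal|apply: eqp_trans (eqp_sym (card_eqp a)) E]. Qed.
Lemma card_id k : is_cardinal k -> card k = k.
Proof. by move=> H; apply: card_unique => //; apply: eqp_refl. Qed.
Lemma lec_card_l a : lec (card a) a. Proof. exact: (eqp_lec (eqp_sym (card_eqp a))). Qed.
Lemma lec_card_r a : lec a (card a). Proof. exact: (eqp_lec (card_eqp a)). Qed.
Lemma ord_le_lec a b : ordinal a -> ordinal b -> a ≼ b -> lec a b.
Proof. by move=> Ha Hb /(ord_sub Ha Hb)/lec_sub. Qed.
Lemma cardinal_lec k (l : M) : is_cardinal k -> is_cardinal l -> (lec k l <-> k ≼ l).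
Proof.
move=> Hk Hl; split=> [H|]; last exact: (ord_le_lec (proj1 Hk) (proj1 Hl)).
apply: ord_nlt; [exact: (proj1 Hl)|exact: (proj1 Hk)|] => K.
apply: (proj2 Hk l K); apply: csb => //; apply: (ord_le_lec (proj1 Hl) (proj1 Hk)); by left.
Qed.
Lemma card_lec a b : lec a b <-> card a ≼ card b.
Proof.
rewrite -(cardinal_lec (card_cardinal a) (card_cardinal b)); split=> H.
  exact: (lec_trans (lec_card_l a) (lec_trans H (lec_card_r b))).
exact: (lec_trans (lec_card_r a) (lec_trans H (lec_card_l b))).
Qed.
Lemma card_le a k : is_cardinal k -> (lec a k <-> card a ≼ k).
Proof. by move=> H; rewrite card_lec (card_id H). Qed.
Lemma card_ge a k : is_cardinal k -> (lec k a <-> k ≼ card a).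
Proof. by move=> H; rewrite card_lec (card_id H). Qed.
Lemma card_lt a k : is_cardinal k -> (card a ≺ k <-> ~ lec k a).
Proof.
move=> H; rewrite (card_ge _ H); split=> [K [L|E]|]; first exact: (mem_asym K L).
  by apply: (mem_irr (x := k)); rewrite {1}E.
by move=> N; apply: ord_nle => //; [exact: (proj1 H)|exact: card_ord].
Qed.
Lemma lec_nle a b : ~ lec a b -> lec b a.
Proof.
rewrite !card_lec => N; left; apply: ord_nle => //; exact: card_ord.
Qed.
Lemma card_ord_le a : ordinal a -> card a ≼ a.
Proof.
move=> Ha; apply: ord_nlt => //; first exact: card_ord.
by move=> H; apply: (proj2 (card_cardinal a) a H); apply: card_eqp.
Qed.
Lemma mem_card_nlec k x : is_cardinal k -> x ∈ k -> ~ lec k x.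
Proof.
move=> Hk xk H; apply: (proj2 Hk x xk); apply: csb => //.
by apply: (ord_le_lec (ord_mem (proj1 Hk) xk) (proj1 Hk)); left.
Qed.

Lemma cantor a : ~ lec (powerset a) a.
Proof.
move=> H; have L : lec a (powerset a).
  apply: (lec_lam (F := sing)); first by df.
    by move=> x xa; apply/powersetE => y /singE ->.
  by move=> x _ y _ E; apply/singE; rewrite -E singE.
have [f [If Sf]] := proj1 (eqpE a (powerset a)) (csb L H).
pose d := sep a (fun x => ~ x ∈ ap f x).
have dE x : x ∈ d <-> x ∈ a /\ ~ x ∈ ap f x by rewrite sepE; df.
have [|x [xa E]] := Sf d; first by apply/powersetE => x /dE [].
by generalize (dE x); rewrite E; tauto.
Qed.
Lemma Df_cardinal n (a : tup M n -> M) : DT a -> Df (fun t => is_cardinal (a t)).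
Proof. by move=> H; rewrite /is_cardinal; df. Qed.
Lemma succ_card_spec k : ordinal k -> (is_cardinal (succ_card k) /\ k ∈ succ_card k) /\
                forall m, is_cardinal m -> k ≺ m -> succ_card k ≼ m.
Proof.
move=> Hk; apply: (epsilon_spec (nonempty M) (fun l => (is_cardinal l /\ k ≺ l) /\
                forall m, is_cardinal m -> k ≺ m -> l ≼ m)).
have [|l [_ [H m]]] := ord_least (P := fun l => is_cardinal l /\ k ∈ l).
  exists (card (powerset k)); split; first exact: card_ord.
  split; first exact: card_cardinal.
  apply: ord_nle => //; first exact: card_ord.
  move=> H; apply: (cantor (a := k)); apply: (lec_trans (lec_card_r _)).
  by apply: ord_le_lec => //; apply: card_ord.
by exists l; split=> // m' Hm H'; apply: m => //; case: Hm.
Qed.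
Lemma succ_card_cardinal k : ordinal k -> is_cardinal (succ_card k).
Proof. by move=> /succ_card_spec [[]]. Qed.
Lemma succ_card_gt k : ordinal k -> k ∈ succ_card k.
Proof. by move=> /succ_card_spec [[]]. Qed.
Lemma lec_succ_card a k : is_cardinal k -> (lec a k <-> ~ lec (succ_card k) a).
Proof.
move=> Hk; have [[Hs ks] m] := succ_card_spec (proj1 Hk).
rewrite -(card_lt _ Hs) (card_le _ Hk); split=> H; first by apply: (ord_le_lt (proj1 Hs) H).
apply: ord_nlt; [exact: (proj1 Hk)|exact: card_ord|] => K.
have [L|E] := m _ (card_cardinal a) K; first exact: (mem_asym H L).
by apply: (mem_irr (x := card a)); rewrite -{2}E.
Qed.
Lemma mem_succ_card k x : is_cardinal k -> x ∈ succ_card k -> lec x k.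
Proof.
move=> Hk xs; apply/lec_succ_card => // H.
exact: (mem_card_nlec (succ_card_cardinal (proj1 Hk)) xs).
Qed.

(** * Finite sets *)

(** Finiteness by lists of the outer logic, which allows induction on lists; it agrees with [finite]
    because ω is standard. *)
Definition fin (a : M) : Prop := exists l : list M, forall x, x ∈ a -> List.In x l.
Lemma fin_sub a b : a ⊆ b -> fin b -> fin a.
Proof. by move=> H [l L]; exists l => x /H /L. Qed.
Lemma fin_nat n : fin (nat_in M n).
Proof.
exists (List.map (nat_in M) (List.seq 0 n)) => x /nat_mem [m [H ->]].
by apply/List.in_map/List.in_seq; lia.
Qed.
Lemma fin_lec a b : lec a b -> fin b -> fin a.
Proof.
move=> [f If] [l L]; have [g [_ gf]] := inj_inv If.
by exists (List.map (ap g) l) => x xa; rewrite -(gf x xa); apply/List.in_map/L/(ap_in (proj1 If)).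
Qed.
Lemma fin_prod a b : fin a -> fin b -> fin (prod a b).
Proof.
move=> [l L] [m N]; exists (List.map (fun p => opair (fst p) (snd p)) (List.list_prod l m)) => z.
move=> /prodE [x [xa [y [yb ->]]]]; apply: (List.in_map (fun p => opair (fst p) (snd p)) _ (x, y)).
by apply: List.in_prod; [apply: L|apply: N].
Qed.
Lemma not_fin_omega : ~ fin (omega M).
Proof.
move=> [l L]; generalize (List.NoDup_incl_length (l := List.map (nat_in M) (List.seq 0 (S (length l)))) (l' := l)).
rewrite List.length_map List.length_seq => H; suff: S (length l) <= length l by lia.
apply: H; last by move=> x /List.in_map_iff [n [<- _]]; apply: L; apply: nat_omega.
by apply: List.NoDup_map_NoDup_ForallPairs; [move=> i j _ _; apply: nat_inj|apply: List.seq_NoDup].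
Qed.
Lemma cardinal_omega : is_cardinal (omega M).
Proof.
split; first exact: ord_omega.
move=> x /omegaE [n ->] /eqp_sym/eqp_lec H; apply: not_fin_omega; exact: (fin_lec H (fin_nat n)).
Qed.
Lemma fin_or_inf a : fin a \/ lec (omega M) a.
Proof.
case: (classic (lec (omega M) a)) => [|N]; [by right|left].
move: N; rewrite -(card_lt _ cardinal_omega) => /omegaE [n E].
by apply: (fin_lec (lec_card_r a)); rewrite E; apply: fin_nat.
Qed.
Lemma finiteP a : finite a <-> fin a.
Proof.
split=> [[n [/omegaE [m ->] /eqp_lec H]]|H]; first exact: (fin_lec H (fin_nat m)).
exists (card a); split; last exact: card_eqp.
apply: (proj2 (card_lt _ cardinal_omega)) => K; apply: not_fin_omega; exact: (fin_lec K H).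
Qed.
Lemma fin_bounded a : a ⊆ omega M -> fin a -> exists m, forall n, nat_in M n ∈ a -> n < m.
Proof.
move=> _ [l L]; have [m H] : exists m, forall n, List.In (nat_in M n) l -> n < m.
  elim: l {L} => [|y l [m IH]]; first by exists 0.
  case: (classic (exists j, y = nat_in M j)) => [[j ->]|N].
    by exists (S (j + m)) => n [/nat_inj|/IH]; lia.
  by exists m => n [E|/IH //]; case: N; exists n.
by exists m => n /L /H.
Qed.

(** * Products and unions *)

Lemma lec_prod a b c d : lec a c -> lec b d -> lec (prod a b) (prod c d).
Proof.
move=> [f [Hf If]] [g [Hg Ig]].
apply: (lec_lam (F := fun z => opair (ap f (pfst z)) (ap g (psnd z)))); first by df.
  by move=> z /prod_eta [_ [? ?]]; apply/pair_prod; split; [apply: (ap_in Hf)|apply: (ap_in Hg)].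
move=> z /prod_eta [E [za zb]] w /prod_eta [E' [wa wb]] /opair_inj [E1 E2].
by rewrite E E' (If _ za _ wa E1) (Ig _ zb _ wb E2).
Qed.
(** If [succ x] reached [k], then [x] would be infinite, and Hilbert's hotel ([x] goes to 0, natural
    numbers are shifted, the rest is fixed) would inject [succ x] into [x], contradicting that [k]
    is a cardinal. *)
Lemma inf_limit k x : infinite_cardinal k -> x ∈ k -> succ x ∈ k.
Proof.
move=> [Hk wk] xk; pose proof (ord_mem (proj1 Hk) xk) as Hx.
have wk' : omega M ⊆ k by apply/(ord_sub ord_omega (proj1 Hk)).
apply: ord_nle; [exact: (proj1 Hk)|exact: ord_succ|] => H.
have K : lec k (succ x) by apply: ord_le_lec => //; [exact: (proj1 Hk)|exact: ord_succ].
have wx : omega M ⊆ x.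
  apply/(ord_sub ord_omega Hx); apply: ord_nlt => //; first exact: ord_omega.
  move=> /omegaE [n E]; apply: not_fin_omega; apply: (fin_lec (lec_trans (lec_sub wk') K)).
  by rewrite E; apply: (fin_nat (S n)).
apply: (mem_card_nlec Hk xk); apply: (lec_trans K).
pose F z := ite (z = x) (empty M) (ite (z ∈ omega M) (succ z) z).
have F1 : F x = empty M by apply: iteT.
have F2 z : z <> x -> z ∈ omega M -> F z = succ z by move=> ? ?; rewrite /F iteF // iteT.
have F3 z : z <> x -> ~ z ∈ omega M -> F z = z by move=> ? ?; rewrite /F iteF // iteF.
have nx z : z ∈ x -> z <> x by move=> zx E; apply: (mem_irr (x := x)); rewrite -{1}E.
have E0 z : succ z <> empty M by move=> E; apply: (proj1 (emptyE z)); rewrite -E succE; right.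
apply: (lec_lam (F := F)); first by rewrite /F; df.
  move=> z /succE [zx|->]; last by rewrite F1; apply: wx; apply: empty_omega.
  case: (classic (z ∈ omega M)) => H'; first by rewrite F2 //; [apply: wx; apply: succ_omega|apply: nx].
  by rewrite F3 //; apply: nx.
have sj z w : succ z = succ w -> z = w.
  move=> E; have : z ∈ succ w by rewrite -E succE; right.
  have : w ∈ succ z by rewrite E succE; right.
  by rewrite !succE => -[H1|->] // [/(mem_asym H1)|->].
have P z w : z ∈ x -> w ∈ x -> F z = F w -> z = w.
  move=> /nx zx /nx wx'; case: (classic (z ∈ omega M)) => zo; case: (classic (w ∈ omega M)) => wo;
  [ by rewrite !F2 //; apply: sj
  | by rewrite F2 // F3 // => E; case: wo; rewrite -E; apply: succ_omega
  | by rewrite F3 // F2 // => E; case: zo; rewrite E; apply: succ_omega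
  | by rewrite !F3 ].
have Q z : z ∈ x -> F z <> empty M.
  move=> /nx zx; case: (classic (z ∈ omega M)) => zo; first by rewrite F2.
  by rewrite F3 // => E; apply: zo; rewrite E; apply: empty_omega.
move=> z /succE [zx|->] w /succE [wx'|->] //; first exact: P.
  by rewrite F1 => E; case: (Q z zx).
by rewrite F1 => E; case: (Q w wx').
Qed.

(** Induction on [k]. Pairs are listed by increasing maximum. If the list ran beyond [k], its first
    [k] entries would fit into the square of some [s ∈ k], whose size is below [k] by the induction
    hypothesis. *)
Lemma hessenberg k : infinite_cardinal k -> lec (prod k k) k.
Proof.
elim/mem_ind: k => k IH ik; have [Hk wk] := ik.
pose m (p : M) := cup (pfst p) (psnd p).
have Dm j (p : tup M j -> M) : DT p -> DT (fun t => m (p t)) by move=> H; rewrite /m; df.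
pose mn (Y : M) := sep Y (fun p => ∀ q ∈ Y, m p ⊆ m q).
have Dmn : DT (k := 1) (fun t : tup M 1 => mn (hd t)).
  by rewrite /mn; apply: DT_sep; first df; apply: Df_ball; first df; apply: Df_subset; apply: Dm; df.
have mnE Y p : p ∈ mn Y <-> p ∈ Y /\ ∀ q ∈ Y, m p ⊆ m q.
  by rewrite sepE //; apply: Df_ball; first df; apply: Df_subset; apply: Dm; df.
pose K := prod k k.
have om p : p ∈ K -> m p ∈ k /\ pfst p ≼ m p /\ psnd p ≼ m p.
  move=> /prod_eta [_ [pa pb]]; pose proof (ord_mem (proj1 Hk) pa) as ha; pose proof (ord_mem (proj1 Hk) pb) as hb.
  have [E|E] : m p = pfst p \/ m p = psnd p.
    have [H|H] : pfst p ≼ psnd p \/ psnd p ≼ pfst p by have [|[]] := ord_total ha hb; [left; left|left; right|right; left].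
      right; apply: ext => z; rewrite cupE; split=> [[/(proj2 (ord_sub ha hb) H)|]|] //; by right.
    left; apply: ext => z; rewrite cupE; split=> [[|/(proj2 (ord_sub hb ha) H)]|] //; by left.
    rewrite E; split=> //; split; [by right|apply/(ord_sub hb ha) => z zp; rewrite -E; apply/cupE; by right].
  rewrite E; split=> //; split; [apply/(ord_sub ha hb) => z zp; rewrite -E; apply/cupE; by left|by right].
have [g Hg] := choice_fun (powerset K); pose ch (Y : M) := ap g (mn Y).
have Dch : DT (k := 1) (fun t : tup M 1 => ch (hd t)) by apply: DT_ap; df.
have nmn Y : Y ⊆ K -> ne Y -> ne (mn Y).
  move=> YK NY; have [a [_ [[p [pY E]] ma]]] := ord_least (P := fun a => exists p, p ∈ Y /\ m p = a)
    (match NY with ex_intro _ p pY => ex_intro _ (m p) (conj (ord_mem (proj1 Hk) (proj1 (om p (YK p pY)))) (ex_intro _ p (conj pY eq_refl))) end).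
  have op q : q ∈ Y -> ordinal (m q) by move=> qY; apply: (ord_mem (proj1 Hk)); apply: (proj1 (om q (YK q qY))).
  exists p; apply/mnE; split=> // q qY; apply/ord_sub; try exact: op.
  by rewrite E; apply: ma; [apply: op|exists q].
have chmn Y : Y ⊆ K -> ne Y -> ch Y ∈ mn Y.
  by move=> YK NY; apply: Hg; [apply/powersetE => z /mnE [/YK]|apply: nmn].
have chS Y : Y ⊆ K -> ne Y -> ch Y ∈ Y by move=> YK NY; generalize (chmn Y YK NY); move=> /mnE [].
have [a [Ha [Hb Hc]]] := enum_end Dch chS.
have Ka : lec K a.
  have Ks : K ⊆ img a (enum K ch).
    move=> p pK; apply: NNPP => N; apply: Hc; exists p; rewrite restE //; split=> // -[b [ba E]].
    by apply: N; rewrite imgE; [exists b|apply: DT_enum; df].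
  by apply: (lec_trans (lec_sub Ks)); apply: lec_img; apply: DT_enum; df.
have [ak|ka] := classic (a ≼ k); first by apply: (lec_trans Ka); apply: ord_le_lec => //; case: Hk.
have {}ka : k ∈ a by apply: ord_nle => //; case: Hk.
pose proof (enum_rest Dch chS (Hb k ka)) as pr; move: pr; rewrite restE // => -[]; set p := enum K ch k => pK pN.
(* The [k]-th pair [p] was still available at every earlier stage, so the pairs listed before it
   have maximum at most [m p] and lie in the square of [s]. *)
have [mk [m1 m2]] := om p pK; pose s := succ (m p).
have sk : s ∈ k by apply: inf_limit.
pose proof (ord_mem (proj1 Hk) sk) as oms.
have le_s x : ordinal x -> x ≼ m p -> x ∈ s by move=> Hx [H|->]; rewrite succE; [left|right].
have H : lec k (prod s s).
  have nb b : b ∈ k -> ne (rest K ch b) by move=> bk; apply: Hb; apply: (ord_tr Ha ka).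
  apply: (lec_lam (F := enum K ch)); first by apply: DT_enum; df.
    move=> b bk; have rK : rest K ch b ⊆ K by move=> z /diffE [].
    generalize (chmn (rest K ch b) rK (nb b bk)); rewrite -enumE //.
    move=> /mnE []; rewrite restE // => -[bK _] H.
    have pr : p ∈ rest K ch b.
      rewrite restE //; split=> // -[c [cb E]]; apply: pN; exists c; split=> //; apply: (ord_tr (proj1 Hk) bk cb).
    pose proof (H p pr) as mm; have [bm [b1 b2]] := om _ bK; have [E [ba bb]] := prod_eta bK.
    have {}mm : m (enum K ch b) ≼ m p by apply/ord_sub => //; apply: (ord_mem (proj1 Hk)).
    rewrite E; apply/pair_prod; split; apply: le_s; try exact: (ord_mem (proj1 Hk) ba); try exact: (ord_mem (proj1 Hk) bb).
      by apply: ord_le_tr b1 mm; apply: (ord_mem (proj1 Hk)).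
    by apply: ord_le_tr b2 mm; apply: (ord_mem (proj1 Hk)).
  move=> b bk c ck E; have [L|[//|L]] := ord_total (ord_mem (proj1 Hk) bk) (ord_mem (proj1 Hk) ck).
    by case: (enum_inj Dch chS (nb c ck) L).
  by case: (enum_inj Dch chS (nb b bk) L).
have [fs|ws] := fin_or_inf s.
  case: not_fin_omega; apply: (fin_lec _ (fin_prod fs fs)); apply: lec_trans H.
  by apply: ord_le_lec => //; [exact: ord_omega|case: Hk].
case: (mem_card_nlec Hk sk); apply: (lec_trans H).
have cs : card s ∈ k by apply: (ord_le_lt (proj1 Hk) (card_ord_le oms)).
apply: (lec_trans (lec_prod (lec_card_r s) (lec_card_r s))); apply: lec_trans (lec_card_l s).
apply: IH => //; split; first exact: card_cardinal.
by apply/(card_ge _ cardinal_omega).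
Qed.
End Cardinals.
#[export] Hint Resolve Df_cardinal : df.

Definition o1 (M : structure) : M := succ_card (omega M).
Definition ctbl {M : structure} (a : M) : Prop := lec a (omega M).

Section Arithmetic.
Context {M : structure} {HM : ZFCw M}.
Implicit Types a b c k x y z f : M.

Lemma lec_prodk k a b : infinite_cardinal k -> lec a k -> lec b k -> lec (prod a b) k.
Proof. by move=> ik H K; apply: (lec_trans (lec_prod H K)); apply: hessenberg. Qed.
Lemma lec_unionk k A : infinite_cardinal k -> lec A k -> (∀ x ∈ A, lec x k) -> lec (union A) k.
Proof.
move=> ik HA H.
have [||c1 H1] := choice_fam (a := union A) (Y := fun z => sep A (fun x => z ∈ x)); first by df.
  by move=> z /unionE [x [xA zx]]; exists x; rewrite sepE; df.
have [||c2 H2] := choice_fam (a := A) (Y := fun x => sep (funs x k) (fun f => inj f x k)); first by df.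
  by move=> x /H [f If]; exists f; rewrite sepE; [split=> //; case: If|df].
apply: (lec_trans (b := prod A k)); last by apply: lec_prodk => //; apply: lec_refl.
have C1 z : z ∈ union A -> ap c1 z ∈ A /\ z ∈ ap c1 z by move=> /H1; rewrite sepE; df.
have C2 x : x ∈ A -> inj (ap c2 x) x k by move=> /H2; rewrite sepE; [case|df].
apply: (lec_lam (F := fun z => opair (ap c1 z) (ap (ap c2 (ap c1 z)) z))); first by df.
  by move=> z /C1 [zA zz]; apply/pair_prod; split=> //; apply: (ap_in (proj1 (C2 _ zA))).
move=> z /C1 [zA zz] w /C1 [wA ww] /opair_inj [E]; rewrite -E in ww *.
by apply: (proj2 (C2 _ zA)).
Qed.
Lemma lec_imgk k A (F : M -> M) : infinite_cardinal k -> DT (k := 1) (fun t : tup M 1 => F (hd t)) ->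
  lec A k -> (∀ x ∈ A, lec (F x) k) -> lec (union (img A F)) k.
Proof.
move=> ik D HA H; apply: lec_unionk => //; first by apply: (lec_trans _ HA); apply: lec_img.
by move=> y; rewrite imgE // => -[x [xA ->]]; apply: H.
Qed.
Lemma fin_inf_lec k a : infinite_cardinal k -> fin a -> lec a k.
Proof.
move=> [Hk wk] H; apply: (lec_trans (b := omega M)); last by apply: ord_le_lec => //; [exact: ord_omega|case: Hk].
apply: lec_nle => K; apply: not_fin_omega; exact: (fin_lec K H).
Qed.
Lemma fin_upair a b : fin (upair a b).
Proof. by exists (cons a (cons b nil)) => x /upairE [->|->]; [left|right; left]. Qed.
Lemma lec_cupk k a b : infinite_cardinal k -> lec a k -> lec b k -> lec (cup a b) k.
Proof.
move=> ik Ha Hb; apply: lec_unionk => //; first by apply: fin_inf_lec => //; exact: fin_upair.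
by move=> x /upairE [->|->].
Qed.
Lemma inf_omega : infinite_cardinal (omega M).
Proof. by split; [exact: cardinal_omega|right]. Qed.
Lemma inf_succ_card k : infinite_cardinal k -> infinite_cardinal (succ_card k).
Proof.
move=> [Hk wk]; split; first by apply: succ_card_cardinal; case: Hk.
left; apply: (ord_le_lt (proj1 (succ_card_cardinal (proj1 Hk))) wk); apply: succ_card_gt; case: Hk => //.
Qed.
Lemma inf_o1 : infinite_cardinal (o1 M). Proof. exact: (inf_succ_card inf_omega). Qed.
Lemma card_o1 : is_cardinal (o1 M). Proof. by case: inf_o1. Qed.
Lemma ord_o1 : ordinal (o1 M). Proof. by case: card_o1. Qed.
Lemma inf_ord k : infinite_cardinal k -> ordinal k. Proof. by move=> [[]]. Qed.
Lemma inf_omega_sub k : infinite_cardinal k -> omega M ⊆ k.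
Proof. move=> ik; apply/(ord_sub ord_omega (inf_ord ik)); by case: ik. Qed.

Lemma reg_bound k A x (F : M -> M) : regular_cardinal k -> lec A x -> x ∈ k ->
  DT (k := 1) (fun t : tup M 1 => F (hd t)) -> (∀ a ∈ A, F a ∈ k) -> ∃ b ∈ k, ∀ a ∈ A, F a ∈ b.
Proof.
move=> [ik R] [f If] xk D H; have [g [Hg gf]] := inj_inv If.
have k0 : empty M ∈ k by apply: (inf_omega_sub ik); exact: empty_omega.
pose h y := ite (y ∈ img A (ap f)) (F (ap g y)) (empty M).
have Dh : DT (k := 1) (fun t : tup M 1 => h (hd t)) by rewrite /h; df.
have Hh : lam x h ∈ funs x k.
  apply: lam_fun => // y yx; rewrite /h; case: (classic (y ∈ img A (ap f))) => H'.
    by rewrite iteT //; apply: H; apply: (ap_in Hg).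
  by rewrite iteF.
have [b [bk Hb]] := R x xk (lam x h) Hh; exists b; split=> // a aA.
pose proof (ap_in (proj1 If) aA) as fx; generalize (Hb (ap f a) fx).
rewrite (app_ap Hh) // ap_lam // /h iteT ?gf // imgE; last by df.
by exists a.
Qed.
Lemma regular_succ k : infinite_cardinal k -> regular_cardinal (succ_card k).
Proof.
move=> ik; pose proof (proj1 ik) as Hk; pose proof (succ_card_cardinal (proj1 Hk)) as Hs.
split; first exact: inf_succ_card.
move=> x xs f Hf.
have U : union (img x (ap f)) ∈ succ_card k.
  have L : lec (union (img x (ap f))) k.
    apply: lec_imgk => //; [by df|exact: (mem_succ_card Hk)|].
    by move=> y yx; apply: (mem_succ_card Hk); apply: (ap_in Hf).
  have O : ordinal (union (img x (ap f))).
    apply: ord_union => y; rewrite imgE; last by df.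
    by move=> [z [zx ->]]; apply: (ord_mem (proj1 Hs)); apply: (ap_in Hf).
  apply: ord_nle => //; [exact: (proj1 Hs)|] => K.
  apply: (proj1 (lec_succ_card _ Hk) L); apply: ord_le_lec => //; exact: (proj1 Hs).
exists (succ (union (img x (ap f)))); split; first by apply: inf_limit => //; apply: inf_succ_card.
move=> y yx; rewrite (app_ap Hf) //; pose proof (ap_in Hf yx) as Hy.
pose proof (ord_mem (proj1 Hs) Hy) as Oy; pose proof (ord_mem (proj1 Hs) U) as OU.
apply/succE; apply/(ord_sub Oy OU) => z zy; apply/unionE; exists (ap f y); split=> //.
by rewrite imgE; [exists y|df].
Qed.
Lemma reg_o1 : regular_cardinal (o1 M). Proof. exact: (regular_succ inf_omega). Qed.
Lemma mem_o1 x : x ∈ o1 M -> ctbl x. Proof. exact: (mem_succ_card cardinal_omega). Qed.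
Lemma omega_o1 : omega M ∈ o1 M. Proof. exact: (succ_card_gt ord_omega). Qed.
Lemma ctbl_bound A (F : M -> M) : ctbl A -> DT (k := 1) (fun t : tup M 1 => F (hd t)) ->
  (∀ a ∈ A, F a ∈ o1 M) -> ∃ b ∈ o1 M, ∀ a ∈ A, F a ∈ b.
Proof. by move=> H; apply: (reg_bound reg_o1 H omega_o1). Qed.
Lemma ctbl_bound_sub A : ctbl A -> A ⊆ o1 M -> ∃ b ∈ o1 M, A ⊆ b.
Proof.
move=> H K; have [||b [bo Hb]] := ctbl_bound (F := fun x => x) H; [by df|exact: K|by exists b].
Qed.
Lemma ctbl_lec_o1 a : ctbl a -> lec a (o1 M).
Proof. by move=> H; apply: (lec_trans H); apply: ord_le_lec; [exact: ord_omega|exact: ord_o1|left; exact: omega_o1]. Qed.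
Lemma o1_not_ctbl : ~ ctbl (o1 M).
Proof. exact: (mem_card_nlec card_o1 omega_o1). Qed.

(** * Powers *)

Lemma lec_powerset a b : lec a b -> lec (powerset a) (powerset b).
Proof.
move=> [f [Hf If]]; apply: (lec_lam (F := fun X => img X (ap f))); first by df.
  move=> X /powersetE XA; apply/powersetE => y; rewrite imgE; last by df.
  by move=> [x [/XA xa ->]]; apply: (ap_in Hf).
have P X Y : X ⊆ a -> Y ⊆ a -> img X (ap f) = img Y (ap f) -> X ⊆ Y.
  move=> XA YA E x xX; have : ap f x ∈ img Y (ap f) by rewrite -E imgE; [exists x|df].
  rewrite imgE; last by df.
  by move=> [y [yY /If ->]] //; [apply: XA|apply: YA].
move=> X /powersetE XA Y /powersetE YA E.
by apply: ext => z; split; [apply: (P X Y)|apply: (P Y X)].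
Qed.
Lemma lec_funs_pow a b : lec (funs a b) (powerset (prod a b)).
Proof. by apply: lec_sub => f /funsE [H _]; apply/powersetE. Qed.
Lemma lec_funs_curry a b c : lec (funs c (funs b a)) (funs (prod c b) a).
Proof.
apply: (lec_lam (F := fun f => lam (prod c b) (fun z => ap (ap f (pfst z)) (psnd z)))); first by df.
  move=> f Hf; apply: lam_fun; first by df.
  by move=> z /prod_eta [_ [? ?]]; apply: ap_in (ap_in Hf _) _.
move=> f Hf g Hg E; apply: (fun_ext Hf Hg) => x xc.
apply: (fun_ext (ap_in Hf xc) (ap_in Hg xc)) => y yb.
generalize (f_equal (fun h => ap h (opair x y)) E); cbv beta; rewrite !ap_lam ?pfstE ?psndE //; try bydf.
  by apply/pair_prod.
by apply/pair_prod.
Qed.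
Lemma lec_pow_funs a : lec (powerset a) (funs a (nat_in M 2)).
Proof.
have n0 : nat_in M 0 ∈ nat_in M 2 by apply/nat_lt; lia.
have n1 : nat_in M 1 ∈ nat_in M 2 by apply/nat_lt; lia.
apply: (lec_lam (F := fun X => lam a (fun x => ite (x ∈ X) (nat_in M 1) (nat_in M 0)))); first by df.
  move=> X _; apply: lam_fun; first by df.
  by move=> x _; case: (classic (x ∈ X)) => H; [rewrite iteT|rewrite iteF].
have P X Y : X ⊆ a -> lam a (fun x => ite (x ∈ X) (nat_in M 1) (nat_in M 0)) =
   lam a (fun x => ite (x ∈ Y) (nat_in M 1) (nat_in M 0)) -> X ⊆ Y.
  move=> XA E x xX; apply: NNPP => xY; generalize (f_equal (fun h => ap h x) E); cbv beta; rewrite !ap_lam; try bydf; try exact: XA.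
  by rewrite iteT // iteF // => /nat_inj.
move=> X /powersetE XA Y /powersetE YA E.
by apply: ext => z; split; [apply: (P X Y)|apply: (P Y X)].
Qed.
Lemma lec_funs_r a a' b : lec a a' -> lec (funs b a) (funs b a').
Proof.
move=> [f [Hf If]]; apply: (lec_lam (F := fun h => lam b (fun x => ap f (ap h x)))); first by df.
  by move=> h Hh; apply: lam_fun; [df|move=> x xb; apply: (ap_in Hf); apply: (ap_in Hh)].
move=> h Hh g Hg E; apply: (fun_ext Hh Hg) => x xb.
generalize (f_equal (fun h => ap h x) E); cbv beta; rewrite !ap_lam //; try bydf.
by apply: If; [apply: (ap_in Hh)|apply: (ap_in Hg)].
Qed.
Lemma lec_funs_l a b b' : ne a -> lec b b' -> lec (funs b a) (funs b' a).
Proof.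
move=> [a0 Ha0] [f If]; have [g [Hg gf]] := inj_inv If.
pose F h := lam b' (fun y => ite (y ∈ img b (ap f)) (ap h (ap g y)) a0).
have E h x : h ∈ funs b a -> x ∈ b -> ap (F h) (ap f x) = ap h x.
  move=> Hh xb; rewrite /F ap_lam; [|df|exact: (ap_in (proj1 If))].
  rewrite iteT ?gf // imgE; last by df.
  by exists x.
apply: (lec_lam (F := F)); first by rewrite /F; df.
  move=> h Hh; apply: lam_fun; first by df.
  move=> y _; case: (classic (y ∈ img b (ap f))) => H; last by rewrite iteF.
  by rewrite iteT //; apply: (ap_in Hh); apply: (ap_in Hg).
move=> h Hh h' Hh' E'; apply: (fun_ext Hh Hh') => x xb.
by rewrite -(E h) // -(E h') // E'.
Qed.
Lemma lec_funs_powk k a : infinite_cardinal k -> lec a (powerset k) -> lec (funs k a) (powerset k).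
Proof.
move=> ik H; apply: (lec_trans (lec_funs_r k H)).
apply: (lec_trans (lec_funs_r k (lec_pow_funs k))); apply: (lec_trans (lec_funs_curry _ _ _)).
apply: (lec_trans (lec_funs_pow _ _)); apply: lec_powerset; apply: lec_prodk => //; first exact: hessenberg.
apply: fin_inf_lec => //; exact: fin_nat.
Qed.

Lemma GCH_pow k : GCH M -> infinite_cardinal k -> lec (powerset k) (succ_card k).
Proof. by move=> G ik; rewrite -(G k ik); apply: lec_card_r. Qed.
(** By regularity every function from [m] to [k] is bounded by some [b ∈ k]. By GCH there are at
    most [k] functions from [m] to each such [b]. *)
Lemma GCH_funs m k : GCH M -> infinite_cardinal m -> regular_cardinal k -> m ∈ k -> lec (funs m k) k.
Proof.
move=> G im rk mk; pose proof (proj1 rk) as ik; pose proof (inf_ord ik) as Ok.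
have H b : b ∈ k -> lec (funs m b) k.
  move=> bk; pose proof (ord_mem Ok bk) as Ob.
  have [c [ck [mc bc]]] : exists c, c ∈ k /\ m ⊆ c /\ b ⊆ c.
    have [K|K] : m ≼ b \/ b ≼ m by have [|[]] := ord_total (inf_ord im) Ob; [left; left|left; right|right; left].
      by exists b; split=> //; split=> //; apply/(ord_sub (inf_ord im) Ob).
    by exists m; split=> //; split=> //; apply/(ord_sub Ob (inf_ord im)).
  pose proof (ord_mem Ok ck) as Oc.
  have cc : card c ∈ k by apply: (ord_le_lt Ok (card_ord_le Oc)).
  have ic : infinite_cardinal (card c).
    split; first exact: card_cardinal.
    apply/(card_ge _ cardinal_omega); apply: (lec_trans (lec_sub (inf_omega_sub im))); exact: lec_sub.
  apply: (lec_trans (lec_funs_pow _ _)).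
  apply: (lec_trans (b := powerset (card c))).
    apply: lec_powerset; apply: lec_prodk => //; apply: (lec_trans _ (lec_card_r c)); exact: lec_sub.
  apply: (lec_trans (GCH_pow G ic)); apply: ord_le_lec => //; first exact: (proj1 (succ_card_cardinal (card_ord c))).
  by apply: (proj2 (succ_card_spec (card_ord c))) => //; case: ik.
apply: (lec_trans (b := union (img k (funs m)))).
  apply: lec_sub => f Hf; have [||b [bk Hb]] := reg_bound rk (lec_refl m) mk (F := ap f); first by df.
    by move=> x xm; apply: (ap_in Hf).
  apply/unionE; exists (funs m b); split; last exact: (fun_codom Hf).
  by rewrite imgE; [exists b|df].
by apply: lec_imgk => //; [df|exact: lec_refl].
Qed.

(** * Countable subsets *)

Definition csub a := sep (powerset a) (@ctbl M).
Lemma Df_ctbl n (a : tup M n -> M) : DT a -> Df (fun t => ctbl (a t)).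
Proof. by move=> H; apply: Df_lec; df. Qed.
Lemma csubE a S : S ∈ csub a <-> S ⊆ a /\ ctbl S.
Proof. by rewrite /csub sepE; [rewrite powersetE|apply: Df_ctbl; df]. Qed.
Lemma DT_csub n (a : tup M n -> M) : DT a -> DT (fun t => csub (a t)).
Proof. by move=> H; rewrite /csub; apply: DT_sep; [df|apply: Df_ctbl; df]. Qed.
Hint Resolve Df_ctbl DT_csub : df.

Lemma small_sub_lec k m a : infinite_cardinal k -> infinite_cardinal m -> lec (funs m k) k -> lec a k ->
  lec (sep (powerset a) (fun S => lec S m)) k.
Proof.
move=> ik im Hf Ha.
have H : lec (sep (powerset a) (fun S => lec S m)) (cup (sing (empty M)) (img (funs m a) (fun f => img m (ap f)))).
  apply: lec_sub => S; rewrite sepE; last by df.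
  rewrite powersetE => -[SA [f If]]; apply/cupE.
  case: (classic (ne S)) => [[s0 s0S]|/ne_not ->]; last by left; apply/singE.
  right; rewrite imgE; last by df.
  have [g [Hg gf]] := inj_inv If.
  exists (lam m (fun y => ite (y ∈ img S (ap f)) (ap g y) s0)).
  have L : ∀ y ∈ m, ite (y ∈ img S (ap f)) (ap g y) s0 ∈ S.
    by move=> y _; case: (classic (y ∈ img S (ap f))) => K; [rewrite iteT //; apply: (ap_in Hg)|rewrite iteF].
  split; first by apply: lam_fun; [df|move=> y /L /SA].
  apply: ext => s; rewrite imgE; last by df.
  split=> [sS|[y [ym ->]]]; last by rewrite ap_lam //; [apply: L|df].
  pose proof (ap_in (proj1 If) sS) as fs; exists (ap f s); split=> //; rewrite ap_lam //; last by df.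
  rewrite iteT ?gf // imgE; last by df.
  by exists s.
apply: (lec_trans H); apply: lec_cupk => //; first by apply: fin_inf_lec => //; apply: fin_upair.
apply: (lec_trans (b := funs m a)); first by apply: lec_img; df.
by apply: (lec_trans (lec_funs_r m Ha)).
Qed.

Definition CH := lec (powerset (omega M)) (o1 M).
Lemma o1_lec_pow : lec (o1 M) (powerset (omega M)).
Proof.
apply: NNPP => N; apply: (cantor (a := omega M)).
by apply: (proj2 (lec_succ_card _ cardinal_omega)) => H; apply: N.
Qed.
Lemma CH_funs : CH -> lec (funs (omega M) (o1 M)) (o1 M).
Proof.
move=> ch; apply: (lec_trans (lec_funs_powk inf_omega _)) => //; exact: o1_lec_pow.
Qed.
Lemma CH_csub a : CH -> lec a (o1 M) -> lec (csub a) (o1 M).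
Proof. by move=> ch; apply: small_sub_lec; [exact: inf_o1|exact: inf_omega|exact: CH_funs]. Qed.

Lemma ctbl_sub a b : a ⊆ b -> ctbl b -> ctbl a.
Proof. by move=> H; apply: lec_trans; apply: lec_sub. Qed.
Lemma ctbl_img a (F : M -> M) : DT (k := 1) (fun t : tup M 1 => F (hd t)) -> ctbl a -> ctbl (img a F).
Proof. by move=> D; apply: lec_trans; apply: lec_img. Qed.

(** The closure takes ω1 steps. CH bounds the number of countable subsets of each stage, which keeps
    all stages of size at most ω1, and a countable subset of the union already lies in one stage. *)
Lemma closing X Y (Phi : M -> M) : CH -> DT (k := 1) (fun t : tup M 1 => Phi (hd t)) ->
  X ⊆ Y -> lec X (o1 M) -> (forall S, S ⊆ Y -> ctbl S -> Phi S ⊆ Y /\ lec (Phi S) (o1 M)) ->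
  exists B, X ⊆ B /\ B ⊆ Y /\ lec B (o1 M) /\ forall S, S ⊆ B -> ctbl S -> Phi S ⊆ B.
Proof.
move=> ch D XY HX HP.
pose step B := cup B (union (img (csub B) Phi)).
have Ds : DT (k := 1) (fun t : tup M 1 => step (hd t)) by rewrite /step; df.
have stepE B x : x ∈ step B <-> x ∈ B \/ exists S, S ⊆ B /\ ctbl S /\ x ∈ Phi S.
  rewrite cupE unionE; split=> -[?|]; try by left.
    by move=> [y []]; rewrite imgE // => -[S [/csubE [? ?] ->]] ?; right; exists S.
  by move=> [S [? [? ?]]]; right; exists (Phi S); split=> //; rewrite imgE //; exists S; split=> //; apply/csubE.
pose F x f := cup X (union (img x (fun b => step (ap f b)))).
have DF : DT (k := 2) (fun t : tup M 2 => F (hd (tl t)) (hd t)) by rewrite /F; df.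
pose G := rec F; have DG : DT (k := 1) (fun t : tup M 1 => G (hd t)) by apply: DT_rec1 => //; df.
have GE a x : x ∈ G a <-> x ∈ X \/ ∃ b ∈ a, x ∈ step (G b).
  have L b : b ∈ a -> ap (lam a G) b = G b by move=> ba; apply: ap_lam.
  rewrite /G recE // -/G {1}/F cupE unionE; split=> -[?|]; try by left.
    by move=> [y []]; rewrite imgE; [move=> [b [ba ->]]; rewrite L //; right; exists b|df].
  move=> [b [ba H]]; right; exists (step (G b)); split=> //; rewrite imgE; last by df.
  by exists b; rewrite L.
have GY a : G a ⊆ Y.
  elim/mem_ind: a => a IH x /GE [/XY //|[b [ba /stepE [/(IH b ba) //|[S [SG [cS xS]]]]]]].
  by apply: (proj1 (HP S _ cS)) => // y /SG /(IH b ba).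
have Gc a : a ∈ o1 M -> lec (G a) (o1 M).
  elim/mem_ind: a => a IH ao.
  have -> : G a = cup X (union (img a (fun b => step (G b)))).
    apply: ext => x; rewrite GE cupE unionE; split=> -[?|]; try by left.
      by move=> [b [ba H]]; right; exists (step (G b)); split=> //; rewrite imgE; [exists b|df].
    by move=> [y []]; rewrite imgE; [move=> [b [ba ->]]; right; exists b|df].
  apply: lec_cupk => //; first exact: inf_o1.
  apply: lec_imgk; [exact: inf_o1|by df|by apply: ctbl_lec_o1; apply: mem_o1|].
  move=> b ba; pose proof (ord_tr ord_o1 ao ba) as bo.
  apply: lec_cupk; [exact: inf_o1|exact: IH|].
  apply: lec_imgk => //; [exact: inf_o1|apply: CH_csub => //; exact: IH|].
  by move=> S /csubE [SG cS]; apply: (proj2 (HP S _ cS)) => y /SG /GY.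
exists (union (img (o1 M) G)).
have BE x : x ∈ union (img (o1 M) G) <-> exists a, a ∈ o1 M /\ x ∈ G a.
  rewrite unionE; split=> [[y []]|[a [ao xa]]]; first by rewrite imgE // => -[a [ao ->]] ?; exists a.
  by exists (G a); split=> //; rewrite imgE //; exists a.
split; first by move=> x xX; apply/BE; exists (omega M); split; [exact: omega_o1|apply/GE; left].
split; first by move=> x /BE [a [_ /GY]].
split; first by apply: lec_imgk => //; [exact: inf_o1|exact: lec_refl].
move=> S SB cS x xS.
have [||c Hc] := choice_fam (a := S) (Y := fun s => sep (o1 M) (fun a => s ∈ G a)); first by df.
  by move=> s /SB /BE [a [? ?]]; exists a; rewrite sepE; df.
have cE s : s ∈ S -> ap c s ∈ o1 M /\ s ∈ G (ap c s) by move=> /Hc; rewrite sepE; df.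
have [||b [bo Hb]] := ctbl_bound (F := ap c) cS; [by df|by move=> s /cE []|].
apply/BE; exists (succ b); split; first by apply: inf_limit; [exact: inf_o1|].
apply/GE; right; exists b; split; first by rewrite succE; right.
apply/stepE; right; exists S; split=> // s sS; have [_ /GE [sX|[d [dc sd]]]] := cE s sS.
  by apply/GE; left.
apply/GE; right; exists d; split=> //; apply: (ord_tr (ord_mem ord_o1 bo) (Hb s sS) dc).
Qed.
End Arithmetic.
#[export] Hint Resolve Df_ctbl DT_csub : df.
Arguments CH M : clear implicits.

(** * The forcing relation *)

Definition trcl {M : structure} : M -> M := rec (fun x f => cup x (union (img x (ap f)))).

Section Trcl.
Context {M : structure} {HM : ZFCw M}.
Lemma trclE (x z : M) : z ∈ trcl x <-> z ∈ x \/ ∃ y ∈ x, z ∈ trcl y.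
Proof.
have DR : DT (k := 1) (fun t : tup M 1 => trcl (hd t)) by apply: DT_rec1; df.
have L y : y ∈ x -> ap (lam x trcl) y = trcl y by move=> yx; apply: ap_lam.
rewrite {1}/trcl recE; last by df.
rewrite -/trcl cupE unionE; split=> -[?|]; try by left.
  by move=> [w []]; rewrite imgE; [move=> [y [yx ->]]; rewrite L //; right; exists y|df].
move=> [y [yx H]]; right; exists (trcl y); split=> //; rewrite imgE; last by df.
by exists y; rewrite L.
Qed.
Lemma trcl_trans (x y z : M) : y ∈ trcl x -> z ∈ y -> z ∈ trcl x.
Proof.
elim/mem_ind: x y z => x IH y z /trclE [yx|[u [ux H]]] zy; apply/trclE; right.
  by exists y; split=> //; apply/trclE; left.
by exists u; split=> //; apply: (IH u ux y).
Qed.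
Lemma dom_trcl (T s q t : M) : (forall y z, y ∈ T -> z ∈ y -> z ∈ T) -> t ∈ T -> opair s q ∈ t -> s ∈ T.
Proof.
move=> H tT st; apply: (H (upair s s)); last exact: upair_l.
by apply: (H (opair s q)); [apply: (H t)|apply: upair_l].
Qed.
(** The name [s] lies three membership steps below [t], so the induction hypothesis also carries the
    elements of [t] and their elements. *)
Lemma name_ind (Q : M -> Prop) : (forall t, (forall s q, opair s q ∈ t -> Q s) -> Q t) -> forall t, Q t.
Proof.
move=> H t; suff [] : Q t /\ (∀ y ∈ t, Q y /\ ∀ z ∈ y, Q z) by [].
elim/mem_ind: t => t IH; split; last first.
  by move=> y yt; have [Hy Ky] := IH y yt; split=> // z /Ky [].
apply: H => s q st; have [_ K] := IH _ st; have [_ K2] := K (upair s s) (upair_l _ _).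
by apply: K2; apply: upair_l.
Qed.
Definition dom (t : M) := union (union t).
Lemma DT_dom k (t : tup M k -> M) : DT t -> DT (fun u => dom (t u)). Proof. by move=> H; rewrite /dom; df. Qed.
Lemma mem_dom (s q t : M) : opair s q ∈ t -> s ∈ dom t.
Proof.
move=> H; apply/unionE; exists (upair s s); split; last exact: upair_l.
by apply/unionE; exists (opair s q); split=> //; apply: upair_l.
Qed.
End Trcl.
#[export] Hint Resolve DT_dom : df.

Section Forcing.
Context {V : structure} {HM : ZFCw V}.
Variables (P po : V).
Hypothesis FN : forcing_notion P po.
Definition ple (q p : V) := opair q p ∈ po.
Lemma Df_ple k (q p : tup V k -> V) : DT q -> DT p -> Df (fun t => ple (q t) (p t)).
Proof. by move=> *; rewrite /ple; df. Qed.
Hint Resolve Df_ple : df.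
Lemma ple_P q p : ple q p -> q ∈ P /\ p ∈ P.
Proof. by case: FN => _ [H _] /H /pair_prod. Qed.
Lemma ple_refl p : p ∈ P -> ple p p.
Proof. by case: FN => _ [_ [H _]]; apply: H. Qed.
Lemma ple_trans p q r : ple p q -> ple q r -> ple p r.
Proof.
move=> H K; have [pP qP] := ple_P H; have [_ rP] := ple_P K.
by case: FN => _ [_ [_ T]]; apply: (T p pP q qP r rP).
Qed.

(** One round of a bisimulation game: below [p], each possible element of either name is matched
    densely often by an element of the other, where matching is judged by [E]. *)
Definition fclause (E : V -> V -> V -> Prop) p s t :=
  (forall s' q, opair s' q ∈ s -> forall r, ple r p -> ple r q ->
    exists x, ple x r /\ exists t' q', opair t' q' ∈ t /\ ple x q' /\ E x s' t') /\
  (forall t' q, opair t' q ∈ t -> forall r, ple r p -> ple r q ->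
    exists x, ple x r /\ exists s' q', opair s' q' ∈ s /\ ple x q' /\ E x s' t').
(* [p] forces [s = t] iff some set of triples closed under the bisimulation clause contains [(p, s, t)]. *)
Definition fbis (R : V) := forall p s t, opair p (opair s t) ∈ R ->
  fclause (fun x a b => opair x (opair a b) ∈ R) p s t.
Definition feq p s t := exists R, fbis R /\ opair p (opair s t) ∈ R.
Lemma Df_fbis k (R : tup V k -> V) : DT R -> Df (fun t => fbis (R t)).
Proof. by move=> H; rewrite /fbis /fclause; df. Qed.
Hint Resolve Df_fbis : df.
Lemma Df_feq k (p s t : tup V k -> V) : DT p -> DT s -> DT t -> Df (fun u => feq (p u) (s u) (t u)).
Proof. by move=> *; rewrite /feq; df. Qed.
Hint Resolve Df_feq : df.
Lemma fclause_mono (E E' : V -> V -> V -> Prop) p s t : (forall x s' q t' q', opair s' q ∈ s -> opair t' q' ∈ t ->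
  E x s' t' -> x ∈ P -> E' x s' t') -> fclause E p s t -> fclause E' p s t.
Proof.
move=> H [C1 C2]; split=> a q aq r rp rq; [have [x [xr [b [q' [bq [xq Ex]]]]]] := C1 a q aq r rp rq|
  have [x [xr [b [q' [bq [xq Ex]]]]]] := C2 a q aq r rp rq];
  by exists x; split=> //; exists b, q'; split=> //; split=> //; apply: H Ex _ => //; eauto; case: (ple_P xr).
Qed.
Lemma fbis_add R p s t : fbis R -> fclause (fun x a b => opair x (opair a b) ∈ R) p s t ->
  fbis (cup R (sing (opair p (opair s t)))).
Proof.
move=> H C p' s' t' /cupE K.
have : fclause (fun x a b => opair x (opair a b) ∈ R) p' s' t'.
  by case: K => [/H //|/singE /opair_inj [-> /opair_inj [-> ->]]].
by apply: fclause_mono => *; apply/cupE; left.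
Qed.
(** For the converse a single set has to witness all matched pairs at once. It is the union [X] of
    all bisimulations on the transitive closure of [{s, t}], enlarged by the triple in question. *)
Lemma feq_unfold p s t : p ∈ P -> (feq p s t <-> fclause feq p s t).
Proof.
move=> pP; split=> [[R [HR H]]|C].
  by move: (HR _ _ _ H); apply: fclause_mono => x s' q t' q' _ _ ? _; exists R.
pose T := trcl (upair s t).
have Ttr y z : y ∈ T -> z ∈ y -> z ∈ T by apply: trcl_trans.
have sT : s ∈ T by apply/trclE; left; apply: upair_l.
have tT : t ∈ T by apply/trclE; left; apply: upair_r.
pose U := prod P (prod T T); pose X := union (sep (powerset U) fbis).
have XE z : z ∈ X <-> exists R, R ⊆ U /\ fbis R /\ z ∈ R.
  rewrite unionE; split=> [[R []]|[R [RU [HR zR]]]].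
    by rewrite sepE; [rewrite powersetE => -[? ?] ?; exists R|df].
  by exists R; split=> //; rewrite sepE; [rewrite powersetE|df].
have HX : fbis X.
  move=> q a b /XE [R [RU [HR zR]]]; move: (HR _ _ _ zR); apply: fclause_mono => x s' q0 t' q' _ _ ? _.
  by apply/XE; exists R.
have key q a b : a ∈ T -> b ∈ T -> q ∈ P -> feq q a b -> opair q (opair a b) ∈ X.
  move=> aT bT qP [R [HR zR]]; apply/XE; exists (cap R U); split; first by move=> z /capE [].
  split; last by apply/capE; rewrite !pair_prod.
  move=> q' a' b' /capE [/HR K]; rewrite !pair_prod => -[_ [a'T b'T]].
  move: K; apply: fclause_mono => x s' q0 t' q1 H1 H2 ? xP; apply/capE; rewrite !pair_prod; split=> //; split=> //.
  by split; [apply: dom_trcl H1|apply: dom_trcl H2].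
exists (cup X (sing (opair p (opair s t)))); split; last by apply/cupE; right; apply/singE.
apply: fbis_add => //; move: C; apply: fclause_mono => x s' q t' q' H1 H2 E xP.
by apply: key E => //; [apply: dom_trcl H1|apply: dom_trcl H2].
Qed.
Lemma feq_mono p q s t : ple q p -> feq p s t -> feq q s t.
Proof.
move=> qp; have [qP pP] := ple_P qp; rewrite !feq_unfold // => -[C1 C2].
by split=> a x ax r rq; [apply: (C1 a x ax r)|apply: (C2 a x ax r)]; apply: ple_trans rq qp.
Qed.
Definition dense_below p (D : V -> Prop) := forall r, ple r p -> exists x, ple x r /\ D x.
Lemma feq_local p s t : p ∈ P -> dense_below p (fun x => feq x s t) -> feq p s t.
Proof.
move=> pP H; apply/feq_unfold => //; split=> a q aq r rp rq; have [x [xr Hx]] := H r rp;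
have [xP rP] := ple_P xr; move: Hx => /feq_unfold => /(_ xP) [C1 C2].
  have [y [yx K]] := C1 a q aq x (ple_refl xP) (ple_trans xr rq).
  by exists y; split=> //; apply: ple_trans yx xr.
have [y [yx K]] := C2 a q aq x (ple_refl xP) (ple_trans xr rq).
by exists y; split=> //; apply: ple_trans yx xr.
Qed.
Definition fmem p s t := dense_below p (fun x => exists t' q, opair t' q ∈ t /\ ple x q /\ feq x s t').
Lemma Df_fmem k (p s t : tup V k -> V) : DT p -> DT s -> DT t -> Df (fun u => fmem (p u) (s u) (t u)).
Proof. by move=> *; rewrite /fmem /dense_below; df. Qed.
Hint Resolve Df_fmem : df.

(** Over ⊥, → and ∀ the clauses are those of Kripke semantics. The atomic clauses refer to density,
    and [forces_local] propagates this, which makes the relation classical. *)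
Fixpoint forces (f : formula) (p : V) (e : nat -> V) : Prop :=
  match f with
  | FMem i j => fmem p (e i) (e j)
  | FEq i j => feq p (e i) (e j)
  | FFalse => False
  | FImp f g => forall q, ple q p -> forces f q e -> forces g q e
  | FAll f => forall x, forces f p (scons x e)
  end.
Lemma DT_env k (c : nat -> V) i : DT (fun t : tup V k => env t c i).
Proof. by exists (FEq 0 (S i)), c => t. Qed.
Lemma Df_forces f k c : Df (k := S k) (fun t => forces f (hd t) (env (tl t) c)).
Proof.
elim: f k c => [i j|i j||f IHf g IHg|f IH] k c /=.
- by apply: Df_fmem; [df|apply: (DT_wk (DT_env _ _ _))|apply: (DT_wk (DT_env _ _ _))].
- by apply: Df_feq; [df|apply: (DT_wk (DT_env _ _ _))|apply: (DT_wk (DT_env _ _ _))].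
- by df.
- apply: Df_all; apply: Df_imp; first by df.
  by apply: Df_imp; [move: (IHf k c)|move: (IHg k c)] => H;
  apply: (Df_ren (k' := S (S k)) (g := fun t : tup V (S (S k)) => (hd t, tl (tl t)) : tup V (S k))
  (r := fun n => match n with 0 => 0 | S n => S (S n) end) _ H) => t d [|n].
- apply: Df_all.
  apply: (Df_ren (k := S (S k)) (k' := S (S k)) (g := fun t : tup V (S (S k)) => (hd (tl t), (hd t, tl (tl t))) : tup V (S (S k)))
  (r := fun n => match n with 0 => 1 | 1 => 0 | n => n end) _ (IH (S k) c)) => t d [|[|n]] //.
Qed.
Lemma forces_mono f p q e : ple q p -> forces f p e -> forces f q e.
Proof.
elim: f p q e => [i j|i j||f IHf g IHg|f IH] p q e qp //=.
- by move=> H r rq; apply: H; apply: ple_trans rq qp.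
- exact: feq_mono.
- by move=> H r rq; apply: H; apply: ple_trans rq qp.
- by move=> H x; apply: IH (H x).
Qed.
Lemma forces_local f p e : p ∈ P -> dense_below p (fun x => forces f x e) -> forces f p e.
Proof.
elim: f p e => [i j|i j||f IHf g IHg|f IH] p e pP /= H.
- move=> r rp; have [x [xr Hx]] := H r rp; have [xP _] := ple_P xr.
  by have [y [yx Hy]] := Hx x (ple_refl xP); exists y; split=> //; apply: ple_trans yx xr.
- exact: feq_local.
- by have [x [_ []]] := H p (ple_refl pP).
- move=> q qp Hq; apply: IHg => [|r rq]; first by case: (ple_P qp).
  have [x [xr Hx]] := H r (ple_trans rq qp); exists x; split=> //; have [xP _] := ple_P xr.
  by apply: Hx; [exact: ple_refl|apply: forces_mono Hq; apply: ple_trans xr rq].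
- move=> x; apply: IH => // r rp; have [y [yr Hy]] := H r rp; by exists y.
Qed.

(** * The generic extension *)

Variable G : V -> Prop.
Hypothesis FG : generic_filter P po G.
Lemma gen_P p : G p -> p ∈ P. Proof. exact: (gf_subset FG). Qed.
Lemma gen_up p q : G p -> ple p q -> G q. Proof. exact: (gf_upward FG). Qed.
Lemma gen_common p q : G p -> G q -> exists r, G r /\ ple r p /\ ple r q. Proof. exact: (gf_directed FG). Qed.
Lemma gen_below p (D : V -> Prop) : Df (k := 1) (fun t : tup V 1 => D (hd t)) -> G p -> dense_below p D ->
  exists x, G x /\ ple x p /\ D x.
Proof.
move=> HD Gp H.
(* Conditions incompatible with [p] are added to make the set dense; none of them can meet the
   filter, which contains [p]. *)
have [|x [Gx]] := gf_generic FG (D := sep P (fun x => (forall y, ple y x -> ~ ple y p) \/ (ple x p /\ D x))).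
  split=> [x|q qP]; first by rewrite sepE; [case|df].
  case: (classic (exists y, ple y q /\ ple y p)) => [[y [yq yp]]|N].
    have [x [xy Dx]] := H y yp; exists x; rewrite sepE; last by df.
    split; last by apply: ple_trans xy yq.
    by split; [case: (ple_P xy)|right; split=> //; apply: ple_trans xy yp].
  exists q; split; last exact: ple_refl.
  by rewrite sepE; [split=> //; left => y yq yp; apply: N; exists y|df].
rewrite sepE; last by df.
move=> [_ [N|[? ?]]]; last by exists x.
by have [y [_ [yx yp]]] := gen_common Gx Gp; case: (N y).
Qed.
Lemma gen_dense (D : V -> Prop) : Df (k := 1) (fun t : tup V 1 => D (hd t)) -> (∀ p ∈ P, exists x, ple x p /\ D x) ->
  exists x, G x /\ D x.
Proof.
move=> HD H; have [p Gp] := gf_nonempty FG.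
have [|x [? [? ?]]] := gen_below HD Gp; last by exists x.
by move=> r rp; apply: H; case: (ple_P rp).
Qed.

Definition gmem (s t : V) := exists p, G p /\ opair s p ∈ t.
Definition gbis (R : V -> V -> Prop) := forall s t, R s t ->
  (forall s', gmem s' s -> exists t', gmem t' t /\ R s' t') /\ (forall t', gmem t' t -> exists s', gmem s' s /\ R s' t').
(** Equality of values of names, expressed without evaluating them: some bisimulation relates the
    two names. The extension is the quotient by this relation. *)
Definition geq (s t : V) := exists R, gbis R /\ R s t.
Lemma geq_bis : gbis geq.
Proof.
move=> s t [R [HR Rst]]; have [C1 C2] := HR s t Rst.
by split=> [s' /C1 [t' [? ?]]|t' /C2 [s' [? ?]]]; [exists t'|exists s']; split=> //; exists R.
Qed.
Lemma geq_refl s : geq s s.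
Proof. by exists eq; split=> // a b ->; split=> c ?; exists c. Qed.
Lemma geq_sym s t : geq s t -> geq t s.
Proof.
move=> H; exists (fun a b => geq b a); split=> // a b K; have [C1 C2] := geq_bis K; by split.
Qed.
Lemma geq_trans s t u : geq s t -> geq t u -> geq s u.
Proof.
move=> H K; exists (fun a b => exists c, geq a c /\ geq c b); split; last by exists t.
move=> a b [c [ac cb]]; have [A1 A2] := geq_bis ac; have [B1 B2] := geq_bis cb.
split=> [x /A1 [y [/B1 [z [? ?]] ?]]|x /B2 [y [/A2 [z [? ?]] ?]]]; exists z; split=> //; by exists y.
Qed.

(** Forced equalities form a bisimulation, which gives one direction. For the other, a condition
    that does not force [s = t] has an extension that fixes an element of one name matched by
    nothing in the other ([N1], [N2]), and such an extension in the filter contradicts bisimilarity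
    by induction on names. *)
Theorem feq_truth s t : geq s t <-> exists p, G p /\ feq p s t.
Proof.
split; last first.
  move=> [p0 [Gp0 H0]]; exists (fun a b => exists p, G p /\ feq p a b); split; last by exists p0.
  clear H0; move=> {}s {}t [p [Gp /feq_unfold]] /(_ (gen_P Gp)) [C1 C2].
  split=> a [q [Gq aq]]; have [r [Gr [rp rq]]] := gen_common Gp Gq.
    have [||x [Gx [_ [t' [q' [H1 [H2 H3]]]]]]] := gen_below (p := r) (D := fun x => exists t' q', opair t' q' ∈ t /\ ple x q' /\ feq x a t') _ Gr.
      by df.
      by move=> r' r'r; apply: (C1 a q aq r'); [apply: ple_trans r'r rp|apply: ple_trans r'r rq].
    by exists t'; split; [exists q'; split=> //; apply: gen_up Gx H2|exists x].
  have [||x [Gx [_ [t' [q' [H1 [H2 H3]]]]]]] := gen_below (p := r) (D := fun x => exists s' q', opair s' q' ∈ s /\ ple x q' /\ feq x s' a) _ Gr.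
    by df.
    by move=> r' r'r; apply: (C2 a q aq r'); [apply: ple_trans r'r rp|apply: ple_trans r'r rq].
  by exists t'; split; [exists q'; split=> //; apply: gen_up Gx H2|exists x].
elim/name_ind: s t => s IH t H; have [C1 C2] := geq_bis H.
pose N1 x := exists s' q, opair s' q ∈ s /\ ple x q /\ forall y, ple y x -> forall t' q', opair t' q' ∈ t -> ple y q' -> ~ feq y s' t'.
pose N2 x := exists t' q, opair t' q ∈ t /\ ple x q /\ forall y, ple y x -> forall s' q', opair s' q' ∈ s -> ple y q' -> ~ feq y s' t'.
have [||x [Gx]] := gen_dense (D := fun x => feq x s t \/ N1 x \/ N2 x).
  by rewrite /N1 /N2; df.
  move=> r rP; case: (classic (feq r s t)) => [?|]; first by exists r; split; [exact: ple_refl|left].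
  rewrite feq_unfold // => NC; apply: NNPP => N; apply: NC.
  split=> a q aq r1 r1r r1q; apply: NNPP => N'; apply: N; exists r1; split=> //; right.
    by left; exists a, q; split=> //; split=> // y yr t' q' tq yq F; apply: N'; exists y; split=> //; exists t', q'.
  by right; exists a, q; split=> //; split=> // y yr t' q' tq yq F; apply: N'; exists y; split=> //; exists t', q'.
move=> [F|[[a [q [aq [xq N]]]]|[a [q [aq [xq N]]]]]]; first by exists x.
- have [|b [[q' [Gq bq']] ab]] := C1 a; first by exists q; split=> //; apply: gen_up Gx xq.
  have [y [Gy Fy]] := IH a q aq b ab.
  have [z [Gz [zx zy]]] := gen_common Gx Gy; have [w [Gw [wz wq]]] := gen_common Gz Gq.
  case: (N w (ple_trans wz zx) b q' bq' wq); apply: feq_mono Fy; exact: ple_trans wz zy.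
- have [|b [[q' [Gq bq']] ab]] := C2 a; first by exists q; split=> //; apply: gen_up Gx xq.
  have [y [Gy Fy]] := IH b q' bq' a ab.
  have [z [Gz [zx zy]]] := gen_common Gx Gy; have [w [Gw [wz wq]]] := gen_common Gz Gq.
  case: (N w (ple_trans wz zx) b q' bq' wq); apply: feq_mono Fy; exact: ple_trans wz zy.
Qed.

Definition gcarrier := {C : V -> Prop | exists t, C = geq t}.
Definition cls (t : V) : gcarrier := exist _ (geq t) (ex_intro _ t eq_refl).
Definition gstr : structure := @Structure gcarrier (fun x y => exists s t, x = cls s /\ y = cls t /\ gmem s t) (inhabits (cls P)).
Lemma cls_eq s t : cls s = cls t <-> geq s t.
Proof.
split=> [/(f_equal (fun c => proj1_sig c t)) /= ->|H]; first exact: geq_refl.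
have E : geq s = geq t.
  by apply: pred_ext => u; split=> K; [apply: geq_trans K; apply: geq_sym|apply: geq_trans K].
rewrite /cls; move: (ex_intro _ s _) (ex_intro _ t _); rewrite E => a b; congr exist; exact: Classical_Prop.proof_irrelevance.
Qed.
Lemma cls_surj (x : gstr) : exists t, x = cls t.
Proof.
case: x => C [t E]; exists t; rewrite /cls; move: (ex_intro _ t _); subst C => b.
by congr exist; exact: Classical_Prop.proof_irrelevance.
Qed.
Lemma cls_mem s t : @mem gstr (cls s) (cls t) <-> exists s', gmem s' t /\ geq s s'.
Proof.
split=> [[a [b [/cls_eq sa [/cls_eq tb ab]]]]|[s' [H /cls_eq ->]]]; last by exists s', t.
have [_ C2] := geq_bis tb; have [c [ct ca]] := C2 a ab.
by exists c; split=> //; apply: geq_trans sa _; apply: geq_sym.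
Qed.
Lemma cls_memE (x : gstr) t : x ∈ (cls t : gstr) <-> exists s p, G p /\ opair s p ∈ t /\ x = cls s.
Proof.
have [u ->] := cls_surj x; rewrite cls_mem.
split=> [[s [[p [Gp H]] /cls_eq E]]|[s [p [Gp [H /cls_eq E]]]]]; first by exists s, p.
by exists s; split=> //; exists p.
Qed.
Lemma gstr_ext : extensional gstr.
Proof.
move=> a b; have [s ->] := cls_surj a; have [t ->] := cls_surj b => H.
apply/cls_eq; exists (fun x y => geq x y \/ (x = s /\ y = t)); split; last by right.
move=> x y [/geq_bis [C1 C2]|[-> ->]].
  by split=> [x' /C1 [y' [? ?]]|y' /C2 [x' [? ?]]]; [exists y'|exists x']; split=> //; left.
split=> z [p [Gp zp]].
  have /cls_mem [w [? ?]] : (cls z : gstr) ∈ (cls t : gstr) by apply/H/cls_memE; exists z, p.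
  by exists w; split=> //; left.
have /cls_mem [w [? ?]] : (cls z : gstr) ∈ (cls s : gstr) by apply/H/cls_memE; exists z, p.
by exists w; split=> //; left; apply: geq_sym.
Qed.
Lemma gstr_wf : well_founded (@mem gstr).
Proof.
move=> x; have [t ->] := cls_surj x; elim/name_ind: t => t IH; constructor=> y /cls_memE [s [p [_ [st ->]]]].
exact: IH st.
Qed.

Lemma fmem_truth s t : @mem gstr (cls s) (cls t) <-> exists p, G p /\ fmem p s t.
Proof.
rewrite cls_mem; split=> [[s' [[q [Gq sq]] /feq_truth [p [Gp F]]]]|[p [Gp F]]].
  have [r [Gr [rp rq]]] := gen_common Gp Gq; exists r; split=> // x xr.
  exists x; split; first by apply: ple_refl; case: (ple_P xr).
  by exists s', q; split=> //; split; [apply: ple_trans xr rq|apply: feq_mono F; apply: ple_trans xr rp].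
have [|x [Gx [_ [t' [q [tq [xq H]]]]]]] := gen_below _ Gp F; first by df.
exists t'; split; first by exists q; split=> //; apply: gen_up Gx xq.
by apply/feq_truth; exists x.
Qed.

(** Induction on the formula. Implication and universal quantification use that the conditions
    forcing the formula or a definite counterexample to it are dense. *)
Theorem forcing_theorem f (e : nat -> V) :
  @sat gstr (fun n => cls (e n)) f <-> exists p, G p /\ forces f p e.
Proof.
have Sc x (e' : nat -> V) : (fun n => cls (scons x e' n)) = @scons gstr (cls x) (fun n => cls (e' n)).
  by apply: functional_extensionality => -[].
have DF g (e' : nat -> V) : Df (k := 1) (fun t : tup V 1 => forces g (hd t) e') by exact: (Df_forces g 0 e').
elim: f e => [i j|i j||f IHf g IHg|f IH] e /=.
- exact: fmem_truth.
- by rewrite cls_eq; exact: feq_truth.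
- by split=> // -[p []].
- rewrite IHf IHg; split=> [H|[p [Gp H]] [q [Gq Hq]]]; last first.
    have [r [Gr [rp rq]]] := gen_common Gp Gq; exists r; split=> //.
    by apply: H => //; apply: forces_mono Hq.
  pose proof (DF f e) as DF1; pose proof (DF g e) as DF2.
  have [||x [Gx [Hx|[Hx N]]]] := gen_dense (D := fun x => (forall q, ple q x -> forces f q e -> forces g q e) \/ (forces f x e /\ forall y, ple y x -> ~ forces g y e)).
  + apply: Df_or; [exact: (DF (FImp f g) e)|apply: Df_and; first exact: DF1].
    apply: Df_all; apply: Df_imp; first by df.
    by apply: Df_not; apply: (Df_closed1 (P := fun x => forces g x e)) => //; df.
  + move=> p pP; case: (classic (exists q, ple q p /\ forces f q e /\ forall y, ple y q -> ~ forces g y e)) => [[q [qp [Hq N]]]|N].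
      by exists q; split=> //; right.
    exists p; split; first exact: ple_refl.
    left=> q qp Hq; have [qP _] := ple_P qp; apply: forces_local => // r rq; apply: NNPP => N'; apply: N; exists r.
    split; first exact: ple_trans rq qp.
    split; first exact: forces_mono Hq.
    by move=> y yr Hy; apply: N'; exists y.
  + by exists x.
  + have [|p [Gp Hp]] := H; first by exists x.
    by have [y [_ [yx yp]]] := gen_common Gx Gp; case: (N y) => //; apply: forces_mono Hp.
- split=> [H|[p [Gp H]] x]; last first.
    have [s ->] := cls_surj x; rewrite -Sc; apply/IH; by exists p.
  have DN : Df (k := 1) (fun t : tup V 1 => forces (FAll f) (hd t) e) by exact: (DF (FAll f) e).
  have [||x [Gx [Hx|[s N]]]] := gen_dense (D := fun x => forces (FAll f) x e \/ exists s, forall y, ple y x -> ~ forces f y (scons s e)).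
  + apply: Df_or => //; apply: Df_ex; apply: Df_all; apply: Df_imp; first by df.
    apply: Df_not.
    apply: (Df_ren (k := 2) (k' := 3) (g := fun t : tup V 3 => (hd t, (hd (tl t), tt)) : tup V 2)
      (r := fun n => match n with 0 => 0 | 1 => 1 | S (S n) => S (S (S n)) end) _ (Df_forces f 1 e)) => t d [|[|n]] //.
  + move=> p pP; case: (classic (exists q s, ple q p /\ forall y, ple y q -> ~ forces f y (scons s e))) => [[q [s [qp N]]]|N].
      by exists q; split=> //; right; exists s.
    exists p; split; first exact: ple_refl.
    left=> /= s; apply: forces_local => // r rp; apply: NNPP => N'; apply: N; exists r, s; split=> // y yr Hy.
    by apply: N'; exists y.
  + by exists x.
  + generalize (H (cls s)); rewrite -Sc IH => -[p [Gp Hp]].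
    by have [y [_ [yx yp]]] := gen_common Gx Gp; case: (N y) => //; apply: forces_mono Hp.
Qed.
End Forcing.
#[export] Hint Resolve Df_ple Df_fbis Df_feq Df_fmem : df.

(** * Axioms of set theory in the generic extension *)

Section GenericModel.
Context {V : structure} {HM : ZFCw V}.
Variables (P po : V) (G : V -> Prop).
Hypotheses (FN : forcing_notion P po) (FG : generic_filter P po G).
Let W := gstr P G.
Let nm (t : V) : W := cls G t.

Lemma gen_ne : exists p, G p /\ p ∈ P.
Proof. have [p Gp] := gf_nonempty FG; exists p; split=> //; exact: (gf_subset FG). Qed.
Lemma names (e : nat -> W) : exists en, e = fun n => nm (en n).
Proof.
exists (fun n => proj1_sig (constructive_indefinite_description _ (cls_surj (e n)))).
apply: functional_extensionality => n; by case: constructive_indefinite_description.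
Qed.
Lemma nm_cons (s : V) (en : nat -> V) : scons (nm s) (fun n => nm (en n)) = fun n => nm (scons s en n).
Proof. by apply: functional_extensionality => -[]. Qed.

Lemma Df_forces1 f en k (z : tup V k -> V) : DT z -> Df (fun t => forces po f (psnd (z t)) (scons (pfst (z t)) en)).
Proof.
move=> Hz; apply: (Df_ext (Q := fun t => exists p s, p = psnd (z t) /\ s = pfst (z t) /\ forces po f p (scons s en))).
  by move=> t; split=> [H|[p [s [-> [->]]]]] //; exists (psnd (z t)), (pfst (z t)).
do 2! apply: Df_ex; do 2! (apply: Df_and; first by df).
refine (Df_ren (k := 2) (k' := S (S k)) (g := fun t : tup V (S (S k)) => (hd (tl t), (hd t, tt)) : tup V 2)
  (r := fun n => match n with 0 => 1 | 1 => 0 | S (S n) => S (S (k + n)) end) _ (Df_forces po f 1 en)).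
by move=> t d [|[|n]] //=; exact: env_ge.
Qed.
Lemma Df_forces2 f en k (z y : tup V k -> V) : DT z -> DT y ->
  Df (fun t => forces po f (psnd (z t)) (scons (y t) (scons (pfst (z t)) en))).
Proof.
move=> Hz Hy; apply: (Df_ext (Q := fun t => exists p s w, p = psnd (z t) /\ s = pfst (z t) /\ w = y t /\ forces po f p (scons w (scons s en)))).
  by move=> t; split=> [H|[p [s [w [-> [-> [->]]]]]]] //; exists (psnd (z t)), (pfst (z t)), (y t).
do 3! apply: Df_ex; do 3! (apply: Df_and; first by df).
refine (Df_ren (k := 3) (k' := S (S (S k))) (g := fun t : tup V (S (S (S k))) => (hd (tl (tl t)), (hd t, (hd (tl t), tt))) : tup V 3)
  (r := fun n => match n with 0 => 2 | 1 => 0 | 2 => 1 | S (S (S n)) => S (S (S (k + n))) end) _ (Df_forces po f 2 en)).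
by move=> t d [|[|[|n]]] //=; exact: env_ge.
Qed.

Lemma nm_memE (x : W) t : x ∈ nm t <-> exists s p, G p /\ opair s p ∈ t /\ x = nm s.
Proof. exact: cls_memE. Qed.
Lemma nm_surj (x : W) : exists t, x = nm t. Proof. exact: cls_surj. Qed.
Lemma nm_prod (x : W) t : x ∈ nm (prod t P) <-> ∃ s ∈ t, x = nm s.
Proof.
rewrite nm_memE; split=> [[s [p [_ []]]]|[s [st ->]]]; first by rewrite pair_prod => -[st _] ->; exists s.
by have [p [Gp pP]] := gen_ne; exists s, p; rewrite pair_prod.
Qed.

Lemma W_sep (f : formula) (e : nat -> W) (a : W) : exists b, forall x, x ∈ b <-> x ∈ a /\ sat (scons x e) f.
Proof.
have [en ->] := names e; have [t ->] := nm_surj a.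
pose b := sep (prod (dom t) P) (fun z => fmem po (psnd z) (pfst z) t /\ forces po f (psnd z) (scons (pfst z) en)).
have bE s p : opair s p ∈ b <-> s ∈ dom t /\ p ∈ P /\ fmem po p s t /\ forces po f p (scons s en).
  rewrite sepE; last by apply: Df_and; [df|apply: Df_forces1; df].
  by rewrite pair_prod pfstE psndE; tauto.
exists (nm b) => x; rewrite nm_memE; split=> [[s [p [Gp [/bE [_ [_ [H1 H2]]] ->]]]]|[]].
  by split; [apply/(fmem_truth FN FG); exists p|rewrite nm_cons; apply/(forcing_theorem FN FG); exists p].
rewrite nm_memE => -[s [q [Gq [st ->]]]].
rewrite nm_cons => /(forcing_theorem FN FG) [p1 [G1 F1]].
have /(fmem_truth FN FG) [p2 [G2 F2]] : @mem W (cls G s) (cls G t) by apply/nm_memE; exists s, q.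
have [p [Gp [pp1 pp2]]] := gen_common FG G1 G2; exists s, p; split=> //; split=> //; apply/bE.
split; first exact: mem_dom st.
split; first exact: (gf_subset FG).
by split; [move=> r rp; apply: F2; apply: (ple_trans FN rp)|apply: (forces_mono FN pp1)].
Qed.
Lemma W_Df_sep (a : W) (Q : W -> Prop) : Df (k := 1) (fun t : tup W 1 => Q (hd t)) -> exists b, forall x, x ∈ b <-> x ∈ a /\ Q x.
Proof.
move=> [p [c E]]; have [b Hb] := W_sep p c a; exists b => x; rewrite Hb.
have H : Q x <-> sat (scons x c) p := E (x, tt); tauto.
Qed.
Lemma W_upair (s t : V) (x : W) : x ∈ nm (prod (upair s t) P) <-> x = nm s \/ x = nm t.
Proof.
rewrite nm_prod; split=> [[u [/upairE [->|->] ->]]|[->|->]]; [by left|by right| |].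
  by exists s; split=> //; apply: upair_l.
by exists t; split=> //; apply: upair_r.
Qed.
(** Collection in the ground model, applied to pairs of a name and a condition, yields a set of
    names that contains a witness for every such pair. Separation in the extension then cuts out the
    range. *)
Lemma W_repl (f : formula) (e : nat -> W) (a : W) : (∀ x ∈ a, exists! y, sat (scons y (scons x e)) f) ->
    exists b, forall y, y ∈ b <-> ∃ x ∈ a, sat (scons y (scons x e)) f.
Proof.
have [en ->] := names e; have [t ->] := nm_surj a => H.
have [|B HB] := collect (P := fun z y => forces po f (psnd z) (scons y (scons (pfst z) en))) (prod (dom t) P).
  by apply: Df_forces2; df.
pose Q y := ∃ x ∈ nm t, sat (scons y (scons x (fun n => nm (en n)))) f.
have [|b Hb] := W_Df_sep (nm (prod B P)) (Q := Q).
  apply: Df_bex; first exact: DT_const.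
  refine (Df_ren (k := 2) (k' := 2) (g := fun t : tup W 2 => (hd (tl t), (hd t, tt)) : tup W 2)
    (r := fun n => match n with 0 => 1 | 1 => 0 | n => n end) (P := fun u => sat (env u (fun n => nm (en n))) f) _ _).
    by move=> u d [|[|n]].
  by exists f, (fun n => nm (en n)).
exists b => y; rewrite Hb; split=> [[]|Qy] //; split=> //.
have [x [xt Sy]] := Qy; have [s [q [Gq [st Ex]]]] := proj1 (nm_memE _ _) xt; subst x.
have [u Eu] := nm_surj y; subst y.
move: Sy; rewrite !nm_cons => /(forcing_theorem FN FG) [p [Gp Fp]].
have [||u' [uB]] := HB (opair s p); first by apply/pair_prod; split; [exact: mem_dom st|exact: (gf_subset FG)].
  by exists u; rewrite psndE pfstE.
rewrite psndE pfstE => F'; apply/nm_prod; exists u'; split=> //.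
have [z [_ U]] := H _ xt.
have S' : sat (scons (nm u') (scons (nm s) (fun n => nm (en n)))) f.
  by rewrite !nm_cons; apply/(forcing_theorem FN FG); exists p.
have Su : sat (scons (nm u) (scons (nm s) (fun n => nm (en n)))) f.
  by rewrite !nm_cons; apply/(forcing_theorem FN FG); exists p.
by rewrite -(U _ Su) (U _ S').
Qed.

Definition check : V -> V := rec (fun x f => img (prod x P) (fun z => opair (ap f (pfst z)) (psnd z))).
Lemma DT_check : DT (k := 1) (fun t : tup V 1 => check (hd t)).
Proof. by apply: DT_rec1; df. Qed.
Lemma checkE x z : z ∈ check x <-> ∃ y ∈ x, ∃ p ∈ P, z = opair (check y) p.
Proof.
pose proof (DT_check) as D.
have L y : y ∈ x -> ap (lam x check) y = check y by move=> yx; apply: ap_lam.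
rewrite {1}/check recE; last by df.
rewrite -/check imgE; last by df.
split=> [[w [/prodE [y [yx [p [pP ->]]]] ->]]|[y [yx [p [pP ->]]]]].
  by rewrite pfstE psndE L //; exists y; split=> //; exists p.
by exists (opair y p); rewrite pair_prod pfstE psndE L.
Qed.
Definition gincl (x : V) : W := nm (check x).
Lemma ginclE x (y : W) : y ∈ gincl x <-> exists z, z ∈ x /\ y = gincl z.
Proof.
rewrite nm_memE; split=> [[s [p [_ [/checkE [z [zx [q [_ /opair_inj [-> _]]]]] ->]]]]|[z [zx ->]]]; first by exists z.
have [p [Gp pP]] := gen_ne; exists (check z), p; split=> //; split=> //; apply/checkE.
by exists z; split=> //; exists p.
Qed.

#[local] Instance gstr_ZFw : ZFw W.
Proof.
have IE : forall x, x ∈ empty W <-> False.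
  apply: (epsilon_spec (nonempty W) (fun b => forall x, x ∈ b <-> False)).
  by exists (gincl (empty V)) => x; rewrite ginclE; split=> // -[z [/emptyE]].
have SE a : forall x, x ∈ succ (gincl a) <-> x ∈ gincl a \/ x = gincl a.
  apply: (epsilon_spec (nonempty W) (fun b => forall x, x ∈ b <-> x ∈ gincl a \/ x = gincl a)).
  exists (gincl (succ a)) => x; rewrite !ginclE; split=> [[z [/succE [za|->] ->]]|[[z [za ->]]|->]].
  by left; exists z.
  by right.
  by exists z; split=> //; apply/succE; left.
  by exists a; split=> //; apply/succE; right.
split.
- exact: gstr_ext.
- move=> a b; have [s ->] := nm_surj a; have [t ->] := nm_surj b.
  by exists (nm (prod (upair s t) P)) => x; exact: W_upair.
- move=> a; have [t Et] := nm_surj a.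
  have [|b Hb] := W_Df_sep (nm (prod (union (img (dom t) dom)) P)) (Q := fun x => ∃ y ∈ a, x ∈ y); first by df.
  exists b => x; rewrite Hb; split=> [[]|H] //; split=> //; apply/nm_prod.
  move: H => [y [ya xy]]; move: ya; rewrite Et nm_memE => -[s [p [_ [st Ey]]]].
  move: xy; rewrite Ey nm_memE => -[u [q [_ [us ->]]]].
  exists u; split=> //; apply/unionE; exists (dom s); split; last exact: mem_dom us.
  by rewrite imgE; [exists s; split=> //; exact: mem_dom st|df].
- move=> a; have [t Et] := nm_surj a.
  have [|b Hb] := W_Df_sep (nm (prod (powerset (prod (dom t) P)) P)) (Q := fun x => x ⊆ a); first by df.
  exists b => x; rewrite Hb; split=> [[]|H] //; split=> //; apply/nm_prod.
  have [u Eu] := nm_surj x.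
  (* Every subset of [a] has a name with domain inside that of [t], so a set of names from the
     ground model suffices for the power set. *)
  pose u' := sep (prod (dom t) P) (fun z => fmem po (psnd z) (pfst z) u).
  have uE s p : opair s p ∈ u' <-> s ∈ dom t /\ p ∈ P /\ fmem po p s u.
    by rewrite sepE; [rewrite pair_prod pfstE psndE; tauto|df].
  exists u'; split; first by apply/powersetE => z; rewrite sepE; [case|df].
  apply: gstr_ext => y; rewrite Eu; split.
    move=> yu; generalize (H y); rewrite Eu Et => /(_ yu); rewrite nm_memE => -[s [p [_ [st E]]]]; subst y.
    move: yu => /(fmem_truth FN FG) [q [Gq F]]; apply/nm_memE; exists s, q; split=> //; split=> //.
    by apply/uE; split; [exact: mem_dom st|split=> //; exact: (gf_subset FG)].
  rewrite nm_memE => -[s [p [Gp [/uE [_ [_ F]] ->]]]]; apply/(fmem_truth FN FG); by exists p.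
- exists (gincl (omega V)); split.
    have -> : empty W = gincl (empty V).
      by apply: gstr_ext => x; rewrite IE ginclE; split=> // -[z [/emptyE]].
    by apply/ginclE; exists (empty V); split=> //; exact: empty_omega.
  move=> x /ginclE [n [no ->]].
  have -> : succ (gincl n) = gincl (succ n).
    apply: gstr_ext => x'; rewrite SE !ginclE; split=> [[[z [za ->]]|->]|[z [/succE [za|->] ->]]].
    by exists z; split=> //; apply/succE; left.
    by exists n; split=> //; apply/succE; right.
    by left; exists z.
    by right.
  by apply/ginclE; exists (succ n); split=> //; exact: succ_omega.
- exact: W_sep.
- exact: W_repl.
- exact: gstr_wf.
Qed.

Lemma gincl_inj x y : gincl x = gincl y -> x = y.
Proof.
elim/(mem_ind (M := V)): x y => x IH y E; apply: ext => z; split=> H.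
  have : gincl z ∈ gincl y by rewrite -E; apply/ginclE; exists z.
  by move=> /ginclE [w [wy /(IH z H) ->]].
have : gincl z ∈ gincl x by rewrite E; apply/ginclE; exists z.
by move=> /ginclE [w [wx K]]; rewrite -(IH w wx z).
Qed.
Lemma gincl_mem x y : gincl x ∈ gincl y <-> x ∈ y.
Proof. by rewrite ginclE; split=> [[z [zy /gincl_inj ->]]|H] //; exists x. Qed.

Definition opn (s t : V) := prod (upair (prod (upair s s) P) (prod (upair s t) P)) P.
Lemma DT_opn k (s t : tup V k -> V) : DT s -> DT t -> DT (fun u => opn (s u) (t u)).
Proof. by move=> *; rewrite /opn; df. Qed.
Lemma nm_opn s t : nm (opn s t) = opair (nm s) (nm t).
Proof.
have U a b : nm (prod (upair a b) P) = upair (nm a) (nm b).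
  by apply: gstr_ext => x; rewrite W_upair upairE.
by rewrite /opn U !U.
Qed.

(** The names [D] of the relevant elements are well-ordered in the ground model by [f]. In the
    extension [N] relates the ordinal of a name to its value, and [c] takes from each member of the
    family the element attached to the least ordinal. *)
#[local] Instance gstr_ZFCw : ZFCw W.
Proof.
split; first exact: gstr_ZFw.
split; [exact: gstr_ext| |exact: zf_pair|exact: zf_union|exact: zf_power|exact: zf_inf|exact: zf_sep|exact: zf_repl| ].
  by move=> a [x xa]; have [y [ya my]] := mem_min (P := fun y => y ∈ a) (ex_intro _ x xa); exists y.
pose proof gstr_ZFw as HW; move=> a Hne Hdj; have [t Et] := nm_surj a.
have [al [Oal /eqpE [f [[Hf If] _]]]] := wo (union (img (dom t) dom)); set D := union _ in Hf If.
pose proof (DT_check) as Dc; pose proof (DT_opn) as Do.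
pose N := img (prod D P) (fun z => opair (opn (check (ap f (pfst z))) (pfst z)) (psnd z)).
have NE (w : W) : w ∈ nm N <-> ∃ s ∈ D, w = opair (gincl (ap f s)) (nm s).
  rewrite nm_memE; split=> [[u [p [Gp [H ->]]]]|[s [sD ->]]].
    move: H; rewrite imgE; last by apply: DT_opair; [apply: Do; df|df].
    move=> [z [/prodE [s [sD [q [qP ->]]]]]]; rewrite pfstE => /opair_inj [-> _].
    by exists s; split=> //; rewrite nm_opn.
  have [p [Gp pP]] := gen_ne; exists (opn (check (ap f s)) s), p; split=> //; split; last by rewrite nm_opn.
  rewrite imgE; last by apply: DT_opair; [apply: Do; df|df].
  by exists (opair s p); rewrite pair_prod pfstE psndE.
pose c := sep (union a) (fun x => ∃ y ∈ a, x ∈ y /\ exists b, opair b x ∈ nm N /\ ∀ x' ∈ y, forall b', opair b' x' ∈ nm N -> ~ b' ∈ b).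
have cE x : x ∈ c <-> x ∈ union a /\ (∃ y ∈ a, x ∈ y /\ exists b, opair b x ∈ nm N /\ ∀ x' ∈ y, forall b', opair b' x' ∈ nm N -> ~ b' ∈ b).
  by rewrite sepE; df.
have inN y x : y ∈ a -> x ∈ y -> exists b, opair b x ∈ nm N.
  rewrite Et nm_memE => -[s [p [_ [st ->]]]]; rewrite nm_memE => -[u [q [_ [us ->]]]].
  exists (gincl (ap f u)); apply/NE; exists u; split=> //; apply/unionE; exists (dom s); split; last exact: mem_dom us.
  by rewrite imgE; [exists s; split=> //; exact: mem_dom st|df].
exists c => y ya.
have [|b [[x [xy bx]] mb]] := mem_min (P := fun b => ∃ x ∈ y, opair b x ∈ nm N).
  by have [x xy] := Hne y ya; have [b Hb] := inN y x ya xy; exists b, x.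
have mb' x' b' : x' ∈ y -> opair b' x' ∈ nm N -> ~ b' ∈ b.
  by move=> x'y H bb; apply: (mb b' bb); exists x'.
exists x; split.
  split=> //; apply/cE; split; first by apply/unionE; exists y.
  by exists y; split=> //; split=> //; exists b; split=> // x' x'y b'; apply: mb'.
move=> x2 [x2y /cE [_ [y2 [y2a [x2y2 [b2 [bx2 m2]]]]]]].
have E : y2 = y by apply: NNPP => NEy; apply: (Hdj y2 y2a y ya NEy x2).
subst y2; pose proof (mb' _ _ x2y bx2) as N1; pose proof (m2 x xy b bx) as N2.
move: bx => /NE [s [sD /opair_inj [Eb Ex]]]; move: bx2 => /NE [s2 [s2D /opair_inj [Eb2 Ex2]]].
rewrite Ex Ex2; congr nm; apply: If => //; subst b b2.
have [H|[//|H]] := ord_total (ord_mem Oal (ap_in Hf sD)) (ord_mem Oal (ap_in Hf s2D)).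
  by case: N2; apply/gincl_mem.
by case: N1; apply/gincl_mem.
Qed.

Definition mk_extension : forcing_extension V :=
  @Build_forcing_extension V P po G W nm gincl FN FG (@gstr_ext V P G)
  (fun t y => nm_memE y t) (fun y => match nm_surj y with ex_intro _ t E => ex_intro _ t (eq_sym E) end) ginclE.
End GenericModel.

Lemma ctm_ZFCw (V : structure) : countable_transitive_model V -> ZFCw V.
Proof. by move=> [[? ? ? ? ? ? ? ? ?] ? ?]; do 2! split. Qed.

(** Countability of [V] lists its dense sets as [en n], and a descending sequence of conditions
    meets them one after another; indices that list no dense set leave the condition unchanged. *)
Lemma generic_exists (V : structure) (P po p0 : V) : countable_transitive_model V -> forcing_notion P po ->
  p0 ∈ P -> exists G, generic_filter P po G /\ G p0.
Proof.
move=> C; pose proof (ctm_ZFCw C) as HM; case: C => _ _ [en He] FN p0P.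
pose D n := dense P po (en n).
pose Pt := {p : V | p ∈ P}.
have step n (p : Pt) : exists q : Pt, ple po (proj1_sig q) (proj1_sig p) /\ (D n -> proj1_sig q ∈ en n).
  case: p => p pP; case: (classic (D n)) => [[S H]|N]; last by exists (exist _ p pP); split=> //; apply: (ple_refl FN).
  have [q [qD qp]] := H p pP; exists (exist _ q (S q qD)); split=> // _.
pose next n p := proj1_sig (constructive_indefinite_description _ (step n p)).
have nextE n p : ple po (proj1_sig (next n p)) (proj1_sig p) /\ (D n -> proj1_sig (next n p) ∈ en n).
  by rewrite /next; case: constructive_indefinite_description.
have [s [s0 sS]] : exists s : nat -> Pt, s 0 = exist _ p0 p0P /\ forall k, s (S k) = next k (s k).
  by exists (fix s n : Pt := match n with 0 => exist _ p0 p0P | S n => next n (s n) end).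
have sle m n : m <= n -> ple po (proj1_sig (s n)) (proj1_sig (s m)).
  elim=> [|k _ IH]; first by apply: (ple_refl FN); case: (s m).
  have [H _] := nextE k (s k); rewrite -sS in H; by apply: (ple_trans FN (q := proj1_sig (s k))).
exists (fun p => exists n, ple po (proj1_sig (s n)) p); split; last by exists 0; rewrite s0; apply: (ple_refl FN).
split.
- by move=> p [n /(ple_P FN) []].
- by exists p0, 0; rewrite s0; apply: (ple_refl FN).
- by move=> p q [n H] K; exists n; apply: (ple_trans FN H).
- move=> p q [m Hm] [n Hn]; exists (proj1_sig (s (m + n))); split.
    by exists (m + n); apply: (ple_refl FN) => //; case: (s (m + n)).
  by split; [apply: (ple_trans FN _ Hm)|apply: (ple_trans FN _ Hn)]; apply: sle; lia.
- move=> E HE; have [n En] := He E; exists (proj1_sig (s (S n))); split.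
    by exists (S n); apply: (ple_refl FN) => //; case: (s (S n)).
  by rewrite -En sS; apply: (proj2 (nextE n (s n))); rewrite /D En.
Qed.

(** * Ground model sets and decided values in the extension *)

Section Transfer.
Context {V : structure} {HM : ZFCw V}.
Variables (P po : V) (G : V -> Prop).
Hypotheses (FN : forcing_notion P po) (FG : generic_filter P po G).
Notation W := (gstr P G).
Notation i := (gincl P G).
Let HW : ZFCw W := gstr_ZFCw FN FG.
Local Existing Instance HW.

Lemma i_mem x y : i x ∈ i y <-> x ∈ y. Proof. exact: (gincl_mem FG). Qed.
Lemma i_inj x y : i x = i y -> x = y. Proof. exact: (gincl_inj FG). Qed.
Lemma i_elem (x : V) (y : W) : y ∈ i x -> ∃ z ∈ x, y = i z.
Proof. by move/(ginclE FG). Qed.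
Lemma i_ext (x : V) (w : W) : (∀ z ∈ x, i z ∈ w) -> (∀ y ∈ w, ∃ z ∈ x, y = i z) -> w = i x.
Proof.
move=> H K; apply: ext => y; split=> [/K [z [zx ->]]|/i_elem [z [zx ->]]]; first by apply/i_mem.
exact: H.
Qed.
Lemma i_empty : empty W = i (empty V).
Proof. by apply: i_ext => [z /emptyE|y /emptyE]. Qed.
Lemma i_upair a b : upair (i a) (i b) = i (upair a b).
Proof.
apply: i_ext => [z /upairE [->|->]|y /upairE [->|->]]; [exact: upair_l|exact: upair_r|exists a|exists b];
by split=> //; apply/upairE; tauto.
Qed.
Lemma i_opair a b : opair (i a) (i b) = i (opair a b).
Proof. by rewrite /opair !i_upair. Qed.
Lemma i_succ a : succ (i a) = i (succ a).
Proof.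
apply: i_ext => [z /succE [za|->]|y /succE [/i_elem [z [za ->]]|->]]; [by apply/succE; left; apply/i_mem|by apply/succE; right| |].
  by exists z; rewrite succE; split=> //; left.
by exists a; rewrite succE; split=> //; right.
Qed.
Lemma i_nat n : nat_in W n = i (nat_in V n).
Proof. by elim: n => [|n /= ->]; [exact: i_empty|exact: i_succ]. Qed.
Lemma i_omega : omega W = i (omega V).
Proof.
apply: i_ext => [z /omegaE [n ->]|y /omegaE [n ->]]; rewrite ?i_nat -?i_nat; first exact: nat_omega.
by exists (nat_in V n); split; [exact: nat_omega|exact: i_nat].
Qed.
Lemma i_sub a b : i a ⊆ i b <-> a ⊆ b.
Proof.
split=> [H x xa|H y /i_elem [x [/H xb ->]]]; last by apply/i_mem.
by apply/i_mem; apply: H; apply/i_mem.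
Qed.
Lemma i_ord a : ordinal a -> ordinal (i a).
Proof.
move=> [H K]; have T x : transitive x -> transitive (i x).
  by move=> Hx y /i_elem [z [zx ->]]; apply/i_sub; apply: Hx.
by split=> [|y /i_elem [z [za ->]]]; apply: T => //; apply: K.
Qed.
Lemma i_prod a b : prod (i a) (i b) = i (prod a b).
Proof.
apply: i_ext => [z /prodE [x [xa [y [yb ->]]]]|z /prodE [x [/i_elem [x' [xa ->]] [y [/i_elem [y' [yb ->]] ->]]]]].
  by rewrite -i_opair pair_prod !i_mem.
by exists (opair x' y'); rewrite pair_prod i_opair.
Qed.
Lemma i_pfst a : (exists x y, a = opair x y) -> pfst (i a) = i (pfst a) /\ psnd (i a) = i (psnd a).
Proof. by move=> [x [y ->]]; rewrite -i_opair !pfstE !psndE. Qed.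
Lemma i_funs f a b : f ∈ funs a b -> i f ∈ funs (i a) (i b) /\ ∀ x ∈ a, ap (i f) (i x) = i (ap f x).
Proof.
move=> Hf; have Hi : i f ∈ funs (i a) (i b).
  apply/funsE; split; first by rewrite i_prod; apply/i_sub; case/funsE: Hf.
  move=> y /i_elem [x [xa ->]]; exists (i (ap f x)); split.
    by rewrite i_opair; apply/i_mem; apply: (ap_pair Hf).
  move=> y' H; have [w [wf E]] := i_elem H.
  generalize (Hf); move=> /funsE [/(_ w wf) /prodE [u [ua [v [vb Ew]]]] _].
  move: E; rewrite Ew -i_opair => /opair_inj [/i_inj E1 ->]; congr gincl.
  by apply: (ap_eq Hf); rewrite E1 -Ew.
split=> // x xa; apply: (ap_eq Hi); rewrite i_opair; apply/i_mem; exact: (ap_pair Hf).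
Qed.
Lemma i_lec a b : lec a b -> lec (i a) (i b).
Proof.
move=> [f [Hf If]]; have [Hi E] := i_funs Hf; exists (i f); split=> //.
by move=> y /i_elem [x [xa ->]] z /i_elem [x' [xa' ->]]; rewrite !E // => /i_inj /If ->.
Qed.

Lemma gen_set : exists Gs : W, forall y, y ∈ Gs <-> exists p, G p /\ y = i p.
Proof.
pose proof (DT_check P) as Dc.
exists (cls G (img P (fun p => opair (check P p) p))) => y; rewrite nm_memE.
split=> [[s [p [Gp [H ->]]]]|[p [Gp ->]]].
  move: H; rewrite imgE; last by df.
  by move=> [q [qP /opair_inj [-> Ep]]]; exists q; rewrite -Ep.
exists (check P p), p; split=> //; split=> //; rewrite imgE; last by df.
by exists p; split=> //; apply: (gf_subset FG).
Qed.

Definition Dec (t p d h : V) := fmem po p (opn P (check P d) (check P h)) t.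
Lemma Df_Dec k (t p d h : tup V k -> V) : DT t -> DT p -> DT d -> DT h -> Df (fun u => Dec (t u) (p u) (d u) (h u)).
Proof. pose proof (DT_check P) as Dc; move=> *; rewrite /Dec; apply: Df_fmem => //; apply: DT_opn; df. Qed.
Lemma dec_truth t d h : opair (i d) (i h) ∈ (cls G t : W) <-> exists p, G p /\ Dec t p d h.
Proof. pose proof (nm_opn FN FG (check P d) (check P h)) as E; cbv beta in E; by rewrite -(fmem_truth FN FG) E. Qed.
Lemma dec_mono t p q d h : ple po q p -> Dec t p d h -> Dec t q d h.
Proof. by move=> qp H r rq; apply: H; apply: (ple_trans FN rq). Qed.
Lemma dec_fun (g : W) t X Y p d h : g = cls G t -> g ∈ funs (i X) (i Y) -> G p -> Dec t p d h -> ap g (i d) = i h.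
Proof. by move=> -> Hg Gp H; apply: (ap_eq Hg); apply/dec_truth; exists p. Qed.
Lemma dec_some (g : W) t X Y d : g = cls G t -> g ∈ funs (i X) (i Y) -> d ∈ X -> exists h p, h ∈ Y /\ G p /\ Dec t p d h.
Proof.
move=> E Hg dX; have idX : i d ∈ i X by apply/i_mem.
have [h [hY Eh]] := i_elem (ap_in Hg idX).
generalize (ap_pair Hg idX); rewrite Eh E => /dec_truth [p [Gp H]]; by exists h, p.
Qed.
End Transfer.

(** * The poset *)

Definition tp {M : structure} (p : M) := pfst p.
Definition sp {M : structure} (p : M) := psnd p.
Definition idx {M : structure} (z : M) := pfst (pfst z).
Definition arg {M : structure} (z : M) := psnd (pfst z).
Definition suppc {M : structure} (p : M) := cup (img (tp p) idx) (img (sp p) pfst).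
Definition join {M : structure} (p q : M) := opair (cup (tp p) (tp q)) (cup (sp p) (sp q)).
Definition res {M : structure} (p B : M) := opair (sep (tp p) (fun z => idx z ∈ B)) (sep (sp p) (fun w => pfst w ∈ B)).

(* A condition is a pair of a countable partial function, with elements [((a, d), v)], and a countable set of
   promises [(a, E)]; the elements [(d, (r, h))] of [E] say that the condition [r] decides the value at [d] of
   a name to be [h].  When [f_a(d) = v] is added, some [r] must be satisfied with [h < v]. *)
Definition lecl {M : structure} (q s : M) (X : M -> Prop) := tp s ⊆ tp q /\ sp s ⊆ sp q /\
  ∀ z ∈ tp q, ~ z ∈ tp s -> forall E, opair (idx z) E ∈ sp s ->
    exists r h, opair (arg z) (opair r h) ∈ E /\ X r /\ h ∈ psnd z.
(** The recursion from a condition to the conditions in its promises is packaged as the existence of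
    a set closed under the clause, which is a first-order statement. [LE_unfold] recovers the
    recursive equation. *)
Definition LE {M : structure} (q p : M) := exists R, p ∈ R /\ ∀ s ∈ R, lecl q s (fun r => r ∈ R).

Section Order.
Context {M : structure} {HM : ZFCw M}.
Implicit Types p q r s z w e B : M.
Lemma DT_tp k (a : tup M k -> M) : DT a -> DT (fun t => tp (a t)). Proof. exact: DT_pfst. Qed.
Lemma DT_sp k (a : tup M k -> M) : DT a -> DT (fun t => sp (a t)). Proof. exact: DT_psnd. Qed.
Lemma DT_idx k (a : tup M k -> M) : DT a -> DT (fun t => idx (a t)). Proof. by move=> H; rewrite /idx; df. Qed.
Lemma DT_arg k (a : tup M k -> M) : DT a -> DT (fun t => arg (a t)). Proof. by move=> H; rewrite /arg; df. Qed.
Hint Resolve DT_tp DT_sp DT_idx DT_arg : df.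
Lemma DT_suppc k (a : tup M k -> M) : DT a -> DT (fun t => suppc (a t)). Proof. by move=> H; rewrite /suppc; df. Qed.
Lemma DT_join k (a b : tup M k -> M) : DT a -> DT b -> DT (fun t => join (a t) (b t)). Proof. by move=> H K; rewrite /join; df. Qed.
Lemma DT_res k (a b : tup M k -> M) : DT a -> DT b -> DT (fun t => res (a t) (b t)). Proof. by move=> H K; rewrite /res; df. Qed.
Lemma Df_LE k (a b : tup M k -> M) : DT a -> DT b -> Df (fun t => LE (a t) (b t)). Proof. by move=> H K; rewrite /LE /lecl; df. Qed.
Hint Resolve DT_suppc DT_join DT_res Df_LE : df.

Lemma suppcE p a : a ∈ suppc p <-> (∃ z ∈ tp p, a = idx z) \/ (∃ w ∈ sp p, a = pfst w).
Proof. by rewrite cupE !imgE; df. Qed.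
Lemma tp_join p q z : z ∈ tp (join p q) <-> z ∈ tp p \/ z ∈ tp q. Proof. by rewrite /tp pfstE cupE. Qed.
Lemma sp_join p q z : z ∈ sp (join p q) <-> z ∈ sp p \/ z ∈ sp q. Proof. by rewrite /sp psndE cupE. Qed.
Lemma tp_res p B z : z ∈ tp (res p B) <-> z ∈ tp p /\ idx z ∈ B. Proof. by rewrite /tp /res pfstE sepE; df. Qed.
Lemma sp_res p B z : z ∈ sp (res p B) <-> z ∈ sp p /\ pfst z ∈ B. Proof. by rewrite /sp /res psndE sepE; df. Qed.
Lemma lecl_mono q s (X Y : M -> Prop) : (forall r, X r -> Y r) -> lecl q s X -> lecl q s Y.
Proof.
move=> H [A [B C]]; split=> //; split=> // z zq zs E ws; have [r [h [? [? ?]]]] := C z zq zs E ws.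
by exists r, h; split=> //; split=> //; apply: H.
Qed.
Lemma trcl_ind (Q : M -> Prop) : (forall x, (∀ y ∈ trcl x, Q y) -> Q x) -> forall x, Q x.
Proof.
move=> H x; suff [] : Q x /\ ∀ y ∈ trcl x, Q y by [].
elim/mem_ind: x => x IH; have K : ∀ y ∈ trcl x, Q y by move=> y /trclE [/IH []|[z [/IH [_ L] /L]]].
by split=> //; apply: H.
Qed.
Lemma pfst_trcl x y z : y ∈ trcl x \/ y = x -> z ∈ pfst y \/ z ∈ psnd y -> z ∈ trcl x.
Proof.
have U u v : u ∈ trcl x \/ u = x -> v ∈ union u -> v ∈ trcl x.
  move=> [ux|->] /unionE [w [wu vw]]; first by apply: trcl_trans vw; apply: trcl_trans wu.
  by apply: trcl_trans vw; apply/trclE; left.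
move=> H [] /unionE [u []]; (rewrite sepE; last by df); move=> [uy _] zu;
by apply: trcl_trans zu; apply: U uy.
Qed.
Lemma opair_trcl (x a b : M) : opair a b ∈ trcl x -> a ∈ trcl x /\ b ∈ trcl x.
Proof.
move=> H; have H1 : upair a b ∈ trcl x by apply: trcl_trans H _; apply: upair_r.
by split; [apply: trcl_trans H1 _; apply: upair_l|apply: trcl_trans H1 _; apply: upair_r].
Qed.
Lemma trcl_trcl (x y z : M) : y ∈ trcl x -> z ∈ trcl y -> z ∈ trcl x.
Proof.
elim/trcl_ind: y z => y IH z yx /trclE [zy|[u [uy zu]]]; first exact: (trcl_trans yx zy).
by apply: (IH u) zu; [apply/trclE; left|apply: (trcl_trans yx uy)].
Qed.
(** The conditions occurring in promises lie deeper in the transitive closure; this is the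
    well-founded descent behind all inductions by [trcl_ind]. *)
Lemma prm_trcl (p a E d r h : M) : opair a E ∈ sp p -> opair d (opair r h) ∈ E -> r ∈ trcl p.
Proof.
move=> wp eE; have [_ ET] := opair_trcl (pfst_trcl (or_intror eq_refl) (or_intror wp)).
by have [_ /opair_trcl []] := opair_trcl (trcl_trans ET eE).
Qed.
Lemma LE_unfold q p : LE q p <-> lecl q p (LE q).
Proof.
split=> [[R [pR H]]|C]; first by apply: lecl_mono (H p pR) => r rR; exists R.
pose X := cup (sep (trcl p) (LE q)) (sing p).
have XE r : r ∈ X <-> (r ∈ trcl p /\ LE q r) \/ r = p by rewrite cupE singE sepE; df.
exists X; split=> [|s sX]; first by apply/XE; right.
have [A [B D]] : lecl q s (LE q).
  by move/XE: sX => [[_ [R [sR H]]]|->] //; apply: lecl_mono (H s sR) => r rR; exists R.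
split=> //; split=> // z zq zs E wE; have [r [h [eE [Lr hz]]]] := D z zq zs E wE.
exists r, h; split=> //; split=> //; apply/XE; left; split=> //.
pose proof (prm_trcl wE eE) as rs; move/XE: sX => [[sT _]|<-] //; exact: trcl_trcl sT rs.
Qed.
Lemma LE_refl p : LE p p. Proof. by apply/LE_unfold; split=> //; split=> // z ? []. Qed.
(** A point new over [s] is either already in [q], where the promise of [s] was met through a
    smaller condition and induction applies, or new over [q], which has inherited the promise. *)
Lemma LE_trans p q s : LE p q -> LE q s -> LE p s.
Proof.
move=> H; elim/trcl_ind: s => s IH /LE_unfold [B1 [B2 B3]]; generalize (H); move=> /LE_unfold [A1 [A2 A3]].
apply/LE_unfold; split=> [z /B1 /A1 //|]; split=> [z /B2 /A2 //|z zp zs E wE].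
case: (classic (z ∈ tp q)) => zq.
  have [r [h [eE [Lr hz]]]] := B3 z zq zs E wE; exists r, h; split=> //; split=> //.
  by apply: IH Lr; apply: prm_trcl wE eE.
by apply: (A3 z zp zq E); apply: B2.
Qed.

Lemma dependent_choice X (Rl : M -> M -> M -> Prop) x0 :
  Df (k := 3) (fun t : tup M 3 => Rl (hd (tl (tl t))) (hd (tl t)) (hd t)) -> x0 ∈ X ->
  (∀ n ∈ omega M, ∀ x ∈ X, ∃ y ∈ X, Rl n x y) ->
  exists f, f ∈ funs (omega M) X /\ ap f (empty M) = x0 /\ ∀ n ∈ omega M, Rl n (ap f n) (ap f (succ n)).
Proof.
move=> D x0X H.
have DY : DT (k := 1) (fun t : tup M 1 => sep X (fun y => Rl (pfst (hd t)) (psnd (hd t)) y)).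
  apply: DT_sep; first by df.
  apply: (Df_ext (Q := fun t : tup M 2 => exists n x, n = pfst (hd (tl t)) /\ x = psnd (hd (tl t)) /\ Rl n x (hd t))).
    by move=> t; split=> [K|[n [x [-> [->]]]]] //; exists (pfst (hd (tl t))), (psnd (hd (tl t))).
  do 2! apply: Df_ex; do 2! (apply: Df_and; first by df).
  refine (Df_ren (k := 3) (k' := 4) (g := fun t : tup M 4 => (hd (tl (tl t)), (hd t, (hd (tl t), tt))) : tup M 3)
   (r := fun n => match n with 0 => 2 | 1 => 0 | 2 => 1 | S (S (S n)) => S (S (S (S n))) end) _ D).
  by move=> t d [|[|[|n]]].
have YE n x y : y ∈ sep X (fun y => Rl n x y) <-> y ∈ X /\ Rl n x y.
  apply: sepE; have := Df_inst D ((x, (n, tt)) : tup M 2) => //.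
have [|c Hc] := choice_fam (a := prod (omega M) X) (Y := fun z => sep X (fun y => Rl (pfst z) (psnd z) y)) DY.
  move=> z /prodE [n [nw [x [xX ->]]]]; rewrite pfstE psndE; have [y [yX Ry]] := H n nw x xX.
  by exists y; apply/YE.
pose F x f := ite (x = empty M) x0 (ap c (opair (union x) (ap f (union x)))).
have DF : DT (k := 2) (fun t : tup M 2 => F (hd (tl t)) (hd t)) by rewrite /F; df.
pose g := rec F; have Dg : DT (k := 1) (fun t : tup M 1 => g (hd t)) by apply: DT_rec1; df.
have g0 : g (empty M) = x0 by rewrite /g recE // /F iteT.
have gS n : n ∈ omega M -> g (succ n) = ap c (opair n (g n)).
  move=> nw; rewrite /g recE // {1}/F -/g iteF; last by move=> E; have: n ∈ empty M by [rewrite -E succE; right]; rewrite emptyE.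
  have -> : union (succ n) = n.
    apply: ext => z; rewrite unionE; split=> [[y [/succE [yn|->] zy]]|zn] //; last by exists n; rewrite succE; split=> //; right.
    by apply: (ord_tr (ord_mem ord_omega nw) yn zy).
  by rewrite ap_lam // succE; right.
have gR n : n ∈ omega M -> g n ∈ X -> g (succ n) ∈ X /\ Rl n (g n) (g (succ n)).
  move=> nw gX; rewrite gS //; generalize (Hc (opair n (g n))); rewrite pfstE psndE YE => K; apply: K.
  by apply/pair_prod.
have gX : ∀ n ∈ omega M, g n ∈ X by apply: omega_ind => [|n nw gX]; [rewrite g0|case: (gR n nw gX)].
exists (lam (omega M) g); split; first exact: lam_fun.
split; first by rewrite ap_lam //; exact: empty_omega.
by move=> n nw; rewrite !ap_lam //; [case: (gR n nw (gX n nw))|exact: succ_omega].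
Qed.
End Order.
#[export] Hint Resolve DT_tp DT_sp DT_idx DT_arg DT_suppc DT_join DT_res Df_LE : df.

(** * Conditions, amalgamation and extension *)

Section Poset.
Context {M : structure} {HM : ZFCw M}.
Implicit Types p q r s z w B : M.
Variables K L : M.
Let Q := prod K L.
Let o := o1 M.
Definition below a := sep (prod K L) (fun b => pfst b ∈ pfst a /\ psnd b ∈ psnd a).
Definition functional t := ∀ z z' ∈ t, pfst z = pfst z' -> z = z'.
Definition fn_part t := t ⊆ prod (prod (prod K L) (o1 M)) (o1 M) /\ ctbl t /\ functional t.
(* [E] is a name, over the suborder [B], for a total function on [o1]. *)
Definition good B E := E ⊆ prod (o1 M) (prod B (o1 M)) /\ lec E (o1 M) /\
  ∀ d ∈ o1 M, ∀ q ∈ B, exists r h, opair d (opair r h) ∈ E /\ ∃ s ∈ B, LE s q /\ LE s r.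
Definition pr_part (PB : M -> M) (j F : M) := ctbl F /\
  ∀ w ∈ F, ∃ a ∈ prod K L, exists E, w = opair a E /\ pfst a ∈ j /\ good (PB a) E.
Definition PBf (f a : M) := sep (ap f (pfst a)) (fun p => suppc p ⊆ below a).
(** The ambient products and power sets make this a set by separation; [PPE] restates membership
    without them. *)
Definition PF (j f : M) := sep (prod (powerset (prod (prod (prod K L) (o1 M)) (o1 M)))
    (powerset (prod (prod K L) (powerset (prod (o1 M) (prod (union (img j (ap f))) (o1 M)))))))
  (fun p => (fn_part (tp p) /\ ∀ z ∈ tp p, pfst (idx z) ∈ j) /\ pr_part (PBf f) j (sp p)).
(* [PP j] consists of the conditions with support in the rows below [j], so that the poset is [PP K]. *)
Definition PP : M -> M := rec PF.
(** [PBf] evaluates its first argument only at [pfst a], so a one-point function stands in for the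
    history of the recursion. *)
Definition PB a := PBf (lam (sing (pfst a)) PP) a.

Lemma DT_below k (a : tup M k -> M) : DT a -> DT (fun t => below (a t)). Proof. by move=> H; rewrite /below; df. Qed.
Hint Resolve DT_below : df.
Lemma DT_PBf k (f a : tup M k -> M) : DT f -> DT a -> DT (fun t => PBf (f t) (a t)). Proof. by move=> *; rewrite /PBf; df. Qed.
Hint Resolve DT_PBf : df.
Lemma Df_good k (B E : tup M k -> M) : DT B -> DT E -> Df (fun t => good (B t) (E t)). Proof. by move=> *; rewrite /good; df. Qed.
Lemma Df_fn_part k (t : tup M k -> M) : DT t -> Df (fun u => fn_part (t u)). Proof. by move=> *; rewrite /fn_part /functional; df. Qed.
Hint Resolve Df_good Df_fn_part : df.
Let DPF : DT (k := 2) (fun t : tup M 2 => PF (hd (tl t)) (hd t)).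
Proof. by rewrite /PF /pr_part; df. Qed.
Lemma DT_PP k (a : tup M k -> M) : DT a -> DT (fun t => PP (a t)).
Proof. by move=> H; apply: DT_rec1. Qed.
Hint Resolve DT_PP : df.
Lemma DT_PB k (a : tup M k -> M) : DT a -> DT (fun t => PB (a t)). Proof. by move=> *; rewrite /PB; df. Qed.
Hint Resolve DT_PB : df.
Lemma Df_pr_part k (F j : tup M k -> M) : DT F -> DT j -> Df (fun t => pr_part PB (j t) (F t)). Proof. by move=> *; rewrite /pr_part; df. Qed.
Hint Resolve Df_pr_part : df.

Lemma PBE a p : p ∈ PB a <-> p ∈ PP (pfst a) /\ suppc p ⊆ below a.
Proof. by rewrite sepE; [rewrite ap_lam; [|df|apply/singE]|df]. Qed.
Lemma PPE j p : p ∈ PP j <-> p = opair (tp p) (sp p) /\ (fn_part (tp p) /\ ∀ z ∈ tp p, pfst (idx z) ∈ j) /\ pr_part PB j (sp p).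
Proof.
have E a : pfst a ∈ j -> PBf (lam j PP) a = PB a.
  by move=> aj; apply: ext => x; rewrite PBE sepE; [rewrite ap_lam; df|df].
have C F : pr_part (PBf (lam j PP)) j F <-> pr_part PB j F.
  by split=> -[c H]; split=> // w /H [a [aQ [E0 [-> [aj g]]]]]; exists a; split=> //; exists E0; rewrite ?E // -?E.
rewrite {1}/PP recE // -/PP sepE; last by rewrite /pr_part; df.
rewrite C; split=> [[/prod_eta [H _] [? ?]]|[H [[T R] F]]]; first by [].
split=> //; rewrite H; apply/pair_prod; split; apply/powersetE; first by case: T.
move=> w wF; have [a [aQ [E0 [-> [aj [g _]]]]]] := proj2 F w wF; apply/pair_prod; split=> //; apply/powersetE.
move=> z /g /prodE [d [dO [y [/prodE [r [/PBE [rP _] [h [ho ->]]]] ->]]]]; rewrite !pair_prod; split=> //; split=> //.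
apply/unionE; exists (PP (pfst a)); split=> //; rewrite imgE; last by df.
by exists (pfst a); rewrite ap_lam //; df.
Qed.

Hypotheses (HK : ordinal K) (HL : ordinal L).
Definition PK := PP K.
Notation P := PK.
Definition cond_good p := p = opair (tp p) (sp p) /\ fn_part (tp p) /\ ctbl (sp p) /\
  ∀ w ∈ sp p, ∃ a ∈ Q, exists E, w = opair a E /\ good (PB a) E.
Lemma PKE p : p ∈ P <-> cond_good p.
Proof.
rewrite PPE; split=> [[H [[T _] [c F]]]|[H [T [c F]]]].
  by do 3! split=> //; move=> w /F [a [aQ [E [-> [_ g]]]]]; exists a; split=> //; exists E.
split=> //; split; first split=> //.
  by move=> z /(proj1 T) /prodE [y [/prodE [a [/prod_eta [_ [? _]] [d [_ ->]]]] [v [_ ->]]]]; rewrite /idx !pfstE.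
split=> // w /F [a [aQ [E [-> g]]]]; exists a; split=> //; exists E; split=> //; split=> //.
by have [_ []] := prod_eta aQ.
Qed.
Lemma tp_idx p z : p ∈ P -> z ∈ tp p -> z = opair (opair (idx z) (arg z)) (psnd z) /\ idx z ∈ Q /\ arg z ∈ o /\ psnd z ∈ o.
Proof.
move=> /PKE [_ [[H _] _]] /H /prodE [y [/prodE [a [aQ [d [dO ->]]]] [v [vo ->]]]].
by rewrite /idx /arg !pfstE !psndE.
Qed.
Lemma sp_prom p w : p ∈ P -> w ∈ sp p -> ∃ a ∈ Q, exists E, w = opair a E /\ good (PB a) E.
Proof. by move=> /PKE [_ [_ [_ H]]] /H. Qed.
Lemma tp_fun p z z' : p ∈ P -> z ∈ tp p -> z' ∈ tp p -> pfst z = pfst z' -> z = z'.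
Proof. move=> /PKE [_ [[_ [_ H]] _]] zt zt'; exact: (H z zt z' zt'). Qed.
Lemma supp_Q p : p ∈ P -> suppc p ⊆ Q.
Proof.
move=> pP a /suppcE [[z [zp ->]]|[w [wp ->]]]; first by case: (tp_idx pP zp) => _ [].
by have [b [bQ [E [-> _]]]] := sp_prom pP wp; rewrite pfstE.
Qed.
Lemma supp_ctbl p : p ∈ P -> ctbl (suppc p).
Proof. by move=> /PKE [_ [[_ [H _]] [H' _]]]; apply: lec_cupk; [exact: inf_omega|apply: ctbl_img => //; df|apply: ctbl_img => //; df]. Qed.
Lemma PB_P a p : a ∈ Q -> (p ∈ PB a <-> p ∈ P /\ suppc p ⊆ below a).
Proof.
move=> aQ; rewrite PBE; split=> -[H S]; split=> //.
  move/PPE: H => [H [[T _] [c F]]]; apply/PKE; do 3! split=> //.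
  by move=> w /F [b [bQ [E [-> [_ g]]]]]; exists b; split=> //; exists E.
move/PKE: H => [H [T [c F]]].
have R b : b ∈ suppc p -> pfst b ∈ pfst a by move=> /S; rewrite sepE; [case=> _ []|df].
apply/PPE; split=> //; split; first by split=> // z zp; apply: R; apply/suppcE; left; exists z.
split=> // w wp; have [b [bQ [E [Ew g]]]] := F w wp; exists b; split=> //; exists E; split=> //; split=> //.
by apply: R; apply/suppcE; right; exists w; split=> //; rewrite Ew pfstE.
Qed.
Lemma prom_P p a E d r h : p ∈ P -> opair a E ∈ sp p -> opair d (opair r h) ∈ E ->
  a ∈ Q /\ d ∈ o /\ r ∈ P /\ suppc r ⊆ below a /\ h ∈ o.
Proof.
move=> pP wp eE; have [a' [aQ [E' [/opair_inj [Ea EE] [g _]]]]] := sp_prom pP wp; subst a' E'.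
by generalize (g _ eE); rewrite !pair_prod PB_P //; tauto.
Qed.
Lemma below_irr a : ~ a ∈ below a.
Proof. rewrite sepE; last by df. by move=> [_ [/mem_irr]]. Qed.
Lemma belowE a b : b ∈ below a <-> b ∈ Q /\ pfst b ∈ pfst a /\ psnd b ∈ psnd a.
Proof. by rewrite sepE; df. Qed.

Lemma join_P p q : p ∈ P -> q ∈ P -> (∀ z ∈ tp p, ∀ z' ∈ tp q, pfst z = pfst z' -> z = z') -> join p q ∈ P.
Proof.
move=> pP qP H; move: (pP) (qP) => /PKE [_ [[p1 [p2 p3]] [p4 p5]]] /PKE [_ [[q1 [q2 q3]] [q4 q5]]].
apply/PKE; split; first by rewrite /join /tp /sp pfstE psndE.
have ET : tp (join p q) = cup (tp p) (tp q) by rewrite /join /tp pfstE.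
have ES : sp (join p q) = cup (sp p) (sp q) by rewrite /join /sp psndE.
split; last first.
  by rewrite ES; split=> [|w /cupE [/p5|/q5]] //; apply: lec_cupk => //; exact: inf_omega.
rewrite ET; split=> [z /cupE [/p1|/q1] //|]; split; first by apply: lec_cupk => //; exact: inf_omega.
move=> z /cupE [zp|zq] z' /cupE [zp'|zq'] E; [exact: p3|exact: H| |exact: q3].
by symmetry; apply: H.
Qed.
Lemma res_P p B : p ∈ P -> res p B ∈ P /\ suppc (res p B) ⊆ B.
Proof.
move=> /PKE [p0 [[p1 [p2 p3]] [p4 p5]]]; split; last first.
  by move=> a /suppcE [[z [/tp_res [_ ?] ->]]|[w [/sp_res [_ ?] ->]]].
apply/PKE; split; first by rewrite /res /tp /sp pfstE psndE.
split; last by split=> [|w /sp_res [/p5]] //; apply: ctbl_sub p4 => z /sp_res [].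
split; first by move=> z /tp_res [/p1].
split; first by apply: ctbl_sub p2 => z /tp_res [].
by move=> z /tp_res [zp _] z' /tp_res [zp' _]; apply: p3.
Qed.
Lemma in_supp_t p z : z ∈ tp p -> idx z ∈ suppc p. Proof. by move=> H; apply/suppcE; left; exists z. Qed.
Lemma in_supp_s p a E : opair a E ∈ sp p -> a ∈ suppc p.
Proof. by move=> H; apply/suppcE; right; exists (opair a E); rewrite pfstE. Qed.
Lemma idx_pfst z z' : pfst z = pfst z' -> idx z = idx z'. Proof. by rewrite /idx => ->. Qed.

(** Points that [r] adds to [p] have their index in [B]. The promises of [p] about them therefore
    survive in [res p B], and [r] keeps them. *)
Lemma amalgam p r B : p ∈ P -> r ∈ P -> suppc r ⊆ B -> LE r (res p B) ->
  join r p ∈ P /\ LE (join r p) p /\ LE (join r p) r.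
Proof.
move=> pP rP rB /LE_unfold [H1 [H2 H3]].
have J : LE (join r p) r.
  apply/LE_unfold; split; first by move=> z zr; apply/tp_join; left.
  split; first by move=> z zr; apply/sp_join; left.
  move=> z /tp_join [//|zp] N E wE; case: N; apply: H1; apply/tp_res; split=> //.
  by apply: rB; apply: in_supp_s wE.
split.
  apply: join_P => // z zr z' zp E; apply: (tp_fun rP) => //; apply: H1; apply/tp_res; split=> //.
  by rewrite -(idx_pfst E); apply: rB; apply: in_supp_t.
split=> //; apply/LE_unfold; split; first by move=> z zr; apply/tp_join; right.
split; first by move=> z zr; apply/sp_join; right.
move=> z /tp_join [zr|//] N E wE; pose proof (rB _ (in_supp_t zr)) as zB.
have [||r' [h [eE [Lr hz]]]] := H3 z zr _ E; first by move=> /tp_res [].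
  by apply/sp_res; rewrite pfstE.
by exists r', h; split=> //; split=> //; apply: LE_trans Lr.
Qed.
Definition down_closed B := forall a, a ∈ B -> below a ⊆ B.
(** A promise of [r] concerns an index in [B] and refers to conditions supported below that index.
    These supports stay in [B] because it is closed downwards, so the recursion never leaves [B]. *)
Lemma res_LE s r B : r ∈ P -> suppc r ⊆ B -> down_closed B -> LE s r -> LE (res s B) r.
Proof.
move=> + + HB; elim/trcl_ind: r => r IH rP rB /LE_unfold [H1 [H2 H3]].
apply/LE_unfold; split; first by move=> z zr; apply/tp_res; split; [exact: H1|apply: rB; exact: in_supp_t].
split; first by move=> w wr; apply/sp_res; split; [exact: H2|apply: rB; apply/suppcE; right; exists w].
move=> z /tp_res [zs zB] N E wE; have [r' [h [eE [Lr hz]]]] := H3 z zs N E wE.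
exists r', h; split=> //; split=> //; have [_ [_ [r'P [r'B _]]]] := prom_P rP wE eE.
apply: IH Lr => //; first exact: prm_trcl wE eE.
by move=> b /r'B bb; apply: (HB (idx z)).
Qed.
(** Neither condition contributes a new point at an index in the support of the other, so no promise
    of either is put to the test. *)
Lemma agree_join p q : p ∈ P -> q ∈ P ->
  (∀ z ∈ tp p, idx z ∈ suppc q -> z ∈ tp q) -> (∀ z ∈ tp q, idx z ∈ suppc p -> z ∈ tp p) ->
  join p q ∈ P /\ LE (join p q) p /\ LE (join p q) q.
Proof.
move=> pP qP A B; split.
  apply: join_P => // z zp z' zq E; apply: (tp_fun qP) => //; apply: A => //.
  by rewrite (idx_pfst E); apply: in_supp_t.
split; apply/LE_unfold; (split; first by move=> z zr; apply/tp_join; tauto);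
  (split; first by move=> z zr; apply/sp_join; tauto).
  by move=> z /tp_join [//|zq] N E wE; case: N; apply: B => //; apply: in_supp_s wE.
by move=> z /tp_join [zp|//] N E wE; case: N; apply: A => //; apply: in_supp_s wE.
Qed.

Definition decr f := ∀ n ∈ omega M, LE (ap f (succ n)) (ap f n).
Lemma decr_le f m n : decr f -> m <= n -> LE (ap f (nat_in M n)) (ap f (nat_in M m)).
Proof.
move=> H; elim=> [|k _ IH]; first exact: LE_refl.
exact: (LE_trans (H _ (nat_omega k)) IH).
Qed.
(** The bound is the union of the chain. A point that appears at stage [m] and is new over a
    condition passed at stage [n] is compared with its promises at stage [m + n], where both are
    present; induction handles the condition that the promise refers to. *)
Lemma chain_bound f : f ∈ funs (omega M) P -> decr f -> ∃ p ∈ P, (forall n, LE p (ap f (nat_in M n))) /\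
  (∀ z ∈ tp p, exists n, z ∈ tp (ap f (nat_in M n))) /\ (∀ w ∈ sp p, exists n, w ∈ sp (ap f (nat_in M n))).
Proof.
move=> Hf D; pose p := opair (union (img (omega M) (fun n => tp (ap f n)))) (union (img (omega M) (fun n => sp (ap f n)))).
have fP n : ap f (nat_in M n) ∈ P by apply: (ap_in Hf); exact: nat_omega.
have tE z : z ∈ tp p <-> exists n, z ∈ tp (ap f (nat_in M n)).
  rewrite /p {1}/tp pfstE unionE; split=> [[y []]|[n H]].
    by rewrite imgE; [move=> [x [/omegaE [n ->] ->]]; exists n|df].
  by exists (tp (ap f (nat_in M n))); split=> //; rewrite imgE; [exists (nat_in M n); split=> //; exact: nat_omega|df].
have sE z : z ∈ sp p <-> exists n, z ∈ sp (ap f (nat_in M n)).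
  rewrite /p {1}/sp psndE unionE; split=> [[y []]|[n H]].
    by rewrite imgE; [move=> [x [/omegaE [n ->] ->]]; exists n|df].
  by exists (sp (ap f (nat_in M n))); split=> //; rewrite imgE; [exists (nat_in M n); split=> //; exact: nat_omega|df].
have mono m n : m <= n -> tp (ap f (nat_in M m)) ⊆ tp (ap f (nat_in M n)).
  by move=> /(decr_le D) /LE_unfold [].
exists p; split.
  apply/PKE; split; first by rewrite /p /tp /sp pfstE psndE.
  split; first split; first by move=> z /tE [n H]; move/PKE: (fP n) => [_ [[/(_ z H)]]].
    split.
      rewrite /p /tp pfstE; apply: lec_imgk; [exact: inf_omega|by df|exact: lec_refl|].
      by move=> x /omegaE [n ->]; move/PKE: (fP n) => [_ [[_ []]]].
    move=> z /tE [m zm] z' /tE [n zn] E; apply: (tp_fun (fP (m + n))) => //; [apply: mono zm|apply: mono zn]; lia.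
  split; last by move=> w /sE [n /(sp_prom (fP n))].
  rewrite /p /sp psndE; apply: lec_imgk; [exact: inf_omega|by df|exact: lec_refl|].
  by move=> x /omegaE [n ->]; move/PKE: (fP n) => [_ [_ []]].
split; last by split=> [z /tE|z /sE].
suff S s : (exists n, LE (ap f (nat_in M n)) s) -> LE p s by move=> n; apply: S; exists n; exact: LE_refl.
elim/trcl_ind: s => s IH [n /LE_unfold [H1 [H2 H3]]].
apply/LE_unfold; split; first by move=> z /H1 ?; apply/tE; exists n.
split; first by move=> z /H2 ?; apply/sE; exists n.
move=> z /tE [m zm] N E wE.
have /LE_unfold [_ [_ H]] : LE (ap f (nat_in M (m + n))) s.
  by apply: (LE_trans (decr_le D (m := n) _)); [lia|apply/LE_unfold].
have zmn : z ∈ tp (ap f (nat_in M (m + n))) by apply: mono zm; lia.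
have [r [h [eE [Lr hz]]]] := H z zmn N E wE.
exists r, h; split=> //; split=> //; apply: IH; first exact: prm_trcl wE eE.
by exists (m + n).
Qed.
Lemma add_promise p a E : p ∈ P -> a ∈ Q -> good (PB a) E ->
  ∃ q ∈ P, LE q p /\ tp q = tp p /\ opair a E ∈ sp q.
Proof.
move=> pP aQ g; exists (opair (tp p) (cup (sp p) (sing (opair a E)))); move/PKE: (pP) => [p0 [p1 [p2 p3]]].
split.
  apply/PKE; rewrite /cond_good /tp /sp pfstE psndE; split=> //; split=> //; split.
    by apply: lec_cupk => //; [exact: inf_omega|apply: fin_inf_lec; [exact: inf_omega|exact: fin_upair]].
  by move=> w /cupE [/p3 //|/singE ->]; exists a; split=> //; exists E.
split; last by rewrite /tp /sp pfstE psndE; split=> //; apply/cupE; right; apply/singE.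
apply/LE_unfold; split; first by rewrite {2}/tp pfstE.
split; first by move=> w wp; rewrite /sp psndE; apply/cupE; left.
by move=> z + N; rewrite {1}/tp pfstE.
Qed.
(** The new point at [a] must not spoil the conditions [r] by which promises are met. By [key] it
    does not: they are supported below [a], and they promise nothing about [a] itself. *)
Lemma extend p0 p a d v : p0 ∈ P -> p ∈ P -> LE p p0 -> (forall E, opair a E ∈ sp p -> opair a E ∈ sp p0) ->
  a ∈ Q -> d ∈ o -> v ∈ o -> ~ (∃ z ∈ tp p, pfst z = opair a d) ->
  (forall E, opair a E ∈ sp p0 -> exists r h, opair d (opair r h) ∈ E /\ LE p r /\ h ∈ v) ->
  ∃ q ∈ P, LE q p /\ opair (opair a d) v ∈ tp q.
Proof.
move=> p0P pP Lp S aQ dO vo N H; set z0 := opair (opair a d) v.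
have i0 : idx z0 = a by rewrite /idx /z0 !pfstE.
pose q := opair (cup (tp p) (sing z0)) (sp p).
have tq z : z ∈ tp q <-> z ∈ tp p \/ z = z0 by rewrite /tp /q pfstE cupE singE.
have sq : sp q = sp p by rewrite /sp /q psndE.
move/PKE: (pP) => [e0 [[p1 [p2 p3]] p4]].
have qP : q ∈ P.
  apply/PKE; rewrite /cond_good sq; split; first by rewrite -{1}sq /q /tp /sp pfstE psndE.
  split=> //; split; first by move=> z /tq [/p1 //|->]; rewrite /z0 !pair_prod.
  split.
    rewrite /q /tp pfstE; apply: lec_cupk => //; [exact: inf_omega|apply: fin_inf_lec; [exact: inf_omega|exact: fin_upair]].
  move=> z /tq [zp|->] z' /tq [zp'|->] E //; first exact: p3.
    by case: N; exists z; split=> //; rewrite E /z0 pfstE.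
  by case: N; exists z'; split=> //; rewrite -E /z0 pfstE.
have key r : r ∈ P -> suppc r ⊆ below a -> LE p r -> LE q r.
  elim/trcl_ind: r => r IH rP rB /LE_unfold [H1 [H2 H3]].
  apply/LE_unfold; split; first by move=> z /H1 ?; apply/tq; left.
  split; first by rewrite sq.
  move=> z /tq [zp|->] Nz E wE; last by move: wE; rewrite i0 => /in_supp_s /rB /below_irr.
  have [r' [h [eE [Lr hz]]]] := H3 z zp Nz E wE; exists r', h; split=> //; split=> //.
  have [_ [_ [r'P [r'B _]]]] := prom_P rP wE eE.
  apply: IH Lr => //; first exact: prm_trcl wE eE.
  move=> b /r'B /belowE [bQ [b1 b2]]; apply/belowE; split=> //.
  generalize (in_supp_s wE); move=> /rB /belowE [zQ [z1 z2]]; have [_ [aK aL]] := prod_eta aQ.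
  split; first by apply: (ord_tr (ord_mem HK aK) z1 b1).
  exact: (ord_tr (ord_mem HL aL) z2 b2).
exists q; split=> //; split; last by apply/tq; right.
apply/LE_unfold; split; first by move=> z zp; apply/tq; left.
split; first by rewrite sq.
move=> z /tq [//|->] Nz E; rewrite i0 => wE; have [r [h [eE [Lr hv]]]] := H E (S E wE).
exists r, h; rewrite /z0 /arg pfstE !psndE; split=> //; split=> //.
by have [_ [_ [rP [rB _]]]] := prom_P pP wE eE; apply: key.
Qed.

(* Below [p], all promises about [f_a(d)] can be given a bound by extending only below [a]. *)
Lemma fulfill p a d : p ∈ P -> a ∈ Q -> d ∈ o -> ∃ q ∈ P, LE q p /\
  (∀ z ∈ tp q, z ∈ tp p \/ idx z ∈ below a) /\ (∀ w ∈ sp q, w ∈ sp p \/ pfst w ∈ below a) /\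
  ∃ v ∈ o, forall E, opair a E ∈ sp p -> exists r h, opair d (opair r h) ∈ E /\ LE q r /\ h ∈ v.
Proof.
move=> pP aQ dO; set B := below a.
have bdc : down_closed B.
  move=> b /belowE [bQ [b1 b2]] c /belowE [cQ [c1 c2]]; apply/belowE; split=> //; have [_ [aK aL]] := prod_eta aQ.
  by split; [apply: (ord_tr (ord_mem HK aK) b1 c1)|apply: (ord_tr (ord_mem HL aL) b2 c2)].
pose near q := LE q p /\ (∀ z ∈ tp q, z ∈ tp p \/ idx z ∈ B) /\ (∀ w ∈ sp q, w ∈ sp p \/ pfst w ∈ B).
have nearE q : q ∈ sep P near <-> q ∈ P /\ near q by rewrite sepE; [|rewrite /near; df].
have [cs _] := proj2 (proj2 (proj1 (PKE p) pP)); have [gi [Hgi gI]] := cs.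
(* Step [n] treats the promise that the injection [gi] of [sp p] into ω numbers by [n]; if it does
   not concern [a], or no promise has this number, nothing needs to be done. *)
pose Rl n q q' := LE q' q /\ ∀ w ∈ sp p, ap gi w = n -> pfst w = a -> exists r h, opair d (opair r h) ∈ psnd w /\ LE q' r.
have [||n nw q /nearE [qP [qp [qt qs]]]|f [Hf [f0 fR]]] := dependent_choice (X := sep P near) (Rl := Rl) (x0 := p).
  by rewrite /Rl; df.
  by apply/nearE; split=> //; split; [exact: LE_refl|split; left].
  case: (classic (exists E, opair a E ∈ sp p /\ ap gi (opair a E) = n)) => [[E [wE En]]|N]; last first.
    exists q; split; first by apply/nearE.
    split; first exact: LE_refl.
    move=> w wp gw aw; case: N; have [b [bQ [E [Ew _]]]] := sp_prom pP wp.
    by exists E; move: wp gw aw; rewrite Ew pfstE => wp gw <-.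
  have [a' [_ [E' [/opair_inj [Ea EE] [_ [_ G]]]]]] := sp_prom pP wE; subst a' E'.
  have [rP rB] := res_P B qP.
  have [|r [h [eE [s [/PB_P]]]]] := G d dO (res q B); first by apply/PB_P.
  move=> /(_ aQ) [sP sB] [sq sr]; have [jP [jq js]] := amalgam qP sP sB sq.
  exists (join s q); split.
    apply/nearE; split=> //; split; first exact: (LE_trans jq qp).
    by split=> [z /tp_join [/in_supp_t /sB|/qt]|w /sp_join [ws|/qs]] //; right => //; apply: sB; apply/suppcE; right; exists w.
  split=> // w wp gw _; have -> : w = opair a E by apply: gI => //; rewrite gw En.
  by rewrite psndE; exists r, h; split=> //; apply: LE_trans sr.
have fP : f ∈ funs (omega M) P by apply: (fun_codom Hf) => n /(ap_in Hf) /nearE [].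
have [|q [qP [qf [qt qs]]]] := chain_bound fP; first by move=> n nw; case: (fR n nw).
exists q; split=> //; split; first by move: (qf 0); rewrite f0.
have nf n : near (ap f (nat_in M n)) by have /nearE [] : ap f (nat_in M n) ∈ sep P near by apply: (ap_in Hf); exact: nat_omega.
split; first by move=> z /qt [n]; case: (nf n) => _ [H _] /H.
split; first by move=> z /qs [n]; case: (nf n) => _ [_ H] /H.
have qE E : opair a E ∈ sp p -> exists r h, opair d (opair r h) ∈ E /\ LE q r /\ h ∈ o.
  move=> wE; generalize (ap_in Hgi wE); move=> /omegaE [n En].
  have [r [h []]] := proj2 (fR _ (nat_omega n)) _ wE En (pfstE a E); rewrite psndE => eE Lr.
  exists r, h; split=> //; split; first exact: (LE_trans (qf (S n)) Lr).
  by case: (prom_P pP wE eE) => _ [_ [_ [_ ]]].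
(* One decided value is chosen for each of the countably many promises about [a]; a countable
   ordinal [v] exceeds them all. *)
have [||c Hc] := choice_fam (a := sep (sp p) (fun w => pfst w = a)) (Y := fun w => sep o (fun h => exists r, opair d (opair r h) ∈ psnd w /\ LE q r)).
  by df.
  move=> w; rewrite sepE; last by df.
  move=> [wp Ew]; have [b [bQ [E [EE _]]]] := sp_prom pP wp; subst w; move: Ew wp; rewrite pfstE => -> wp.
  by have [r [h [? [? ?]]]] := qE E wp; exists h; rewrite sepE; [split=> //; exists r; rewrite psndE|df].
have cE E : opair a E ∈ sp p -> ap c (opair a E) ∈ o /\ exists r, opair d (opair r (ap c (opair a E))) ∈ E /\ LE q r.
  move=> wp; generalize (Hc (opair a E)); rewrite !sepE ?psndE; try bydf.
  by rewrite pfstE => /(_ (conj wp eq_refl)).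
have cA : ctbl (sep (sp p) (fun w => pfst w = a)) by apply: ctbl_sub cs => w; rewrite sepE; [case|df].
have [||v [vo Hv]] := ctbl_bound (F := ap c) cA; first by df.
  move=> w; rewrite sepE; last by df.
  move=> [wp Ew]; have [b [bQ [E [EE _]]]] := sp_prom pP wp; subst w; move: Ew wp; rewrite pfstE => -> wp.
  by case: (cE E wp).
exists v; split=> // E wE; have [_ [r [? ?]]] := cE E wE; exists r, (ap c (opair a E)); split=> //; split=> //.
by apply: Hv; rewrite sepE; [rewrite pfstE|df].
Qed.
End Poset.
#[export] Hint Resolve DT_below DT_PBf Df_good Df_fn_part DT_PP DT_PB Df_pr_part : df.

(** * Chain condition and size of the poset *)

Section ChainCondition.
Context {M : structure} {HM : ZFCw M}.
Variables K L : M.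
Hypotheses (HK : ordinal K) (HL : ordinal L).
Notation P := (PK K L).
Let Q := prod K L.
Definition ord_of := sep (prod P P) (fun z => LE (pfst z) (psnd z)).
Lemma pleE q p : ple ord_of q p <-> q ∈ P /\ p ∈ P /\ LE q p.
Proof. by rewrite /ple sepE; [rewrite pair_prod pfstE psndE; tauto|df]. Qed.
Lemma empty_cond : opair (empty M) (empty M) ∈ P.
Proof.
have C : ctbl (empty M) by apply: lec_sub => x /emptyE.
apply/PKE; rewrite /cond_good /tp /sp pfstE psndE; split=> //; split; last by split=> // w /emptyE.
by split; [move=> z /emptyE|split=> // z /emptyE].
Qed.
Lemma ord_forcing : forcing_notion P ord_of.
Proof.
split; first by exists (opair (empty M) (empty M)); exact: empty_cond.
split; first by move=> z; rewrite sepE; [case|df].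
split; first by move=> p pP; apply/pleE; split=> //; split=> //; exact: LE_refl.
by move=> p pP q qP r rP /pleE [_ [_ H]] /pleE [_ [_ H']]; apply/pleE; split=> //; split=> //; exact: LE_trans H H'.
Qed.

(** The ℵ2-chain condition in the form in which it is used. For each trace, that is a countable set
    [S] of indices, a countable part [t] on [S] and an argument [d], one condition in [D] with this
    trace is chosen. A set [B] of size at most ω1 is closed under the supports of these
    representatives. A condition [q] in [D] is then compatible, by [agree_join], with the
    representative of its trace on [B]: where the supports meet, both have the same points. *)
Lemma predense_small (D : M -> M -> Prop) : CH M -> Df (k := 2) (fun t : tup M 2 => D (hd (tl t)) (hd t)) ->
  (∀ d ∈ o1 M, ∀ p ∈ P, ∃ q ∈ P, LE q p /\ D d q) ->
  exists D0, D0 ⊆ prod (o1 M) P /\ lec D0 (o1 M) /\ (forall d p, opair d p ∈ D0 -> D d p) /\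
    ∀ d ∈ o1 M, ∀ q ∈ P, exists p, opair d p ∈ D0 /\ ∃ s ∈ P, LE s p /\ LE s q.
Proof.
move=> ch HD dn; have [g Hg] := choice_fun (powerset P).
pose o := o1 M; pose Y S t d := sep P (fun p => D d p /\ sep (tp p) (fun z => idx z ∈ S) = t).
have YE S t d p : p ∈ Y S t d <-> p ∈ P /\ D d p /\ sep (tp p) (fun z => idx z ∈ S) = t by rewrite /Y sepE; df.
pose pk z := ap g (Y (pfst z) (pfst (psnd z)) (psnd (psnd z))).
have Dpk : DT (k := 1) (fun t : tup M 1 => pk (hd t)) by rewrite /pk /Y; df.
pose T B := prod (csub B) (prod (csub (prod (prod B o) o)) o).
have TE B z : z ∈ T B <-> ∃ S ∈ csub B, ∃ t ∈ csub (prod (prod B o) o), ∃ d ∈ o, z = opair S (opair t d).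
  rewrite prodE; split=> [[S [HS [y [/prodE [t [Ht [d [Hd ->]]]] ->]]]]|[S [HS [t [Ht [d [Hd ->]]]]]]].
    by exists S; split=> //; exists t; split=> //; exists d.
  by exists S; split=> //; exists (opair t d); rewrite pair_prod.
have lT B : lec B o -> lec (T B) o.
  move=> HB; apply: lec_prodk; [exact: inf_o1|exact: CH_csub|].
  apply: lec_prodk; [exact: inf_o1| |exact: lec_refl]; apply: CH_csub => //.
  apply: lec_prodk; [exact: inf_o1| |exact: lec_refl].
  by apply: lec_prodk; [exact: inf_o1| |exact: lec_refl].
pose N z := ne (Y (pfst z) (pfst (psnd z)) (psnd (psnd z))).
have DN : Df (k := 1) (fun t : tup M 1 => N (hd t)) by rewrite /N /Y; df.
have pkY z : N z -> pk z ∈ Y (pfst z) (pfst (psnd z)) (psnd (psnd z)).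
  by move=> Nz; apply: Hg => //; apply/powersetE => p /YE [].
(* [Phi S] collects the supports of the representatives of all traces on countable subsets of [S];
   [T S] has size at most ω1 by CH. *)
pose Phi S := union (img (sep (T S) N) (fun z => suppc (pk z))).
have [|||S SQ cS|B [_ [BQ [cB HB]]]] := closing (X := empty M) (Y := Q) (Phi := Phi) ch.
  by rewrite /Phi /T /o; df.
  by move=> x /emptyE.
  by apply: lec_sub => x /emptyE.
  split.
    move=> a /unionE [y []]; rewrite imgE; last by df.
    move=> [z []]; rewrite sepE; last by df.
    by move=> [zT /pkY /YE [pP _]] -> /(supp_Q pP).
  apply: lec_imgk; [exact: inf_o1|by df| |].
    apply: (lec_trans (b := T S)); last by apply: lT; apply: ctbl_lec_o1.
    by apply: lec_sub => z; rewrite sepE; [case|df].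
  move=> z; rewrite sepE; last by df.
  by move=> [zT /pkY /YE [pP _]]; apply: ctbl_lec_o1; exact: supp_ctbl pP.
pose D0 := img (sep (T B) N) (fun z => opair (psnd (psnd z)) (pk z)).
have D0E w : w ∈ D0 <-> ∃ z ∈ T B, N z /\ w = opair (psnd (psnd z)) (pk z).
  rewrite imgE; last by df.
  split=> [[z []]|[z [zT [Nz ->]]]]; first by rewrite sepE; [move=> [? ?] ?; exists z|df].
  by exists z; split=> //; rewrite sepE; df.
exists D0; split.
  move=> w /D0E [z [/TE [S [HS [t [Ht [d [Hd Ez]]]]]] [Nz ->]]]; generalize (pkY z Nz); move=> /YE [pP _].
  by apply/pair_prod; split=> //; rewrite Ez !psndE.
split; first by apply: (lec_trans (lec_img _ _)); [df|apply: (lec_trans (b := T B)); [apply: lec_sub => z; rewrite sepE; [case|df]|exact: lT]].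
split; first by move=> d p /D0E [z [zT [Nz /opair_inj [-> ->]]]]; generalize (pkY z Nz); move=> /YE [_ []].
move=> d dO q0 q0P; have [q [qP [qq0 Dq]]] := dn d dO q0 q0P.
pose S := cap (suppc q) B; pose t := sep (tp q) (fun z => idx z ∈ S).
have cS : ctbl S by apply: ctbl_sub (supp_ctbl qP) => x /capE [].
have tE z : z ∈ t <-> z ∈ tp q /\ idx z ∈ S by rewrite sepE; df.
have SB : S ⊆ B by move=> x /capE [].
have ct : t ∈ csub (prod (prod S o) o).
  apply/csubE; split; last by move/PKE: (qP) => [_ [[_ [c _]] _]]; apply: ctbl_sub c => z /tE [].
  by move=> z /tE [zq zS]; have [E [_ [? ?]]] := tp_idx qP zq; rewrite E !pair_prod.
pose z := opair S (opair t d).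
have [z1 [z2 z3]] : pfst z = S /\ pfst (psnd z) = t /\ psnd (psnd z) = d by rewrite /z !psndE !pfstE.
have Nz : N z by exists q; rewrite z1 z2 z3; apply/YE; do !split.
have zT : z ∈ T S by apply/TE; exists S; split; [by apply/csubE; split=> [x|]|exists t; split=> //; exists d].
generalize (pkY z Nz); move=> /YE; rewrite z1 z2 z3 => -[pP [Dp Ept]].
have pB : suppc (pk z) ⊆ B.
  move=> a ap; apply: (HB S SB cS); apply/unionE; exists (suppc (pk z)); split=> //.
  rewrite imgE; last by df.
  by exists z; split=> //; rewrite sepE; df.
exists (pk z); split.
  apply/D0E; exists z; split; last by rewrite z3.
  apply/TE; exists S; split; first by apply/csubE.
  exists t; split; last by exists d.
  move/csubE: ct => [ts ct]; apply/csubE; split=> // w /ts.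
  move=> /prodE [y [/prodE [a [/SB aB [d' [dO' ->]]]] [v [vo ->]]]]; by rewrite !pair_prod.
have tE' w : w ∈ t <-> w ∈ tp (pk z) /\ idx w ∈ S by rewrite -Ept sepE; df.
have [||jP [j1 j2]] := agree_join pP qP.
  move=> w wp wq; have : w ∈ t by apply/tE'; split=> //; apply/capE; split=> //; apply: pB; exact: in_supp_t.
    by move=> /tE [].
  move=> w wq wp; have : w ∈ t by apply/tE; split=> //; apply/capE; split; [exact: in_supp_t|exact: pB].
    by move=> /tE' [].
exists (join (pk z) q); split=> //; split=> //; exact: LE_trans j2 qq0.
Qed.

(** Induction on the rows. Since [L] is regular above ω1, GCH gives at most [L] functions from ω1 to
    [L], which bounds the number of countable parts and of names of size ω1. *)
Lemma poset_card : GCH M -> regular_cardinal L -> o1 M ∈ L -> K ⊆ L ->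
  lec P L /\ lec (sep (powerset (prod (o1 M) (prod P (o1 M)))) (fun E => lec E (o1 M))) L.
Proof.
move=> gch rL oL KL; pose proof (proj1 rL) as iL; pose proof (inf_o1 (M := M)) as io.
have fo : lec (funs (o1 M) L) L by apply: GCH_funs.
have ol : lec (o1 M) L by apply: lec_sub; apply/(ord_sub ord_o1 HL); left.
have fw : lec (funs (omega M) L) L.
  apply: (lec_trans _ fo); apply: lec_funs_l; first by exists (o1 M).
  by apply: ctbl_lec_o1; exact: lec_refl.
have small U : lec U L -> lec (sep (powerset (prod (o1 M) (prod U (o1 M)))) (fun E => lec E (o1 M))) L.
  by move=> HU; apply: small_sub_lec => //; do 2! (apply: lec_prodk => //).
have cs U : lec U L -> lec (csub U) L by move=> HU; apply: small_sub_lec => //; exact: inf_omega.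
have QL : lec Q L by apply: lec_prodk => //; [exact: lec_sub|exact: lec_refl].
suff H j : j ⊆ K -> lec (PP K L j) L by pose proof (H K (fun x h => h)) as HP; split=> //; exact: small.
elim/mem_ind: j => j IH jK; have Oj i : i ∈ j -> i ⊆ K by move=> /jK iK x xi; apply: (ord_tr HK iK xi).
pose U := union (img j (PP K L)).
pose proof (DT_PP K L) as DP.
have HU : lec U L.
  apply: lec_imgk => //; [by apply: DP; df|apply: lec_sub => x /jK /KL //|].
  by move=> i ij; apply: IH => //; exact: Oj.
apply: (lec_trans (b := prod (csub (prod (prod Q (o1 M)) (o1 M)))
   (csub (prod Q (sep (powerset (prod (o1 M) (prod U (o1 M)))) (fun E => lec E (o1 M))))))); last first.
  apply: lec_prodk => //; first by apply: cs; do 2! (apply: lec_prodk => //).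
  by apply: cs; apply: lec_prodk => //; exact: small.
apply: lec_sub => p /PPE [E0 [[[t1 [t2 _]] _] [c F]]]; rewrite E0; apply/pair_prod; split; apply/csubE; split=> //.
move=> w wF; have [a [aQ [E [-> [aj [g1 [g2 _]]]]]]] := F w wF; apply/pair_prod; split=> //.
rewrite sepE; last by df.
rewrite powersetE; split=> // z /g1 /prodE [d [dO [y [/prodE [r [/PBE [rP _] [h [ho ->]]]] ->]]]].
rewrite !pair_prod; split=> //; split=> //; apply/unionE; exists (PP K L (pfst a)); split=> //.
by rewrite imgE; [exists (pfst a)|apply: DP; df].
Qed.
End ChainCondition.

Lemma succ_card_unique {M : structure} {HM : ZFCw M} (k l : M) : is_cardinal k -> is_cardinal l -> k ∈ l ->
  (∀ x ∈ l, lec x k) -> l = succ_card k.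
Proof.
move=> Hk Hl kl H; have [[Hs ks] m] := succ_card_spec (proj1 Hk).
by have [/H K|] := m l Hl kl; [case: (mem_card_nlec Hs ks K)|].
Qed.
Lemma surj_of_lec {M : structure} {HM : ZFCw M} (a b : M) : ne a -> lec a b ->
  exists g, g ∈ funs b a /\ ∀ x ∈ a, ∃ y ∈ b, ap g y = x.
Proof.
move=> [a0 Ha] [f If]; have [g [Hg gf]] := inj_inv If.
exists (lam b (fun y => ite (y ∈ img a (ap f)) (ap g y) a0)); split.
  apply: lam_fun; first by df.
  by move=> y _; case: (classic (y ∈ img a (ap f))) => H; [rewrite iteT //; apply: (ap_in Hg)|rewrite iteF].
move=> x xa; pose proof (ap_in (proj1 If) xa) as fb; exists (ap f x); split=> //; rewrite ap_lam //; last by df.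
by rewrite iteT ?gf // imgE; [exists x|df].
Qed.

(** * Preservation of ω1, CH and regular cardinals *)

Section Extension.
Context {V : structure} {HM : ZFCw V}.
Variables K L : V.
Hypotheses (HK : ordinal K) (HL : ordinal L) (gch : GCH V).
Variable G : V -> Prop.
Notation P := (PK K L).
Notation po := (ord_of K L).
Hypothesis FG : generic_filter P po G.
Notation W := (gstr P G).
Notation i := (gincl P G).
Let FN := ord_forcing K L.
Let HW : ZFCw W := gstr_ZFCw FN FG.
Local Existing Instance HW.
Let Q := prod K L.
Notation o := (o1 V).
Let iE (x : V) (y : W) : y ∈ i x -> ∃ z ∈ x, y = i z := @i_elem V HM P po G FG x y.
Let iM x y : i x ∈ i y <-> x ∈ y := i_mem FG x y.

Lemma gch_CH : CH V. Proof. exact: (GCH_pow gch inf_omega). Qed.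
Lemma gP p : G p -> p ∈ P. Proof. exact: (gf_subset FG). Qed.
Lemma gup p q : G p -> q ∈ P -> LE p q -> G q.
Proof. by move=> Gp qP H; apply: (gf_upward FG Gp); apply/pleE; split=> //; exact: gP. Qed.
Lemma gcommon p q : G p -> G q -> exists r, G r /\ LE r p /\ LE r q.
Proof. by move=> Gp Gq; have [r [Gr [/pleE [_ [_ ?]] /pleE [_ [_ ?]]]]] := gf_directed FG Gp Gq; exists r. Qed.
Lemma gdense (D : V -> Prop) : Df (k := 1) (fun t : tup V 1 => D (hd t)) ->
  (∀ p ∈ P, ∃ q ∈ P, LE q p /\ D q) -> exists q, G q /\ D q.
Proof.
move=> HD H; apply: (gen_dense FN FG HD) => p pP; have [q [qP [qp Dq]]] := H p pP.
by exists q; split=> //; apply/pleE.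
Qed.

(** Below any condition either some extension excludes all values at some argument ([Bad]), which
    cannot happen in the filter, or a descending sequence decides one value after another and its
    bound decides the whole sequence ([Good]). *)
Lemma no_new_seq A (g : W) : g ∈ funs (omega W) (i A) -> exists f, f ∈ funs (omega V) A /\ g = i f.
Proof.
rewrite (i_omega FN FG) => Hg; have [t Et] := cls_surj g.
pose proof (Df_Dec (V := V) P po) as DD.
pose Good q := exists f, f ∈ funs (omega V) A /\ ∀ n ∈ omega V, Dec P po t q n (ap f n).
pose Bad q := ∃ n ∈ omega V, forall s, ple po s q -> ∀ h ∈ A, ~ Dec P po t s n h.
have [||q [Gq [[f [Hf Hq]]|[n [nw N]]]]] := gdense (D := fun q => Good q \/ Bad q).
- apply: Df_or; [apply: Df_ex; apply: Df_and; first df; apply: Df_ball; first df; apply: DD; df|].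
  apply: Df_bex; first df; apply: Df_all; apply: Df_imp; first df; apply: Df_ball; first df.
  by apply: Df_not; apply: DD; df.
- move=> p pP; case: (classic (∃ s ∈ P, LE s p /\ Bad s)) => [[s [sP [sp Bs]]]|NB].
    by exists s; split=> //; split=> //; right.
  have st s : s ∈ P -> LE s p -> ∀ n ∈ omega V, exists s' h, s' ∈ P /\ LE s' s /\ h ∈ A /\ Dec P po t s' n h.
    move=> sP sp n nw; apply: NNPP => N; apply: NB; exists s; split=> //; split=> //; exists n; split=> // s' /pleE [s'P [_ s's]] h hA H.
    by apply: N; exists s', h.
  have [s0 [a0 [_ [_ [a0A _]]]]] := st p pP (LE_refl p) (empty V) empty_omega.
  pose X := prod (sep P (fun s => LE s p)) A.
  have XE s h : opair s h ∈ X <-> s ∈ P /\ LE s p /\ h ∈ A by rewrite pair_prod sepE; [tauto|df].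
  have [|||f [Hf [f0 fR]]] := dependent_choice (X := X) (Rl := fun n x y => LE (pfst y) (pfst x) /\ Dec P po t (pfst y) n (psnd y)) (x0 := opair p a0).
    by apply: Df_and; [df|apply: DD; df].
    by apply/XE; split=> //; split=> //; exact: LE_refl.
    move=> n nw x /prodE [s [+ [h [hA ->]]]]; rewrite sepE; last by df.
    move=> [sP sp]; have [s' [h' [s'P [s's [h'A H]]]]] := st s sP sp n nw.
    by exists (opair s' h'); rewrite !pfstE !psndE XE; split=> //; split=> //; split=> //; exact: LE_trans s's sp.
  have fX n : n ∈ omega V -> pfst (ap f n) ∈ P /\ psnd (ap f n) ∈ A.
    move=> nw; have [E [+ hA]] := prod_eta (ap_in Hf nw); rewrite sepE; last by df.
    by case.
  pose u := lam (omega V) (fun n => pfst (ap f n)).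
  have Hu : u ∈ funs (omega V) P by apply: lam_fun; [df|move=> n /fX []].
  have uE n : n ∈ omega V -> ap u n = pfst (ap f n) by move=> nw; rewrite ap_lam //; df.
  have [|q [qP [qf _]]] := chain_bound Hu.
    by move=> n nw; rewrite !uE //; [case: (fR n nw)|exact: succ_omega].
  exists q; split=> //; split; first by generalize (qf 0); rewrite uE ?f0 ?pfstE //; exact: empty_omega.
  left; exists (lam (omega V) (fun n => psnd (ap f (succ n)))); split.
    by apply: lam_fun; [df|move=> n /succ_omega /fX []].
  move=> n /omegaE [m ->]; pose proof (nat_omega (M := V) m) as nw; rewrite ap_lam //; last by df.
  apply: (dec_mono FN) (proj2 (fR _ nw)); apply/pleE; pose proof (succ_omega nw) as sw; split=> //; split; first by case: (fX _ sw).
  by generalize (qf (S m)); rewrite uE.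
- exists f; split=> //; have [Hi Ei] := i_funs FN FG Hf; apply: (fun_ext Hg Hi) => x /iE [n [nw ->]].
  by rewrite Ei //; apply: (dec_fun FN FG Et Hg Gq); apply: Hq.
- have [h [p [hA [Gp H]]]] := dec_some FN FG Et Hg nw; have [r [Gr [rp rq]]] := gcommon Gp Gq.
  case: (N r _ h hA); first by apply/pleE; do !split=> //; exact: gP.
  by apply: (dec_mono FN) H; apply/pleE; do !split=> //; exact: gP.
Qed.

(** A collapse of ω1 would provide a sequence of type ω running through all ground model countable
    ordinals; such a sequence is not new, so ω1 would be countable in the ground model. *)
Lemma W_o1 : o1 W = i o.
Proof.
symmetry; pose proof (i_omega FN FG) as iw; apply: succ_card_unique; [exact: cardinal_omega| |by rewrite iw; apply/iM; exact: omega_o1|].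
  split; first by apply: (i_ord FG); exact: ord_o1.
  move=> x /iE [a [ao ->]] /eqp_sym/eqp_lec H.
  have L0 : ne (i o) by exists (i (empty V)); apply/iM; apply: (inf_omega_sub inf_o1); exact: empty_omega.
  have L1 : lec (i o) (omega W) by apply: (lec_trans H); rewrite iw; apply: (i_lec FN FG); exact: mem_o1.
  have [g [Hg gs]] := surj_of_lec L0 L1.
  have [f [Hf Ef]] := no_new_seq Hg; have [_ Ei] := i_funs FN FG Hf.
  apply: (o1_not_ctbl (M := V)); apply: (lec_fun_surj Hf) => y yo.
  have [|z [zw Ez]] := gs (i y); first by apply/iM.
  move: zw Ez; rewrite iw => /iE [n [nw ->]]; rewrite Ef Ei // => /(i_inj FG) <-; by exists n.
by move=> x /iE [a [ao ->]]; rewrite iw; apply: (i_lec FN FG); exact: mem_o1.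
Qed.
Lemma W_CH : CH W.
Proof.
apply: (lec_trans (lec_pow_funs _)); rewrite W_o1 (i_nat FN FG).
apply: (lec_trans (b := i (funs (omega V) (nat_in V 2)))).
  by apply: lec_sub => g /no_new_seq [f [Hf ->]]; apply/iM.
apply: (i_lec FN FG); apply: (lec_trans (lec_funs_pow _ _)); apply: lec_trans gch_CH; apply: lec_powerset.
by apply: lec_prodk; [exact: inf_omega|exact: lec_refl|apply: fin_inf_lec; [exact: inf_omega|exact: fin_nat]].
Qed.

Definition Dcd t Y d p := (∃ h ∈ Y, Dec P po t p d h) \/ (forall s, ple po s p -> ∀ h ∈ Y, ~ Dec P po t s d h).
Definition predense D0 := ∀ q ∈ P, ∃ p ∈ D0, ∃ s ∈ P, LE s p /\ LE s q.
Lemma Df_Dcd k (d p : tup V k -> V) t Y : DT d -> DT p -> Df (fun u => Dcd t Y (d u) (p u)).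
Proof.
pose proof (Df_Dec (V := V) P po) as DD; move=> Hd Hp; apply: Df_or.
  by apply: Df_bex; first df; apply: DD; df.
apply: Df_all; apply: Df_imp; first df; apply: Df_ball; first df; apply: Df_not; apply: DD; df.
Qed.
Lemma decide_fam t X Y : exists c, ∀ d ∈ X, ap c d ⊆ P /\ lec (ap c d) o /\ predense (ap c d) /\ ∀ p ∈ ap c d, Dcd t Y d p.
Proof.
pose R d D0 := D0 ⊆ P /\ lec D0 o /\ predense D0 /\ ∀ p ∈ D0, Dcd t Y d p.
have DR : Df (k := 2) (fun t : tup V 2 => R (hd (tl t)) (hd t)).
  by rewrite /R /predense; do 3! (apply: Df_and; first by df); apply: Df_ball; first df; apply: Df_Dcd; df.
have [||c Hc] := choice_fam (a := X) (Y := fun d => sep (powerset P) (R d)); first by df.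
  move=> d dX; have DdD : Df (k := 1) (fun u : tup V 1 => Dcd t Y d (hd u)) by apply: Df_Dcd; df.
  have [||D0 [D1 [D2 [D3 D4]]]] := predense_small (K := K) (L := L) (D := fun _ p => Dcd t Y d p) gch_CH; first by df.
    move=> _ _ p pP; case: (classic (∃ q ∈ P, LE q p /\ ∃ h ∈ Y, Dec P po t q d h)) => [[q [qP [qp H]]]|N].
      by exists q; split=> //; split=> //; left.
    exists p; split=> //; split; first exact: LE_refl.
    by right => s /pleE [sP [_ sp]] h hY H; apply: N; exists s; split=> //; split=> //; exists h.
  exists (img D0 psnd); rewrite sepE; last by df.
  have E p : p ∈ img D0 psnd <-> ∃ z ∈ D0, p = psnd z by rewrite imgE; df.
  have H : img D0 psnd ⊆ P by move=> p /E [z [/D1 /prod_eta [_ [_ ?]] ->]].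
  rewrite powersetE; split=> //; split=> //; split; first by apply: (lec_trans (lec_img _ _)); df.
  split; last by move=> p /E [z [zD ->]]; have [Ez _] := prod_eta (D1 z zD); apply: (D3 (pfst z)); rewrite -Ez.
  move=> q qP; have [|p [pD Hp]] := D4 (empty V) _ q qP; first by apply: (inf_omega_sub inf_o1); exact: empty_omega.
  by exists p; split=> //; apply/E; exists (opair (empty V) p); rewrite psndE.
by exists c => d /Hc; rewrite sepE; [case|df].
Qed.
Lemma predense_gen D0 : D0 ⊆ P -> predense D0 -> exists p, p ∈ D0 /\ G p.
Proof.
move=> DP H; have [||s [Gs [p [pD sp]]]] := gdense (D := fun s => ∃ p ∈ D0, LE s p); first by df.
  by move=> q qP; have [p [pD [s [sP [sp sq]]]]] := H q qP; exists s; split=> //; split=> //; exists p.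
by exists p; split=> //; apply: gup sp => //; apply: DP.
Qed.
Lemma Dcd_gen (g : W) t X Y d p : g = cls G t -> g ∈ funs (i X) (i Y) -> d ∈ X -> G p -> Dcd t Y d p ->
  ∃ h ∈ Y, Dec P po t p d h.
Proof.
move=> Et Hg dX Gp [//|N]; have [h [q [hY [Gq H]]]] := dec_some FN FG Et Hg dX.
have [r [Gr [rp rq]]] := gcommon Gp Gq; case: (N r _ h hY); first by apply/pleE; do !split=> //; exact: gP.
by apply: (dec_mono FN) H; apply/pleE; do !split=> //; exact: gP.
Qed.

(** The value at [d] is decided by every condition of the filter in the predense set [ap c d], so
    the values decided by its at most ω1 members cover it. *)
Lemma cover (g : W) X Y : g ∈ funs (i X) (i Y) ->
  exists F : V -> V, DT (k := 1) (fun t : tup V 1 => F (hd t)) /\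
   ∀ d ∈ X, F d ⊆ Y /\ lec (F d) o /\ ap g (i d) ∈ i (F d).
Proof.
move=> Hg; have [t Et] := cls_surj g; have [c Hc] := decide_fam t X Y.
pose proof (Df_Dec (V := V) P po) as DD; have [gc Hgc] := choice_fun (powerset Y).
pose S d p := sep Y (fun h => Dec P po t p d h).
have DS : DT (k := 2) (fun u : tup V 2 => S (hd (tl u)) (hd u)) by apply: DT_sep; [df|apply: DD; df].
have SE d p h : h ∈ S d p <-> h ∈ Y /\ Dec P po t p d h by apply: sepE; apply: DD; df.
(* If a condition decides no value, [gc] is applied to the empty set and its value is arbitrary; the
   separation removes values outside [Y]. *)
pose F d := sep (img (ap c d) (fun p => ap gc (S d p))) (fun h => h ∈ Y).
exists F; split; first by rewrite /F; df.
move=> d dX; have [cP [cl [pd cD]]] := Hc d dX.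
have FE h : h ∈ F d <-> (∃ p ∈ ap c d, h = ap gc (S d p)) /\ h ∈ Y by rewrite sepE ?imgE; df.
split; first by move=> h /FE [].
split; first by apply: (lec_trans (b := img (ap c d) (fun p => ap gc (S d p)))); [apply: lec_sub => h /FE [H _]; rewrite imgE; df|apply: (lec_trans (lec_img _ _)); df].
have [p [pc Gp]] := predense_gen cP pd.
have [h [hY H]] := Dcd_gen Et Hg dX Gp (cD p pc).
have /SE [gY gD] : ap gc (S d p) ∈ S d p by apply: Hgc; [apply/powersetE => x /SE []|exists h; apply/SE].
rewrite (dec_fun FN FG Et Hg Gp gD); apply/iM; apply/FE; split=> //; by exists p.
Qed.
(** A function into [k] has its values in ground model sets of size at most ω1, hence below [k].
    Bounds of these sets form a ground model function, which is bounded by the regularity of [k]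
    there. *)
Lemma W_regular k : regular_cardinal k -> o ∈ k -> regular_cardinal (i k).
Proof.
move=> rk ok; pose proof (proj1 rk) as ik; pose proof (inf_ord ik) as Ok.
have B (x f : W) : x ∈ i k -> f ∈ funs x (i k) -> ∃ b ∈ i k, ∀ y ∈ x, ap f y ∈ b.
  move=> /iE [x0 [x0k ->]] Hf; have [F [DF HF]] := cover Hf.
  have [||c Hc] := choice_fam (a := x0) (Y := fun d => sep k (fun b => F d ⊆ b)); first by df.
    move=> d /HF [FY [Fl _]]; have [||b [bk Hb]] := reg_bound rk Fl ok (F := fun x => x); first by df.
      exact: FY.
    by exists b; rewrite sepE; df.
  have cE d : d ∈ x0 -> ap c d ∈ k /\ F d ⊆ ap c d by move=> /Hc; rewrite sepE; df.
  have [||b [bk Hb]] := reg_bound rk (lec_refl x0) x0k (F := ap c); first by df.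
    by move=> d /cE [].
  exists (i b); split; first by apply/iM.
  move=> y /iE [d [dx ->]]; have [_ [_ H]] := HF d dx.
  have [h [hF ->]] := iE H; apply/iM; pose proof (ord_mem Ok bk) as Ob.
  by apply: (ord_tr Ob (Hb d dx)); apply: (proj2 (cE d dx)).
split; last by move=> x xk f Hf; have [b [bk Hb]] := B x f xk Hf; exists b; split=> // y yx; rewrite (app_ap Hf) //; exact: Hb.
split; last by left; rewrite (i_omega FN FG); apply/iM; apply: (ord_tr Ok ok omega_o1).
split; first exact: (i_ord FG Ok).
move=> x xk /eqpE [f [[Hf _] Sf]]; have [b [bk Hb]] := B x f xk Hf.
have [y [yx E]] := Sf b bk; apply: (mem_irr (x := b)); rewrite -{1}E; exact: Hb.
Qed.
Lemma W_succ_o1 : succ_card (o1 W) = i (succ_card o).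
Proof.
symmetry; apply: succ_card_unique; [exact: card_o1| |by rewrite W_o1; apply/iM; exact: (succ_card_gt ord_o1)|].
  have [[//]] := W_regular (regular_succ inf_o1) (succ_card_gt ord_o1).
move=> x /iE [a [ao ->]]; rewrite W_o1; apply: (i_lec FN FG); exact: (mem_succ_card card_o1).
Qed.
End Extension.

(** * Small names for functions on ω1 *)

Section Generic.
Context {V : structure} {HM : ZFCw V}.
Variables K L : V.
Hypotheses (HK : ordinal K) (HL : ordinal L) (gch : GCH V).
Variable G : V -> Prop.
Notation P := (PK K L).
Notation po := (ord_of K L).
Hypothesis FG : generic_filter P po G.
Notation W := (gstr P G).
Notation i := (gincl P G).
Let FN := ord_forcing K L.
Let HW : ZFCw W := gstr_ZFCw FN FG.
Local Existing Instance HW.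
Let Q := prod K L.
Notation o := (o1 V).
Let iE (x : V) (y : W) : y ∈ i x -> ∃ z ∈ x, y = i z := @i_elem V HM P po G FG x y.
Let iM x y : i x ∈ i y <-> x ∈ y := i_mem FG x y.
Let iP x y : opair (i x) (i y) = i (opair x y) := i_opair FN FG x y.

(* Names for functions on [o1]: the pairs [(d, (r, h))] with [r] in the generic filter give the values. *)
Definition predE E := ∀ d ∈ o, ∀ q ∈ P, exists r h, opair d (opair r h) ∈ E /\ ∃ s ∈ P, LE s q /\ LE s r.
Definition Sm := sep (powerset (prod o (prod P o))) (fun E => lec E o /\ predE E).
Definition caps E (g : W) := forall d r h, opair d (opair r h) ∈ E -> G r -> ap g (i d) = i h.
Definition SE (E : V) : V := union (img E (fun e => suppc (pfst (psnd e)))).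
Lemma SmE (E : V) : E ∈ Sm <-> E ⊆ prod o (prod P o) /\ lec E o /\ predE E.
Proof. by rewrite sepE; [rewrite powersetE|rewrite /predE; df]. Qed.
Lemma SEE (E d r h a : V) : opair d (opair r h) ∈ E -> a ∈ suppc r -> a ∈ SE E.
Proof.
move=> H ar; apply/unionE; exists (suppc r); split=> //; rewrite imgE; last by df.
by exists (opair d (opair r h)); rewrite psndE pfstE.
Qed.
Lemma SE_small E : E ∈ Sm -> SE E ⊆ Q /\ lec (SE E) o.
Proof.
move=> /SmE [Es [El _]]; split.
  move=> a /unionE [y []]; rewrite imgE; last by df.
  by move=> [z [/Es /prodE [d [_ [y' [/prodE [r [rP [h [_ ->]]]] ->]]]] ->]]; rewrite psndE pfstE => /(supp_Q rP).
apply: lec_imgk => //; [exact: inf_o1|by df|].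
move=> z /Es /prodE [d [_ [y' [/prodE [r [rP [h [_ ->]]]] ->]]]]; rewrite psndE pfstE; apply: ctbl_lec_o1; exact: supp_ctbl rP.
Qed.

Lemma capture (g : W) : g ∈ funs (i o) (i o) -> ∃ E ∈ Sm, caps E g.
Proof.
move=> Hg; have [t Et] := cls_surj g; have [c Hc] := decide_fam K L gch t o o.
pose proof (Df_Dec (V := V) P po) as DD; have [gc Hgc] := choice_fun (powerset o).
pose S (d p : V) : V := sep o (fun h => Dec P po t p d h).
have DS : DT (k := 2) (fun u : tup V 2 => S (hd (tl u)) (hd u)) by apply: DT_sep; [df|apply: DD; df].
have SPE d p h : h ∈ S d p <-> h ∈ o /\ Dec P po t p d h by apply: sepE; apply: DD; df.
have gS d p : ne (S d p) -> ap gc (S d p) ∈ S d p by move=> H; apply: Hgc => //; apply/powersetE => x /SPE [].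
have o0 : empty V ∈ o by apply: (inf_omega_sub inf_o1); exact: empty_omega.
(* A condition that excludes every value receives the default 0; by [Dcd_gen] it does not belong to
   the filter, so the default never becomes a value. *)
pose hh (d p : V) : V := ite (ne (S d p)) (ap gc (S d p)) (empty V).
have ho d p : hh d p ∈ o.
  by rewrite /hh; case: (classic (ne (S d p))) => H; [rewrite iteT //; case/SPE: (gS d p H)|rewrite iteF].
have Dh : DT (k := 2) (fun u : tup V 2 => hh (hd (tl u)) (hd u)) by rewrite /hh; df.
pose E := union (img o (fun d => img (ap c d) (fun p => opair d (opair p (hh d p))))).
have EE z : z ∈ E <-> ∃ d ∈ o, ∃ p ∈ ap c d, z = opair d (opair p (hh d p)).
  rewrite unionE; split=> [[y []]|[d [dO [p [pc ->]]]]].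
    rewrite imgE; last by df.
    by move=> [d [dO ->]]; rewrite imgE; [move=> [p [pc ->]]; exists d; split=> //; exists p|df].
  exists (img (ap c d) (fun p => opair d (opair p (hh d p)))); rewrite !imgE; try bydf.
  by split; [exists d|exists p].
exists E; split.
  apply/SmE; split.
    by move=> z /EE [d [dO [p [pc ->]]]]; rewrite !pair_prod; split=> //; split=> //; apply: (proj1 (Hc d dO)).
  split.
    apply: lec_imgk; [exact: inf_o1|by df|exact: lec_refl|].
    by move=> d /Hc [_ [H _]]; apply: (lec_trans (lec_img _ _) H); df.
  move=> d dO q qP; have [_ [_ [H _]]] := Hc d dO; have [p [pc [s [sP [s1 s2]]]]] := H q qP.
  exists p, (hh d p); split; last by exists s.
  by apply/EE; exists d; split=> //; exists p.
move=> d r h /EE [d' [dO [p [pc /opair_inj [Ed /opair_inj [Er Eh]]]]]] Gr; subst d' p h.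
have [_ [_ [_ H]]] := Hc d dO; have [h [hO Hh]] := Dcd_gen FG Et Hg dO Gr (H r pc).
have N : ne (S d r) by exists h; apply/SPE.
rewrite /hh iteT //; apply: (dec_fun FN FG Et Hg Gr); by case/SPE: (gS d r N).
Qed.
Lemma caps_val E d : E ∈ Sm -> d ∈ o -> exists r h, opair d (opair r h) ∈ E /\ G r.
Proof.
move=> /SmE [Es [_ pE]] dO; have [||s [Gs [r [h [H sr]]]]] := gdense FG (D := fun s => exists r h, opair d (opair r h) ∈ E /\ LE s r); first by df.
  by move=> q qP; have [r [h [H [s [sP [sq sr]]]]]] := pE d dO q qP; exists s; split=> //; split=> //; exists r, h.
exists r, h; split=> //; apply: (gup FG) Gs _ sr; by generalize (Es _ H); rewrite !pair_prod; tauto.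
Qed.
(** [caps] quantifies over ground model sets and the filter. Choice of names in the extension needs
    a first-order version there, obtained from the set [Gs] of conditions in the filter. *)
Lemma caps_W : exists C : W -> W -> Prop, Df (k := 2) (fun t : tup W 2 => C (hd (tl t)) (hd t)) /\
  ∀ E ∈ Sm, forall g, C (i E) g <-> caps E g.
Proof.
have [Gs HGs] := gen_set FG (P := P).
exists (fun e g => forall d r h, opair d (opair r h) ∈ e -> r ∈ Gs -> ap g d = h); split; first by df.
move=> E /SmE [Es _] g; split=> [H d r h dE Gr|H d r h /iE [z [zE Ez]] /HGs [p [Gp Ep]]].
  by apply: (H (i d) (i r) (i h)); [rewrite !iP; apply/iM|apply/HGs; exists r].
generalize (Es z zE); move=> /prodE [d0 [_ [y [/prodE [r0 [_ [h0 [_ Ey]]]] Ez']]]]; subst y z.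
by move: Ez; rewrite -!iP => /opair_inj [-> /opair_inj [Er ->]]; apply: (H d0 r0 h0) => //; rewrite (i_inj FG (x := r0) (y := p)) // -Er.
Qed.
(** [b1] and [b2] stand for coordinate ranks of names. The names are chosen in the extension only,
    but the cardinals remain regular there, so the ranks of the chosen names are bounded. *)
Lemma family (A x : W) X1 X2 b1 b2 : regular_cardinal X1 -> regular_cardinal X2 -> o ∈ X1 -> o ∈ X2 ->
  A ⊆ funs (i o) (i o) -> lec A x -> x ∈ i X1 -> x ∈ i X2 -> b1 ∈ funs Sm X1 -> b2 ∈ funs Sm X2 ->
  ∃ y1 ∈ X1, ∃ y2 ∈ X2, ∀ g ∈ A, ∃ E ∈ Sm, caps E g /\ ap b1 E ∈ y1 /\ ap b2 E ∈ y2.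
Proof.
move=> r1 r2 o1X o2X AF Ax x1 x2 Hb1 Hb2; have [C [DC HC]] := caps_W.
have [||e He] := choice_fam (a := A) (Y := fun g => sep (i Sm) (fun e => C e g)); first by df.
  move=> g /AF /capture [E [ES cE]]; exists (i E); rewrite sepE; last by df.
  by split; [apply/iM|apply/HC].
have eE g : g ∈ A -> exists E, E ∈ Sm /\ ap e g = i E /\ caps E g.
  move=> gA; generalize (He g gA); rewrite sepE; last by df.
  by move=> [/iE [E [ES ->]] H]; exists E; split=> //; split=> //; apply/HC.
have [B1 E1] := i_funs FN FG Hb1; have [B2 E2] := i_funs FN FG Hb2.
pose proof (W_regular gch FG r1 o1X) as K1; pose proof (W_regular gch FG r2 o2X) as K2.
have [||y1 [/iE [z1 [zX1 ->]] H1]] := reg_bound K1 Ax x1 (F := fun g => ap (i b1) (ap e g)); first by df.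
  by move=> g /eE [E [ES [-> _]]]; rewrite E1 //; apply/iM; apply: (ap_in Hb1).
have [||y2 [/iE [z2 [zX2 ->]] H2]] := reg_bound K2 Ax x2 (F := fun g => ap (i b2) (ap e g)); first by df.
  by move=> g /eE [E [ES [-> _]]]; rewrite E2 //; apply/iM; apply: (ap_in Hb2).
exists z1; split=> //; exists z2; split=> // g gA; have [E [ES [Ee cE]]] := eE g gA.
exists E; split=> //; split=> //; generalize (H1 g gA); generalize (H2 g gA); rewrite Ee E1 // E2 //.
by move=> /iM ? /iM ?.
Qed.
Lemma W_funs_card : regular_cardinal L -> o ∈ L -> K ⊆ L -> lec (funs (i o) (i o)) (i L).
Proof.
move=> rL oL KL; have [_ H] := poset_card HK HL gch rL oL KL; have [C [DC HC]] := caps_W.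
apply: (lec_trans (b := i Sm)); last first.
  apply: (i_lec FN FG); apply: lec_trans H; apply: lec_sub => E /SmE [Es [El _]].
  by rewrite sepE; [rewrite powersetE|df].
have [||e He] := choice_fam (a := funs (i o) (i o)) (Y := fun g => sep (i Sm) (fun e => C e g)); first by df.
  move=> g /capture [E [ES cE]]; exists (i E); rewrite sepE; last by df.
  by split; [apply/iM|apply/HC].
have eE g : g ∈ funs (i o) (i o) -> exists E, E ∈ Sm /\ ap e g = i E /\ caps E g.
  move=> gA; generalize (He g gA); rewrite sepE; last by df.
  by move=> [/iE [E [ES ->]] H']; exists E; split=> //; split=> //; apply/HC.
apply: (lec_lam (F := ap e)); first by df.
  by move=> g /eE [E [ES [-> _]]]; apply/iM.
move=> g Hg g' Hg'; have [E [ES [-> cE]]] := eE g Hg; have [E' [ES' [-> cE']]] := eE g' Hg' => /(i_inj FG) EE; subst E'.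
apply: (fun_ext Hg Hg') => y /iE [d [dO ->]]; have [r [h [dE Gr]]] := caps_val ES dO.
by rewrite (cE d r h) // (cE' d r h).
Qed.

(** * The generic functions *)

Definition tval a d v := exists p, G p /\ opair (opair a d) v ∈ tp p.
Lemma tval_unique a d v v' : tval a d v -> tval a d v' -> v = v'.
Proof.
move=> [p [Gp H]] [q [Gq H']]; have [r [Gr [/LE_unfold [A _] /LE_unfold [B _]]]] := gcommon FG Gp Gq.
generalize (tp_fun (gP FG Gr) (A _ H) (B _ H')); rewrite !pfstE => /(_ eq_refl) /opair_inj [] //.
Qed.
(** If [p] has no value at [(a, d)], [fulfill] bounds all promises about it by some [v] without
    touching this point, and [extend] can add [v] itself as the value. *)
Lemma tval_ex a d : a ∈ Q -> d ∈ o -> ∃ v ∈ o, tval a d v.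
Proof.
move=> aQ dO; have [||q [Gq [v Hv]]] := gdense FG (D := fun q => exists v, opair (opair a d) v ∈ tp q); first by df.
  move=> p pP; case: (classic (∃ z ∈ tp p, pfst z = opair a d)) => [[z [zp Ez]]|N].
    by exists p; split=> //; split; [exact: LE_refl|exists (psnd z); rewrite -Ez; have [E _] := tp_idx pP zp; move: zp; rewrite {1}E /idx /arg Ez pfstE psndE].
  have [q [qP [qp [qt [qs [v [vo H]]]]]]] := fulfill HK HL pP aQ dO.
  have nb E : ~ opair a E ∈ sp q \/ opair a E ∈ sp p.
    case: (classic (opair a E ∈ sp q)) => [/qs [|]|]; [by right|rewrite pfstE => /below_irr []|by left].
  have [||r [rP [rq Hr]]] := extend HK HL pP qP qp _ aQ dO vo _ H.
    by move=> E; case: (nb E).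
    move=> [z [zq Ez]]; have [zp|] := qt z zq; first by apply: N; exists z.
    by rewrite /idx Ez pfstE => /below_irr.
  by exists r; split=> //; split; [exact: LE_trans rq qp|exists v].
exists v; split; last by exists q.
by have [_ [_ [_]]] := tp_idx (gP FG Gq) Hv; rewrite psndE.
Qed.
Lemma gen_fun : exists T : W, T ∈ funs (prod (i Q) (i o)) (i o) /\
  forall a d v, tval a d v -> ap T (opair (i a) (i d)) = i v.
Proof.
have [Gs HGs] := gen_set FG (P := P).
pose T : W := sep (i (prod (prod Q o) o)) (fun z => ∃ p ∈ Gs, z ∈ pfst p).
have TE (z : W) : z ∈ T <-> exists a d v, a ∈ Q /\ d ∈ o /\ v ∈ o /\ z = i (opair (opair a d) v) /\ tval a d v.
  rewrite sepE; last by df.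
  have PF p : G p -> pfst (i p) = i (tp p).
    by move=> /(gP FG) /PKE [E _]; exact: (proj1 (i_pfst FN FG (ex_intro _ (tp p) (ex_intro _ (sp p) E)))).
  split=> [[/iE [z0 [/prodE [y [/prodE [a [aQ [d [dO ->]]]] [v [vo ->]]]] ->]] [g [/HGs [p [Gp ->]]]]]|[a [d [v [aQ [dO [vo [-> [p [Gp H]]]]]]]]]].
    by rewrite PF // => /iM H; exists a, d, v; do !split=> //; exists p.
  split; first by apply/iM; rewrite !pair_prod.
  by exists (i p); split; [apply/HGs; exists p|rewrite PF //; apply/iM].
have HT : T ∈ funs (prod (i Q) (i o)) (i o).
  apply/funsE; split; first by move=> z; rewrite sepE; [rewrite !(i_prod FN FG); case|df].
  move=> y /prodE [u [/iE [a [aQ ->]] [w [/iE [d [dO ->]] ->]]]]; have [v [vo Hv]] := tval_ex aQ dO.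
  exists (i v); split; first by apply/TE; exists a, d, v; rewrite -!iP.
  move=> w' /TE [a' [d' [v' [_ [_ [_ []]]]]]]; rewrite -!iP.
  by move=> /opair_inj [/opair_inj [/(i_inj FG) <- /(i_inj FG) <-] ->] /(tval_unique Hv) ->.
exists T; split=> // a d v H; apply: (ap_eq HT); apply/TE; have [p [Gp Hp]] := H.
have [_ [aQ [dO vo]]] := tp_idx (gP FG Gp) Hp; move: aQ dO vo; rewrite /idx /arg !pfstE !psndE => aQ dO vo.
by exists a, d, v; rewrite -!iP.
Qed.

Lemma down_below a : a ∈ Q -> down_closed K L (below K L a).
Proof.
move=> aQ b /belowE [bQ [b1 b2]] c /belowE [cQ [c1 c2]]; apply/belowE; split=> //; have [_ [aK aL]] := prod_eta aQ.
by split; [apply: (ord_tr (ord_mem HK aK) b1 c1)|apply: (ord_tr (ord_mem HL aL) b2 c2)].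
Qed.
(** Restricting conditions to the indices below [a] shows that [E] is also a total name for the
    suborder below [a], so some condition in the filter promises to bound it. The promise constrains
    all points outside the countable domain of that condition. *)
Lemma dominate a E (g : W) : a ∈ Q -> E ∈ Sm -> SE E ⊆ below K L a -> caps E g ->
  ∃ b ∈ o, ∀ d ∈ o, ~ d ∈ b -> exists v h, tval a d v /\ ap g (i d) = i h /\ h ∈ v.
Proof.
move=> aQ ES SB cE; generalize (ES); move=> /SmE [Es [El pE]].
have gd : good (PB K L a) E.
  have rB d r h : opair d (opair r h) ∈ E -> d ∈ o /\ r ∈ P /\ h ∈ o /\ suppc r ⊆ below K L a.
    by move=> H; generalize (Es _ H); rewrite !pair_prod => -[? [? ?]]; do !split=> //; move=> b br; apply: SB; exact: SEE H br.
  split; last split=> //.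
    move=> z zE; generalize (Es z zE); move=> /prodE [d [_ [y [/prodE [r [_ [h [_ Ey]]]] Ez]]]]; subst y z.
    by have [? [? [? ?]]] := rB d r h zE; rewrite !pair_prod; do !split=> //; apply/PB_P.
  move=> d dO q /(PB_P _ aQ) [qP qB]; have [r [h [H [s [sP [sq sr]]]]]] := pE d dO q qP.
  have [_ [rP [_ rb]]] := rB d r h H; exists r, h; split=> //; exists (res s (below K L a)).
  have [? ?] := res_P (below K L a) sP; split; first by apply/PB_P.
  by split; [apply: (res_LE qP qB (down_below aQ) sq)|apply: (res_LE rP rb (down_below aQ) sr)].
have [||p [Gp Hp]] := gdense FG (D := fun p => opair a E ∈ sp p); first by df.
  by move=> p pP; have [q [qP [qp [_ ?]]]] := add_promise pP aQ gd; exists q.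
pose proof (gP FG Gp) as pP.
have [b [bo Hb]] : ∃ b ∈ o, img (tp p) arg ⊆ b.
  apply: ctbl_bound_sub; first by apply: ctbl_img; [df|move/PKE: pP => [_ [[_ []]]]].
  by move=> y; rewrite imgE; [move=> [z [zp ->]]; case: (tp_idx pP zp) => _ [_ []]|df].
exists b; split=> // d dO dN; have [v [vo [q [Gq Hq]]]] := tval_ex aQ dO.
have [r [Gr [/LE_unfold [_ [_ rp]] /LE_unfold [rq _]]]] := gcommon FG Gp Gq.
generalize (rp _ (rq _ Hq)); rewrite /idx /arg !pfstE !psndE => /(_ _ E Hp) [].
  by move=> zp; apply: dN; apply: Hb; rewrite imgE; [exists (opair (opair a d) v); rewrite /arg pfstE psndE|df].
move=> r' [h [dE [Lr hv]]]; exists v, h; split; first by exists q.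
have rP : r' ∈ P by generalize (Es _ dE); rewrite !pair_prod; tauto.
by split=> //; exact: (cE _ _ _ dE (gup FG Gr rP Lr)).
Qed.
(** The name is decided by a condition supported in [B], hence without touching the index [a]. The
    value at [(a, d)] can therefore be chosen after the value of [g] at [d] is known. *)
Lemma escape a B E c (g : W) b : a ∈ Q -> ~ a ∈ B -> down_closed K L B -> E ∈ Sm -> SE E ⊆ B -> caps E g ->
  c ∈ funs o o -> (∀ h ∈ o, ∀ w ∈ o, ∃ v ∈ o, w ∈ v /\ ap c v = h) -> b ∈ o ->
  ∃ d ∈ o, ~ d ∈ b /\ exists v, tval a d v /\ v ∈ o /\ ap g (i d) = i (ap c v) /\ ap c v ∈ v.
Proof.
move=> aQ aB Bd ES SB cE Hc Hcu bo; generalize (ES); move=> /SmE [Es [El pE]].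
pose D (q : V) := ∃ d ∈ o, ~ d ∈ b /\ exists v r, v ∈ o /\ opair (opair a d) v ∈ tp q /\ opair d (opair r (ap c v)) ∈ E /\ LE q r /\ ap c v ∈ v.
have [||q [Gq [d [dO [db [v [r [vo [Hv [dE [qr hv]]]]]]]]]]] := gdense FG (D := D); first by rewrite /D; df.
  move=> p pP; have [d [dO [db N]]] : ∃ d ∈ o, ~ d ∈ b /\ ~ ∃ z ∈ tp p, pfst z = opair a d.
    have [b' [bo' Hb]] : ∃ b' ∈ o, img (tp p) arg ⊆ b'.
      apply: ctbl_bound_sub; first by apply: ctbl_img; [df|move/PKE: pP => [_ [[_ []]]]].
      by move=> y; rewrite imgE; [move=> [z [zp ->]]; case: (tp_idx pP zp) => _ [_ []]|df].
    pose proof (ord_mem ord_o1 bo) as Ob; pose proof (ord_mem ord_o1 bo') as Ob'.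
    have nb d : ~ d ∈ b' -> ~ ∃ z ∈ tp p, pfst z = opair a d.
      by move=> N [z [zp Ez]]; apply: N; apply: Hb; rewrite imgE; [exists z; rewrite /arg Ez psndE|df].
    have [H|H] := classic (b ∈ b').
      by exists b'; split=> //; split; [exact: mem_asym|apply: nb; exact: mem_irr].
    by exists b; split=> //; split; [exact: mem_irr|apply: nb].
  (* [v0] bounds all promises about this point, which itself stays undecided. *)
  have [q [qP [qp [qt [qs [v0 [v0o H]]]]]]] := fulfill HK HL pP aQ dO.
  have [rP' rB'] := res_P B qP; have [r [h [dE [s [sP [sq sr]]]]]] := pE d dO _ rP'.
  have [_ [rP hO]] : d ∈ o /\ r ∈ P /\ h ∈ o by generalize (Es _ dE); rewrite !pair_prod.
  have rB : suppc r ⊆ B by move=> x xr; apply: SB; exact: SEE dE xr.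
  have [sP' sB'] := res_P B sP; have [jP [jq js]] := amalgam qP sP' sB' (res_LE rP' rB' Bd sq).
  set s' := res s B in sP' sB' jP jq js; pose j := join s' q.
  have jr : LE j r by exact: (LE_trans js (res_LE rP rB Bd sr)).
  have [w [wo [vw hw]]] : ∃ w ∈ o, v0 ≼ w /\ h ≼ w.
    have [K1|[K1|K1]] := ord_total (ord_mem ord_o1 v0o) (ord_mem ord_o1 hO);
    [exists h; split=> //; split; [by left|by right]|exists h; split=> //; split; by right|exists v0; split=> //; split; [by right|by left]].
  (* [v] lies above [v0], which keeps the promises, above [h], and in the fiber of [c] over [h]. *)
  have [v [vo [wv cv]]] := Hcu h hO w wo; pose proof (ord_mem ord_o1 vo) as Ov.
  have v0v : v0 ⊆ v by apply/(ord_sub (ord_mem ord_o1 v0o) Ov); left; apply: ord_le_lt vw wv.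
  have [|||r' [rP2 [rj Hr]]] := extend (p0 := p) (p := j) (a := a) (d := d) (v := v) HK HL pP jP (LE_trans jq qp) _ aQ dO vo.
    move=> E'; rewrite /j => /sp_join [/in_supp_s /sB' //|/qs [|]] //; by rewrite pfstE => /below_irr.
    move=> [z [/tp_join [/in_supp_t zs|zq] Ez]]; first by apply: aB; move: (sB' _ zs); rewrite /idx Ez pfstE.
    have [zp|] := qt z zq; first by apply: N; exists z.
    by rewrite /idx Ez pfstE => /below_irr.
    by move=> E' /H [r1 [h1 [? [? ?]]]]; exists r1, h1; split=> //; split; [apply: (LE_trans jq)|apply: v0v].
  exists r'; split=> //; split; first exact: (LE_trans rj (LE_trans jq qp)).
  exists d; split=> //; split=> //; exists v, r; split=> //; split=> //; rewrite cv; split=> //; split; first exact: (LE_trans rj jr).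
  exact: (ord_le_lt Ov hw wv).
exists d; split=> //; split=> //; exists v; split; first by exists q.
have rP : r ∈ P by generalize (Es _ dE); rewrite !pair_prod; tauto.
by split=> //; split=> //; exact: (cE _ _ _ dE (gup FG Gq rP qr)).
Qed.
End Generic.

(* Functions from [o1] to [o1] code functions from reals to reals; a value [v] also codes the countable set [v]. *)
Definition Fn (M : structure) : M := funs (o1 M) (o1 M).
Definition Cap {M : structure} (g F : M) := ∃ b ∈ o1 M, ∀ d ∈ o1 M, ~ d ∈ b -> ap g d ∈ ap F d.
Definition Hit {M : structure} (c g F : M) :=
  ∀ b ∈ o1 M, ∃ d ∈ o1 M, ~ d ∈ b /\ ap c (ap F d) = ap g d /\ ap g d ∈ ap F d.
Definition cap_small {M : structure} (k : M) := forall A, A ⊆ Fn M -> ~ lec k A -> ∃ F ∈ Fn M, ∀ g ∈ A, Cap g F.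
Definition hit_small {M : structure} (c k : M) := forall A, A ⊆ Fn M -> ~ lec k A -> ∃ F ∈ Fn M, ∀ g ∈ A, Hit c g F.
Definition hit_family {M : structure} (c k : M) := exists A, A ⊆ Fn M /\ lec A k /\ ∀ g ∈ Fn M, ∃ F ∈ A, Hit c g F.

(** [c] reads the first coordinate in an enumeration of all pairs of countable ordinals; each fiber
    is uncountable and hence unbounded. *)
Lemma unbounded_fibers {M : structure} {HM : ZFCw M} :
  exists c, c ∈ Fn M /\ ∀ h ∈ o1 M, ∀ w ∈ o1 M, ∃ v ∈ o1 M, w ∈ v /\ ap c v = h.
Proof.
have o0 : empty M ∈ o1 M by apply: (inf_omega_sub inf_o1); exact: empty_omega.
have [||g [Hg gs]] := surj_of_lec (a := prod (o1 M) (o1 M)) (b := o1 M).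
  by exists (opair (empty M) (empty M)); apply/pair_prod.
  exact: (hessenberg inf_o1).
exists (lam (o1 M) (fun v => pfst (ap g v))); split.
  by apply: lam_fun; [df|move=> v vo; case: (prod_eta (ap_in Hg vo)) => _ []].
move=> h ho w wo; apply: NNPP => N; apply: o1_not_ctbl.
have sw : succ w ∈ o1 M by apply: inf_limit => //; exact: inf_o1.
apply: (lec_trans (b := succ w)); last exact: mem_o1.
apply: (lec_trans (b := img (succ w) (fun v => psnd (ap g v)))); last by apply: lec_img; df.
apply: lec_sub => x xo; rewrite imgE; last by df.
have [|v [vo Ev]] := gs (opair h x); first by apply/pair_prod.
exists v; rewrite Ev psndE; split=> //; pose proof (ord_mem ord_o1 vo) as Ov; pose proof (ord_mem ord_o1 wo) as Ow.
have [K|[->|K]] := ord_total Ov Ow; [by apply/succE; left|by apply/succE; right|].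
by case: N; exists v; split=> //; split=> //; rewrite ap_lam //; [rewrite Ev pfstE|df].
Qed.

(** * Dominating and escaping families in the extension *)

Section Facts.
Context {V : structure} {HM : ZFCw V}.
Variables K L : V.
Hypotheses (HK : ordinal K) (HL : ordinal L) (gch : GCH V).
Variable G : V -> Prop.
Notation P := (PK K L).
Notation po := (ord_of K L).
Hypothesis FG : generic_filter P po G.
Notation W := (gstr P G).
Notation i := (gincl P G).
Let FN := ord_forcing K L.
Let HW : ZFCw W := gstr_ZFCw FN FG.
Local Existing Instance HW.
Let Q := prod K L.
Notation o := (o1 V).
Let iE (x : V) (y : W) : y ∈ i x -> ∃ z ∈ x, y = i z := @i_elem V HM P po G FG x y.
Let iM x y : i x ∈ i y <-> x ∈ y := i_mem FG x y.
Let iP x y : opair (i x) (i y) = i (opair x y) := i_opair FN FG x y.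


Let io : o1 W = i o := W_o1 FG.
(** The support of a name has size at most ω1, so a coordinate is bounded on it below any regular
    cardinal above ω1. The bounds are chosen in the ground model. *)
Lemma row_bounds X (pr : V -> V) : regular_cardinal X -> o ∈ X -> DT (k := 1) (fun t : tup V 1 => pr (hd t)) ->
  (∀ a ∈ Q, pr a ∈ X) -> exists b, b ∈ funs (Sm K L) X /\ ∀ E ∈ Sm K L, ∀ a ∈ SE E, pr a ∈ ap b E.
Proof.
move=> rX oX D H; have DS k (E : tup V k -> V) : DT E -> DT (fun t => SE (E t)) by move=> HE; rewrite /SE; df.
have DSE : DT (k := 1) (fun t : tup V 1 => SE (hd t)) by apply: DS; df.
have [||b Hb] := choice_fam (a := Sm K L) (Y := fun E => sep X (fun b => ∀ a ∈ SE E, pr a ∈ b)); first by df.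
  move=> E ES; have [SQ Sl] := SE_small ES.
  have [|b [bX Hb]] := reg_bound rX Sl oX D; first by move=> a /SQ /H.
  by exists b; rewrite sepE; df.
have bE E : E ∈ Sm K L -> ap b E ∈ X /\ ∀ a ∈ SE E, pr a ∈ ap b E by move=> /Hb; rewrite sepE; df.
exists (lam (Sm K L) (ap b)); split; first by apply: lam_fun; [df|move=> E /bE []].
by move=> E ES; rewrite ap_lam //; [case: (bE E ES)|df].
Qed.
Lemma generic_family : exists T : W, (∀ a ∈ i Q, lam (o1 W) (fun d => ap T (opair a d)) ∈ Fn W) /\
  forall a d v, tval G a d v -> a ∈ Q -> d ∈ o -> ap (lam (o1 W) (fun d => ap T (opair (i a) d))) (i d) = i v.
Proof.
have [T [HT Tv]] := gen_fun HK HL FG; exists T; split.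
  move=> a aQ; rewrite /Fn; apply: lam_fun; first by df.
  by move=> d; rewrite io => dO; apply: (ap_in HT); apply/pair_prod.
move=> a d v H aQ dO; rewrite ap_lam; [exact: Tv|df|by rewrite io; apply/iM].
Qed.
Lemma small_mem (A : W) k : is_cardinal k -> ~ lec k A -> card A ∈ k /\ lec A (card A).
Proof. by move=> Hk N; split; [apply/(card_lt _ Hk)|exact: lec_card_r]. Qed.

Hypotheses (rL : regular_cardinal L) (oL : o ∈ L) (KL : K ⊆ L).
Let cL : is_cardinal (i L) := proj1 (proj1 (W_regular gch FG rL oL)).
Let QE a : a ∈ Q -> pfst a ∈ K /\ psnd a ∈ L. Proof. by move=> /prod_eta [_ []]. Qed.

(** The ranks of the given names are bounded in both coordinates, and the pair [(y1, y2)] of bounds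
    is an index above all their supports. *)
Lemma fact_cap : regular_cardinal K -> o ∈ K -> cap_small (i K).
Proof.
move=> rK oK A AF NA; pose proof (proj1 (proj1 (W_regular gch FG rK oK))) as cK.
have [AK lA] := small_mem cK NA; have [T [TF Tv]] := generic_family.
have [||b1 [Hb1 B1]] := row_bounds (pr := pfst) rK oK; [df|by move=> a /QE []|].
have [||b2 [Hb2 B2]] := row_bounds (pr := psnd) rL oL; [df|by move=> a /QE []|].
have AL : card A ∈ i L by move/iE: AK => [x [xK ->]]; apply/iM; apply: KL.
have {}AF : A ⊆ funs (i o) (i o) by move: AF; rewrite /Fn io.
have [y1 [y1K [y2 [y2L H]]]] := family gch FG rK rL oK oL AF lA AK AL Hb1 Hb2.
have aQ : opair y1 y2 ∈ Q by apply/pair_prod.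
exists (lam (o1 W) (fun d => ap T (opair (i (opair y1 y2)) d))); split; first by apply: TF; apply/iM.
move=> g gA; have [E [ES [cE [e1 e2]]]] := H g gA; have [SQ _] := SE_small ES.
have SB : SE E ⊆ below K L (opair y1 y2).
  move=> a aS; apply/belowE; rewrite pfstE psndE; split; first exact: SQ.
  by split; [apply: (ord_tr (ord_mem HK y1K) e1); apply: (B1 E ES)|apply: (ord_tr (ord_mem HL y2L) e2); apply: (B2 E ES)].
have [b [bo Hb]] := dominate HK HL FG aQ ES SB cE.
exists (i b); split; first by rewrite io; apply/iM.
move=> x xo Nd; have /iE [d [dO Ed]] : x ∈ i o by rewrite -io.
subst x; have [|v [h [Hv [-> hv]]]] := Hb d dO; first by move=> db; apply: Nd; apply/iM.
by rewrite (Tv _ _ v) //; apply/iM.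
Qed.

Lemma hit_escape c a B E (g T : W) : c ∈ funs o o -> (∀ h ∈ o, ∀ w ∈ o, ∃ v ∈ o, w ∈ v /\ ap c v = h) ->
  (forall a d v, tval G a d v -> a ∈ Q -> d ∈ o -> ap (lam (o1 W) (fun d => ap T (opair (i a) d))) (i d) = i v) ->
  a ∈ Q -> ~ a ∈ B -> down_closed K L B -> E ∈ Sm K L -> SE E ⊆ B -> caps E g ->
  Hit (i c) g (lam (o1 W) (fun d => ap T (opair (i a) d))).
Proof.
move=> Hc cu Tv aQ aB Bd ES SB cE b; rewrite {1}io => /iE [b0 [b0o ->]].
have [d [dO [db [v [Hv [vo [Eg cv]]]]]]] := escape HK HL FG aQ aB Bd ES SB cE Hc cu b0o.
exists (i d); split; first by rewrite io; apply/iM.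
split; first by move=> /iM.
rewrite (Tv a d v) // Eg; have [_ Ec] := i_funs FN FG Hc; rewrite Ec //; split=> //; by apply/iM.
Qed.

Lemma fact_hit c : c ∈ funs o o -> (∀ h ∈ o, ∀ w ∈ o, ∃ v ∈ o, w ∈ v /\ ap c v = h) -> empty V ∈ K ->
  hit_small (i c) (i L).
Proof.
move=> Hc cu K0 A AF NA; have [AL lA] := small_mem cL NA; have [T [TF Tv]] := generic_family.
have [||b [Hb B]] := row_bounds (pr := psnd) rL oL; [df|by move=> a /QE []|].
have {}AF : A ⊆ funs (i o) (i o) by move: AF; rewrite /Fn io.
have [y1 [y1L [y2 [y2L H]]]] := family gch FG rL rL oL oL AF lA AL AL Hb Hb.
(* An index in row 0 suffices for escaping: the set of all indices with second coordinate below [y1]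
   is closed downwards, contains the supports and omits this index. *)
have aQ : opair (empty V) y1 ∈ Q by apply/pair_prod.
exists (lam (o1 W) (fun d => ap T (opair (i (opair (empty V) y1)) d))); split; first by apply: TF; apply/iM.
move=> g gA; have [E [ES [cE [e1 _]]]] := H g gA; have [SQ _] := SE_small ES; pose proof (ord_mem HL y1L) as Oy.
have BE x : x ∈ sep Q (fun x => psnd x ∈ y1) <-> x ∈ Q /\ psnd x ∈ y1 by rewrite sepE; df.
apply: (hit_escape (B := sep Q (fun x => psnd x ∈ y1)) Hc cu Tv aQ _ _ ES _ cE).
- by move=> /BE [_]; rewrite psndE => /mem_irr.
- by move=> x /BE [xQ xy] z /belowE [zQ [_ zx]]; apply/BE; split=> //; apply: (ord_tr Oy xy zx).
- by move=> x xS; apply/BE; split; [exact: SQ|apply: (ord_tr Oy e1); apply: (B E ES)].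
Qed.
Lemma fact_rows c : c ∈ funs o o -> (∀ h ∈ o, ∀ w ∈ o, ∃ v ∈ o, w ∈ v /\ ap c v = h) ->
  regular_cardinal K -> o ∈ K -> hit_family (i c) (i K).
Proof.
move=> Hc cu rK oK; have [T [TF Tv]] := generic_family.
have L0 : empty V ∈ L by apply: (inf_omega_sub (proj1 rL)); exact: empty_omega.
pose Fr (j : W) := lam (o1 W) (fun d => ap T (opair (opair j (i (empty V))) d)).
have DF : DT (k := 1) (fun t : tup W 1 => Fr (hd t)) by rewrite /Fr; df.
exists (img (i K) Fr); split.
  move=> x; rewrite imgE // => -[y [/iE [j [jK ->]] ->]]; rewrite /Fr iP; apply: TF; apply/iM; exact/pair_prod.
split; first exact: lec_img.
move=> g; rewrite /Fn io => Hg; have [E [ES cE]] := capture gch FG Hg.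
have [||b [Hb B]] := row_bounds (pr := pfst) rK oK; [df|by move=> a /QE []|].
pose proof (ap_in Hb ES) as jK; set j := ap b E in jK; have [SQ _] := SE_small ES.
(* Here only the first coordinate is bounded: the rows before [j] are closed downwards and contain
   the support of the name of [g], so one function from each row is enough. *)
have aQ : opair j (empty V) ∈ Q by apply/pair_prod.
exists (Fr (i j)); split; first by rewrite imgE //; exists (i j); split=> //; apply/iM.
have BE x : x ∈ sep Q (fun x => pfst x ∈ j) <-> x ∈ Q /\ pfst x ∈ j by rewrite sepE; df.
rewrite /Fr iP; apply: (hit_escape (B := sep Q (fun x => pfst x ∈ j)) Hc cu Tv aQ _ _ ES _ cE).
- by move=> /BE [_]; rewrite pfstE => /mem_irr.
- by move=> x /BE [xQ xy] z /belowE [zQ [zx _]]; apply/BE; split=> //; apply: (ord_tr (ord_mem HK jK) xy zx).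
- by move=> x xS; apply/BE; split; [exact: SQ|apply: (B E ES)].
Qed.
(** With a single row no index lies below another, so the support itself is closed downwards. It has
    size at most ω1 and therefore omits one of the first ℵ2 columns. *)
Lemma fact_o2 c : c ∈ funs o o -> (∀ h ∈ o, ∀ w ∈ o, ∃ v ∈ o, w ∈ v /\ ap c v = h) ->
  K = sing (empty V) -> succ_card o ⊆ L -> hit_family (i c) (i (succ_card o)).
Proof.
move=> Hc cu K1 o2L; have [T [TF Tv]] := generic_family.
have K0 : empty V ∈ K by rewrite K1; apply/singE.
pose Fr (l : W) := lam (o1 W) (fun d => ap T (opair (opair (i (empty V)) l) d)).
have DF : DT (k := 1) (fun t : tup W 1 => Fr (hd t)) by rewrite /Fr; df.
exists (img (i (succ_card o)) Fr); split.
  move=> x; rewrite imgE // => -[y [/iE [l [/o2L lL ->]] ->]]; rewrite /Fr iP; apply: TF; apply/iM; exact/pair_prod.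
split; first exact: lec_img.
move=> g; rewrite /Fn io => Hg; have [E [ES cE]] := capture gch FG Hg; have [SQ Sl] := SE_small ES.
have [l [lo Nl]] : exists l, l ∈ succ_card o /\ ~ l ∈ img (SE E) psnd.
  apply: NNPP => N; apply: (proj1 (lec_succ_card (img (SE E) psnd) card_o1)).
    by apply: (lec_trans (lec_img _ _) Sl); df.
  by apply: lec_sub => l lo; apply: NNPP => Nl; apply: N; exists l.
have aQ : opair (empty V) l ∈ Q by apply/pair_prod; split=> //; exact: o2L.
exists (Fr (i l)); split; first by rewrite imgE //; exists (i l); split=> //; apply/iM.
rewrite /Fr iP; apply: (hit_escape (B := SE E) Hc cu Tv aQ _ _ ES _ cE) => //.
- by move=> aS; apply: Nl; rewrite imgE; [exists (opair (empty V) l); rewrite psndE|df].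
- move=> x xS z /belowE [zQ [zx _]]; have [xK _] := QE (SQ x xS).
  by move: xK zx; rewrite K1 => /singE -> /emptyE.
Qed.
End Facts.

(** Collects what the rest needs from forcing: from here on neither conditions nor names occur. *)
Theorem extension_facts (V : structure) (K L : V) : countable_transitive_model V -> GCH V ->
  ordinal K -> regular_cardinal L -> o1 V ∈ L -> K ⊆ L -> empty V ∈ K ->
  exists W : forcing_extension V, (ZFCw W /\ CH W) /\ (succ_card (o1 W) = incl W (succ_card (o1 V)) /\ lec (Fn W) (incl W L)) /\
   ((forall k, regular_cardinal k -> o1 V ∈ k -> is_cardinal (incl W k)) /\ forall x y, x ∈ y -> incl W x ∈ incl W y) /\
   exists c, c ∈ Fn W /\ hit_small c (incl W L) /\
    (regular_cardinal K -> o1 V ∈ K -> cap_small (incl W K) /\ hit_family c (incl W K)) /\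
    (K = sing (empty V) -> succ_card (o1 V) ⊆ L -> hit_family c (incl W (succ_card (o1 V)))).
Proof.
move=> C gch HK rL oL KL K0; pose proof (ctm_ZFCw C) as HM; pose proof (inf_ord (proj1 rL)) as HL.
pose proof (ord_forcing K L) as FN; have [G [FG _]] := generic_exists C FN (empty_cond K L).
exists (mk_extension FN FG); rewrite /=; pose proof (gstr_ZFCw FN FG) as HW; pose proof (W_o1 FG) as io.
have [c [Hc cu]] := unbounded_fibers (M := V); have [Hi _] := i_funs FN FG Hc.
split; first by split=> //; apply: (W_CH gch FG).
split; first by split; [apply: (W_succ_o1 gch FG)|rewrite /Fn io; apply: (W_funs_card HK HL gch FG rL oL KL)].
split; first by split=> [k rk ok|x y xy]; [case: (W_regular gch FG rk ok) => -[]|apply/(i_mem FG)].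
exists (gincl (PK K L) G c); split; first by rewrite /Fn io.
split; first exact: (fact_hit HK HL gch FG rL oL Hc cu K0).
split=> [rK oK|E o2L]; last exact: (fact_o2 HK HL gch FG Hc cu E o2L).
by split; [exact: (fact_cap HK HL gch FG rL oL KL rK oK)|exact: (fact_rows HK HL gch FG rL Hc cu rK oK)].
Qed.

(** * From functions on [o1] to functions on the reals *)

(* [y] is a Luzin sequence for [I]. *)
Definition luzin_ideal {M : structure} (I : ideal_name) : Prop :=
  (forall A : M, A ⊆ baire M -> ctbl A -> in_ideal I A) /\
  exists y, inj y (o1 M) (baire M) /\ forall A : M, in_ideal I A -> ∃ b ∈ o1 M, ∀ d ∈ o1 M, ~ d ∈ b -> ~ ap y d ∈ A.
Definition Rr {M : structure} (r : rel_name) (a b : M) : Prop :=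
  match r with leStar => a ≼ b | neqStar => a <> b | inStar => a ∈ b end.
(** A definable substitute for [rel]: it uses [ap], and cofiniteness is expressed by a bound in
    ω. *)
Definition RL {M : structure} (r : rel_name) (u v : M) : Prop :=
  ∃ m ∈ omega M, ∀ n ∈ omega M, ~ n ∈ m -> Rr r (ap u n) (ap v n).

Section Reals.
Context {M : structure} {HM : ZFCw M}.
Implicit Types (f g u v s x y A F : M).
Notation o := (o1 M).

Lemma Df_Rr k r (a b : tup M k -> M) : DT a -> DT b -> Df (fun t => Rr r (a t) (b t)).
Proof. by move=> Ha Hb; case: r; rewrite /Rr /ord_le; df. Qed.
Hint Resolve Df_Rr : df.
Lemma Df_RL k r (a b : tup M k -> M) : DT a -> DT b -> Df (fun t => RL r (a t) (b t)).
Proof. by move=> Ha Hb; rewrite /RL; df. Qed.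
Hint Resolve Df_RL : df.
Lemma nlt_nat m n : ~ nat_in M n ∈ nat_in M m <-> m <= n.
Proof. rewrite nat_lt; lia. Qed.
Lemma relE r u v X : u ∈ baire M -> v ∈ funs (omega M) X -> (rel r u v <-> RL r u v).
Proof.
move=> Hu Hv.
have E : rel r u v <-> finite (sep (omega M) (fun n => ~ Rr r (ap u n) (ap v n))).
  have S (Q : M -> Prop) : (∀ n ∈ omega M, Q n <-> Rr r (ap u n) (ap v n)) ->
    setof (fun n => n ∈ omega M /\ ~ Q n) = sep (omega M) (fun n => ~ Rr r (ap u n) (ap v n)).
    by move=> H; congr setof; apply: pred_ext => n; split=> -[no N]; split=> // K; apply: N; apply/H.
  case: r S => S; rewrite /rel /almost_all S //; move=> n no; by rewrite (app_ap Hu no) (app_ap Hv no).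
rewrite E finiteP; split=> [H|[m [/omegaE [k ->] H]]].
  have [|m Hm] := fin_bounded _ H; first by move=> n; rewrite sepE; [case|df].
  exists (nat_in M m); split; first exact: nat_omega.
  move=> n /omegaE [j ->] /nlt_nat mj; apply: NNPP => N; suff: j < m by lia.
  by apply: Hm; rewrite sepE; [split=> //; exact: nat_omega|df].
apply: (fin_sub (b := nat_in M k)); last exact: fin_nat.
move=> n; rewrite sepE; last by df.
by move=> [no N]; apply: NNPP => K; apply: N; apply: H.
Qed.

Definition finsub : M := setof (fun a => a ⊆ omega M /\ finite a).
Lemma finsubE a : a ∈ finsub <-> a ⊆ omega M /\ finite a.
Proof.
apply: (setof_sub (a := powerset (omega M)) (P := fun a => a ⊆ omega M /\ finite a)); first by rewrite /finite; df.
by move=> x [H _]; apply/powersetE.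
Qed.
Lemma slalomsE s : s ∈ slaloms M <-> s ∈ funs (omega M) finsub /\ ∀ n ∈ omega M, lec (ap s n) n.
Proof.
have L a n : n ∈ omega M -> (card a ≼ n <-> lec a n).
  move=> /omegaE [k ->]; pose proof (ord_nat (M := M) k) as Ok; split=> H.
    by apply: (lec_trans (lec_card_r a)); apply: ord_le_lec => //; exact: card_ord.
  by apply: (ord_le_tr Ok _ (card_ord_le Ok)); apply/card_lec.
have E : forall x, x ∈ slaloms M <-> x ∈ funs (omega M) finsub /\ ∀ n ∈ omega M, card (app x n) ≼ n.
  apply: setofE; exists (sep (funs (omega M) finsub) (fun s => ∀ n ∈ omega M, lec (ap s n) n)) => x.
  rewrite sepE; last by df.
  by split=> -[Hx H]; split=> // n no; move: (H n no); rewrite (app_ap Hx no) L.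
rewrite E; split=> -[Hx H]; split=> // n no; move: (H n no); by rewrite (app_ap Hx no) L.
Qed.
Lemma baire_E x n : x ∈ baire M -> n ∈ omega M -> ap x n ∈ omega M.
Proof. by move=> H; apply: (ap_in H). Qed.
Lemma codomain_fun r v : v ∈ codomain M r -> exists X, v ∈ funs (omega M) X.
Proof. by case: r => [H|H|/slalomsE [H _]]; [exists (omega M)|exists (omega M)|exists finsub]. Qed.

Lemma slalom_bound B : B ⊆ baire M -> ctbl B -> ∃ s ∈ slaloms M, ∀ x ∈ B, RL inStar x s.
Proof.
move=> BB cB; case: (classic (ne B)) => [NB|NB]; last first.
  exists (lam (omega M) (fun _ => empty M)); split; last by move=> x xB; case: NB; exists x.
  apply/slalomsE; split; last first.
    by move=> n no; rewrite ap_lam //; [apply: lec_sub => z /emptyE|df].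
  apply: lam_fun => [|n _]; first by df.
  by apply/finsubE; split; [move=> z /emptyE|apply/finiteP; exists nil => z /emptyE].
have [u [Hu us]] := surj_of_lec NB cB.
(* Only the first [n] reals of the list are caught at [n], which respects the size bound of a
   slalom; the real with number [k] is caught from [k + 1] on. *)
pose s := lam (omega M) (fun n => img n (fun k => ap (ap u k) n)).
have sE n : n ∈ omega M -> ap s n = img n (fun k => ap (ap u k) n) by move=> no; rewrite ap_lam //; df.
have ino n k : n ∈ omega M -> k ∈ n -> k ∈ omega M by move=> no kn; apply: (ord_tr ord_omega no kn).
have lecn n : lec (img n (fun k => ap (ap u k) n)) n by apply: lec_img; df.
exists s; split.
  apply/slalomsE; split; last by move=> n no; rewrite sE.
  apply: lam_fun => [|n no]; first by df.
  apply/finsubE; split.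
    move=> y; rewrite imgE; last by df.
    by move=> [k [kn ->]]; apply: baire_E => //; apply: BB; apply: (ap_in Hu); apply: (ino n).
  by apply/finiteP; apply: (fin_lec (lecn n)); generalize (no); move=> /omegaE [m ->]; exact: fin_nat.
move=> x /us [k [ko Ek]]; exists (succ k); split; first exact: succ_omega.
move=> n no N; rewrite /= sE // imgE; last by df.
exists k; split; last by rewrite Ek.
pose proof (ord_mem ord_omega ko) as Ok; pose proof (ord_mem ord_omega no) as On.
have [H|[H|//]] := ord_total On Ok; case: N; apply/succE; [by left|by right].
Qed.
Lemma real_bound B : B ⊆ baire M -> ctbl B ->
  ∃ y ∈ baire M, ∀ x ∈ B, ∃ m ∈ omega M, ∀ n ∈ omega M, ~ n ∈ m -> ap x n ∈ ap y n.
Proof.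
move=> BB cB; have [s [/slalomsE [Hs _] sB]] := slalom_bound BB cB.
have [||c Hc] := choice_fam (a := omega M) (Y := fun n => sep (omega M) (fun m => ap s n ⊆ m)); first by df.
  move=> n no; generalize (ap_in Hs no); move=> /finsubE [sw /finiteP sf]; have [m Hm] := fin_bounded sw sf.
  exists (nat_in M m); rewrite sepE; last by df.
  by split=> [|k ks]; [exact: nat_omega|generalize (sw k ks); move=> /omegaE [j Ej]; subst k; apply/nat_lt; apply: Hm].
have cE n : n ∈ omega M -> ap c n ∈ omega M /\ ap s n ⊆ ap c n by move=> /Hc; rewrite sepE; df.
exists (lam (omega M) (ap c)); split; first by apply: lam_fun; [df|move=> n /cE []].
move=> x /sB [m [mo H]]; exists m; split=> // n no N; rewrite ap_lam //; last by df.
by apply: (proj2 (cE n no)); apply: (H n no N).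
Qed.
Lemma strict_RL r u v : r <> inStar -> u ∈ baire M ->
  (∃ m ∈ omega M, ∀ n ∈ omega M, ~ n ∈ m -> ap u n ∈ ap v n) -> RL r u v.
Proof.
move=> Hr Hu [m [mo H]]; exists m; split=> // n no N; pose proof (H n no N) as K.
by case: r Hr => //= _; [left|move=> E; apply: (mem_irr (x := ap v n)); rewrite -{1}E].
Qed.
Lemma bounds r v0 : (v0 ⊆ baire M) -> ctbl v0 -> ∃ y ∈ codomain M r, ∀ x ∈ v0, RL r x y.
Proof.
move=> vB cv; case: (classic (r = inStar)) => [->|N]; first exact: slalom_bound.
have [y [yB H]] := real_bound vB cv; exists y; split; first by case: r N.
by move=> x xv; apply: strict_RL => //; [exact: vB|exact: H].
Qed.
Lemma fail_ex r v : v ∈ codomain M r -> ∃ u ∈ baire M, ~ RL r u v.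
Proof.
have nz (m : M) : m ∈ omega M -> ~ m ∈ m by move=> _; exact: mem_irr.
case: r => /= Hv.
- exists (lam (omega M) (fun n => succ (ap v n))); split.
    by apply: lam_fun; [df|move=> n no; apply: succ_omega; apply: (ap_in Hv)].
  move=> [m [mo /(_ m mo (nz m mo))]] /=; rewrite ap_lam //; last by df.
  have vm : ap v m ∈ succ (ap v m) by apply/succE; right.
  by move=> [/(mem_asym vm)|E] //; move: vm; rewrite E => /mem_irr.
- by exists v; split=> // -[m [mo /(_ m mo (nz m mo))]].
- generalize (Hv); move=> /slalomsE [Hs _].
  have [||c Hc] := choice_fam (a := omega M) (Y := fun n => sep (omega M) (fun m => ~ m ∈ ap v n)); first by df.
    move=> n no; generalize (ap_in Hs no); move=> /finsubE [sw /finiteP sf]; have [m Hm] := fin_bounded sw sf.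
    exists (nat_in M m); rewrite sepE; last by df.
    by split; [exact: nat_omega|move=> /Hm; lia].
  have cE n : n ∈ omega M -> ap c n ∈ omega M /\ ~ ap c n ∈ ap v n by move=> /Hc; rewrite sepE; df.
  exists (lam (omega M) (ap c)); split; first by apply: lam_fun; [df|move=> n /cE []].
  move=> [m [mo /(_ m mo (nz m mo))]] /=; rewrite ap_lam //; [by case: (cE m mo)|df].
Qed.

Hypothesis ch : CH M.
Lemma baire_o1 : exists f g, f ∈ funs (baire M) o /\ g ∈ funs o (baire M) /\
  (∀ x ∈ baire M, ap g (ap f x) = x) /\ (∀ h ∈ o, ap f (ap g h) = h).
Proof.
have B1 : lec (baire M) o.
  apply: (lec_trans (lec_funs_pow _ _)); apply: lec_trans ch; apply: lec_powerset; exact: (hessenberg inf_omega).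
have B2 : lec o (baire M).
  apply: (lec_trans o1_lec_pow); apply: (lec_trans (lec_pow_funs _)); apply: lec_funs_r.
  by apply: lec_sub => z /nat_mem [n [_ ->]]; exact: nat_omega.
generalize (csb B1 B2); move=> /eqpE [f [If Sf]]; have [g [Hg gf]] := inj_inv If.
have Ei : img (baire M) (ap f) = o.
  apply: ext => y; rewrite imgE; last by df.
  by split=> [[x [xB ->]]|/Sf [x [xB <-]]]; [exact: (ap_in (proj1 If))|exists x].
exists f, g; rewrite Ei in Hg; split; first by case: If.
by split=> //; split=> // h /Sf [x [xB <-]]; rewrite gf.
Qed.

Variable I : ideal_name.
Hypothesis LI : luzin_ideal (M := M) I.
Lemma rel_modE r f g : f ∈ funs (baire M) (baire M) -> g ∈ funs (baire M) (codomain M r) ->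
  (rel_mod I r f g <-> in_ideal I (sep (baire M) (fun x => ~ RL r (ap f x) (ap g x)))).
Proof.
move=> Hf Hg; rewrite /rel_mod; suff -> : setof (fun x => x ∈ baire M /\ ~ rel r (app f x) (app g x)) =
  sep (baire M) (fun x => ~ RL r (ap f x) (ap g x)) by [].
congr setof; apply: pred_ext => x.
have E : x ∈ baire M -> (rel r (app f x) (app g x) <-> RL r (ap f x) (ap g x)).
  move=> xB; rewrite (app_ap Hf xB) (app_ap Hg xB); have [X HX] := codomain_fun (ap_in Hg xB).
  by apply: (relE r _ HX); apply: (ap_in Hf).
by split=> -[xB N]; split=> // K; apply: N; apply/E.
Qed.

Lemma unbounded_ge r k A : is_cardinal k -> cap_small k -> unbounded r I A -> k ≼ card A.
Proof.
move=> Hk cs [AF UA]; apply: NNPP => N0; have N : ~ lec k A by move/(card_ge _ Hk).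
apply: UA; have [cd [e [Hcd [He [ecd cde]]]]] := baire_o1.
pose hat f := lam o (fun d => ap cd (ap f (ap e d))).
have Dh : DT (k := 1) (fun t : tup M 1 => hat (hd t)) by rewrite /hat; df.
have [||F [FF HF]] := cs (img A hat).
    move=> g; rewrite imgE // => -[f [/AF fA ->]].
    by apply: lam_fun; [df|move=> d dO; apply: (ap_in Hcd); apply: (ap_in fA); apply: (ap_in He)].
  by move=> H; apply: N; apply: (lec_trans H); apply: lec_img.
(* An ordinal [v] is read as the countable set of reals coded below [v]; [ap B v] bounds or catches
   all of them. *)
have [||B HB] := choice_fam (a := o) (Y := fun v => sep (codomain M r) (fun y => ∀ x ∈ img v (ap e), RL r x y)); first by df.
  move=> v vo; have [||y [yc Hy]] := bounds r (v0 := img v (ap e)).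
      move=> x; rewrite imgE; last by df.
      by move=> [h [hv ->]]; apply: (ap_in He); apply: (ord_tr ord_o1 vo hv).
    by apply: ctbl_img; [df|exact: mem_o1].
  by exists y; rewrite sepE; df.
have BE v : v ∈ o -> ap B v ∈ codomain M r /\ ∀ h ∈ v, RL r (ap e h) (ap B v).
  move=> /HB; rewrite sepE; last by df.
  by move=> [? H]; split=> // h hv; apply: H; rewrite imgE; [exists h|df].
have FE x : x ∈ baire M -> ap F (ap cd x) ∈ o by move=> xB; apply: (ap_in FF); apply: (ap_in Hcd).
have gF : lam (baire M) (fun x => ap B (ap F (ap cd x))) ∈ funs (baire M) (codomain M r).
  by apply: lam_fun; [df|move=> x xB; case: (BE _ (FE x xB))].
exists (lam (baire M) (fun x => ap B (ap F (ap cd x)))); split=> // f fA; pose proof (AF f fA) as Hf.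
apply/rel_modE => //.
have [b [bo Hb]] : Cap (hat f) F by apply: HF; rewrite imgE //; exists f.
apply: (proj1 LI); first by move=> x; rewrite sepE; [case|df].
apply: (lec_trans (b := b)); last exact: mem_o1.
have sub x : x ∈ sep (baire M) (fun x => ~ RL r (ap f x) (ap (lam (baire M) (fun x => ap B (ap F (ap cd x)))) x)) -> x ∈ baire M /\ ap cd x ∈ b.
  rewrite sepE; last by df.
  move=> [xB NR]; split=> //; apply: NNPP => Nb; apply: NR; rewrite ap_lam //; last by df.
  pose proof (ap_in Hcd xB) as dO; generalize (Hb _ dO Nb); rewrite /hat ap_lam //; last by df.
  rewrite ecd // => K; have fB : ap f x ∈ baire M by apply: (ap_in (a := baire M) (b := baire M)).
  generalize (proj2 (BE _ (FE x xB)) _ K); by rewrite ecd.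
apply: (lec_lam (F := ap cd)); first by df.
  by move=> x /sub [].
by move=> x /sub [xB _] x' /sub [xB' _] E; rewrite -(ecd x) // -(ecd x') // E.
Qed.
End Reals.

(** * Values of the cardinal characteristics from facts about ω1 *)

Section Sizes.
Context {M : structure} {HM : ZFCw M}.
Implicit Types (f g u v s x y A F : M).
Notation o := (o1 M).
Notation RF := (funs (baire M) (baire M)).
Hint Resolve Df_Rr Df_RL : df.

Lemma least_size_eq (Q : M -> Prop) A k : is_cardinal k -> Q A -> lec A k -> (forall A, Q A -> k ≼ card A) -> least_size Q = k.
Proof.
move=> Hk QA Ak H.
have cA : card A = k by apply: ord_le_anti; [apply/card_le|exact: H].
have [[A' [QA' <-]] H'] : (exists A, Q A /\ card A = least_size Q) /\ forall A, Q A -> least_size Q ≼ card A.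
  by apply: (epsilon_spec (nonempty M) (fun k => (exists A, Q A /\ card A = k) /\ forall A, Q A -> k ≼ card A)); exists k; split=> //; exists A.
by apply: ord_le_anti; [rewrite -cA; exact: H'|exact: H].
Qed.

Hypothesis ch : CH M.
Lemma continuum_o1 : continuum M = o.
Proof.
apply: card_unique; first exact: card_o1.
by apply: csb => //; exact: o1_lec_pow.
Qed.
Lemma lec_baire_o1 : lec (baire M) o /\ lec o (baire M).
Proof.
have [f [g [Hf [Hg [gf fg]]]]] := baire_o1 ch; split.
  by exists f; split=> // x xB x' xB' E; rewrite -(gf x) // -(gf x') // E.
by exists g; split=> // x xB x' xB' E; rewrite -(fg x) // -(fg x') // E.
Qed.
Lemma lec_RF : lec RF (Fn M) /\ lec (powerset o) (Fn M) /\ lec (Fn M) (powerset o).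
Proof.
have [B1 B2] := lec_baire_o1.
have o0 : ne o by exists (empty M); apply: (inf_omega_sub inf_o1); exact: empty_omega.
split; last split.
- by apply: (lec_trans (lec_funs_r _ B1)); apply: lec_funs_l.
- apply: (lec_trans (lec_pow_funs _)); apply: lec_funs_r; apply: lec_sub => z /nat_mem [n [_ ->]].
  by apply: (inf_omega_sub inf_o1); exact: nat_omega.
- by apply: (lec_trans (lec_funs_pow _ _)); apply: lec_powerset; apply: (hessenberg inf_o1).
Qed.

(** A diagonal argument: at [d] only the countably many functions listed before [d] have to be
    bounded. *)
Lemma cap_o2 : cap_small (succ_card o).
Proof.
move=> A AF /(lec_succ_card _ card_o1) Ao; case: (classic (ne A)) => [NA|NA]; last first.
  exists (lam o (fun d => d)); split; first by apply: lam_fun; [df|].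
  by move=> g gA; case: NA; exists g.
have [u [Hu us]] := surj_of_lec NA Ao.
pose S (d : M) : M := img d (fun x => ap (ap u x) d).
have SE d z : z ∈ S d <-> ∃ x ∈ d, z = ap (ap u x) d by rewrite /S imgE //; df.
have DS : DT (k := 1) (fun t : tup M 1 => S (hd t)) by rewrite /S; df.
have [||c Hc] := choice_fam (a := o) (Y := fun d => sep o (fun b => S d ⊆ b)); first by df.
  move=> d dO; have [||b [bo Hb]] := ctbl_bound_sub (A := S d).
      by apply: ctbl_img; [df|exact: mem_o1].
    move=> z /SE [x [xd ->]]; apply: (ap_in (a := o) (b := o)) => //; apply: AF; apply: (ap_in Hu).
    exact: (ord_tr ord_o1 dO xd).
  by exists b; rewrite sepE; df.
exists (lam o (ap c)); split; first by apply: lam_fun; [df|move=> d /Hc; rewrite sepE; [case|df]].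
move=> g /us [x [xo <-]]; exists (succ x); split; first exact: (inf_limit inf_o1).
move=> d dO N; rewrite ap_lam //; last by df.
generalize (Hc d dO); rewrite sepE; last by df.
move=> [_]; apply; apply/SE; exists x; split=> //.
pose proof (ord_mem ord_o1 xo) as Ox; pose proof (ord_mem ord_o1 dO) as Od.
by have [H|[H|//]] := ord_total Od Ox; case: N; apply/succE; [left|right].
Qed.

Variable I : ideal_name.
Hypothesis LI : luzin_ideal (M := M) I.
Lemma full_unbounded r : unbounded r I RF.
Proof.
split; first by move=> x.
move=> [g [Hg H]].
have [||c Hc] := choice_fam (a := baire M) (Y := fun x => sep (baire M) (fun u => ~ RL r u (ap g x))); first by df.
  by move=> x xB; have [u [uB N]] := fail_ex (ap_in Hg xB); exists u; rewrite sepE; df.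
have cE x : x ∈ baire M -> ap c x ∈ baire M /\ ~ RL r (ap c x) (ap g x) by move=> /Hc; rewrite sepE; df.
have Hf : lam (baire M) (ap c) ∈ RF by apply: lam_fun; [df|move=> x /cE []].
generalize (H _ Hf); move/(rel_modE I Hf Hg) => J; have [_ [y [Hy K]]] := LI; have [b [bo Hb]] := K _ J.
apply: (Hb b bo (@mem_irr _ _ b)); pose proof (ap_in (proj1 Hy) bo) as yB.
rewrite sepE; last by df.
by rewrite ap_lam //; [split=> //; case: (cE _ yB)|df].
Qed.
Lemma full_dominating r : dominating r I (funs (baire M) (codomain M r)).
Proof.
split; first by move=> x.
move=> g Hg.
have [||c Hc] := choice_fam (a := baire M) (Y := fun x => sep (codomain M r) (fun v => RL r (ap g x) v)); first by df.
  move=> x xB; have [||v [vc Hv]] := bounds r (v0 := sing (ap g x)).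
      by move=> z /singE ->; apply: (ap_in Hg).
    by apply: fin_inf_lec; [exact: inf_omega|exact: fin_upair].
  by exists v; rewrite sepE; [split=> //; apply: Hv; apply/singE|df].
have cE x : x ∈ baire M -> ap c x ∈ codomain M r /\ RL r (ap g x) (ap c x) by move=> /Hc; rewrite sepE; df.
have Hf : lam (baire M) (ap c) ∈ funs (baire M) (codomain M r) by apply: lam_fun; [df|move=> x /cE []].
exists (lam (baire M) (ap c)); split=> //; apply/rel_modE => //.
have E x : ~ x ∈ sep (baire M) (fun x => ~ RL r (ap g x) (ap (lam (baire M) (ap c)) x)).
  rewrite sepE; last by df.
  by move=> [xB]; apply; rewrite ap_lam //; [case: (cE x xB)|df].
apply: (proj1 LI) => [x /E //|]; by apply: lec_sub => x /E.
Qed.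

(** [unc F] matters only on the Luzin sequence: at [y_d] it takes a real that fails against the real
    coded by [c(F(d))]. A hit means that this coded real is the value of [g] at [y_d], so failures
    occur at unboundedly many [d] and their set is not in the ideal. *)
Lemma hit_fail c r : c ∈ Fn M -> r <> inStar -> exists unc code : M -> M,
  (DT (k := 1) (fun t : tup M 1 => unc (hd t)) /\ DT (k := 1) (fun t : tup M 1 => code (hd t))) /\
  (∀ F ∈ Fn M, unc F ∈ RF) /\ (∀ g ∈ RF, code g ∈ Fn M) /\
  ∀ F ∈ Fn M, ∀ g ∈ RF, Hit c (code g) F -> ~ rel_mod I r (unc F) g.
Proof.
move=> Hc Nr; have [cd [e [Hcd [He [ecd cde]]]]] := baire_o1 ch.
have [_ [y [Hy LY]]] := LI; have [yi [Hyi yiy]] := inj_inv Hy.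
have cr : codomain M r = baire M by case: r Nr.
have [||Z HZ] := choice_fam (a := o) (Y := fun v => sep (baire M) (fun u => ~ RL r u (ap e (ap c v)))); first by df.
  move=> v vo; have [|u [uB N]] := fail_ex (r := r) (v := ap e (ap c v)); last by exists u; rewrite sepE; df.
  by rewrite cr; apply: (ap_in He); apply: (ap_in Hc).
have ZE v : v ∈ o -> ap Z v ∈ baire M /\ ~ RL r (ap Z v) (ap e (ap c v)) by move=> /HZ; rewrite sepE; df.
have [a0 a0B] : ne (baire M) by case: (ZE (empty M)) => [|H _]; [apply: (inf_omega_sub inf_o1); exact: empty_omega|exists (ap Z (empty M))].
(* Off the Luzin sequence any fixed real serves as value. *)
pose U (F x : M) : M := ite (x ∈ img o (ap y)) (ap Z (ap F (ap yi x))) a0.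
have DU F : DT (k := 1) (fun t : tup M 1 => U F (hd t)) by rewrite /U; df.
exists (fun F => lam (baire M) (U F)), (fun g => lam o (fun d => ap cd (ap g (ap y d)))).
split; first by split; rewrite /U; df.
have HU F : F ∈ Fn M -> lam (baire M) (U F) ∈ RF.
  move=> HF; apply: lam_fun => // x xB; rewrite /U; case: (classic (x ∈ img o (ap y))) => Hx; last by rewrite iteF.
  by rewrite iteT //; case: (ZE (ap F (ap yi x))) => //; apply: (ap_in HF); apply: (ap_in Hyi).
split=> //; split.
  by move=> g Hg; apply: lam_fun; [df|move=> d dO; apply: (ap_in Hcd); apply: (ap_in Hg); apply: (ap_in (proj1 Hy))].
move=> F HF g Hg H; rewrite -{2}cr in Hg; move/(rel_modE I (HU F HF) Hg) => J; rewrite cr in Hg.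
have [b [bo Hb]] := LY _ J; have [d [dO [Nd [E _]]]] := H b bo; apply: (Hb d dO Nd).
pose proof (ap_in (proj1 Hy) dO) as yB; rewrite sepE; last by df.
split=> //; rewrite ap_lam //; rewrite /U iteT; last by rewrite imgE; [exists d|df].
rewrite yiy //; have [_] := ZE _ (ap_in HF dO); rewrite E ap_lam //; last by df.
by rewrite ecd //; apply: (ap_in Hg).
Qed.

Lemma hit_unbounded c r k : c ∈ Fn M -> r <> inStar -> hit_family c k -> exists A, unbounded r I A /\ lec A k.
Proof.
move=> Hc Nr [A [AF [Ak HA]]]; have [unc [code [[Du Dc] [Hu [Hd H]]]]] := hit_fail Hc Nr.
exists (img A unc); split; last by apply: (lec_trans (lec_img A Du)).
split; first by move=> f; rewrite imgE // => -[F [FA ->]]; apply: Hu; exact: AF.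
have -> : codomain M r = baire M by case: r Nr {H}.
move=> [g [Hg K]]; have [F [FA HF]] := HA _ (Hd g Hg).
by apply: (H F (AF F FA) g Hg HF); apply: K; rewrite imgE //; exists F.
Qed.
Lemma hit_dominating c r k A : c ∈ Fn M -> r <> inStar -> hit_small c k -> is_cardinal k -> dominating r I A -> k ≼ card A.
Proof.
move=> Hc Nr hs Hk [AF DA]; apply/card_ge => //; apply: NNPP => N; have [unc [code [[Du Dc] [Hu [Hd H]]]]] := hit_fail Hc Nr.
have cr : codomain M r = baire M by case: r Nr {H AF DA}.
rewrite cr in AF; have [||F [HF HA]] := hs (img A code).
    by move=> h; rewrite imgE // => -[g [gA ->]]; apply: Hd; exact: AF.
  by move=> K; apply: N; apply: (lec_trans K); apply: lec_img.
have [g [gA K]] := DA _ (Hu F HF); apply: (H F HF g (AF g gA)) => //.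
by apply: HA; rewrite imgE //; exists g.
Qed.

Lemma exp2_continuum k : is_cardinal k -> lec (Fn M) k -> k ≼ card RF -> exp2 (continuum M) = k.
Proof.
move=> Hk Fk /(card_ge _ Hk) H; rewrite continuum_o1; apply: card_unique => //.
have [H1 [H2 H3]] := lec_RF; apply: csb; first exact: (lec_trans H2).
by apply: (lec_trans H); apply: (lec_trans H1).
Qed.
Lemma bnum_eq r k : is_cardinal k -> cap_small k -> (exists A, unbounded r I A /\ lec A k) -> bnum M r I = k.
Proof. by move=> Hk cs [A [UA Ak]]; apply: (least_size_eq Hk UA Ak) => A'; exact: (unbounded_ge ch LI). Qed.
Lemma dnum_eq c r k : c ∈ Fn M -> r <> inStar -> hit_small c k -> is_cardinal k -> lec (Fn M) k -> dnum M r I = k.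
Proof.
move=> Hc Nr hs Hk Fk; apply: (least_size_eq Hk (full_dominating r)); last by move=> A; exact: (hit_dominating Hc).
have -> : codomain M r = baire M by case: r Nr.
exact: (lec_trans (proj1 lec_RF)).
Qed.
Lemma hit_RF c k : c ∈ Fn M -> hit_small c k -> is_cardinal k -> k ≼ card RF.
Proof. by move=> Hc hs Hk; apply: (hit_dominating (r := leStar) Hc _ hs Hk (full_dominating _)). Qed.
End Sizes.

(** * Baire category and Luzin sequences *)

Section BaireSpace.
Context {M : structure} {HM : ZFCw M}.
Implicit Types (f g u v s t x y A F X : M).
Notation o := (o1 M).
Notation w := (omega M).
Notation N n := (nat_in M n).

Lemma fsub f g a b X Y : f ∈ funs a X -> g ∈ funs b Y -> (f ⊆ g <-> a ⊆ b /\ ∀ i ∈ a, ap f i = ap g i).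
Proof.
move=> Hf Hg; split=> [H|[ab E] z].
  have K i : i ∈ a -> i ∈ b /\ ap f i = ap g i.
    move=> ia; have /(fun_mem _ Hg) [j [jb /opair_inj [-> E]]] : opair i (ap f i) ∈ g by apply: H; exact: (ap_pair Hf ia).
    by [].
  by split=> i /K [].
by move=> /(fun_mem _ Hf) [i [ia ->]]; apply/(fun_mem _ Hg); exists i; split; [exact: ab|rewrite E].
Qed.
Lemma nat_sub m n : N m ⊆ N n <-> m <= n.
Proof.
split=> [H|H x /nat_mem [k [km ->]]]; last by apply/nat_lt; lia.
have [//|L] : m <= n \/ n < m by lia.
by move/nat_lt: L => /H /mem_irr.
Qed.

Definition FS : M := union (img w (fun n => funs n w)).
Lemma FSE s : s ∈ FS <-> exists n, s ∈ funs (N n) w.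
Proof.
rewrite unionE; split=> [[y []]|[n Hs]].
  by rewrite imgE; [move=> [n [/omegaE [m ->] ->]] H; exists m|df].
by exists (funs (N n) w); split=> //; rewrite imgE; [exists (N n); split=> //; exact: nat_omega|df].
Qed.
Lemma FS_fin_seq s : s ∈ FS <-> exists n, fin_seq s n.
Proof.
rewrite FSE; split=> [[n H]|[n [/omegaE [m ->] H]]]; last by exists m.
by exists (N n); split=> //; exact: nat_omega.
Qed.
Lemma ctbl_FS : ctbl FS.
Proof.
apply: lec_imgk; [exact: inf_omega|by df|exact: lec_refl|].
move=> x /omegaE [n ->]; elim: n => [|n IH].
  apply: (lec_trans (b := N 1)); last by apply: fin_inf_lec; [exact: inf_omega|exact: fin_nat].
  apply: (lec_lam (F := fun _ => N 0)) => [|v Hv|v Hv u Hu _]; [by df|by apply/nat_lt; lia|].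
  by apply: (fun_ext Hv Hu) => z /emptyE.
apply: lec_trans (hessenberg inf_omega); apply: (lec_trans (b := prod (funs (N n) w) w)); last first.
  by apply: lec_prod => //; exact: lec_refl.
have nn : N n ∈ N (S n) by apply/nat_lt.
have ns i : i ∈ N n -> i ∈ N (S n) by move=> H; apply/succE; left.
apply: (lec_lam (F := fun f => opair (lam (N n) (ap f)) (ap f (N n)))); first by df.
  move=> f Hf; apply/pair_prod; split; last exact: (ap_in Hf).
  by apply: lam_fun; [df|move=> i /ns; apply: (ap_in Hf)].
move=> f Hf g Hg /opair_inj [E1 E2]; apply: (fun_ext Hf Hg) => i /succE [ii|->] //.
have : ap (lam (N n) (ap f)) i = ap (lam (N n) (ap g)) i by rewrite E1.
by rewrite !ap_lam //; df.
Qed.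

Definition snoc (s k : M) n : M := cup s (sing (opair (N n) k)).
Lemma snocP s k n : s ∈ funs (N n) w -> k ∈ w ->
  snoc s k n ∈ funs (N (S n)) w /\ s ⊆ snoc s k n /\ s <> snoc s k n /\ ap (snoc s k n) (N n) = k.
Proof.
move=> Hs kw; have nn : N n ∈ N (S n) by apply/nat_lt.
have H : snoc s k n ∈ funs (N (S n)) w.
  apply/funsE; split=> [z /cupE [/(fun_mem _ Hs) [i [ii ->]]|/singE ->]|i /succE Hi].
      by apply/pair_prod; split; [apply/succE; left|apply: (ap_in Hs)].
    by apply/pair_prod.
  case: Hi => [ii|->].
    exists (ap s i); split=> [|y /cupE]; first by apply/cupE; left; apply: (ap_pair Hs).
    by move=> [/(ap_eq Hs) //|/singE /opair_inj [E _]]; move: ii; rewrite E => /mem_irr.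
  exists k; split=> [|y /cupE]; first by apply/cupE; right; apply/singE.
  by move=> [/(fun_mem _ Hs) [j [jn /opair_inj [E _]]]|/singE /opair_inj [_ ->]] //; move: jn; rewrite -E => /mem_irr.
have S1 : s ⊆ snoc s k n by move=> z zs; apply/cupE; left.
split=> //; split=> //; split; last by apply: (ap_eq H); apply/cupE; right; apply/singE.
move=> E; have : opair (N n) k ∈ s by rewrite E; apply/cupE; right; apply/singE.
by move/(fun_mem _ Hs) => [j [jn /opair_inj [Ej _]]]; move: jn; rewrite -Ej => /mem_irr.
Qed.
Lemma FS_below s n t m x : s ∈ funs (N n) w -> t ∈ funs (N m) w -> x ∈ baire M -> s ⊆ x -> t ⊆ x -> n <= m -> s ⊆ t.
Proof.
move=> Hs Ht Hx /(fsub Hs Hx) [_ Es] /(fsub Ht Hx) [_ Et] nm; apply/(fsub Hs Ht); split; first exact/nat_sub.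
by move=> i ii; rewrite Es // Et //; apply: (proj2 (nat_sub n m) nm).
Qed.
Lemma res_x x n : x ∈ baire M -> lam (N n) (ap x) ∈ funs (N n) w /\ lam (N n) (ap x) ⊆ x.
Proof.
move=> xB; have sub i : i ∈ N n -> i ∈ w by move=> /nat_mem [m [_ ->]]; exact: nat_omega.
have H : lam (N n) (ap x) ∈ funs (N n) w by apply: lam_fun; [df|move=> i /sub; apply: (ap_in xB)].
by split=> //; apply/(fsub H xB); split=> // i ii; rewrite ap_lam //; df.
Qed.
Lemma FS_join s t x : s ∈ FS -> t ∈ FS -> x ∈ baire M -> s ⊆ x -> t ⊆ x -> exists v, v ∈ FS /\ s ⊆ v /\ t ⊆ v /\ v ⊆ x.
Proof.
move=> /FSE [n Hs] /FSE [m Ht] xB sx tx; have [H1 H2] := res_x (n + m) xB; exists (lam (N (n + m)) (ap x)).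
split; first by apply/FSE; exists (n + m).
by split; [apply: (FS_below Hs H1 xB) => //; lia|split=> //; apply: (FS_below Ht H1 xB) => //; lia].
Qed.
Lemma coneE s x : x ∈ cone s <-> x ∈ baire M /\ s ⊆ x.
Proof. by apply: (setof_sub (a := baire M) (P := fun x => x ∈ baire M /\ s ⊆ x)); [df|move=> z []]. Qed.
Lemma DT_cone k (s : tup M k -> M) : DT s -> DT (fun z : tup M k => cone (s z)).
Proof. by move=> Hs; apply: (DT_set (Q := fun t0 : tup M (S k) => hd t0 ∈ baire M /\ s (tl t0) ⊆ hd t0)) => [t0 z|]; [exact: coneE|df]. Qed.
Lemma cone_ne s : s ∈ FS -> exists x, x ∈ cone s.
Proof.
move=> /FSE [n Hs]; exists (lam w (fun i => ite (i ∈ N n) (ap s i) (empty M))).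
have H : lam w (fun i => ite (i ∈ N n) (ap s i) (empty M)) ∈ baire M.
  apply: lam_fun => [|i iw]; first by df.
  by case: (classic (i ∈ N n)) => K; [rewrite iteT //; apply: (ap_in Hs)|rewrite iteF //; exact: empty_omega].
apply/coneE; split=> //; apply/(fsub Hs H); have sub i : i ∈ N n -> i ∈ w by move=> /nat_mem [m [_ ->]]; exact: nat_omega.
by split=> // i ii; rewrite ap_lam; [rewrite iteT|df|exact: sub].
Qed.
Lemma cone_sub s : cone s ⊆ baire M. Proof. by move=> x /coneE []. Qed.
Lemma cone_open s : s ∈ FS -> is_open (cone s).
Proof. by move=> /FS_fin_seq [n H]; split=> [|x xs]; [exact: cone_sub|exists s, n; split=> //; split=> // y]. Qed.
Lemma openE A : is_open A <-> A ⊆ baire M /\ ∀ x ∈ A, ∃ s ∈ FS, s ⊆ x /\ cone s ⊆ A.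
Proof.
split=> -[AB H]; split=> // x xA.
  by have [s [n [Hs [/coneE [_ sx] sA]]]] := H x xA; exists s; split=> //; apply/FS_fin_seq; exists n.
have [s [/FS_fin_seq [n Hn] [sx sA]]] := H x xA; exists s, n; split=> //; split=> //.
by apply/coneE; split=> //; exact: AB.
Qed.

(** A fusion argument shared by the category theorem and the lower bound for the measure of cones:
    strictly growing members of [P] converge to a real, and the [n]-th step takes care of [B n]. *)
Lemma branch P s (B : M -> M -> Prop) : Df (k := 2) (fun t : tup M 2 => B (hd (tl t)) (hd t)) -> P ⊆ FS -> s ∈ P ->
  (∀ n ∈ w, ∀ t ∈ P, ∃ t' ∈ P, t ⊆ t' /\ t <> t' /\ B n t') ->
  ∃ x ∈ baire M, s ⊆ x /\ forall n, ∃ t ∈ P, t ⊆ x /\ B (N n) t /\ exists m, n <= m /\ t ∈ funs (N m) w.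
Proof.
move=> D PF sP H; have [|f [Hf [f0 fS]]] := dependent_choice (Rl := fun n t t' => t ⊆ t' /\ t <> t' /\ B n t') _ sP H; first by df.
pose F n := ap f (N n); have FP n : F n ∈ P by apply: (ap_in Hf); exact: nat_omega.
have step n : F n ⊆ F (S n) /\ F n <> F (S n) /\ B (N n) (F (S n)) by apply: (fS (N n)); exact: nat_omega.
have mono n m : n <= m -> F n ⊆ F m.
  elim=> [|k _ IH] z // /IH; exact: (proj1 (step k)).
have len n : exists m, n <= m /\ F n ∈ funs (N m) w.
  elim: n => [|n [m [nm Hm]]]; first by generalize (PF _ (FP 0)); move=> /FSE [m Hm]; exists m; split=> //; lia.
  generalize (PF _ (FP (S n))); move=> /FSE [m' Hm']; exists m'; split=> //.
  have [Fs [Fn _]] := step n; have [/nat_sub mm Ea] := proj1 (fsub Hm Hm') Fs.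
  have [//|E] : S n <= m' \/ m = m' by lia.
  by subst m'; case: Fn; apply: (fun_ext Hm Hm').
(* Every step lengthens the sequence, so stage [i + 1] is the first one guaranteed to be defined at
   [i]. *)
pose x := lam w (fun i => ap (ap f (succ i)) i).
have xE i : ap x (N i) = ap (F (S i)) (N i) by rewrite ap_lam //; [df|exact: nat_omega].
have xB : x ∈ baire M.
  apply: lam_fun => [|i /omegaE [k ->]]; first by df.
  by have [m [km Hm]] := len (S k); apply: (ap_in Hm); apply/nat_lt; lia.
have Fx n : F n ⊆ x.
  have [m [nm Hm]] := len n; apply/(fsub Hm xB); split=> [i /nat_mem [k [_ ->]]|i /nat_mem [k [km ->]]]; first exact: nat_omega.
  rewrite xE; have [m' [km' Hm']] := len (S k).
  have k1 : N k ∈ N m by apply/nat_lt.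
  have k2 : N k ∈ N m' by apply/nat_lt; lia.
  have [nk|nk] : n <= S k \/ S k <= n by lia.
    by have [_ E] := proj1 (fsub Hm Hm') (mono _ _ nk); apply: E.
  by have [_ E] := proj1 (fsub Hm' Hm) (mono _ _ nk); rewrite E.
exists x; split=> //; split; first by rewrite -f0; exact: (Fx 0).
move=> n; exists (F (S n)); split=> //; split=> //; split; first by case: (step n) => _ [].
by have [m [nm Hm]] := len (S n); exists m; split=> //; lia.
Qed.

(** [y_d] is chosen outside the members of [T] listed before [d] and different from the earlier
    points. These are countably many sets in [J], so their union is not the whole space. *)
Lemma luzin_sequence (J : M -> Prop) T : (forall S, ctbl S -> (∀ X ∈ S, J X) -> J (union S)) -> (∀ x ∈ baire M, J (sing x)) ->
  (forall X, J X -> ~ baire M ⊆ X) -> ne T -> lec T o -> (∀ X ∈ T, J X) ->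
  exists y, inj y o (baire M) /\ forall A, (∃ X ∈ T, A ⊆ X) -> ∃ b ∈ o, ∀ d ∈ o, ~ d ∈ b -> ~ ap y d ∈ A.
Proof.
move=> JU J1 JB nT To JT; have [u [Hu us]] := surj_of_lec nT To.
have [c Hc] := choice_fun (powerset (baire M)).
pose F d f := ap c (diff (baire M) (cup (union (img d (ap u))) (img d (ap f)))).
have DF : DT (k := 2) (fun t : tup M 2 => F (hd (tl t)) (hd t)) by rewrite /F; df.
pose G := rec F; have DG : DT (k := 1) (fun t : tup M 1 => G (hd t)) by apply: DT_rec1 => //; df.
have GE d : d ∈ o -> (G d ∈ baire M) /\ (∀ e ∈ d, ~ G d ∈ ap u e /\ G d <> G e).
  elim/mem_ind: d => d IH dO.
  have io e : e ∈ d -> e ∈ o by move=> ed; exact: (ord_tr ord_o1 dO ed).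
  pose S := cup (img d (ap u)) (img d (fun e => sing (G e))).
  have JS : J (union S).
    apply: JU => [|X /cupE].
      by apply: lec_cupk; [exact: inf_omega| |]; apply: ctbl_img; try exact: mem_o1; df.
    rewrite !imgE; try by df.
    by move=> [[e [ed ->]]|[e [ed ->]]]; [apply: JT; apply: (ap_in Hu); exact: io|apply: J1; apply: (proj1 (IH e ed (io e ed)))].
  have L e : e ∈ d -> ap (lam d G) e = G e by move=> ed; apply: ap_lam.
  have subU x : x ∈ cup (union (img d (ap u))) (img d (ap (lam d G))) <-> x ∈ union S.
    rewrite cupE !unionE imgE; last by df.
    split=> [[[y [yi xy]]|[e [ed ->]]]|[y [/cupE [yi|]]]].
          by exists y; split=> //; apply/cupE; left.
        exists (sing (G e)); split; last by rewrite L //; apply/singE.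
      by apply/cupE; right; rewrite imgE; [exists e|df].
      by move=> xy; left; exists y.
    by rewrite imgE; [move=> [e [ed ->]] /singE ->; right; exists e; rewrite L|df].
  have /diffE [GB NG] : G d ∈ diff (baire M) (cup (union (img d (ap u))) (img d (ap (lam d G)))).
    rewrite {1}/G recE // -/G {1}/F; apply: Hc; first by apply/powersetE => x /diffE [].
    apply: NNPP => NE; apply: (JB _ JS) => x xB; apply: NNPP => xn; apply: NE; exists x; apply/diffE; split=> //.
    by move/subU.
  split=> // e ed; split=> K; apply: NG; apply/cupE.
    by left; apply/unionE; exists (ap u e); split=> //; rewrite imgE; [exists e|df].
  by right; rewrite imgE; [exists e; rewrite L|df].
exists (lam o G); split.
  split; first by apply: lam_fun => // d /GE [].
  move=> d dO e eo; rewrite !ap_lam // => E.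
  have [H|[//|H]] := ord_total (ord_mem ord_o1 dO) (ord_mem ord_o1 eo).
    by case: (proj2 (proj2 (GE e eo) d H)).
  by case: (proj2 (proj2 (GE d dO) e H)).
(* The set with number [b] is avoided only by the points with index above [b], hence [succ b]. *)
move=> A [X [XT AX]]; have [b [bo E]] := us X XT; exists (succ b); split; first exact: (inf_limit inf_o1).
move=> d dO Nd; rewrite ap_lam // => /AX; rewrite -E; apply: (proj1 (proj2 (GE d dO) b _)).
have [H|[H|//]] := ord_total (ord_mem ord_o1 dO) (ord_mem ord_o1 bo); case: Nd; apply/succE; by [left|right].
Qed.
End BaireSpace.

(** * Luzin sequences for the meager and the σ-compactly generated ideal *)

Section Category.
Context {M : structure} {HM : ZFCw M}.
Implicit Types (f g u v s t x y A F X c : M).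
Notation o := (o1 M).
Notation w := (omega M).
Notation N n := (nat_in M n).
Hint Resolve DT_cone : df.

(** Codes of closed nowhere dense sets: a dense set [c] of finite sequences stands for the set
    [Th c] of reals outside all its cones. There are at most as many codes as subsets of a countable
    set, so CH applies. *)
Definition Tc : M := sep (powerset FS) (fun c => ∀ s ∈ FS, ∃ t ∈ c, s ⊆ t).
Definition Th c : M := sep (baire M) (fun x => ∀ t ∈ c, ~ t ⊆ x).
Definition Jm A := exists S, S ⊆ Tc /\ ctbl S /\ A ⊆ union (img S Th).
Lemma TcE c : c ∈ Tc <-> c ⊆ FS /\ ∀ s ∈ FS, ∃ t ∈ c, s ⊆ t.
Proof. by rewrite sepE ?powersetE; df. Qed.
Lemma ThE c x : x ∈ Th c <-> x ∈ baire M /\ ∀ t ∈ c, ~ t ⊆ x.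
Proof. by rewrite sepE; df. Qed.
Lemma DT_Th k (c : tup M k -> M) : DT c -> DT (fun z : tup M k => Th (c z)).
Proof. by move=> H; rewrite /Th; df. Qed.
Hint Resolve DT_Th : df.
Lemma UThE S x : x ∈ union (img S Th) <-> ∃ c ∈ S, x ∈ Th c.
Proof.
rewrite unionE; split=> [[y []]|[c [cS H]]]; last by exists (Th c); split=> //; rewrite imgE; [exists c|df].
by rewrite imgE; [move=> [c [cS ->]] H; exists c|df].
Qed.
Lemma seq_unionE F X x : F ∈ funs w X -> (x ∈ seq_union F <-> ∃ n ∈ w, x ∈ ap F n).
Proof.
move=> HF; have E y : y ∈ seq_union F <-> ∃ n ∈ w, y ∈ app F n.
  apply: setofE; exists (union (img w (ap F))) => z; rewrite unionE; split=> [[v []]|[n [no H]]].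
    by rewrite imgE; [move=> [n [no ->]] H; exists n; rewrite (app_ap HF no)|df].
  by exists (ap F n); rewrite -(app_ap HF no); split=> //; rewrite imgE; [exists n; rewrite (app_ap HF no)|df].
by rewrite E; split=> -[n [no H]]; exists n; move: H; rewrite (app_ap HF no).
Qed.
Lemma closureE A x : x ∈ closure A <-> x ∈ baire M /\ forall U, is_open U -> x ∈ U -> exists y, y ∈ U /\ y ∈ A.
Proof.
apply: (setof_sub (a := baire M) (P := fun x => x ∈ baire M /\ forall U, is_open U -> x ∈ U -> exists y, y ∈ U /\ y ∈ A)); last by move=> z [].
apply: (Df_ext (Q := fun z : tup M 1 => hd z ∈ baire M /\ forall U, (U ⊆ baire M /\ ∀ x ∈ U, ∃ s ∈ FS, s ⊆ x /\ cone s ⊆ U) -> hd z ∈ U -> exists y, y ∈ U /\ y ∈ A)).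
  by move=> z; split=> -[? H]; split=> // U /openE; apply: H.
df.
Qed.

Lemma nd_code A : nowhere_dense A -> ∃ c ∈ Tc, A ⊆ Th c.
Proof.
move=> [AB H]; exists (sep FS (fun t => ∀ x ∈ A, ~ t ⊆ x)).
have cE t : t ∈ sep FS (fun t => ∀ x ∈ A, ~ t ⊆ x) <-> t ∈ FS /\ ∀ x ∈ A, ~ t ⊆ x by rewrite sepE; df.
split; last by move=> x xA; apply/ThE; split; [exact: AB|move=> t /cE [_]; apply].
apply/TcE; split=> [t /cE []|s sF] //; apply: NNPP => K.
have [z zs] := cone_ne sF; suff E : cone s = empty M by move: zs; rewrite E => /emptyE.
apply: H; first exact: cone_open.
move=> x /coneE [xB sx]; apply/closureE; split=> // U /openE [UB HU] xU.
have [t [tF [tx tU]]] := HU x xU; have [v [vF [sv [tv vx]]]] := FS_join sF tF xB sx tx.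
apply: NNPP => NU; apply: K; exists v; split=> //; apply/cE; split=> // y yA vy; apply: NU; exists y; split=> //.
by apply: tU; apply/coneE; split; [exact: AB|move=> z' /tv /vy].
Qed.
Lemma nd_intro A c : c ∈ Tc -> A ⊆ Th c -> nowhere_dense A.
Proof.
move=> /TcE [cF cd] H; split=> [x /H /ThE []|U /openE [UB HU] UA] //; apply: NNPP => NE.
have [z zU] : ne U by apply: NNPP => /ne_not.
have [s [sF [sz sU]]] := HU z zU; have [t [tc st]] := cd s sF; have [y /coneE [yB ty]] := cone_ne (cF t tc).
have /UA /closureE [_ /(_ (cone t))] : y ∈ U by apply: sU; apply/coneE; split=> // u /st /ty.
case=> [||v [/coneE [_ tv] /H /ThE [_ /(_ t tc)]]] //; first by apply: cone_open; exact: cF.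
by apply/coneE.
Qed.
Lemma point_code x : x ∈ baire M -> ∃ c ∈ Tc, x ∈ Th c.
Proof.
move=> xB; exists (sep FS (fun t => ~ t ⊆ x)).
have cE t : t ∈ sep FS (fun t => ~ t ⊆ x) <-> t ∈ FS /\ ~ t ⊆ x by rewrite sepE; df.
split; last by apply/ThE; split=> // t /cE [].
apply/TcE; split=> [t /cE []|s /FSE [n Hs]] //.
have xn : ap x (N n) ∈ w by apply: (ap_in xB); exact: nat_omega.
have [Ht [st [_ E]]] := snocP Hs (succ_omega xn); exists (snoc s (succ (ap x (N n))) n); split=> //.
apply/cE; split; first by apply/FSE; exists (S n).
move=> /(fsub Ht xB) [_ /(_ (N n))]; rewrite E => K; apply: (mem_irr (x := ap x (N n))); rewrite -{2}K; last by apply/nat_lt.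
by apply/succE; right.
Qed.
(** On a compact set only finitely many values occur at coordinate [n], so extending a sequence of
    length [n] by a larger value leaves the set. This makes every compact set nowhere dense and lets
    one Luzin sequence serve both ideals. *)
Lemma compact_code C : compact C -> ∃ c ∈ Tc, C ⊆ Th c.
Proof.
move=> [CB HC]; exists (sep FS (fun t => ∀ x ∈ C, ~ t ⊆ x)).
have cE t : t ∈ sep FS (fun t => ∀ x ∈ C, ~ t ⊆ x) <-> t ∈ FS /\ ∀ x ∈ C, ~ t ⊆ x by rewrite sepE; df.
split; last by move=> x xC; apply/ThE; split; [exact: CB|move=> t /cE [_]; apply].
apply/TcE; split=> [t /cE []|s /FSE [n Hs]] //; pose proof (nat_omega (M := M) n) as nw.
pose V (k : M) : M := sep (baire M) (fun x => ap x (N n) = k).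
have VE k x : x ∈ V k <-> x ∈ baire M /\ ap x (N n) = k by rewrite sepE; df.
have DV : DT (k := 1) (fun z : tup M 1 => V (hd z)) by rewrite /V; df.
have [||D [DC [/finiteP fD CD]]] := HC (img w V).
    move=> U; rewrite imgE // => -[k [kw ->]]; apply/openE; split=> [x /VE []|x /VE [xB E]] //.
    have [H1 H2] := res_x (S n) xB; exists (lam (N (S n)) (ap x)); split; first by apply/FSE; exists (S n).
    split=> // y /coneE [yB] /(fsub H1 yB) [_ /(_ (N n))] K; apply/VE; split=> //.
    have nn : N n ∈ N (S n) by apply/nat_lt.
    by rewrite -K // ap_lam //; df.
  move=> x xC; apply/unionE; exists (V (ap x (N n))); split; last by apply/VE; split=> //; exact: CB.
  by rewrite imgE //; exists (ap x (N n)); split=> //; apply: (ap_in (CB x xC)).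
have aE k : k ∈ sep w (fun k => V k ∈ D) <-> k ∈ w /\ V k ∈ D by rewrite sepE; df.
have [||m Hm] := fin_bounded (a := sep w (fun k => V k ∈ D)); first by move=> k /aE [].
  apply: (fin_lec _ fD); apply: (lec_lam (F := V)) => // [k /aE [] //|k /aE [kw _] k' /aE [kw' _] E].
  have cB : lam w (fun _ => k) ∈ baire M by apply: lam_fun; df.
  have /VE [_] : lam w (fun _ => k) ∈ V k' by rewrite -E; apply/VE; split=> //; rewrite ap_lam //; df.
  by rewrite ap_lam //; df.
pose proof (nat_omega (M := M) m) as mw; have [Ht [st [_ E]]] := snocP Hs mw; exists (snoc s (N m) n); split=> //.
apply/cE; split; first by apply/FSE; exists (S n).
move=> x xC /(fsub Ht (CB x xC)) [_ /(_ (N n))]; rewrite E => K.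
have [U [UD xU]] := proj1 (unionE _ _) (CD x xC).
generalize (DC U UD); rewrite imgE // => -[k [kw EU]]; move: xU; rewrite EU => /VE [_ Ek].
have: m < m; last by lia.
apply: Hm; apply/aE; split=> //; rewrite K; last by apply/nat_lt.
by rewrite Ek -EU.
Qed.

Lemma category S : S ⊆ Tc -> ctbl S -> ~ baire M ⊆ union (img S Th).
Proof.
move=> ST cS H.
have e0 : empty M ∈ FS by apply/FSE; exists 0; apply/funsE; split=> [z /emptyE|x /emptyE].
have ext1 t : t ∈ FS -> exists t', t' ∈ FS /\ t ⊆ t' /\ t <> t'.
  move=> /FSE [n Ht]; have [H1 [H2 [H3 _]]] := snocP Ht empty_omega; exists (snoc t (empty M) n); split=> //.
  by apply/FSE; exists (Datatypes.S n).
case: (classic (ne S)) => [nS|/ne_not E]; last first.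
  by have [x /coneE [xB _]] := cone_ne e0; generalize (H x xB); move=> /UThE [c []]; rewrite E => /emptyE.
have [u [Hu us]] := surj_of_lec nS cS.
have [|||x [xB [_ Hx]]] := branch (P := FS) (s := empty M) (B := fun n t => ∃ r ∈ ap u n, r ⊆ t) _ _ e0.
      by df.
    by move=> z.
  move=> n no t tF; have uS : ap u n ∈ S by apply: (ap_in Hu).
  (* The member [r] of the dense set may equal [t]; the further extension [t'] makes the sequence
     strictly longer, as [branch] demands. *)
  generalize (ST _ uS); move=> /TcE [cF cd]; have [r [rc tr]] := cd t tF; have [t' [tF' [rt rn]]] := ext1 r (cF r rc).
  exists t'; split=> //; split; first by move=> z /tr /rt.
  split; last by exists r.
  by move=> E; apply: rn; apply: ext => z; split=> [/rt //|]; rewrite -E => /tr.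
generalize (H x xB); move=> /UThE [c [cS' /ThE [_ K]]]; have [n [no En]] := us c cS'; generalize (no); move=> /omegaE [k Ek].
have [t [_ [tx [[r [rc rt]] _]]]] := Hx k; apply: (K r); last by move=> z /rt /tx.
by rewrite -En Ek.
Qed.

Hypothesis ch : CH M.
Lemma category_luzin : exists y, inj y o (baire M) /\ forall A, Jm A -> ∃ b ∈ o, ∀ d ∈ o, ~ d ∈ b -> ~ ap y d ∈ A.
Proof.
have DU : DT (k := 1) (fun z : tup M 1 => union (img (hd z) Th)) by df.
have To : lec Tc o.
  apply: lec_trans ch; apply: (lec_trans (b := powerset FS)); last by apply: lec_powerset; exact: ctbl_FS.
  by apply: lec_sub => c /TcE [cF _]; apply/powersetE.
have [|||||| y [Hy H]] := luzin_sequence (J := Jm) (T := img (csub Tc) (fun S => union (img S Th))).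
- move=> S cS HS.
  have [||c Hc] := choice_fam (a := S) (Y := fun X => sep (csub Tc) (fun R => X ⊆ union (img R Th))); first by df.
    move=> X XS; have [R [RT [cR XR]]] := HS X XS; exists R; rewrite sepE; last by df.
    by split=> //; apply/csubE.
  have cE X : X ∈ S -> (ap c X ⊆ Tc /\ ctbl (ap c X)) /\ X ⊆ union (img (ap c X) Th).
    by move=> /Hc; rewrite sepE; [move=> [/csubE ? ?]|df].
  have uE z : z ∈ union (img S (ap c)) <-> ∃ X ∈ S, z ∈ ap c X.
    rewrite unionE; split=> [[v []]|[X [XS zX]]]; last by exists (ap c X); split=> //; rewrite imgE; [exists X|df].
    by rewrite imgE; [move=> [X [XS ->]] ?; exists X|df].
  exists (union (img S (ap c))); split; first by move=> z /uE [X [/cE [[K _] _] /K]].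
  split; first by apply: lec_imgk; [exact: inf_omega|df|done|move=> X /cE [[]]].
  move=> x /unionE [X [XS xX]]; have [_ K] := cE X XS; generalize (K x xX); move=> /UThE [d [dX xd]].
  by apply/UThE; exists d; split=> //; apply/uE; exists X.
- move=> x xB; have [c [cT xc]] := point_code xB; exists (sing c); split; first by move=> z /singE ->.
  split; first by apply: fin_inf_lec; [exact: inf_omega|exact: fin_upair].
  by move=> z /singE ->; apply/UThE; exists c; split=> //; apply/singE.
- by move=> X [S [ST [cS XS]]] BX; apply: (category ST cS) => x /BX /XS.
- exists (union (img (empty M) Th)); rewrite imgE //; exists (empty M); split=> //; apply/csubE.
  by split; [move=> z /emptyE|apply: lec_sub => z /emptyE].
- by apply: (lec_trans (lec_img _ DU)); apply: CH_csub.
- move=> X; rewrite imgE // => -[S [/csubE [ST cS] ->]]; exists S; split=> //; split=> // z; done.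
- exists y; split=> // A [S [ST [cS AS]]]; apply: H; exists (union (img S Th)); split=> //.
  by rewrite imgE //; exists S; split=> //; apply/csubE.
Qed.
Lemma Jm_seq F (Q : M -> Prop) : (forall A, Q A -> ∃ c ∈ Tc, A ⊆ Th c) -> F ∈ funs w (powerset (baire M)) ->
  (∀ n ∈ w, Q (app F n)) -> Jm (seq_union F).
Proof.
move=> HQ HF H.
have [||c Hc] := choice_fam (a := w) (Y := fun n => sep Tc (fun c => ap F n ⊆ Th c)); first by df.
  move=> n no; have [c [cT K]] := HQ _ (H n no); exists c; rewrite sepE; last by df.
  by rewrite -(app_ap HF no).
have cE n : n ∈ w -> ap c n ∈ Tc /\ ap F n ⊆ Th (ap c n) by move=> /Hc; rewrite sepE; df.
exists (img w (ap c)); split; first by move=> z; rewrite imgE; [move=> [n [/cE [? _] ->]]|df].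
split; first by apply: ctbl_img; [df|exact: lec_refl].
move=> x /(seq_unionE _ HF) [n [no xn]]; apply/UThE; exists (ap c n); have [_ K] := cE n no; split; last exact: K.
by rewrite imgE; [exists n|df].
Qed.
Lemma ctbl_seq A : A ⊆ baire M -> ctbl A -> exists F, F ∈ funs w (powerset (baire M)) /\ A = seq_union F /\
  ∀ n ∈ w, exists x, x ∈ baire M /\ app F n ⊆ sing x /\ (ap F n = empty M \/ ap F n = sing x).
Proof.
move=> AB cA; have [x0 x0B] : ne (baire M) by have [|x /coneE [xB _]] := cone_ne (s := empty M); [apply/FSE; exists 0; apply/funsE; split=> [z /emptyE|x /emptyE]|exists x].
case: (classic (ne A)) => [nA|/ne_not E]; last first.
  have HF : lam w (fun _ => empty M) ∈ funs w (powerset (baire M)) by apply: lam_fun => [|n _]; [df|apply/powersetE => z /emptyE].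
  exists (lam w (fun _ => empty M)); split=> //; split.
    apply: ext => x; rewrite (seq_unionE _ HF) E; split=> [/emptyE //|[n [no]]]; by rewrite ap_lam //; df.
  by move=> n no; exists x0; rewrite (app_ap HF no) ap_lam //; [split=> //; split=> [z /emptyE|] //; left|df].
have [u [Hu us]] := surj_of_lec nA cA.
have HF : lam w (fun n => sing (ap u n)) ∈ funs w (powerset (baire M)).
  by apply: lam_fun => [|n no]; [df|apply/powersetE => z /singE ->; apply: AB; apply: (ap_in Hu)].
exists (lam w (fun n => sing (ap u n))); split=> //; split.
  apply: ext => x; rewrite (seq_unionE _ HF); split=> [/us [n [no <-]]|[n [no]]].
    by exists n; split=> //; rewrite ap_lam //; [apply/singE|df].
  by rewrite ap_lam //; [move=> /singE ->; apply: (ap_in Hu)|df].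
move=> n no; exists (ap u n); rewrite (app_ap HF no) ap_lam //; last by df.
by split; [apply: AB; apply: (ap_in Hu)|split=> [z|] //; right].
Qed.
Lemma compact_sing x X : x ∈ baire M -> X = empty M \/ X = sing x -> compact X.
Proof.
move=> xB HX; have XB : X ⊆ baire M by case: HX => -> z; [move=> /emptyE|move=> /singE ->].
split=> // C _ XC; case: HX => E.
  exists (empty M); split; first by move=> z /emptyE.
  by split; [apply/finiteP; exists nil => z /emptyE|rewrite E => z /emptyE].
have /unionE [U [UC xU]] : x ∈ union C by apply: XC; rewrite E; apply/singE.
exists (sing U); split; first by move=> z /singE ->.
split; first by apply/finiteP; exact: fin_upair.
by rewrite E => z /singE ->; apply/unionE; exists U; split=> //; apply/singE.
Qed.

Lemma luzin_MK I : I <> idealN -> luzin_ideal (M := M) I.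
Proof.
move=> NI; split=> [A AB cA|].
  have [F [HF [E H]]] := ctbl_seq AB cA; case: I NI => //= _.
    exists F; split=> //; split=> // n no; have [x [xB [Fx _]]] := H n no; have [c [cT xc]] := point_code xB.
    by apply: (nd_intro cT) => z /Fx /singE ->.
  exists (seq_union F); rewrite E; split=> [|z] //; exists F; split=> //; split=> // n no.
  by have [x [xB [_ K]]] := H n no; rewrite (app_ap HF no); apply: (compact_sing xB).
have [y [Hy HJ]] := category_luzin; exists y; split=> // A IA; apply: HJ; case: I NI IA => //= _.
  by move=> [F [HF [H ->]]]; apply: (Jm_seq nd_code HF H).
move=> [B [[F [HF [H ->]]] AF]]; have [S [ST [cS K]]] := Jm_seq compact_code HF H.
by exists S; split=> //; split=> // z /AF /K.
Qed.
End Category.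

(** * Borel sets of the model *)

Section Borel.
Context {M : structure} {HM : ZFCw M}.
Notation N n := (nat_in M n).
Notation w := (omega M).
Implicit Types (A B F S U : M).
Hint Resolve DT_cone : df.
Lemma seq_unionU F X : F ∈ funs w X -> seq_union F = union (img w (ap F)).
Proof.
move=> HF; apply: ext => x; rewrite (seq_unionE _ HF) unionE; split=> [[n [no H]]|[y []]].
  by exists (ap F n); split=> //; rewrite imgE; [exists n|df].
by rewrite imgE; [move=> [n [no ->]] H; exists n|df].
Qed.
Lemma sigmaE S : sigma_algebra S <-> S ⊆ powerset (baire M) /\ baire M ∈ S /\ (∀ B ∈ S, diff (baire M) B ∈ S) /\
  ∀ F ∈ funs w S, union (img w (ap F)) ∈ S.
Proof.
by split=> -[H1 [H2 [H3 H4]]]; split=> //; split=> //; split=> // F HF; [rewrite -(seq_unionU HF)|rewrite (seq_unionU HF)]; apply: H4.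
Qed.
Lemma powerset_sigma : sigma_algebra (powerset (baire M)).
Proof.
apply/sigmaE; split=> [x|] //; split; first by apply/powersetE => x.
split=> [B _|F HF]; apply/powersetE => x; first by move/diffE => [].
by rewrite -(seq_unionU HF) (seq_unionE _ HF) => -[n [no]]; generalize (ap_in HF no); move=> /powersetE; apply.
Qed.
Lemma borelE B : B ∈ borel M <-> forall S, sigma_algebra S -> (forall U, is_open U -> U ∈ S) -> B ∈ S.
Proof.
apply: (setof_sub (a := powerset (baire M)) (P := fun B => forall S, sigma_algebra S -> (forall U, is_open U -> U ∈ S) -> B ∈ S)).
  apply: (Df_ext (Q := fun z : tup M 1 => forall S, (S ⊆ powerset (baire M) /\ baire M ∈ S /\ (∀ B ∈ S, diff (baire M) B ∈ S) /\
    ∀ F ∈ funs w S, union (img w (ap F)) ∈ S) -> (forall U, (U ⊆ baire M /\ ∀ x ∈ U, ∃ s ∈ FS, s ⊆ x /\ cone s ⊆ U) -> U ∈ S) -> hd z ∈ S)).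
    move=> z; split=> H S /sigmaE HS HU; apply: (H S HS) => U.
      by move/openE; apply: HU.
    by move=> HO; apply: HU; apply/openE.
  by df.
move=> B' H; apply: (H _ powerset_sigma) => U [UB _]; exact/powersetE.
Qed.
Lemma borel_sub B : B ∈ borel M -> B ⊆ baire M.
Proof. by move=> /borelE /(_ _ powerset_sigma) H; apply/powersetE; apply: H => U [UB _]; exact/powersetE. Qed.
Lemma borel_open U : is_open U -> U ∈ borel M.
Proof. by move=> HU; apply/borelE => S _; apply. Qed.
Lemma borel_compl B : B ∈ borel M -> diff (baire M) B ∈ borel M.
Proof. by move=> /borelE H; apply/borelE => S HS HU; have [_ [_ [HC _]]] := HS; apply: HC; exact: H. Qed.
Lemma borel_seq F : F ∈ funs w (borel M) -> seq_union F ∈ borel M.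
Proof.
move=> HF; apply/borelE => S HS HU; have [_ [_ [_ K]]] := HS; apply: K.
by apply: (fun_codom HF) => n no; generalize (ap_in HF no); move=> /borelE; apply.
Qed.
Lemma borel_empty : empty M ∈ borel M.
Proof. by apply: borel_open; apply/openE; split=> x /emptyE. Qed.
Lemma borel_cup A B : A ∈ borel M -> B ∈ borel M -> cup A B ∈ borel M.
Proof.
move=> HA HB; have HF : lam w (fun n => ite (n = empty M) A B) ∈ funs w (borel M).
  by apply: lam_fun => [|n _]; [df|case: (classic (n = empty M)) => E; [rewrite iteT|rewrite iteF]].
have -> : cup A B = seq_union (lam w (fun n => ite (n = empty M) A B)); last exact: borel_seq.
pose proof (nat_omega (M := M) 1) as o1.
have n1 : N 1 <> empty M by move/(@nat_inj _ _ 1 0).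
apply: ext => x; rewrite cupE (seq_unionE _ HF); split=> [[H|H]|[n [no]]].
- by exists (empty M); split; [exact: empty_omega|rewrite ap_lam; [rewrite iteT|df|exact: empty_omega]].
- by exists (N 1); split=> //; rewrite ap_lam; [rewrite iteF|df|].
- by rewrite ap_lam //; [case: (classic (n = empty M)) => E; [rewrite iteT|rewrite iteF] => // ?; [left|right]|df].
Qed.
Lemma borel_diff A B : A ∈ borel M -> B ∈ borel M -> diff A B ∈ borel M.
Proof.
move=> HA HB; have -> : diff A B = diff (baire M) (cup (diff (baire M) A) B); last by apply: borel_compl; apply: borel_cup => //; exact: borel_compl.
apply: ext => x; rewrite !diffE cupE diffE; generalize (@borel_sub A HA x); tauto.
Qed.
Lemma baire_cone : cone (empty M) = baire M.
Proof. by apply: ext => x; rewrite coneE; split=> [[]|] //; split=> // z /emptyE. Qed.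
End Borel.

(** * The real line of a model *)

Notation Re := Rdefinitions.R.

(* The rational (a - b) / (n + 1) is coded by ((a, b), n). *)
Definition vl (q : nat * nat * nat) : Re := ((INR (fst (fst q)) - INR (snd (fst q))) / (INR (snd q) + 1))%R.
Lemma vl_dense (x y : Re) : (x < y)%R -> exists q, (x < vl q < y)%R.
Proof.
move=> xy; have [n Hn] := INR_unbounded (1 / (y - x)); pose D := (INR n + 1)%R.
have Dp : (D > 0)%R by rewrite /D; generalize (pos_INR n); lra.
have [L1 L2] := archimed (x * D); set z := up (x * D) in L1 L2.
have [q Hq] : exists q, vl q = (IZR z / D)%R.
  have [Hz|Hz] : (0 <= z \/ z < 0)%Z by lia.
    exists (Z.to_nat z, 0, n); rewrite /vl /= INR_IZR_INZ Z2Nat.id // -/D; congr (_ / _)%R; lra.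
  exists (0, Z.to_nat (- z), n); rewrite /vl /= [INR (Z.to_nat _)]INR_IZR_INZ Z2Nat.id ?opp_IZR -/D; last by lia.
  congr (_ / _)%R; lra.
exists q; rewrite Hq; split.
  by apply: (Rmult_lt_reg_r D) => //; rewrite /Rdiv Rmult_assoc Rinv_l; lra.
apply: (Rmult_lt_reg_r D) => //; rewrite /Rdiv Rmult_assoc Rinv_l; last by lra.
have : ((y - x) * D > 1)%R.
  apply: (Rmult_lt_reg_l (/ (y - x))); first by apply: Rinv_0_lt_compat; lra.
  by rewrite -Rmult_assoc Rinv_l; rewrite /D; lra.
by lra.
Qed.

Section RealLine.
Context {M : structure} {HM : ZFCw M}.
Notation N n := (nat_in M n).
Notation w := (omega M).

(** Cuts are formed by separation, so the arithmetic of ω has to be definable. This is the recursion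
    [a + b = a ∪ {a + x : x < b}]. *)
Definition nadd (a b : M) : M := rec (fun x f => cup a (img x (ap f))) b.
Lemma DT_nadd k (a b : tup M k -> M) : DT a -> DT b -> DT (fun t => nadd (a t) (b t)).
Proof. by move=> Ha Hb; apply: (DT_rec (F := fun t x f => cup (a t) (img x (ap f)))); df. Qed.
Hint Resolve DT_nadd : df.
Lemma naddE a b : nadd (N a) (N b) = N (a + b).
Proof.
have D : DT (k := 2) (fun t : tup M 2 => cup (N a) (img (hd (tl t)) (ap (hd t)))) by df.
have DL : DT (k := 1) (fun t : tup M 1 => nadd (N a) (hd t)) by df.
elim/lt_wf_ind: b => b IH; rewrite /nadd recE // -/(nadd (N a)); apply: ext => x.
rewrite cupE imgE; last by df.
have L c : c < b -> ap (lam (N b) (nadd (N a))) (N c) = N (a + c) by move=> cb; rewrite ap_lam // ?IH //; apply/nat_lt.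
split=> [[/nat_mem [k [ka ->]]|[y [/nat_mem [c [cb ->]] ->]]]|/nat_mem [k [ka ->]]].
- by apply/nat_lt; lia.
- by rewrite L //; apply/nat_lt; lia.
- have [H|H] : k < a \/ a <= k by lia.
    by left; apply/nat_lt.
  right; exists (N (k - a)); split; first by apply/nat_lt; lia.
  by rewrite L; [congr nat_in; lia|lia].
Qed.
Definition nmul (a b : M) : M := rec (fun x f => union (img x (fun c => nadd (ap f c) a))) b.
Lemma DT_nmul k (a b : tup M k -> M) : DT a -> DT b -> DT (fun t => nmul (a t) (b t)).
Proof. by move=> Ha Hb; apply: (DT_rec (F := fun t x f => union (img x (fun c => nadd (ap f c) (a t))))); df. Qed.
Hint Resolve DT_nmul : df.
Lemma nmulE a b : nmul (N a) (N b) = N (a * b).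
Proof.
have D : DT (k := 2) (fun t : tup M 2 => union (img (hd (tl t)) (fun c => nadd (ap (hd t) c) (N a)))) by df.
have DL : DT (k := 1) (fun t : tup M 1 => nmul (N a) (hd t)) by df.
elim/lt_wf_ind: b => b IH; rewrite /nmul recE // -/(nmul (N a)); apply: ext => x; rewrite unionE.
have L c : c < b -> nadd (ap (lam (N b) (nmul (N a))) (N c)) (N a) = N (a * c + a).
  by move=> cb; rewrite ap_lam // ?IH ?naddE //; apply/nat_lt.
split=> [[y []]|/nat_mem [k [ka ->]]].
  rewrite imgE; last by df.
  by move=> [c' [/nat_mem [c [cb ->]] ->]]; rewrite L // => /nat_mem [k [ka ->]]; apply/nat_lt; nia.
exists (N (a * (b - 1) + a)); split; last by apply/nat_lt; nia.
rewrite imgE; last by df.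
exists (N (b - 1)); split; [apply/nat_lt; nia|rewrite L //; nia].
Qed.

Definition cd (q : nat * nat * nat) : M := opair (opair (N (fst (fst q))) (N (snd (fst q)))) (N (snd q)).
Definition Q3 : M := prod (prod w w) w.
Lemma Q3E q : q ∈ Q3 <-> exists a, q = cd a.
Proof.
split=> [/prodE [x [/prodE [y [/omegaE [a ->] [z [/omegaE [b ->] ->]]]] [v [/omegaE [n ->] ->]]]]|[[[a b] n] ->]].
  by exists (a, b, n).
by rewrite /cd /=; apply/pair_prod; split; [apply/pair_prod; split|]; exact: nat_omega.
Qed.
Lemma Q3cd a : cd a ∈ Q3. Proof. by apply/Q3E; exists a. Qed.

(* [q < x * y + z], with denominators cleared and all terms moved to their positive side *)
Definition ltq (q x y z : M) : Prop :=
  let p u := pfst (pfst u) in let m u := psnd (pfst u) in let d u := succ (psnd u) in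
  nadd (nadd (nmul (p q) (nmul (d x) (nmul (d y) (d z))))
    (nmul (nadd (nmul (p x) (m y)) (nmul (m x) (p y))) (nmul (d q) (d z)))) (nmul (m z) (nmul (d q) (nmul (d x) (d y))))
  ∈ nadd (nadd (nmul (m q) (nmul (d x) (nmul (d y) (d z))))
    (nmul (nadd (nmul (p x) (p y)) (nmul (m x) (m y))) (nmul (d q) (d z)))) (nmul (p z) (nmul (d q) (nmul (d x) (d y)))).
Lemma Df_ltq k (q x y z : tup M k -> M) : DT q -> DT x -> DT y -> DT z -> Df (fun t => ltq (q t) (x t) (y t) (z t)).
Proof. by move=> *; rewrite /ltq; df. Qed.
Lemma ltqE q x y z : ltq (cd q) (cd x) (cd y) (cd z) <-> (vl q < vl x * vl y + vl z)%R.
Proof.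
have sE n : succ (N n) = N (S n) by [].
rewrite /ltq /cd !(pfstE, psndE, sE) !(nmulE, naddE) nat_lt /vl.
move: q x y z => [[qa qb] qn] [[xa xb] xn] [[ya yb] yn] [[za zb] zn]; rewrite [fst _]/= [snd _]/=.
set l := (_ + _)%nat; set r := (_ + _)%nat.
have P n : (INR n + 1 > 0)%R by generalize (pos_INR n); lra.
have E : (((INR xa - INR xb) / (INR xn + 1) * ((INR ya - INR yb) / (INR yn + 1)) + (INR za - INR zb) / (INR zn + 1)) -
   (INR qa - INR qb) / (INR qn + 1) =
   (INR r - INR l) / ((INR qn + 1) * (INR xn + 1) * (INR yn + 1) * (INR zn + 1)))%R.
  rewrite /l /r /=; rewrite !(plus_INR, mult_INR, S_INR); field.
  by move: (P qn) (P xn) (P yn) (P zn); lra.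
have DP : ((INR qn + 1) * (INR xn + 1) * (INR yn + 1) * (INR zn + 1) > 0)%R by do 3! (apply: Rmult_gt_0_compat => //).
set DD := (_ * _)%R in DP E; pose proof (Rinv_0_lt_compat _ DP) as I; rewrite /= in E *.
split=> [/lt_INR H|H].
  suff : ((INR r - INR l) / DD > 0)%R by lra.
  by apply: Rmult_gt_0_compat; lra.
apply: INR_lt; suff : (INR r - INR l > 0)%R by lra.
have K : ((INR r - INR l) / DD > 0)%R by lra.
by apply: (Rmult_lt_reg_r (/ DD)) => //; rewrite Rmult_0_l.
Qed.
End RealLine.

(** * Dedekind cuts and a complete ordered field in the model *)

Section Cuts.
Context {M : structure} {HM : ZFCw M}.
Notation N n := (nat_in M n).
Notation w := (omega M).
Hint Resolve DT_nadd DT_nmul Df_ltq : df.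
Implicit Types (X Y Z : M) (r s : Re).

Definition q0 : M := cd (0, 0, 0).
Definition q1 : M := cd (1, 0, 0).
Definition qm : M := cd (0, 1, 0).
Lemma vl0 : vl (0, 0, 0) = 0%R. Proof. by rewrite /vl /=; lra. Qed.
Lemma vl1 : vl (1, 0, 0) = 1%R. Proof. by rewrite /vl /=; lra. Qed.
Lemma vlm : vl (0, 1, 0) = (-1)%R. Proof. by rewrite /vl /=; lra. Qed.
(** As ω is standard, the model has all rationals, and a set of them in the model can be compared
    with the lower cut of an outer real. *)
Definition isreal X r := X ⊆ Q3 /\ forall a, cd a ∈ X <-> (vl a < r)%R.
Lemma isreal_uniq X r s : isreal X r -> isreal X s -> r = s.
Proof.
move=> [_ H] [_ K]; have [L|[//|L]] := Rtotal_order r s.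
  have [a Ha] := vl_dense L; have /K/H La : (vl a < s)%R by lra.
  by lra.
have [a Ha] := vl_dense L; have /H/K La : (vl a < r)%R by lra.
by lra.
Qed.
Lemma isreal_ext X Y r : isreal X r -> isreal Y r -> X = Y.
Proof.
move=> [XQ H] [YQ K]; apply: ext => z; split=> [zX|zY].
  by generalize (XQ z zX); move=> /Q3E [a E]; move: zX; rewrite E H K.
by generalize (YQ z zY); move=> /Q3E [a E]; move: zY; rewrite E H K.
Qed.
Lemma mk (P : M -> Prop) r : Df (k := 1) (fun t : tup M 1 => P (hd t)) -> (forall a, P (cd a) <-> (vl a < r)%R) -> isreal (sep Q3 P) r.
Proof.
move=> D H; split=> [z|a]; rewrite sepE //; first by case.
by rewrite H; split=> [[]|] //; split=> //; exact: Q3cd.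
Qed.
Definition R0 : M := sep (powerset Q3) (fun X => ne X /\ (∃ q ∈ Q3, ~ q ∈ X) /\
  (∀ q ∈ X, ∀ p ∈ Q3, ltq p q q1 q0 -> p ∈ X) /\ ∀ q ∈ X, ∃ p ∈ X, ltq q p q1 q0).
Lemma ltq1 a b : ltq (cd a) (cd b) q1 (q0 : M) <-> (vl a < vl b)%R.
Proof. by rewrite ltqE vl0 vl1 Rmult_1_r Rplus_0_r. Qed.
(** Completeness of [Re] supplies the supremum of a cut, and the absence of a largest element keeps
    the supremum itself out of the cut. *)
Lemma R0E X : X ∈ R0 <-> exists r, isreal X r.
Proof.
rewrite sepE; last by df.
rewrite powersetE; split=> [[XQ [[q qX] [[p [pQ Np]] [D U]]]]|[r [XQ H]]].
  have inv z : z ∈ X -> exists a, z = cd a by move=> /XQ /Q3E.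
  have D' a b : cd b ∈ X -> (vl a < vl b)%R -> cd a ∈ X by move=> bX L; apply: (D _ bX); [exact: Q3cd|apply/ltq1].
  generalize (pQ); move=> /Q3E [b Eb]; have [a Ea] := inv q qX.
  have ub a' : cd a' ∈ X -> (vl a' <= vl b)%R.
    by move=> K; apply: Rnot_lt_le => L; apply: Np; rewrite Eb; exact: (D' _ a').
  have [||r [Hr1 Hr2]] := completeness (fun x => exists a, cd a ∈ X /\ x = vl a).
      by exists (vl b) => x [a' [K ->]]; exact: ub.
    by exists (vl a), a; rewrite -Ea.
  exists r; split=> // a'; split=> [K|L].
    have [p' [pX]] := U _ K; have [c Ec] := inv p' pX; rewrite Ec => /ltq1 L.
    by have : (vl c <= r)%R by [apply: Hr1; exists c; rewrite -Ec]; lra.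
  apply: NNPP => NK; suff : (r <= vl a')%R by lra.
  by apply: Hr2 => x [c [cX ->]]; apply: Rnot_lt_le => L'; apply: NK; exact: (D' _ c).
split=> //; split.
  by have [|a Ha] := @vl_dense (r - 1) r; [lra|exists (cd a); apply/H; lra].
split; first by have [|a Ha] := @vl_dense r (r + 1); [lra|exists (cd a); split; [exact: Q3cd|rewrite H; lra]].
split=> [q qX p /Q3E [a ->]|q qX]; generalize (XQ q qX); move=> /Q3E [b Eb]; move: qX; rewrite Eb => /H L.
  by move=> /ltq1 L'; apply/H; lra.
by have [c Hc] := vl_dense L; exists (cd c); split; [apply/H|apply/ltq1]; lra.
Qed.
Definition phi X : Re := epsilon (inhabits 0%R) (isreal X).
Lemma phiE X : X ∈ R0 -> isreal X (phi X).
Proof. by move=> /R0E H; exact: (epsilon_spec (inhabits 0%R) _ H). Qed.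
Lemma phi_eq X r : isreal X r -> X ∈ R0 /\ phi X = r.
Proof. by move=> H; have K : X ∈ R0 by [apply/R0E; exists r]; split=> //; apply: (isreal_uniq (phiE K) H). Qed.
Lemma phi_inj X Y : X ∈ R0 -> Y ∈ R0 -> phi X = phi Y -> X = Y.
Proof. by move=> /phiE H /phiE K E; rewrite E in H; exact: (isreal_ext H K). Qed.
Lemma phi_mem X a : X ∈ R0 -> (cd a ∈ X <-> (vl a < phi X)%R).
Proof. by move=> /phiE []. Qed.
Lemma out_mem X x : X ∈ R0 -> (x ∈ Q3 /\ ~ x ∈ X <-> exists b, x = cd b /\ (phi X <= vl b)%R).
Proof.
move=> HX; split=> [[/Q3E [b ->]]|[b [-> L]]].
  by rewrite phi_mem // => L; exists b; split=> //; lra.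
by split; [exact: Q3cd|rewrite phi_mem //; lra].
Qed.

Definition radd X Y : M := sep Q3 (fun q => ∃ x ∈ X, ∃ y ∈ Y, ltq q x q1 y).
Lemma raddP X Y : X ∈ R0 -> Y ∈ R0 -> radd X Y ∈ R0 /\ phi (radd X Y) = (phi X + phi Y)%R.
Proof.
move=> HX HY; apply: phi_eq; apply: mk => [|a]; first by df.
have [XQ _] := phiE HX; have [YQ _] := phiE HY; split=> [[x [xX [y [yY H]]]]|L].
  generalize (XQ x xX); move=> /Q3E [b Eb]; generalize (YQ y yY); move=> /Q3E [c Ec]; subst x y.
  by move: xX yY H; rewrite ltqE !phi_mem // vl1; lra.
pose e := ((phi X + phi Y - vl a) / 2)%R.
have [|b Hb] := @vl_dense (phi X - e) (phi X); first by rewrite /e; lra.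
have [|c Hc] := @vl_dense (phi Y - e) (phi Y); first by rewrite /e; lra.
exists (cd b); split; first by apply/phi_mem => //; lra.
exists (cd c); split; first by apply/phi_mem => //; lra.
by apply/ltqE; rewrite vl1 /e in Hb Hc *; lra.
Qed.

(** A product of cuts without distinction of signs: [q] lies below the product when it lies below
    the product at all four corners of some rational rectangle around the point. A bilinear function
    has its minimum over a rectangle at a corner. *)
Definition rmul X Y : M := sep Q3 (fun q => ∃ x ∈ X, ∃ x' ∈ Q3, ~ x' ∈ X /\ ∃ y ∈ Y, ∃ y' ∈ Q3, ~ y' ∈ Y /\
  ltq q x y q0 /\ ltq q x y' q0 /\ ltq q x' y q0 /\ ltq q x' y' q0).
Lemma between (q x r x' c : Re) : (x < r <= x' -> q < x * c -> q < x' * c -> q < r * c)%R.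
Proof. move=> H H1 H2; have [K|K] : (0 <= c \/ c < 0)%R by lra. nra. nra. Qed.
Lemma near_product (r s d : Re) : (0 < d)%R -> exists e, (0 < e)%R /\
  forall x y, (Rabs (x - r) <= e -> Rabs (y - s) <= e -> r * s - d < x * y)%R.
Proof.
move=> dp; pose C := (Rabs r + Rabs s + 1)%R; pose proof (Rabs_pos r) as rp; pose proof (Rabs_pos s) as sp.
have Cp : (0 < C)%R by rewrite /C; lra.
(* If [x] and [y] are within [e ≤ 1] of [r] and [s], the product changes by at most
   [e * (e + |r| + |s|) ≤ e * C], and the choice of [e] makes this at most [d / 2]. *)
pose e := Rmin 1 (d / (2 * C)); have e1 : (e <= 1)%R by exact: Rmin_l.
have e2 : (e <= d / (2 * C))%R by exact: Rmin_r.
have ep : (0 < e)%R by apply: Rmin_pos; [lra|apply: Rdiv_lt_0_compat; lra].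
have eC : (e * C < d)%R.
  have : (e * C <= d / (2 * C) * C)%R by apply: Rmult_le_compat_r; lra.
  have -> : (d / (2 * C) * C = d / 2)%R by field; lra.
  by lra.
exists e; split=> // x y Hx Hy.
have -> : (x * y = r * s + ((x - r) * (y - s) + r * (y - s) + s * (x - r)))%R by ring.
set T := (_ * _ + _ + _)%R.
have A : (Rabs T <= e * C)%R.
  apply: (Rle_trans _ (Rabs (x - r) * Rabs (y - s) + Rabs r * Rabs (y - s) + Rabs s * Rabs (x - r))).
    rewrite -!Rabs_mult; apply: (Rle_trans _ _ _ (Rabs_triang _ _)); apply: Rplus_le_compat_r; exact: Rabs_triang.
  generalize (Rabs_pos (x - r)); generalize (Rabs_pos (y - s)); rewrite /C; nra.
generalize (Rle_abs (- T)); rewrite Rabs_Ropp; lra.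
Qed.
Lemma rmulP X Y : X ∈ R0 -> Y ∈ R0 -> rmul X Y ∈ R0 /\ phi (rmul X Y) = (phi X * phi Y)%R.
Proof.
move=> HX HY; apply: phi_eq; apply: mk => [|a]; first by df.
have [XQ _] := phiE HX; have [YQ _] := phiE HY; split.
  move=> [x [xX [x' [xQ [xN [y [yY [y' [yQ [yN H]]]]]]]]]].
  generalize (XQ x xX); move=> /Q3E [b Eb]; generalize (YQ y yY); move=> /Q3E [c Ec].
  have [b' [Eb' Lb]] := proj1 (out_mem x' HX) (conj xQ xN); have [c' [Ec' Lc]] := proj1 (out_mem y' HY) (conj yQ yN).
  subst x x' y y'; move: xX yY H; rewrite !ltqE !phi_mem // vl0 !Rplus_0_r => L1 L2 [H1 [H2 [H3 H4]]].
  rewrite Rmult_comm; apply: (@between _ (vl c) _ (vl c')); first lra.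
    by rewrite Rmult_comm; apply: (@between _ (vl b) _ (vl b')); lra.
  by rewrite Rmult_comm; apply: (@between _ (vl b) _ (vl b')); lra.
move=> L; have [|e [ep He]] := @near_product (phi X) (phi Y) (phi X * phi Y - vl a); first lra.
have [|b Hb] := @vl_dense (phi X - e) (phi X); first lra.
have [|b' Hb'] := @vl_dense (phi X) (phi X + e); first lra.
have [|c Hc] := @vl_dense (phi Y - e) (phi Y); first lra.
have [|c' Hc'] := @vl_dense (phi Y) (phi Y + e); first lra.
have [Q1 Q2] := proj2 (out_mem (cd b') HX) (ex_intro _ b' (conj eq_refl (Rlt_le _ _ (proj1 Hb')))).
have [Q1' Q2'] := proj2 (out_mem (cd c') HY) (ex_intro _ c' (conj eq_refl (Rlt_le _ _ (proj1 Hc')))).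
exists (cd b); split; first by apply/phi_mem => //; lra.
exists (cd b'); split=> //; split=> //.
exists (cd c); split; first by apply/phi_mem => //; lra.
exists (cd c'); split=> //; split=> //.
have A x y : (Rabs (x - phi X) <= e -> Rabs (y - phi Y) <= e -> vl a < x * y + 0)%R by move=> Hx Hy; generalize (He x y Hx Hy); lra.
by rewrite !ltqE vl0; repeat split; apply: A; apply: Rabs_le; lra.
Qed.
Lemma rnegP X : X ∈ R0 -> exists Y, Y ∈ R0 /\ phi Y = (- phi X)%R.
Proof.
move=> HX; exists (sep Q3 (fun q => ∃ x ∈ Q3, ~ x ∈ X /\ ltq q qm x q0)); apply: phi_eq; apply: mk => [|a]; first by df.
split=> [[x [xQ [xN H]]]|L].
  by have [b [E Lb]] := proj1 (out_mem x HX) (conj xQ xN); subst x; move: H; rewrite ltqE vlm vl0; lra.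
have [|b Hb] := @vl_dense (phi X) (- vl a); first lra.
have [Q1 Q2] := proj2 (out_mem (cd b) HX) (ex_intro _ b (conj eq_refl (Rlt_le _ _ (proj1 Hb)))).
by exists (cd b); split=> //; split=> //; rewrite ltqE vlm vl0; lra.
Qed.
Lemma rinv_pos X : X ∈ R0 -> (0 < phi X)%R -> exists Y, Y ∈ R0 /\ phi Y = (/ phi X)%R.
Proof.
move=> HX P; pose proof (Rinv_0_lt_compat _ P) as IP.
exists (sep Q3 (fun q => ∃ x ∈ Q3, ~ x ∈ X /\ ∃ y ∈ Q3, ~ ltq q1 x y q0 /\ ltq q y q1 q0)); apply: phi_eq; apply: mk => [|a]; first by df.
split=> [[x [xQ [xN [y [/Q3E [c ->] [H1 /ltq1 H2]]]]]]|L].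
  have [b [E Lb]] := proj1 (out_mem x HX) (conj xQ xN); subst x; move: H1; rewrite ltqE vl1 vl0 => H1.
  apply: (Rlt_le_trans _ _ _ H2); apply: (Rmult_le_reg_l (phi X)) => //; rewrite Rinv_r; last lra.
  have [K|K] : (0 <= vl c \/ vl c < 0)%R by lra.
    by have : (phi X * vl c <= vl b * vl c)%R; [apply: Rmult_le_compat_r|lra].
  nra.
have [|c Hc] := @vl_dense (Rmax 0 (vl a)) (/ phi X); first by apply: Rmax_lub_lt.
have c0 : (0 < vl c)%R by generalize (Rmax_l 0 (vl a)); lra.
have ca : (vl a < vl c)%R by generalize (Rmax_r 0 (vl a)); lra.
have Xc : (phi X < / vl c)%R by rewrite -(Rinv_inv (phi X)); apply: Rinv_lt_contravar; [apply: Rmult_lt_0_compat; lra|lra].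
have [b Hb] := vl_dense Xc.
have [Q1 Q2] := proj2 (out_mem (cd b) HX) (ex_intro _ b (conj eq_refl (Rlt_le _ _ (proj1 Hb)))).
exists (cd b); split=> //; split=> //; exists (cd c); split; first exact: Q3cd.
split; last exact/ltq1.
rewrite ltqE vl1 vl0; have : (vl b * vl c < / vl c * vl c)%R by apply: Rmult_lt_compat_r; lra.
rewrite Rinv_l; lra.
Qed.
Lemma ratP a : exists X, X ∈ R0 /\ phi X = vl a.
Proof.
exists (sep Q3 (fun q => ltq q (cd a) q1 q0)); apply: phi_eq; apply: mk => [|b]; first by df.
exact: ltq1.
Qed.

Definition addf : M := lam (prod R0 R0) (fun z => radd (pfst z) (psnd z)).
Definition mulf : M := lam (prod R0 R0) (fun z => rmul (pfst z) (psnd z)).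
Definition lef : M := sep (prod R0 R0) (fun z => pfst z ⊆ psnd z).
Lemma opE (F : M -> M -> M) x y : DT (k := 2) (fun t : tup M 2 => F (hd (tl t)) (hd t)) -> x ∈ R0 -> y ∈ R0 ->
  (∀ x ∈ R0, ∀ y ∈ R0, F x y ∈ R0) -> app2 (lam (prod R0 R0) (fun z => F (pfst z) (psnd z))) x y = F x y.
Proof.
move=> D Hx Hy H; rewrite /app2 (app_ap (a := prod R0 R0) (b := R0)); last by apply/pair_prod.
  by rewrite ap_lam; [rewrite pfstE psndE|df|apply/pair_prod].
by apply: lam_fun => [|z /prod_eta [_ [H1 H2]]]; [df|apply: H].
Qed.
Lemma addE x y : x ∈ R0 -> y ∈ R0 -> app2 addf x y ∈ R0 /\ phi (app2 addf x y) = (phi x + phi y)%R.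
Proof.
move=> Hx Hy; rewrite (opE (F := radd)) //; [exact: raddP|by rewrite /radd; df|].
by move=> u Hu v Hv; case: (raddP Hu Hv).
Qed.
Lemma mulE x y : x ∈ R0 -> y ∈ R0 -> app2 mulf x y ∈ R0 /\ phi (app2 mulf x y) = (phi x * phi y)%R.
Proof.
move=> Hx Hy; rewrite (opE (F := rmul)) //; [exact: rmulP|by rewrite /rmul; df|].
by move=> u Hu v Hv; case: (rmulP Hu Hv).
Qed.
Lemma leE x y : opair x y ∈ lef <-> x ∈ R0 /\ y ∈ R0 /\ (phi x <= phi y)%R.
Proof.
rewrite sepE; last by df.
rewrite pair_prod pfstE psndE; split=> [[[Hx Hy] H]|[Hx [Hy L]]].
  split=> //; split=> //; apply: Rnot_lt_le => /vl_dense [a Ha].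
  by have /H : cd a ∈ x; [apply/phi_mem => //; lra|rewrite phi_mem //; lra].
split=> // z zx; have [xQ _] := phiE Hx; generalize (xQ z zx); move=> /Q3E [a E]; move: zx; rewrite E !phi_mem //; lra.
Qed.
Lemma complete_R0 A : A ⊆ R0 -> ne A -> (∃ b ∈ R0, ∀ x ∈ A, opair x b ∈ lef) -> exists b, lub R0 lef A b.
Proof.
move=> AR [x0 x0A] [b [bR Hb]].
have [||r [Hr1 Hr2]] := completeness (fun r => exists x, x ∈ A /\ r = phi x).
    by exists (phi b) => r [x [xA ->]]; generalize (Hb x xA); move=> /leE [_ [_ L]].
  by exists (phi x0), x0.
have IU : isreal (union A) r.
  split=> [z /unionE [x [xA zx]]|a]; first by case: (phiE (AR x xA)) => + _; apply.
  rewrite unionE; split=> [[x [xA]]|L].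
    by rewrite (phi_mem _ (AR x xA)) => L; have : (phi x <= r)%R by [apply: Hr1; exists x]; lra.
  apply: NNPP => K; suff : (r <= vl a)%R by lra.
  by apply: Hr2 => s [x [xA ->]]; apply: Rnot_lt_le => L'; apply: K; exists x; split=> //; apply/(phi_mem _ (AR x xA)).
have [UR EU] := phi_eq IU; exists (union A); split.
  by split=> // x xA; apply/leE; split; [exact: AR|split=> //; rewrite EU; apply: Hr1; exists x].
move=> c cR Hc; apply/leE; split=> //; split=> //; rewrite EU; apply: Hr2 => s [x [xA ->]].
by generalize (Hc x xA); move=> /leE [_ []].
Qed.

(** The image may be a proper subfield of [Re]; its density is what transfers strict inequalities
    and suprema. *)
Record real_embedding (K : real_field M) (phi : M -> Re) : Prop := {
  emb_inj : ∀ x ∈ R K, ∀ y ∈ R K, phi x = phi y -> x = y;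
  emb_add : ∀ x ∈ R K, ∀ y ∈ R K, phi (app2 (add K) x y) = (phi x + phi y)%R;
  emb_mul : ∀ x ∈ R K, ∀ y ∈ R K, phi (app2 (mul K) x y) = (phi x * phi y)%R;
  emb_le : ∀ x ∈ R K, ∀ y ∈ R K, opair x y ∈ le K <-> (phi x <= phi y)%R;
  emb_one : phi (one K) = 1%R;
  emb_dense : forall a b, (a < b)%R -> ∃ x ∈ R K, (a < phi x < b)%R
}.
Lemma op_fun (F : M -> M -> M) : DT (k := 2) (fun t : tup M 2 => F (hd (tl t)) (hd t)) ->
  (∀ x ∈ R0, ∀ y ∈ R0, F x y ∈ R0) -> is_function (lam (prod R0 R0) (fun z => F (pfst z) (psnd z))) (prod R0 R0) R0.
Proof. by move=> D H; apply/funsE; apply: lam_fun => [|z /prod_eta [_ [H1 H2]]]; [df|apply: H]. Qed.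
Ltac field_eq aR mR aE mE := apply: phi_inj; repeat first [assumption | apply aR | apply mR]; rewrite !(aE, mE); repeat first [assumption | apply aR | apply mR].
Lemma reals_exist : exists K phi, real_embedding K phi.
Proof.
have [z [zR Ez]] := ratP (0, 0, 0); have [e [eR Ee]] := ratP (1, 0, 0); rewrite vl0 in Ez; rewrite vl1 in Ee.
have aR x y : x ∈ R0 -> y ∈ R0 -> app2 addf x y ∈ R0 by move=> Hx Hy; case: (addE Hx Hy).
have aE x y : x ∈ R0 -> y ∈ R0 -> phi (app2 addf x y) = (phi x + phi y)%R by move=> Hx Hy; case: (addE Hx Hy).
have mR x y : x ∈ R0 -> y ∈ R0 -> app2 mulf x y ∈ R0 by move=> Hx Hy; case: (mulE Hx Hy).
have mE x y : x ∈ R0 -> y ∈ R0 -> phi (app2 mulf x y) = (phi x * phi y)%R by move=> Hx Hy; case: (mulE Hx Hy).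
have F1 : is_function addf (prod R0 R0) R0 by apply: op_fun; [rewrite /radd; df|move=> x Hx y Hy; case: (raddP Hx Hy)].
have F2 : is_function mulf (prod R0 R0) R0 by apply: op_fun; [rewrite /rmul; df|move=> x Hx y Hy; case: (rmulP Hx Hy)].
have F3 : lef ⊆ prod R0 R0 by move=> p; rewrite sepE; [case|df].
have L3 x y z' : opair x y ∈ lef -> opair y z' ∈ lef -> opair x z' ∈ lef.
  by move=> /leE [Hx [_ L]] /leE [_ [Hz L']]; apply/leE; split=> //; split=> //; lra.
have [K [E1 [E2 [E3 [E4 E5]]]]] : exists K : real_field M, R K = R0 /\ add K = addf /\ mul K = mulf /\ le K = lef /\ one K = e.
{ have neg x : x ∈ R0 -> ∃ y ∈ R0, app2 addf x y = z.
    move=> Hx; have [y [Hy Ey]] := rnegP Hx; exists y; split=> //; field_eq aR mR aE mE; rewrite Ey Ez; ring.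
  have inv x : x ∈ R0 -> x <> z -> ∃ y ∈ R0, app2 mulf x y = e.
    move=> Hx xz; have P : phi x <> 0%R by move=> E; apply: xz; apply: phi_inj => //; rewrite Ez.
    have [y [Hy Ey]] : exists y, y ∈ R0 /\ phi y = (/ phi x)%R.
      have [L|[//|L]] := Rtotal_order 0 (phi x); first exact: rinv_pos.
        by move=> E; case: P.
      have [x' [Hx' Ex']] := rnegP Hx; have [|y' [Hy' Ey']] := rinv_pos Hx'; first by rewrite Ex'; lra.
      have [y [Hy Ey]] := rnegP Hy'; exists y; split=> //; rewrite Ey Ey' Ex'; field; lra.
    exists y; split=> //; field_eq aR mR aE mE; rewrite Ey Ee; field; lra.
  unshelve eexists (Build_real_field F1 F2 F3 zR eR _ _ _ _ _ _ _ _ _ _ _ _ _ _ _ _) => //.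
  - by move=> x Hx y Hy u Hu; field_eq aR mR aE mE; ring.
  - by move=> x Hx y Hy; field_eq aR mR aE mE; ring.
  - by move=> x Hx; field_eq aR mR aE mE; rewrite Ez; ring.
  - by move=> x Hx y Hy u Hu; field_eq aR mR aE mE; ring.
  - by move=> x Hx y Hy; field_eq aR mR aE mE; ring.
  - by move=> x Hx; field_eq aR mR aE mE; rewrite Ee; ring.
  - by move=> x Hx y Hy u Hu; field_eq aR mR aE mE; ring.
  - by move=> E; move: Ee; rewrite E Ez; lra.
  - by move=> x Hx y Hy u Hu; exact: L3.
  - by move=> x Hx y Hy /leE [_ [_ L]] /leE [_ [_ L']]; apply: phi_inj => //; lra.
  - by move=> x Hx y Hy; have [L|L] := Rle_or_lt (phi x) (phi y); [left|right]; apply/leE; split=> //; split=> //; lra.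
  - move=> x Hx y Hy u Hu /leE [_ [_ L]]; apply/leE; split; first exact: aR.
    by split; [exact: aR|rewrite !aE //; lra].
  - move=> x Hx y Hy /leE [_ [_ L]] /leE [_ [_ L']]; apply/leE; split=> //.
    by split; [exact: mR|rewrite mE // Ez; apply: Rmult_le_pos; lra].
  - exact: complete_R0. }
exists K, phi; split; rewrite ?E1 ?E2 ?E3 ?E4 ?E5 //.
- by move=> x Hx y Hy; exact: phi_inj.
- by move=> x Hx y Hy; exact: aE.
- by move=> x Hx y Hy; exact: mE.
- by move=> x Hx y Hy; split=> [/leE [_ []]|L] //; apply/leE.
- move=> a b /vl_dense [q Hq]; have [x [Hx Ex]] := ratP q; exists x; split=> //; rewrite Ex //.
Qed.
End Cuts.

(** * Outer measure *)

Fixpoint psum (f : nat -> Re) (n : nat) : Re := match n with 0 => 0%R | S n => (psum f n + f n)%R end.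
Section Sums.
Open Scope R_scope.
Implicit Types (f g : nat -> Re) (r : Re).
Lemma psum_le f g n : (forall i, (i < n)%nat -> f i <= g i) -> psum f n <= psum g n.
Proof. elim: n => [|n IH] H /=; first lra. by apply: Rplus_le_compat; [apply: IH => i Hi; apply: H; lia|apply: H; lia]. Qed.
Lemma psum_ext f g n : (forall i, (i < n)%nat -> f i = g i) -> psum f n = psum g n.
Proof. by move=> H; apply: Rle_antisym; apply: psum_le => i /H ->; lra. Qed.
Lemma psum_plus f g n : psum (fun i => f i + g i) n = psum f n + psum g n.
Proof. elim: n => [|n /= ->] /=; lra. Qed.
Lemma psum0 n : psum (fun _ => 0) n = 0.
Proof. elim: n => [|n /= ->] /=; lra. Qed.
Lemma psum_scal a f n : psum (fun i => a * f i) n = a * psum f n.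
Proof. elim: n => [|n /= ->] /=; lra. Qed.
Lemma psum_mono f m n : (forall i, 0 <= f i) -> (m <= n)%nat -> psum f m <= psum f n.
Proof. by move=> H; elim=> [|k _ IH] /=; [lra|generalize (H k); lra]. Qed.
Lemma psum_swap (f : nat -> nat -> Re) m n : psum (fun i => psum (f i) n) m = psum (fun k => psum (fun i => f i k) m) n.
Proof. elim: m => [|m IH] /=; first by rewrite psum0. by rewrite IH -psum_plus. Qed.
Lemma psum_term f n i : (forall i, 0 <= f i) -> (i < n)%nat -> f i <= psum f n.
Proof.
move=> H Hi; apply: (Rle_trans _ (psum f (S i))); last exact: psum_mono.
have : 0 <= psum f i; last by move=> /=; lra.
by generalize (psum_mono (m := 0) (n := i) H); move=> /(_ (Nat.le_0_l i)).
Qed.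
Lemma psum_one f n v : 0 <= v -> (forall i, f i = 0 \/ f i = v) -> (forall i j, f i <> 0 -> f j <> 0 -> i = j) -> psum f n <= v.
Proof.
move=> v0 H U; have [Z|[i Hi]] : (forall i, (i < n)%nat -> f i = 0) \/ exists i, (i < n)%nat /\ f i <> 0.
    case: (classic (exists i, (i < n)%nat /\ f i <> 0)) => K; [by right|left => i Hi].
    by apply: NNPP => N; apply: K; exists i.
  by rewrite (psum_ext (g := fun _ => 0)) // psum0.
elim: n i Hi => [|n IH] i [Hi Ni] /=; first lia.
have [Z|Z] := classic (f n = 0).
  rewrite Z Rplus_0_r; apply: (IH i); split=> //.
  by have [//|E] : (i < n)%nat \/ i = n by [lia]; case: Ni; rewrite E.
rewrite (psum_ext (g := fun _ => 0)) ?psum0; first by case: (H n) => -> ; lra.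
move=> j Hj; apply: NNPP => Nj; generalize (U j n Nj Z); lia.
Qed.
Definition hf (n : nat) : Re := (/ 2) ^ n.
Lemma hf_pos n : 0 < hf n.
Proof. by apply: pow_lt; lra. Qed.
Lemma hfS n : hf (S n) = hf n / 2.
Proof. by rewrite /hf /=; lra. Qed.
Lemma hfD m n : hf (m + n) = hf m * hf n.
Proof. exact: pow_add. Qed.
Lemma hf_small e : 0 < e -> exists n, hf n < e.
Proof.
move=> ep; have [|n Hn] := pow_lt_1_zero (/ 2) _ e ep; first by rewrite Rabs_pos_eq; lra.
exists n; generalize (Hn n (Nat.le_refl n)); rewrite Rabs_pos_eq //; apply: Rlt_le; exact: hf_pos.
Qed.
Lemma psum_hf n : psum (fun k => hf (S k)) n = 1 - hf n.
Proof. elim: n => [|n /= ->]; first by rewrite /hf /=; lra. by rewrite hfS; lra. Qed.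
Lemma le_small a b : (forall n, a <= b + hf n) -> a <= b.
Proof.
move=> H; apply: Rnot_lt_le => L; have [|n Hn] := @hf_small (a - b); first lra.
by generalize (H n); lra.
Qed.
Definition tot f r := forall n, psum f n <= r.
(** Partial sums of both series grow, so the supremum for one may be taken while a partial sum of
    the other is held fixed; doing this twice adds the two suprema. *)
Lemma tot_split f g r a b : (forall i, 0 <= f i) -> (forall i, 0 <= g i) -> tot (fun i => f i + g i) r ->
  (forall r1, tot f r1 -> a <= r1) -> (forall r2, tot g r2 -> b <= r2) -> a + b <= r.
Proof.
move=> f0 g0 H Ha Hb; suff : a <= r - b by lra.
apply: Ha => n; suff : b <= r - psum f n by lra.
apply: Hb => m; generalize (H (n + m)%nat); rewrite psum_plus.
generalize (psum_mono (m := n) (n := n + m) f0); generalize (psum_mono (m := m) (n := n + m) g0); move=> /(_ ltac:(lia)) + /(_ ltac:(lia)); lra.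
Qed.
End Sums.

(* [dg x i] is the value of [x] at [i]; [wtn s n] is the measure of the cone of [s] if [s] has length [n]. *)
Section Weights.
Context {M : structure} {HM : ZFCw M}.
Notation N n := (nat_in M n).
Notation w := (omega M).
Implicit Types (s t x c A : M).
Definition dg x i : nat := epsilon (inhabits 0) (fun k => ap x (N i) = N k).
Lemma dgE x i k : ap x (N i) = N k -> dg x i = k.
Proof. by move=> H; apply: (nat_inj (M := M)); rewrite -H; symmetry; apply: (epsilon_spec (inhabits 0) (fun k => ap x (N i) = N k)); exists k. Qed.
Fixpoint wtn s n : Re := match n with 0 => 1%R | S n => (wtn s n * hf (S (dg s n)))%R end.
Definition ln s : nat := epsilon (inhabits 0) (fun n => s ∈ funs (N n) w).
Definition wt s : Re := wtn s (ln s).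
Lemma len_uniq s m n : s ∈ funs (N m) w -> s ∈ funs (N n) w -> m = n.
Proof.
move=> Hm Hn; have [/nat_sub A _] := proj1 (fsub Hm Hn) (fun z zs => zs); have [/nat_sub B _] := proj1 (fsub Hn Hm) (fun z zs => zs); lia.
Qed.
Lemma wtE s n : s ∈ funs (N n) w -> wt s = wtn s n.
Proof.
move=> H; rewrite /wt; suff -> : ln s = n by [].
by apply: (len_uniq (s := s)) => //; apply: (epsilon_spec (inhabits 0) (fun n => s ∈ funs (N n) w)); exists n.
Qed.
Lemma wtn_ext s t n : (forall i, i < n -> ap s (N i) = ap t (N i)) -> wtn s n = wtn t n.
Proof. by elim: n => //= n IH H; rewrite IH => [|i Hi]; [rewrite /dg H|apply: H; lia]. Qed.
Lemma wtn_pos s n : (0 < wtn s n <= hf n)%R.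
Proof.
elim: n => [|n IH] /=; first by rewrite /hf /=; lra.
have [P1 P2] : (0 < hf (S (dg s n)) <= / 2)%R.
  split; first exact: hf_pos.
  rewrite hfS; have : (hf (dg s n) <= 1)%R; last lra.
  by elim: (dg s n) => [|k K]; [rewrite /hf /=; lra|rewrite hfS; generalize (hf_pos k); lra].
rewrite [hf (S n)]hfS; set h := hf (S (dg s n)) in P1 P2 *; split; nra.
Qed.
Lemma wt_pos s : (0 < wt s)%R. Proof. by case: (wtn_pos s (ln s)). Qed.
Lemma wt_sub s t n m : s ∈ funs (N n) w -> t ∈ funs (N m) w -> s ⊆ t -> (wt t <= wt s)%R.
Proof.
move=> Hs Ht /(fsub Hs Ht) [/nat_sub nm E]; rewrite (wtE Hs) (wtE Ht).
rewrite (wtn_ext (s := s) (t := t) (n := n)); last by move=> i Hi; apply: E; apply/nat_lt.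
elim: nm => [|k _ IH] /=; first lra.
generalize (wtn_pos t k); pose proof (wtn_pos t (S k)) as P; move: P; rewrite /=.
have P : (hf (S (dg t k)) <= 1)%R.
  by elim: (S (dg t k)) => [|j K]; [rewrite /hf /=; lra|rewrite hfS; generalize (hf_pos j); lra].
nra.
Qed.
Lemma wt_snoc s k n : s ∈ funs (N n) w -> wt (snoc s (N k) n) = (wt s * hf (S k))%R.
Proof.
move=> Hs; have [H [st [_ E]]] := snocP Hs (nat_omega (M := M) k); rewrite (wtE H) (wtE Hs) /= (dgE E); congr (_ * _)%R.
by apply: wtn_ext => i Hi; have [_ K] := proj1 (fsub Hs H) st; rewrite K //; apply/nat_lt.
Qed.
Lemma snoc_inj s j k n t : s ∈ funs (N n) w -> t ∈ FS -> snoc s (N j) n ⊆ t -> snoc s (N k) n ⊆ t -> j = k.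
Proof.
move=> Hs /FSE [m Ht] Hj Hk; have [H1 [_ [_ E1]]] := snocP Hs (nat_omega (M := M) j); have [H2 [_ [_ E2]]] := snocP Hs (nat_omega (M := M) k).
have nn : N n ∈ N (S n) by apply/nat_lt.
have [_ K1] := proj1 (fsub H1 Ht) Hj; have [_ K2] := proj1 (fsub H2 Ht) Hk.
by apply: (nat_inj (M := M)); rewrite -E1 -E2 K1 // K2.
Qed.
Lemma nat_rec_fun X a (F : M -> M -> M) : DT (k := 2) (fun t : tup M 2 => F (hd (tl t)) (hd t)) -> a ∈ X ->
  (∀ n ∈ w, ∀ x ∈ X, F n x ∈ X) -> exists f, f ∈ funs w X /\ ap f (empty M) = a /\ ∀ n ∈ w, ap f (succ n) = F n (ap f n).
Proof.
move=> D aX H; have [||f [Hf [f0 fS]]] := dependent_choice (X := X) (Rl := fun n x y => y = F n x) _ aX; first by df.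
  by move=> n no x xX; exists (F n x); split=> //; exact: H.
by exists f.
Qed.
Lemma FS_enum : exists u, bij u w FS.
Proof.
apply/eqpE; apply: csb; last exact: ctbl_FS.
apply: (lec_lam (F := fun n => sing (opair (N 0) n))); first by df.
  move=> n no; apply/FSE; exists 1; apply/funsE.
  split=> [z /singE ->|i /nat_mem [j [j1 ->]]]; first by apply/pair_prod; split=> //; apply/nat_lt; lia.
  have -> : j = 0 by lia.
  by exists n; split; [apply/singE|move=> y /singE /opair_inj [_ ->]].
move=> m mo n no E; have : opair (N 0) m ∈ sing (opair (N 0) n) by rewrite -E; apply/singE.
by move/singE => /opair_inj [_ ->].
Qed.
End Weights.

(** * Construction of the outer measure *)

Section Outer.
Context {M : structure} {HM : ZFCw M}.
Variables (K : real_field M) (phi : M -> Re).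
Hypothesis EM : real_embedding K phi.
Notation N n := (nat_in M n).
Notation w := (omega M).
Notation RK := (R K).
Notation lez x y := (opair x y ∈ le K).
Implicit Types (s t x y z c A B : M).
Hint Resolve DT_cone DT_nadd : df.

Definition pl x y : M := ap (add K) (opair x y).
Definition ml x y : M := ap (mul K) (opair x y).
Lemma DT_pl k (x y : tup M k -> M) : DT x -> DT y -> DT (fun z0 : tup M k => pl (x z0) (y z0)).
Proof. by move=> *; rewrite /pl; df. Qed.
Lemma DT_ml k (x y : tup M k -> M) : DT x -> DT y -> DT (fun z0 : tup M k => ml (x z0) (y z0)).
Proof. by move=> *; rewrite /ml; df. Qed.
Hint Resolve DT_pl DT_ml : df.
Lemma plE x y : x ∈ RK -> y ∈ RK -> app2 (add K) x y = pl x y /\ pl x y ∈ RK /\ phi (pl x y) = (phi x + phi y)%R.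
Proof.
move=> Hx Hy; have HF : add K ∈ funs (prod RK RK) RK by apply/funsE; exact: add_fun.
have P : opair x y ∈ prod RK RK by apply/pair_prod.
have E : app2 (add K) x y = pl x y by exact: (app_ap HF P).
by split=> //; split; [exact: (ap_in HF P)|rewrite -E; apply: (emb_add EM)].
Qed.
Lemma mlE x y : x ∈ RK -> y ∈ RK -> app2 (mul K) x y = ml x y /\ ml x y ∈ RK /\ phi (ml x y) = (phi x * phi y)%R.
Proof.
move=> Hx Hy; have HF : mul K ∈ funs (prod RK RK) RK by apply/funsE; exact: mul_fun.
have P : opair x y ∈ prod RK RK by apply/pair_prod.
have E : app2 (mul K) x y = ml x y by exact: (app_ap HF P).
by split=> //; split; [exact: (ap_in HF P)|rewrite -E; apply: (emb_mul EM)].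
Qed.
Lemma phi_zero : phi (zero K) = 0%R.
Proof.
pose proof (zero_in K) as z; have E : pl (zero K) (zero K) = zero K by rewrite -(proj1 (plE z z)); apply: add0.
by have [_ [_ ]] := plE z z; rewrite E; lra.
Qed.
Lemma lezE x y : x ∈ RK -> y ∈ RK -> (lez x y <-> (phi x <= phi y)%R).
Proof. by move=> Hx Hy; apply: (emb_le EM). Qed.
Lemma phi_lub A b r : lub RK (le K) A b -> A ⊆ RK -> (∀ x ∈ A, (phi x <= r)%R) -> (phi b <= r)%R.
Proof.
move=> [[bR _] H] AR Hr; apply: Rnot_lt_le => /(emb_dense EM) [z [zR Hz]].
have L : lez b z by apply: H => // x xA; apply/lezE => //; [exact: AR|generalize (Hr x xA); lra].
by move/(lezE bR zR): L; lra.
Qed.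
Lemma halves : exists h, h ∈ funs w RK /\ forall n, phi (ap h (N n)) = hf (S n).
Proof.
pose proof (one_in K) as oR; have [_ [tR tE]] := plE oR oR; rewrite (emb_one EM) in tE.
have [|y [yR Ey]] := mulV tR; first by move=> E; move: tE; rewrite E phi_zero; lra.
have [E1 [_ E2]] := mlE tR yR; rewrite -E1 Ey tE (emb_one EM) in E2.
have yE : phi y = (/ 2)%R by lra.
have [||h [Hh [h0 hS]]] := nat_rec_fun (F := fun n x => ml x y) _ yR; first by df.
  by move=> n _ x xR; case: (mlE xR yR) => _ [].
exists h; split=> //; elim=> [|n IH]; first by rewrite h0 /hf /=; lra.
pose proof (nat_omega (M := M) n) as no; have [_ [_ E]] := mlE (ap_in Hh no) yR.
by rewrite [N _]/(succ (N n)) hS // E IH (hfS (S n)) yE.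
Qed.

Variables (u h : M).
Hypotheses (Hu : bij u w FS) (Hh : h ∈ funs w RK) (hE : forall n, phi (ap h (N n)) = hf (S n)).
(** [wt] takes outer real values. Separation and choice in the model need the weights as elements of
    its field, found as the last terms of sequences of partial products. *)
Lemma weight_fun : exists wf, ∀ s ∈ FS, ap wf s ∈ RK /\ phi (ap wf s) = wt s.
Proof.
pose Q s z := ∃ p ∈ funs w RK, ∃ n ∈ w, s ∈ funs n w /\ ap p (empty M) = one K /\
  (∀ i ∈ n, ap p (succ i) = ml (ap p i) (ap h (ap s i))) /\ z = ap p n.
have [||wf Hwf] := choice_fam (a := FS) (Y := fun s => sep RK (Q s)); first by rewrite /Q; df.
{ move=> s /FSE [n Hs].
  have [|||p [Hp [p0 pS]]] := nat_rec_fun (X := RK) (a := one K) (F := fun i x => ite (i ∈ N n) (ml x (ap h (ap s i))) x).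
  - by df.
  - exact: one_in.
  - move=> i iw x xR; case: (classic (i ∈ N n)) => Hi; [rewrite iteT //|by rewrite iteF].
    by have [_ []] := mlE xR (ap_in Hh (ap_in Hs Hi)).
  - pose proof (nat_omega (M := M) n) as no; exists (ap p (N n)); rewrite sepE; last by rewrite /Q; df.
    split; first exact: (ap_in Hp); exists p; split=> //; exists (N n); split=> //; split=> //; split=> //; split=> // i Hi.
    by rewrite pS; [rewrite iteT|apply: (ord_tr ord_omega no Hi)]. }
exists wf => s sF; generalize (Hwf s sF); rewrite sepE; last by rewrite /Q; df.
move=> [aR [p [Hp [n' [/omegaE [n ->] [Hs [p0 [pS ->]]]]]]]]; split; first by apply: (ap_in Hp); exact: nat_omega.
rewrite (wtE Hs).
have : forall m, m <= n -> phi (ap p (N m)) = wtn s m; last by apply.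
elim=> [|m IH] mn; first by rewrite p0 (emb_one EM).
have mi : N m ∈ N n by apply/nat_lt.
generalize (ap_in Hs mi); move=> /omegaE [k Ek]; pose proof (nat_omega (M := M) m) as mo.
have [_ [_ E]] := mlE (ap_in Hp mo) (ap_in Hh (ap_in Hs mi)).
by rewrite [N _]/(succ (N m)) pS // E IH ?Ek ?hE /= ?(dgE Ek) //; lia.
Qed.

Definition W i : Re := wt (ap u (N i)).
Definition fc c i : Re := match excluded_middle_informative (N i ∈ c) with left _ => W i | right _ => 0%R end.
Lemma uF i : ap u (N i) ∈ FS. Proof. by apply: (ap_in (proj1 (proj1 Hu))); exact: nat_omega. Qed.
Lemma u_surj s : s ∈ FS -> exists i, ap u (N i) = s.
Proof. by move=> /(proj2 Hu) [i [/omegaE [k ->] E]]; exists k. Qed.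
Lemma W_pos i : (0 < W i)%R. Proof. exact: wt_pos. Qed.
Lemma fc_in c i : N i ∈ c -> fc c i = W i.
Proof. by rewrite /fc; case: excluded_middle_informative. Qed.
Lemma fc_out c i : ~ N i ∈ c -> fc c i = 0%R.
Proof. by rewrite /fc; case: excluded_middle_informative. Qed.
Lemma fc_ge0 c i : (0 <= fc c i)%R.
Proof. by rewrite /fc; case: excluded_middle_informative => _; [apply: Rlt_le; exact: W_pos|lra]. Qed.
Lemma fc_sub c d i : (N i ∈ c -> N i ∈ d) -> (fc c i <= fc d i)%R.
Proof.
move=> H; case: (classic (N i ∈ c)) => Hc; first by rewrite !fc_in //; [lra|exact: H].
by rewrite fc_out //; exact: fc_ge0.
Qed.
Lemma sums_fun wf : (∀ s ∈ FS, ap wf s ∈ RK /\ phi (ap wf s) = wt s) ->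
  exists SS, ∀ c ∈ powerset w, ap SS c ∈ funs w RK /\ forall n, phi (ap (ap SS c) (N n)) = psum (fc c) n.
Proof.
move=> Hw; pose F c n x := ite (n ∈ c) (pl x (ap wf (ap u n))) x.
have FR c n x : n ∈ w -> x ∈ RK -> F c n x ∈ RK.
  move=> no xR; rewrite /F; case: (classic (n ∈ c)) => H; last by rewrite iteF.
  by rewrite iteT //; have [wR _] := Hw _ (ap_in (proj1 (proj1 Hu)) no); case: (plE xR wR) => _ [].
have [||SS HS] := choice_fam (a := powerset w) (Y := fun c => sep (funs w RK) (fun S => ap S (empty M) = zero K /\
   ∀ n ∈ w, ap S (succ n) = F c n (ap S n))); first by rewrite /F; df.
{ move=> c _; have [|||S [HS [S0 SE]]] := nat_rec_fun (X := RK) (a := zero K) (F := F c).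
  - by rewrite /F; df.
  - exact: zero_in.
  - by move=> n no x; exact: FR.
  - by exists S; rewrite sepE; [|rewrite /F; df]. }
exists SS => c cP; generalize (HS c cP); rewrite sepE; last by rewrite /F; df.
move=> [SR [S0 SE]]; split=> //; elim=> [|n IH]; first by rewrite S0 phi_zero.
pose proof (nat_omega (M := M) n) as no; rewrite [N _]/(succ (N n)) SE // /F /=.
case: (classic (N n ∈ c)) => H; last by rewrite iteF // IH fc_out //; lra.
rewrite iteT //; have [wR wE] := Hw _ (uF n); have [_ [_ ->]] := plE (ap_in SR no) wR.
by rewrite IH wE fc_in.
Qed.

Definition covers c A := c ⊆ w /\ ∀ x ∈ A, ∃ i ∈ c, ap u i ⊆ x.
Definition upper (SS : M) c z := ∀ n ∈ w, lez (ap (ap SS c) n) z.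
(** The field axiom provides suprema, so the infimum of the totals of covers is taken as the
    supremum of their lower bounds. *)
Definition Low (SS : M) A : M := sep RK (fun z => ∀ c ∈ powerset w, covers c A -> ∀ z' ∈ RK, upper SS c z' -> lez z z').
Lemma e0F : empty M ∈ FS.
Proof. by apply/FSE; exists 0; apply/funsE; split=> [z /emptyE|x /emptyE]. Qed.
Lemma wt0 : wt (empty M) = 1%R.
Proof. by rewrite (wtE (n := 0)) //; apply/funsE; split=> [z /emptyE|x /emptyE]. Qed.
Lemma tot_sing i : tot (fc (sing (N i))) (W i).
Proof.
move=> n; have S j : N j ∈ sing (N i) -> j = i by move=> /singE /nat_inj.
apply: psum_one; first by apply: Rlt_le; exact: W_pos.
  by move=> j; case: (classic (N j ∈ sing (N i))) => H; [right; rewrite fc_in // (S j H)|left; rewrite fc_out].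
have T j : fc (sing (N i)) j <> 0%R -> j = i.
  by move=> H; apply: S; apply: NNPP => Nj; apply: H; rewrite fc_out.
by move=> j k /T -> /T ->.
Qed.

Section Values.
Variables (SS : M).
Hypothesis SSP : ∀ c ∈ powerset w, ap SS c ∈ funs w RK /\ forall n, phi (ap (ap SS c) (N n)) = psum (fc c) n.
Lemma upperE c z : c ⊆ w -> z ∈ RK -> (upper SS c z <-> tot (fc c) (phi z)).
Proof.
move=> /powersetE cw zR; have [SR SE] := SSP cw; split=> [H n|H n' /omegaE [n ->]].
  pose proof (nat_omega (M := M) n) as no; rewrite -SE; apply/lezE => //; [exact: (ap_in SR)|exact: H].
apply/lezE => //; first by apply: (ap_in SR); exact: nat_omega.
by rewrite SE.
Qed.
Lemma LowE A z : z ∈ Low SS A <-> z ∈ RK /\ forall c z', covers c A -> z' ∈ RK -> tot (fc c) (phi z') -> (phi z <= phi z')%R.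
Proof.
rewrite sepE; last by rewrite /covers /upper; df.
split=> -[zR H]; split=> //.
  by move=> c z' Hc z'R Ht; apply/lezE => //; apply: (H c) => //; [apply/powersetE; case: Hc|apply/upperE => //; case: Hc].
by move=> c cw Hc z' z'R /upperE Ht; apply/lezE => //; apply: (H c) => //; apply: Ht => //; case: Hc.
Qed.
Lemma measure_fun : exists mS, ∀ A ∈ powerset (baire M), lub RK (le K) (Low SS A) (ap mS A).
Proof.
have [||mS H] := choice_fam (a := powerset (baire M)) (Y := fun A => sep RK (lub RK (le K) (Low SS A))).
- by rewrite /lub /Low /covers /upper; df.
- move=> A /powersetE AB; have [|||b Hb] := @complete M K (Low SS A).
  + by move=> z /LowE [].
  + exists (zero K); apply/LowE; split; first exact: zero_in.
    by move=> c z' Hc z'R /(_ 0) /=; rewrite phi_zero.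
  + exists (one K); split; first exact: one_in.
    move=> z /LowE [zR Hz]; apply/lezE => //; first exact: one_in.
    have [i Ei] := u_surj e0F; apply: (Hz (sing (N i))); [|exact: one_in|].
      split=> [x /singE ->|x xA]; first exact: nat_omega.
      by exists (N i); split; [apply/singE|rewrite Ei => y /emptyE].
    by rewrite (emb_one EM) -wt0 -Ei; exact: tot_sing.
  + exists b; rewrite sepE; last by rewrite /lub /Low /covers /upper; df.
    by split=> //; case: Hb => -[].
- exists mS => A AB; generalize (H A AB); rewrite sepE; first by case.
  by rewrite /lub /Low /covers /upper; df.
Qed.
End Values.
End Outer.

(** * Subadditivity, cones and Caratheodory measurability *)

Section OuterMeasure.
Context {M : structure} {HM : ZFCw M}.
Variables (K : real_field M) (phi : M -> Re).
Hypothesis EM : real_embedding K phi.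
Notation N n := (nat_in M n).
Notation w := (omega M).
Notation RK := (R K).
Implicit Types (s t x y z c A B : M).
Hint Resolve DT_cone DT_nadd DT_pl DT_ml : df.
Variables (u h SS mS : M).
Hypotheses (Hu : bij u w FS) (Hh : h ∈ funs w RK) (hE : forall n, phi (ap h (N n)) = hf (S n)).
Hypothesis SSP : ∀ c ∈ powerset w, ap SS c ∈ funs w RK /\ forall n, phi (ap (ap SS c) (N n)) = psum (fc u c) n.
Hypothesis mSP : ∀ A ∈ powerset (baire M), lub RK (le K) (Low K u SS A) (ap mS A).
Notation fc := (fc u).
Notation cov := (covers u).
Definition om A : Re := phi (ap mS A).

Lemma mS_lub A : A ⊆ baire M -> lub RK (le K) (Low K u SS A) (ap mS A) /\ ap mS A ∈ RK.
Proof. by move=> AB; have L : lub RK (le K) (Low K u SS A) (ap mS A) by [apply: mSP; apply/powersetE]; split=> //; case: L => -[]. Qed.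
Lemma om_cover A c r : A ⊆ baire M -> cov c A -> tot (fc c) r -> (om A <= r)%R.
Proof.
move=> AB Hc Ht; have [L _] := mS_lub AB; apply: (phi_lub EM L) => [z /(LowE EM SSP) []|z /(LowE EM SSP) [zR H]] //.
apply: Rnot_lt_le => /(emb_dense EM) [z' [z'R Hz]]; suff : (phi z <= phi z')%R by lra.
by apply: (H c) => // n; generalize (Ht n); lra.
Qed.
Lemma om_near A r : A ⊆ baire M -> (om A < r)%R -> exists c, cov c A /\ tot (fc c) r.
Proof.
move=> AB /(emb_dense EM) [z [zR Hz]]; apply: NNPP => NE; have [[[_ L] _] bR] := mS_lub AB.
have zL : z ∈ Low K u SS A.
  apply/(LowE EM SSP); split=> // c z' Hc z'R Ht; apply: Rnot_lt_le => Lz; apply: NE; exists c; split=> // n.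
  by generalize (Ht n); lra.
by move/(lezE EM zR bR): (L z zL); rewrite -/(om A); lra.
Qed.
Lemma om_ge0 A : A ⊆ baire M -> (0 <= om A)%R.
Proof.
move=> AB; apply: Rnot_lt_le => L; have [|c [_ /(_ 0)]] /= := om_near (r := (om A / 2)%R) AB; lra.
Qed.
Lemma om_mono A B : A ⊆ B -> B ⊆ baire M -> (om A <= om B)%R.
Proof.
move=> AB BB; apply: Rnot_lt_le => L; have [|c [[cw Hc] Ht]] := om_near (r := ((om A + om B) / 2)%R) BB; first lra.
have : (om A <= (om A + om B) / 2)%R; last lra.
by apply: (@om_cover _ c) => //; [move=> x /AB /BB|split=> // x /AB /Hc].
Qed.
Lemma om_cup A B : A ⊆ baire M -> B ⊆ baire M -> (om (cup A B) <= om A + om B)%R.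
Proof.
move=> AB BB; apply: le_small => n; pose proof (hf_pos (S n)) as Hn.
have [|c [[cw Hc] Tc]] := om_near (r := (om A + hf (S n))%R) AB; first lra.
have [|d [[dw Hd] Td]] := om_near (r := (om B + hf (S n))%R) BB; first lra.
apply: (@om_cover _ (cup c d)) => [x /cupE [/AB|/BB]|| m] //.
  split=> [i /cupE [/cw|/dw]|x /cupE [/Hc|/Hd] [i [ic ix]]] //; exists i; split=> //; apply/cupE; by [left|right].
apply: (Rle_trans _ (psum (fun i => fc c i + fc d i)%R m)).
  apply: psum_le => i _; generalize (fc_ge0 u c i); generalize (fc_ge0 u d i).
  case: (classic (N i ∈ cup c d)) => [/cupE [H|H]|H]; last by rewrite (fc_out _ H); lra.
    by rewrite (fc_in _ H) (@fc_in _ u (cup c d)); [lra|apply/cupE; left].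
  by rewrite (fc_in _ H) (@fc_in _ u (cup c d)); [lra|apply/cupE; right].
by rewrite psum_plus; generalize (Tc m); generalize (Td m); rewrite hfS in Hn *; lra.
Qed.
Lemma om_union (F : M -> M) r : DT (k := 1) (fun t : tup M 1 => F (hd t)) -> (∀ n ∈ w, F n ⊆ baire M) ->
  (forall n, psum (fun i => om (F (N i))) n <= r)%R -> (om (union (img w F)) <= r)%R.
Proof.
move=> D FB Hr; apply: le_small => m.
have UE x : x ∈ union (img w F) <-> ∃ n ∈ w, x ∈ F n.
  rewrite unionE; split=> [[y []]|[n [no xn]]]; last by exists (F n); split=> //; apply/imgE => //; exists n.
  by rewrite imgE // => -[n [no ->]] xn; exists n.
(* The cover of [F n] may exceed its outer measure by the value of [h] at [n + m], which is
   [hf (S (n + m))]; these errors add up to at most [hf m]. *)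
pose Y n := sep (powerset w) (fun c => cov c (F n) /\ upper K SS c (pl K (ap mS (F n)) (ap h (nadd n (N m))))).
have DC : DT (k := 1) (fun t : tup M 1 => Y (hd t)) by rewrite /Y /covers /upper; df.
have hn n : ap h (nadd (N n) (N m)) ∈ RK /\ phi (ap h (nadd (N n) (N m))) = hf (S (n + m)).
  by rewrite naddE hE; split=> //; apply: (ap_in Hh); exact: nat_omega.
have [|C HC] := choice_fam (a := w) (Y := Y) DC.
  move=> n' no; pose proof (FB n' no) as FnB; generalize (no); move=> /omegaE [n En]; subst n'; have [_ fR] := mS_lub FnB.
  have [h1 h2] := hn n; have [_ [pR pE]] := plE EM fR h1.
  have [|c [Hc Tc]] := om_near (r := phi (pl K (ap mS (F (N n))) (ap h (nadd (N n) (N m))))) FnB.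
    by rewrite pE h2 -/(om _); generalize (hf_pos (S (n + m))); lra.
  exists c; rewrite /Y sepE; last by rewrite /covers /upper; df.
  by split; [apply/powersetE; case: Hc|split=> //; apply/(upperE EM SSP) => //; case: Hc].
have CE n : cov (ap C (N n)) (F (N n)) /\ tot (fc (ap C (N n))) (om (F (N n)) + hf (S (n + m))).
  pose proof (nat_omega (M := M) n) as no; generalize (HC _ no); rewrite /Y sepE; last by rewrite /covers /upper; df.
  move=> [_ [Hc Hup]]; split=> //; have [_ fR] := mS_lub (FB _ no); have [h1 h2] := hn n; have [_ [pR pE]] := plE EM fR h1.
  by pose proof (proj1 (upperE EM SSP (proj1 Hc) pR) Hup) as Tu; rewrite pE h2 in Tu.
pose c := union (img w (ap C)).
have cE i : i ∈ c <-> exists n, i ∈ ap C (N n).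
  rewrite unionE; split=> [[y []]|[n H]].
    by rewrite imgE; [move=> [n' [/omegaE [n ->] ->]]; exists n|df].
  by exists (ap C (N n)); split=> //; rewrite imgE; [exists (N n); split=> //; exact: nat_omega|df].
apply: (@om_cover _ c) => [x /UE [n [no /(FB n no)]]||p] //.
  split=> [i /cE [n]|x /UE [n' [/omegaE [n ->]]]]; first by case: (CE n) => -[+ _] _; apply.
  by case: (CE n) => -[_ K1] _ /K1 [i [ic ix]]; exists i; split=> //; apply/cE; exists n.
(* The finitely many indices of [c] below [p] already occur in the first [q] covers, so the double
   sum is finite and can be interchanged. *)
have [q Hq] : exists q, forall i, i < p -> N i ∈ c -> exists n, n < q /\ N i ∈ ap C (N n).
  elim: p => [|p [q Hq]]; first by exists 0 => i; lia.
  case: (classic (N p ∈ c)) => [/cE [n Hn]|Np].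
    exists (S (q + n)) => i Hi ic; have [L|->] : i < p \/ i = p by lia.
      by have [k [kq Hk]] := Hq i L ic; exists k; split=> //; lia.
    by exists n; split=> //; lia.
  exists q => i Hi ic; have [L|E] : i < p \/ i = p by lia.
    exact: Hq.
  by case: Np; rewrite -E.
apply: (Rle_trans _ (psum (fun i => psum (fun k => fc (ap C (N k)) i) q) p)).
  apply: psum_le => i Hi; case: (classic (N i ∈ c)) => ic; last first.
    by rewrite (fc_out _ ic) -(psum0 q); apply: psum_le => k _; exact: fc_ge0.
  have [k [kq Hk]] := Hq i Hi ic; rewrite (fc_in _ ic) -(fc_in _ Hk).
  by apply: (psum_term (f := fun k => fc (ap C (N k)) i)) => // j; exact: fc_ge0.
rewrite psum_swap; apply: (Rle_trans _ (psum (fun k => om (F (N k)) + hf m * hf (S k))%R q)).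
  apply: psum_le => k _; have [_ T] := CE k; apply: (Rle_trans _ _ _ (T p)).
  by rewrite -hfD; have -> : m + S k = S (k + m) by [lia]; lra.
rewrite psum_plus psum_scal psum_hf; generalize (Hr q); generalize (hf_pos q); generalize (hf_pos m); nra.
Qed.

Lemma om_cone_le s : s ∈ FS -> (om (cone s) <= wt s)%R.
Proof.
move=> sF; have [i Ei] := u_surj Hu sF; apply: (@om_cover _ (sing (N i))); first exact: cone_sub.
  split=> [x /singE ->|x /coneE [_ sx]]; first exact: nat_omega.
  by exists (N i); split; [apply/singE|rewrite Ei].
by rewrite -Ei; apply: tot_sing.
Qed.
(* If a cover of a cone had too small a total weight, one could find a branch all of whose initial segments are undercovered. *)
Lemma om_cone_ge s : s ∈ FS -> (wt s <= om (cone s))%R.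
Proof.
move=> sF; apply: Rnot_lt_le => L; have [|c [[cw Hc] Tc]] := om_near (r := ((om (cone s) + wt s) / 2)%R) (@cone_sub _ _ s); first lra.
set r := (_ / 2)%R in Tc; have rs : (r < wt s)%R by rewrite /r; lra.
pose ct t : M := sep c (fun i => t ⊆ ap u i).
have ctE t i : i ∈ ct t <-> i ∈ c /\ t ⊆ ap u i by rewrite sepE; df.
have ctw t : ct t ⊆ w by move=> i /ctE [/cw].
have [wf Hwf] := weight_fun EM Hh hE.
(* Undercovering is witnessed by a field element strictly below the weight, since outer reals cannot
   occur in a formula; [PE] translates back. *)
pose P := sep FS (fun t => (∀ i ∈ c, ~ ap u i ⊆ t) /\ ∃ z ∈ RK, z <> ap wf t /\ opair z (ap wf t) ∈ le K /\ upper K SS (ct t) z).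
have PE t : t ∈ P <-> t ∈ FS /\ (∀ i ∈ c, ~ ap u i ⊆ t) /\ exists r, (r < wt t)%R /\ tot (fc (ct t)) r.
  rewrite sepE; last by rewrite /ct /upper; df.
  split=> -[tF [H1 H2]]; split=> //; split=> //; have [wR wE] := Hwf t tF.
    move: H2 => [z [zR [zn [/(lezE EM zR wR) zl /(upperE EM SSP (ctw t) zR) T]]]]; exists (phi z); split=> //.
    by rewrite -wE; case: zl => // E; case: zn; exact: (emb_inj EM zR wR E).
  move: H2 => [r' [rl T]]; have [z [zR Hz]] := emb_dense EM rl; exists z; split=> //.
  split; first by move=> E; move: Hz; rewrite E wE; lra.
  split; first by apply/(lezE EM zR wR); rewrite wE; lra.
  by apply/(upperE EM SSP (ctw t) zR) => n; generalize (T n); lra.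
have sP : s ∈ P.
  apply/PE; split=> //; split.
    move=> i ic us; generalize (cw i ic); move=> /omegaE [j Ej]; subst i.
    generalize (uF Hu j); move=> /FSE [n Hn]; generalize (sF); move=> /FSE [m Hm]; generalize (wt_sub Hn Hm us); rewrite -/(W u j).
    generalize (psum_term (fc_ge0 u c) (Nat.lt_succ_diag_r j)); rewrite (fc_in _ ic).
    by generalize (Tc (S j)); lra.
  exists r; split=> // n; apply: (Rle_trans _ _ _ _ (Tc n)); apply: psum_le => i _; apply: fc_sub => /ctE [] //.
have [|||x [xB [sx Hx]]] := branch (P := P) (B := fun _ _ => True) _ _ sP _.
- by df.
- by move=> t /PE [].
- move=> _ _ t /PE [tF [tc [r0 [rt Tt]]]]; generalize (tF); move=> /FSE [n Hn].
  (* [m] lies strictly between the bound [r0] and the weight of [t]. If no child is undercovered,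
     the cover spends more than [m * hf (S k)] on the child with last value [k]; the first [q]
     children together then exceed [r0] for large [q]. *)
  apply: NNPP => NE; pose m := ((wt t + r0) / 2)%R.
  have r00 : (0 <= r0)%R by generalize (Tt 0).
  have bad k : exists p, (m * hf (S k) < psum (fc (ct (snoc t (N k) n))) p)%R.
    have [H1 [H2 [H3 _]]] := snocP Hn (nat_omega (M := M) k); have sF' : snoc t (N k) n ∈ FS by apply/FSE; exists (S n).
    have mw : (m * hf (S k) < wt (snoc t (N k) n))%R by rewrite (wt_snoc k Hn) /m; generalize (hf_pos (S k)); nra.
    apply: NNPP => NB; have T : tot (fc (ct (snoc t (N k) n))) (m * hf (S k)).
      by move=> p; apply: Rnot_lt_le => Lp; apply: NB; exists p.
    apply: NE; exists (snoc t (N k) n); split; last by split.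
    apply/PE; split=> //; split; last by exists (m * hf (S k))%R.
    move=> i ic us; generalize (cw i ic); move=> /omegaE [j Ej]; subst i.
    (* No member of the cover is an initial segment of [t], so one that is an initial segment of the
       child is the child, whose weight alone exceeds the bound. *)
    have E : ap u (N j) = snoc t (N k) n.
      generalize (uF Hu j); move=> /FSE [l Hl]; have [/nat_sub ll El] := proj1 (fsub Hl H1) us.
      have [E|l'] : l = S n \/ l <= n by lia.
        by subst l; exact: (fun_ext Hl H1).
      case: (tc (N j) ic); apply/(fsub Hl Hn); split; first exact/nat_sub.
      move=> i /nat_mem [i' [Hi ->]]; have [_ ->] := proj1 (fsub Hn H1) H2; last by apply/nat_lt; lia.
      by apply: El; apply/nat_lt.
    generalize (T (S j)); have jin : N j ∈ ct (snoc t (N k) n) by apply/ctE; split=> //; rewrite E.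
    generalize (psum_term (fc_ge0 u (ct (snoc t (N k) n))) (Nat.lt_succ_diag_r j)).
    by rewrite (fc_in _ jin) /W E; lra.
  have [q Hq] : exists q, (r0 < m * (1 - hf q))%R.
    have mp : (r0 < m)%R by rewrite /m; lra.
    have [|q Hq] := @hf_small ((m - r0) / m); first by apply: Rdiv_lt_0_compat; lra.
    exists q; have : (hf q * m < (m - r0) / m * m)%R by apply: Rmult_lt_compat_r; lra.
    by have -> : ((m - r0) / m * m = m - r0)%R; [field; lra|lra].
  have [p Hp] : exists p, forall k, k < q -> (m * hf (S k) <= psum (fc (ct (snoc t (N k) n))) p)%R.
    elim: q {Hq} => [|q [p Hp]]; first by exists 0; lia.
    have [p' Hp'] := bad q; exists (p + p') => k Hk.
    have mono a b := @psum_mono _ a b (fc_ge0 u (ct (snoc t (N k) n))).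
    have [L'|E] : k < q \/ k = q by lia.
      by apply: (Rle_trans _ _ _ (Hp k L')); apply: mono; lia.
    by subst k; apply: (Rle_trans _ _ _ (Rlt_le _ _ Hp')); apply: mono; lia.
  have : (psum (fun k => m * hf (S k)) q <= psum (fc (ct t)) p)%R.
    apply: (Rle_trans _ _ _ (psum_le (g := fun k => psum (fc (ct (snoc t (N k) n))) p) Hp)).
    rewrite psum_swap; apply: psum_le => i _.
    have inj k : fc (ct (snoc t (N k) n)) i <> 0%R -> N i ∈ c /\ snoc t (N k) n ⊆ ap u (N i).
      by move=> H; apply: NNPP => Nk; apply: H; rewrite fc_out // => /ctE.
    apply: psum_one; first exact: fc_ge0.
      move=> k; case: (classic (N i ∈ ct (snoc t (N k) n))) => H; last by left; rewrite fc_out.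
      right; rewrite (fc_in _ H) fc_in //; move/ctE: H => [ic H]; apply/ctE; split=> // z zt; apply: H.
      by have [_ [H2 _]] := snocP Hn (nat_omega (M := M) k); apply: H2.
    by move=> k k' /inj [_ S1] /inj [_ S2]; apply: (snoc_inj Hn (uF Hu i) S1 S2).
  by rewrite psum_scal psum_hf; generalize (Tt p); lra.
- have /Hc [i [ic ix]] : x ∈ cone s by apply/coneE.
  generalize (cw i ic); move=> /omegaE [j Ej]; subst i; generalize (uF Hu j); move=> /FSE [l Hl].
  have [t [/PE [_ [tc _]] [tx [_ [m [lm Hm]]]]]] := Hx l; apply: (tc _ ic); exact: (FS_below Hl Hm xB).
Qed.
Lemma om_cone s : s ∈ FS -> om (cone s) = wt s.
Proof. by move=> sF; apply: Rle_antisym; [exact: om_cone_le|exact: om_cone_ge]. Qed.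

(** Caratheodory's criterion in the direction that subadditivity does not give. *)
Definition meas B := B ⊆ baire M /\ forall A, A ⊆ baire M -> (om (cap A B) + om (diff A B) <= om A)%R.
Lemma cap_subl A B : cap A B ⊆ A. Proof. by move=> x /capE []. Qed.
Lemma diff_subl A B : diff A B ⊆ A. Proof. by move=> x /diffE []. Qed.
Lemma sub_tr A B C : A ⊆ B -> B ⊆ C -> A ⊆ C. Proof. by move=> H HK x /H /HK. Qed.
Lemma meas_eq A B : meas B -> A ⊆ baire M -> om A = (om (cap A B) + om (diff A B))%R.
Proof.
move=> [BB H] AB; apply: Rle_antisym; last exact: H.
pose proof (sub_tr (@cap_subl A B) AB) as S1; pose proof (sub_tr (@diff_subl A B) AB) as S2.
apply: (Rle_trans _ _ _ _ (om_cup S1 S2)); apply: om_mono; last by move=> x /cupE [/S1|/S2].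
by move=> x xA; apply/cupE; case: (classic (x ∈ B)) => HK; [left; apply/capE|right; apply/diffE].
Qed.
Lemma meas_compl B : meas B -> meas (diff (baire M) B).
Proof.
move=> [BB H]; split=> [|A AB]; first exact: diff_subl.
have -> : cap A (diff (baire M) B) = diff A B.
  by apply: ext => x; rewrite capE !diffE; split=> [[? []]|[? ?]] //; split=> //; split=> //; exact: AB.
have -> : diff A (diff (baire M) B) = cap A B; last by rewrite Rplus_comm; exact: H.
apply: ext => x; rewrite capE !diffE; split=> [[xA HK]|[xA xB]]; split=> //; last by case.
by apply: NNPP => N; apply: HK; split=> //; exact: AB.
Qed.
Lemma om_empty : om (empty M) = 0%R.
Proof.
have E : empty M ⊆ baire M by move=> x /emptyE.
apply: Rle_antisym; last exact: om_ge0.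
apply: (@om_cover _ (empty M)) => // [|n]; first by split=> x /emptyE.
by rewrite (psum_ext (g := fun _ => 0%R)) ?psum0; [lra|move=> i _; rewrite fc_out // => /emptyE].
Qed.
Lemma meas_empty : meas (empty M).
Proof.
split=> [x /emptyE|A AB] //; have -> : cap A (empty M) = empty M by apply: ext => x; rewrite capE emptyE; tauto.
have -> : diff A (empty M) = A by apply: ext => x; rewrite diffE emptyE; tauto.
by rewrite om_empty; lra.
Qed.
Lemma meas_cup B C : meas B -> meas C -> meas (cup B C).
Proof.
move=> [BB HB] [CB HC]; split=> [x /cupE [/BB|/CB]|A AB] //.
have S1 : cap A B ⊆ baire M := sub_tr (@cap_subl A B) AB; have S2 : diff A B ⊆ baire M := sub_tr (@diff_subl A B) AB.
have S3 : cap (diff A B) C ⊆ baire M := sub_tr (@cap_subl _ C) S2.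
have -> : diff A (cup B C) = diff (diff A B) C by apply: ext => x; rewrite !diffE cupE; tauto.
have : (om (cap A (cup B C)) <= om (cup (cap A B) (cap (diff A B) C)))%R.
  apply: om_mono; last by move=> x /cupE [/S1|/S3].
  by move=> x; rewrite capE !cupE !capE diffE; case: (classic (x ∈ B)); tauto.
by generalize (om_cup S1 S3); generalize (HB A AB); generalize (HC _ S2); lra.
Qed.

Section Sequences.
Variable F : M -> M.
Hypotheses (DF : DT (k := 1) (fun t : tup M 1 => F (hd t))) (mF : ∀ n ∈ w, meas (F n)).
Definition Gs (n : M) : M := union (img n F).
Lemma GsE n x : x ∈ Gs n <-> ∃ i ∈ n, x ∈ F i.
Proof.
rewrite unionE; split=> [[y []]|[i [ii H]]]; last by exists (F i); rewrite imgE //; split=> //; exists i.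
by rewrite imgE // => -[i [ii ->]] H; exists i.
Qed.
Lemma GsS n : Gs (N (S n)) = cup (Gs (N n)) (F (N n)).
Proof.
apply: ext => x; rewrite cupE !GsE; split=> [[i [/succE [ii|->] H]]|[[i [ii H]]|H]].
- by left; exists i.
- by right.
- by exists i; split=> //; apply/succE; left.
- by exists (N n); split=> //; apply/succE; right.
Qed.
Lemma meas_Gs n : meas (Gs (N n)).
Proof.
elim: n => [|n IH]; last by rewrite GsS; apply: meas_cup => //; apply: mF; exact: nat_omega.
have -> : Gs (N 0) = empty M; last exact: meas_empty.
by apply: ext => x; rewrite GsE emptyE; split=> // -[i [/emptyE]].
Qed.
Definition Ds (n : M) : M := diff (F n) (Gs n).
Lemma sum_Ds A n : A ⊆ baire M -> psum (fun i => om (cap A (Ds (N i)))) n = om (cap A (Gs (N n))).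
Proof.
move=> AB; elim: n => [|n IH] /=.
  have -> : cap A (Gs (N 0)) = empty M by apply: ext => x; rewrite capE GsE emptyE; split=> // -[_ [i [/emptyE]]].
  by rewrite om_empty.
have S1 : cap A (Gs (N (S n))) ⊆ baire M := sub_tr (@cap_subl A _) AB.
rewrite (meas_eq (meas_Gs n) S1) IH; congr (om _ + om _)%R; apply: ext => x; rewrite ?capE ?diffE ?capE GsS cupE; tauto.
Qed.
Lemma Ds_cover x : x ∈ Gs w -> exists n, x ∈ Ds (N n).
Proof.
move=> /GsE [n' [/omegaE [n ->]]]; elim/lt_wf_ind: n => n IH H.
case: (classic (x ∈ Gs (N n))) => HK; last by exists n; apply/diffE.
by generalize (HK); move=> /GsE [i [/nat_mem [k [kn ->]] Hk]]; exact: (IH k kn).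
Qed.
(** For the finite unions the criterion holds by induction. The part of [A] in the full union is
    covered by the disjoint pieces [Ds], whose partial sums are measured by the finite unions, and
    subadditivity passes to the limit. *)
Lemma meas_union : meas (Gs w).
Proof.
have UB : Gs w ⊆ baire M by move=> x /GsE [n [/mF [+ _]]]; apply.
split=> // A AB; suff : (om (cap A (Gs w)) <= om A - om (diff A (Gs w)))%R by lra.
have DD : DT (k := 1) (fun t : tup M 1 => cap A (Ds (hd t))) by rewrite /Ds /Gs; df.
have SB n : n ∈ w -> cap A (Ds n) ⊆ baire M by move=> _ x /capE [/AB].
apply: (Rle_trans _ (om (union (img w (fun n => cap A (Ds n)))))).
  have E x : x ∈ union (img w (fun n => cap A (Ds n))) <-> ∃ n ∈ w, x ∈ cap A (Ds n).
    rewrite unionE; split=> [[y []]|[n [no H]]]; last by exists (cap A (Ds n)); rewrite imgE //; split=> //; exists n.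
    by rewrite imgE // => -[n [no ->]] H; exists n.
  apply: om_mono => [x /capE [xA /Ds_cover [n H]]|x /E [n [no /SB]]]; last by apply.
  by apply/E; exists (N n); split; [exact: nat_omega|apply/capE].
apply: om_union => // n; rewrite sum_Ds //; have [_ /(_ A AB)] := meas_Gs n.
suff : (om (diff A (Gs w)) <= om (diff A (Gs (N n))))%R by lra.
apply: om_mono; last exact: (sub_tr (@diff_subl A _) AB).
move=> x; rewrite !diffE !GsE => -[xA HK]; split=> // -[i [ii H]]; apply: HK; exists i; split=> //.
exact: (ord_tr ord_omega (nat_omega (M := M) n) ii).
Qed.
Lemma sum_disjoint n : (∀ i ∈ w, ∀ j ∈ w, i <> j -> forall x, ~ (x ∈ F i /\ x ∈ F j)) ->
  (psum (fun i => om (F (N i))) n <= om (Gs w))%R.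
Proof.
move=> dis; have UB : Gs w ⊆ baire M by move=> x /GsE [m [/mF [+ _]]]; apply.
apply: (Rle_trans _ (psum (fun i => om (cap (Gs w) (Ds (N i)))) n)); last first.
  by rewrite sum_Ds //; apply: om_mono => //; exact: cap_subl.
apply: Req_le; apply: psum_ext => i _; congr om; pose proof (nat_omega (M := M) i) as io; apply: ext => x; rewrite capE diffE !GsE.
split=> [H|[_ []]] //; split; first by exists (N i).
split=> // -[j [/nat_mem [k [ki ->]] Hk]]; apply: (dis (N i) io (N k) (nat_omega k) _ x); last by split.
by move/nat_inj => E; lia.
Qed.
End Sequences.

(** What remains of the cone is the union of the sibling cones. Putting back the omitted weight as
    [d] turns the sum into a geometric one bounded by [wt s]. *)
Lemma om_sibling s k n : s ∈ funs (N n) w -> (om (diff (cone s) (cone (snoc s (N k) n))) <= wt s - wt (snoc s (N k) n))%R.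
Proof.
move=> Hs; pose F j := sep (cone (snoc s j n)) (fun _ => j <> N k).
have DF : DT (k := 1) (fun t : tup M 1 => F (hd t)) by rewrite /F /snoc; df.
have FE j x : x ∈ F j <-> x ∈ cone (snoc s j n) /\ j <> N k by rewrite sepE; df.
have FB j : F j ⊆ baire M by move=> x /FE [/coneE []].
have sn j : snoc s (N j) n ∈ FS by apply/FSE; exists (S n); case: (snocP Hs (nat_omega (M := M) j)).
apply: (Rle_trans _ (om (Gs F w))).
  apply: om_mono; last by move=> x /(GsE DF) [j [_ /FB]].
  move=> x /diffE [/coneE [xB sx] Nx]; apply/(GsE DF); pose proof (nat_omega (M := M) n) as no; pose proof (ap_in xB no) as xn.
  have E : snoc s (ap x (N n)) n ⊆ x by move=> z /cupE [/sx|/singE ->] //; apply: (ap_pair xB no).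
  exists (ap x (N n)); split=> //; apply/FE; split; first by apply/coneE.
  by move=> Ek; apply: Nx; apply/coneE; split=> //; rewrite -Ek.
apply: om_union => // m.
pose d j : Re := match Nat.eq_dec j k with left _ => wt (snoc s (N k) n) | right _ => 0%R end.
have d0 j : (0 <= d j)%R by rewrite /d; case: Nat.eq_dec => _; [apply: Rlt_le; exact: wt_pos|lra].
have : (psum (fun i => om (F (N i)) + d i)%R (m + S k) <= psum (fun i => wt s * hf (S i)) (m + S k))%R.
  apply: psum_le => i _; rewrite -(wt_snoc i Hs) /d; case: Nat.eq_dec => E.
    have -> : F (N i) = empty M by apply: ext => x; rewrite FE emptyE E; tauto.
    by rewrite om_empty E; lra.
  generalize (om_mono (A := F (N i)) (B := cone (snoc s (N i) n))); rewrite (om_cone (sn i)) => H.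
  by rewrite Rplus_0_r; apply: H => [x /FE []|] //; exact: cone_sub.
rewrite psum_plus psum_scal psum_hf.
have : (d k <= psum d (m + S k))%R by apply: psum_term => //; lia.
have -> : d k = wt (snoc s (N k) n) by rewrite /d; case: Nat.eq_dec.
generalize (@psum_mono (fun i => om (F (N i))) m (m + S k) (fun i => om_ge0 (@FB _)) ltac:(lia)).
by generalize (wt_pos s); generalize (hf_pos (m + S k)); nra.
Qed.
Lemma om_cone_diff t s a b : t ∈ funs (N a) w -> s ∈ funs (N b) w -> t ⊆ s -> (om (diff (cone t) (cone s)) <= wt t - wt s)%R.
Proof.
move=> Ht Hs ts; have [/nat_sub ab _] := proj1 (fsub Ht Hs) ts; elim: ab s Hs ts => [|b' ab IH] s Hs ts.
  have E : t = s by have [_ E] := proj1 (fsub Ht Hs) ts; exact: (fun_ext Ht Hs).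
  have -> : diff (cone t) (cone s) = empty M by apply: ext => x; rewrite diffE emptyE E; tauto.
  by rewrite om_empty E; lra.
have bb : N b' ∈ N (S b') by apply/nat_lt.
have bs i : i ∈ N b' -> i ∈ N (S b') by move=> H; apply/succE; left.
have Hs' : lam (N b') (ap s) ∈ funs (N b') w by apply: lam_fun; [df|move=> i /bs; apply: (ap_in Hs)].
set s' := lam (N b') (ap s) in Hs'; generalize (ap_in Hs bb); move=> /omegaE [k Ek].
have s'E i : i ∈ N b' -> ap s' i = ap s i by move=> ii; rewrite /s' ap_lam //; df.
have [H1 [H2 [_ H3]]] := snocP Hs' (nat_omega (M := M) k).
have E : s = snoc s' (N k) b'.
  apply: (fun_ext Hs H1) => i /succE [ii|->]; last by rewrite H3.
  by have [_ <-] := proj1 (fsub Hs' H1) H2; rewrite ?s'E.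
have ts' : t ⊆ s'.
  have [_ Et] := proj1 (fsub Ht Hs) ts; apply/(fsub Ht Hs'); split; first exact/nat_sub.
  by move=> i ii; rewrite Et // s'E //; apply: (proj2 (nat_sub (M := M) a b') ab).
have B1 : diff (cone t) (cone s') ⊆ baire M by move=> x /diffE [/coneE []].
have B2 : diff (cone s') (cone s) ⊆ baire M by move=> x /diffE [/coneE []].
pose proof (IH s' Hs' ts') as L1; generalize (om_sibling k Hs'); rewrite -E => L2; pose proof (om_cup B1 B2) as L3.
suff : (om (diff (cone t) (cone s)) <= om (cup (diff (cone t) (cone s')) (diff (cone s') (cone s))))%R by lra.
apply: om_mono; last by move=> x /cupE [/B1|/B2].
by move=> x; rewrite cupE !diffE; case: (classic (x ∈ cone s')); tauto.
Qed.
(** A nearly optimal cover [c] of [A] is split. If some member is an initial segment of [s], its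
    weight is divided between [cone s] and the rest of its cone by [om_cone_diff], and the other
    members cover what is left of [A]. Otherwise the members that extend [s] cover the part of [A]
    in the cone and the others cover the rest. *)
Lemma meas_cone s : s ∈ FS -> meas (cone s).
Proof.
move=> sF; split=> [|A AB]; first exact: cone_sub.
have S1 : cap A (cone s) ⊆ baire M := sub_tr (@cap_subl A _) AB; have S2 : diff A (cone s) ⊆ baire M := sub_tr (@diff_subl A _) AB.
apply: le_small => e; have [|c [[cw Hc] Tc]] := om_near (r := (om A + hf e)%R) AB; first by generalize (hf_pos e); lra.
set r := (om A + hf e)%R in Tc *; generalize (sF); move=> /FSE [b Hb].
case: (classic (∃ i ∈ c, ap u i ⊆ s)) => [[i' [ic us]]|NE].
  generalize (cw i' ic); move=> /omegaE [i Ei]; subst i'; generalize (uF Hu i); move=> /FSE [a Ha].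
  pose c' := diff c (sing (N i)).
  have c'E j : j ∈ c' <-> j ∈ c /\ j <> N i by rewrite diffE singE.
  have T' : tot (fc c') (r - W u i).
    move=> n; generalize (Tc (n + S i)); rewrite (psum_ext (g := fun j => fc c' j + fc (sing (N i)) j)%R).
      rewrite psum_plus; generalize (psum_mono (fc_ge0 u c') (m := n) (n := n + S i) ltac:(lia)).
      generalize (psum_term (fc_ge0 u (sing (N i))) (n := n + S i) (i := i) ltac:(lia)); rewrite (@fc_in _ u (sing (N i))); last exact/singE.
      lra.
    move=> j _; case: (classic (j = i)) => [->|ji].
      by rewrite (fc_in _ ic) fc_out ?fc_in ?Rplus_0_l //; [apply/singE|move/c'E; tauto].
    rewrite (@fc_out _ u (sing (N i)) j); last by move/singE/nat_inj.
    case: (classic (N j ∈ c)) => jc; first by rewrite !fc_in; [lra| |] => //; apply/c'E; split=> // /nat_inj.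
    by rewrite !fc_out; [lra| |] => // /c'E [].
  pose X := sep A (fun x => ∃ j ∈ c', ap u j ⊆ x).
  have XE x : x ∈ X <-> x ∈ A /\ ∃ j ∈ c', ap u j ⊆ x by rewrite sepE; df.
  have XB : X ⊆ baire M by move=> x /XE [/AB].
  have LX : (om X <= r - W u i)%R by apply: (@om_cover _ c') => //; split=> [j /c'E [/cw]|x /XE []].
  have L1 : (om (cap A (cone s)) <= wt s)%R by rewrite -om_cone //; apply: om_mono; [move=> x /capE []|exact: cone_sub].
  have DB : diff (cone (ap u (N i))) (cone s) ⊆ baire M by move=> x /diffE [/coneE []].
  have : (om (diff A (cone s)) <= om (cup (diff (cone (ap u (N i))) (cone s)) X))%R.
    apply: om_mono; last by move=> x /cupE [/DB|/XB].
    move=> x /diffE [xA xs]; apply/cupE; have [j [jc jx]] := Hc x xA; case: (classic (j = N i)) => [E|ji].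
      by left; apply/diffE; split=> //; apply/coneE; split; [exact: AB|rewrite -E].
    by right; apply/XE; split=> //; exists j; split=> //; apply/c'E.
  generalize (om_cup DB XB); generalize (om_cone_diff Ha Hb us); rewrite -/(W u i); lra.
pose c1 := sep c (fun i => s ⊆ ap u i); pose c2 := sep c (fun i => ~ s ⊆ ap u i).
have c1E i : i ∈ c1 <-> i ∈ c /\ s ⊆ ap u i by rewrite sepE; df.
have c2E i : i ∈ c2 <-> i ∈ c /\ ~ s ⊆ ap u i by rewrite sepE; df.
apply: (tot_split (f := fc c1) (g := fc c2)); try exact: fc_ge0.
- move=> n; apply: (Rle_trans _ _ _ _ (Tc n)); apply: Req_le; apply: psum_ext => i _.
  case: (classic (N i ∈ c)) => ic; last by rewrite !fc_out; [lra| | |] => // [/c2E|/c1E] [].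
  case: (classic (s ⊆ ap u (N i))) => H.
    by rewrite (fc_in _ ic) fc_in ?fc_out; [lra| |] => //; [move/c2E; tauto|apply/c1E].
  by rewrite (fc_in _ ic) fc_out ?fc_in; [lra| |] => //; [apply/c2E|move/c1E; tauto].
- move=> r1 T1; apply: (@om_cover _ c1) => //; split=> [i /c1E [/cw]|x /capE [xA /coneE [xB sx]]] //.
  have [i [ic ix]] := Hc x xA; exists i; split=> //; apply/c1E; split=> //.
  generalize (cw i ic); move=> /omegaE [j Ej]; subst i; generalize (uF Hu j); move=> /FSE [a Ha].
  have [ba|ab] : b <= a \/ a <= b by lia.
    exact: (FS_below Hb Ha xB).
  by case: NE; exists (N j); split=> //; exact: (FS_below Ha Hb xB).
- move=> r2 T2; apply: (@om_cover _ c2) => //; split=> [i /c2E [/cw]|x /diffE [xA xs]] //.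
  have [i [ic ix]] := Hc x xA; exists i; split=> //; apply/c2E; split=> // su; apply: xs; apply/coneE.
  by split; [exact: AB|move=> z /su /ix].
Qed.
Lemma meas_open U : is_open U -> meas U.
Proof.
move=> /openE [UB HU]; pose F n := sep (cone (ap u n)) (fun _ => cone (ap u n) ⊆ U).
have DF : DT (k := 1) (fun t : tup M 1 => F (hd t)) by rewrite /F; df.
have FE n x : x ∈ F n <-> x ∈ cone (ap u n) /\ cone (ap u n) ⊆ U by rewrite sepE; df.
have -> : U = Gs F w.
  apply: ext => x; rewrite (GsE DF); split=> [xU|[n [no /FE [xn]]]]; last by apply.
  have [s [sF [sx sU]]] := HU x xU; have [i Ei] := u_surj Hu sF; exists (N i); split; first exact: nat_omega.
  by apply/FE; rewrite Ei; split=> //; apply/coneE; split=> //; exact: UB.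
apply: meas_union => // n no; case: (classic (cone (ap u n) ⊆ U)) => H.
  have -> : F n = cone (ap u n) by apply: ext => x; rewrite FE; tauto.
  by apply: meas_cone; apply: (ap_in (proj1 (proj1 Hu))).
have -> : F n = empty M by apply: ext => x; rewrite FE emptyE; tauto.
exact: meas_empty.
Qed.

(** The definition of Borel sets ranges over σ-algebras that are elements of the model, so the
    criterion is restated with the order of the field [K] to form the set [Ms]. *)
Lemma borel_meas B : B ∈ borel M -> meas B.
Proof.
pose Ms := sep (powerset (baire M)) (fun B => ∀ A ∈ powerset (baire M), opair (pl K (ap mS (cap A B)) (ap mS (diff A B))) (ap mS A) ∈ le K).
have L C A : A ⊆ baire M -> (opair (pl K (ap mS (cap A C)) (ap mS (diff A C))) (ap mS A) ∈ le K <-> (om (cap A C) + om (diff A C) <= om A)%R).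
  move=> AB; have [_ R1] := mS_lub (sub_tr (@cap_subl A C) AB); have [_ R2] := mS_lub (sub_tr (@diff_subl A C) AB).
  by have [_ R3] := mS_lub AB; have [_ [R4 E]] := plE EM R1 R2; rewrite (lezE EM R4 R3) E.
have MsE C : C ∈ Ms <-> meas C.
  rewrite sepE; last by df.
  rewrite powersetE; split=> -[CB H]; split=> // A AB; first by apply/L => //; apply: H; apply/powersetE.
  by move/powersetE: AB => AB; apply/L => //; exact: H.
move=> /borelE H; apply/MsE; apply: H => [|U HU]; last by apply/MsE; exact: meas_open.
apply/sigmaE; split=> [C /MsE [CB _]|]; first exact/powersetE.
split; first by apply/MsE; rewrite -baire_cone; apply: meas_cone; exact: e0F.
split=> [C /MsE HC|F HF]; apply/MsE; first exact: meas_compl.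
apply: (meas_union (F := ap F)) => [|n no]; first by df.
by apply/MsE; apply: (ap_in HF).
Qed.

Definition mu0 : M := lam (borel M) (ap mS).
Lemma mu0_fun : mu0 ∈ funs (borel M) RK.
Proof. by apply: lam_fun => [|B HB]; [df|case: (mS_lub (borel_sub HB))]. Qed.
Lemma mu0E B : B ∈ borel M -> app mu0 B = ap mS B.
Proof. by move=> HB; rewrite (app_ap mu0_fun HB) ap_lam //; df. Qed.
Lemma half_powersE hh : half_powers K hh -> hh ∈ funs w RK /\ forall n, phi (ap hh (N n)) = hf (S n).
Proof.
move=> [Hf [H0 HS]]; split=> //.
have D n : phi (app2 (add K) (app hh (N n)) (app hh (N n))) = (2 * phi (ap hh (N n)))%R.
  by pose proof (nat_omega (M := M) n) as no; rewrite (app_ap Hf no) (emb_add EM); try exact: (ap_in Hf); lra.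
elim=> [|n IH].
  by generalize (D 0); rewrite H0 (emb_one EM) /hf /=; lra.
pose proof (nat_omega (M := M) n) as no; generalize (D (S n)); rewrite (HS _ no) (app_ap Hf no) IH (hfS (S n)); lra.
Qed.
Lemma mu0_lebesgue : lebesgue_measure K mu0.
Proof.
have bR B : B ∈ borel M -> ap mS B ∈ RK by move=> HB; case: (mS_lub (borel_sub HB)).
have omE : ap mS (empty M) = zero K.
  apply: (emb_inj EM); [apply: bR; exact: borel_empty|exact: zero_in|].
  by rewrite (phi_zero EM); exact: om_empty.
split.
- exact: mu0_fun.
- move=> B HB; rewrite mu0E //; apply/(lezE EM (zero_in K) (bR B HB)); rewrite (phi_zero EM); exact: (om_ge0 (borel_sub HB)).
- by rewrite mu0E //; exact: borel_empty.
- move=> F HF dis; have FR n : n ∈ w -> ap mS (ap F n) ∈ RK by move=> no; apply: bR; apply: (ap_in HF).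
  have [|||S [HS [S0 SS']]] := nat_rec_fun (X := RK) (a := zero K) (F := fun n x => pl K x (ap mS (ap F n))).
        by df.
      exact: zero_in.
    by move=> n no x xR; case: (plE EM xR (FR n no)) => _ [].
  have SE n : phi (ap S (N n)) = psum (fun i => om (ap F (N i))) n.
    elim: n => [|n IH]; first by rewrite S0 (phi_zero EM).
    pose proof (nat_omega (M := M) n) as no; rewrite [N _]/(succ (N n)) SS' //; have [_ [_ ->]] := plE EM (ap_in HS no) (FR _ no).
    by rewrite IH.
  pose proof (borel_sub (borel_seq HF)) as UB; pose proof (bR _ (borel_seq HF)) as bU.
  have DF : DT (k := 1) (fun t : tup M 1 => ap F (hd t)) by df.
  have mF : ∀ n ∈ w, meas (ap F n) by move=> n no; apply: borel_meas; apply: (ap_in HF).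
  exists S; split=> //; split; first by rewrite (app_ap HS empty_omega).
  split=> [n no|].
    pose proof (succ_omega no) as sno; rewrite (app_ap HS sno) (app_ap HS no) (app_ap HF no) mu0E; last exact: (ap_in HF).
    by rewrite SS' //; case: (plE EM (ap_in HS no) (FR n no)).
  have E x : x ∈ setof (fun x => ∃ n ∈ w, x = app S n) <-> ∃ n ∈ w, x = ap S n.
    have -> : setof (fun x => ∃ n ∈ w, x = app S n) = img w (ap S); last by rewrite imgE; df.
    by congr setof; apply: pred_ext => z; split=> -[n [no ->]]; exists n; rewrite (app_ap HS no).
  rewrite mu0E; last exact: borel_seq.
  split.
    split=> // x /E [n' [/omegaE [n ->] ->]]; apply/(lezE EM _ bU); first by apply: (ap_in HS); exact: nat_omega.
    rewrite SE (seq_unionU HF) -/(Gs (ap F) w); apply: sum_disjoint => // i io j jo ij y.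
    by generalize (dis i io j jo ij y); rewrite (app_ap HF io) (app_ap HF jo).
  move=> c cR Hc; apply/(lezE EM bU cR); rewrite (seq_unionU HF); apply: om_union => // [n no|n].
    by apply: borel_sub; apply: (ap_in HF).
  pose proof (nat_omega (M := M) n) as no; rewrite -SE; apply/(lezE EM (ap_in HS no) cR); apply: Hc; apply/E.
  by exists (N n).
- move=> hh s n' /half_powersE [Hh' hE'] [/omegaE [n ->] Hs]; have sF : s ∈ FS by apply/FSE; exists n.
  have hR i : i ∈ N n -> ap hh (ap s i) ∈ RK by move=> ii; apply: (ap_in Hh'); apply: (ap_in Hs).
  have [|||p [Hp [p0 pS]]] := nat_rec_fun (X := RK) (a := one K) (F := fun i x => ite (i ∈ N n) (ml K x (ap hh (ap s i))) x).
        by df.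
      exact: one_in.
    move=> i iw x xR; case: (classic (i ∈ N n)) => Hi; [rewrite iteT //|by rewrite iteF].
    by case: (mlE EM xR (hR i Hi)) => _ [].
  pose proof (nat_omega (M := M) n) as no; exists p; split=> //; split; first by rewrite (app_ap Hp empty_omega).
  split=> [i ii|].
    pose proof (ord_tr ord_omega no ii) as io; pose proof (succ_omega io) as sio; pose proof (ap_in Hs ii) as ss.
    rewrite (app_ap Hp sio) (app_ap Hp io) (app_ap Hs ii) (app_ap Hh' ss) pS // iteT //.
    by case: (mlE EM (ap_in Hp io) (hR i ii)).
  have cB : cone s ∈ borel M by apply: borel_open; exact: cone_open.
  rewrite (app_ap Hp no) (mu0E cB); apply: (emb_inj EM); [exact: (ap_in Hp)|exact: bR|].
  rewrite -/(om _) (om_cone sF) (wtE Hs).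
  have : forall m, m <= n -> phi (ap p (N m)) = wtn s m; last by apply.
  elim=> [|m IH] mn; first by rewrite p0 (emb_one EM).
  have mi : N m ∈ N n by apply/nat_lt.
  generalize (ap_in Hs mi); move=> /omegaE [k Ek]; pose proof (nat_omega (M := M) m) as mo.
  have [_ [_ E]] := mlE EM (ap_in Hp mo) (hR _ mi).
  by rewrite [N _]/(succ (N m)) pS // iteT // E IH ?Ek ?hE' /= ?(dgE Ek) //; lia.
Qed.
End OuterMeasure.

(** * Null sets *)

Section Dyadic.
Context {M : structure} {HM : ZFCw M}.
Variable K : real_field M.
Notation RK := (R K).
Notation N n := (nat_in M n).
Notation w := (omega M).
Notation "x ⊕ y" := (app2 (add K) x y) (at level 50, left associativity).
Notation "x ⊗ y" := (app2 (mul K) x y) (at level 40, left associativity).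
Notation "x ⊑ y" := (opair x y ∈ le K) (at level 70).
Implicit Types (x y z : M).
Lemma opl_in x y : x ∈ RK -> y ∈ RK -> x ⊕ y ∈ RK.
Proof.
move=> Hx Hy; have HF : add K ∈ funs (prod RK RK) RK by apply/funsE; exact: add_fun.
have P : opair x y ∈ prod RK RK by apply/pair_prod.
by rewrite /app2 (app_ap HF P); exact: (ap_in HF P).
Qed.
Lemma oml_in x y : x ∈ RK -> y ∈ RK -> x ⊗ y ∈ RK.
Proof.
move=> Hx Hy; have HF : mul K ∈ funs (prod RK RK) RK by apply/funsE; exact: mul_fun.
have P : opair x y ∈ prod RK RK by apply/pair_prod.
by rewrite /app2 (app_ap HF P); exact: (ap_in HF P).
Qed.
Let z0 := zero_in K.
Let o0 := one_in K.
Ltac rin := repeat first [assumption | exact z0 | exact o0 | apply opl_in | apply oml_in].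
Lemma opl0 x : x ∈ RK -> x ⊕ zero K = x.
Proof. by move=> Hx; rewrite addC //; apply: add0. Qed.
Lemma oplCA x y z : x ∈ RK -> y ∈ RK -> z ∈ RK -> x ⊕ (y ⊕ z) = y ⊕ (x ⊕ z).
Proof. by move=> Hx Hy Hz; rewrite !addA // (addC Hx Hy). Qed.
Lemma opl_cancel x y z : x ∈ RK -> y ∈ RK -> z ∈ RK -> x ⊕ z = y ⊕ z -> x = y.
Proof.
move=> Hx Hy Hz E; have [v [Hv Ev]] := addN Hz.
by rewrite -(opl0 Hx) -(opl0 Hy) -Ev !addA // E.
Qed.
Lemma ole_refl x : x ∈ RK -> x ⊑ x. Proof. by move=> Hx; case: (le_total Hx Hx). Qed.
Lemma ole_add2 x y x' y' : x ∈ RK -> y ∈ RK -> x' ∈ RK -> y' ∈ RK -> x ⊑ y -> x' ⊑ y' -> x ⊕ x' ⊑ y ⊕ y'.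
Proof.
move=> Hx Hy Hx' Hy' L L'; apply: (@le_trans _ K _ _ (y ⊕ x')); rin; first exact: le_add.
by rewrite (addC Hy Hx') (addC Hy Hy'); exact: le_add.
Qed.
(** Multiples by outer natural numbers. In an arbitrary field of the model, dyadic values are
    compared by clearing powers of two with the field axioms alone. *)
Fixpoint nm k x : M := match k with 0 => zero K | S k => x ⊕ nm k x end.
Lemma nm_in k x : x ∈ RK -> nm k x ∈ RK.
Proof. by move=> Hx; elim: k => [|k IH] /=; rin. Qed.
Ltac nin := repeat first [assumption | exact z0 | exact o0 | apply opl_in | apply oml_in | apply nm_in].
Lemma nm_addn a b x : x ∈ RK -> nm (a + b) x = nm a x ⊕ nm b x.
Proof. move=> Hx; elim: a => [|a IH] /=; first by rewrite add0 //; nin. by rewrite IH addA //; nin. Qed.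
Lemma nm_opl a x y : x ∈ RK -> y ∈ RK -> nm a (x ⊕ y) = nm a x ⊕ nm a y.
Proof.
move=> Hx Hy; elim: a => [|a IH] /=; first by rewrite add0.
pose proof (nm_in a Hx) as Ha; pose proof (nm_in a Hy) as Hb.
by rewrite IH -!addA //; nin; congr app2; rewrite oplCA //; nin.
Qed.
Lemma nm_mulnA a b x : x ∈ RK -> nm (a * b) x = nm a (nm b x).
Proof. by move=> Hx; elim: a => //= a IH; rewrite nm_addn // IH. Qed.
Lemma oml0 x : x ∈ RK -> x ⊗ zero K = zero K.
Proof.
move=> Hx; pose proof (oml_in Hx z0) as H; apply: (@opl_cancel _ _ (x ⊗ zero K)) => //.
by rewrite -mulD // add0 // add0.
Qed.
Lemma nm_oml a x y : x ∈ RK -> y ∈ RK -> nm a (x ⊗ y) = x ⊗ nm a y.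
Proof. move=> Hx Hy; elim: a => [|a IH] /=; first by rewrite oml0. by rewrite IH mulD //; nin. Qed.
Lemma nm_zero a : nm a (zero K) = zero K.
Proof. by elim: a => //= a ->; rewrite add0. Qed.
Lemma nm_le a x y : x ∈ RK -> y ∈ RK -> x ⊑ y -> nm a x ⊑ nm a y.
Proof. by move=> Hx Hy L; elim: a => [|a IH] /=; [exact: ole_refl|apply: ole_add2; nin]. Qed.
Lemma nm_le_inv a x y : x ∈ RK -> y ∈ RK -> a <> 0 -> nm a x ⊑ nm a y -> x ⊑ y.
Proof.
case: a => // a Hx Hy _ /= L; case: (le_total Hx Hy) => // L'.
pose proof (nm_le a Hy Hx L') as La; pose proof (nm_in a Hx) as Ha; pose proof (nm_in a Hy) as Hb.
suff -> : x = y by exact: ole_refl.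
apply: (@opl_cancel _ _ (nm a x)) => //; apply: (@le_antisym _ K); nin.
  by apply: (@le_trans _ K _ _ (y ⊕ nm a y)); nin; apply: ole_add2; nin; exact: ole_refl.
by apply: ole_add2; nin; exact: ole_refl.
Qed.
Hypothesis one_ge0 : zero K ⊑ one K.
Lemma nm_one a b : a <= b -> nm a (one K) ⊑ nm b (one K).
Proof.
elim=> [|c _ IH] /=; first by apply: ole_refl; nin.
apply: (@le_trans _ K _ _ (nm c (one K))); nin.
by rewrite -{1}(add0 (nm_in c o0)); apply: le_add; nin.
Qed.

(* [x] is the dyadic rational [d]. *)
Definition dy x (d : Re) := x ∈ RK /\ exists k n, nm (2 ^ n) x = nm k (one K) /\ d = (INR k * hf n)%R.
Lemma pow2 n : 2 ^ n <> 0. Proof. by apply: Nat.pow_nonzero. Qed.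
Lemma hf_pow n : (INR (2 ^ n) * hf n = 1)%R.
Proof. by elim: n => [|n IH]; [rewrite /hf /=; lra|rewrite hfS Nat.pow_succ_r' mult_INR -IH /=; lra]. Qed.
Lemma dy_scale x k n m : x ∈ RK -> nm (2 ^ n) x = nm k (one K) -> nm (2 ^ (m + n)) x = nm (2 ^ m * k) (one K).
Proof. by move=> Hx E; rewrite Nat.pow_add_r nm_mulnA // E -nm_mulnA. Qed.
Lemma hf_scale k m n : (INR (2 ^ m * k) * hf (m + n) = INR k * hf n)%R.
Proof. by rewrite mult_INR hfD; generalize (hf_pow m); move: (INR _) (hf m) (hf n) (INR k) => a b c d E; rewrite (_ : (a * d * (b * c) = (a * b) * (d * c))%R); [rewrite E; lra|ring]. Qed.
Lemma dy_zero : dy (zero K) 0.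
Proof. by split=> //; exists 0, 0; split; [rewrite nm_zero|rewrite /=; lra]. Qed.
Lemma dy_one : dy (one K) 1.
Proof. by split=> //; exists 1, 0; split=> //; rewrite /hf /=; lra. Qed.
Lemma dy_opl x y d e : dy x d -> dy y e -> dy (x ⊕ y) (d + e).
Proof.
move=> [Hx [k [n [E1 ->]]]] [Hy [l [m [E2 ->]]]]; split; first exact: opl_in.
exists (2 ^ m * k + 2 ^ n * l), (m + n); split.
  by rewrite nm_opl // (dy_scale m Hx E1) (Nat.add_comm m n) (dy_scale n Hy E2) nm_addn.
by rewrite plus_INR Rmult_plus_distr_r hf_scale (Nat.add_comm m n) hf_scale.
Qed.
Lemma dy_le x y d e : dy x d -> dy y e -> (d <= e)%R -> x ⊑ y.
Proof.
move=> [Hx [k [n [E1 ->]]]] [Hy [l [m [E2 ->]]]] L; apply: (nm_le_inv Hx Hy (@pow2 (m + n))).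
rewrite (dy_scale m Hx E1) (Nat.add_comm m n) (dy_scale n Hy E2); apply: nm_one; apply: INR_le.
apply: (Rmult_le_reg_r (hf (n + m))); first exact: hf_pos.
by rewrite hf_scale (Nat.add_comm n m) hf_scale.
Qed.
Lemma dy_half_oml x y d n : dy x d -> y ∈ RK -> nm (2 ^ n) y = one K -> dy (x ⊗ y) (d * hf n).
Proof.
move=> [Hx [k [m [E ->]]]] Hy Ey; split; first exact: oml_in.
exists k, (m + n); split; last by rewrite hfD; ring.
by rewrite Nat.pow_add_r nm_mulnA; nin; rewrite nm_oml // Ey mulC // mul1.
Qed.
Lemma half_powers_nm hh n : half_powers K hh -> ap hh (N n) ∈ RK /\ nm (2 ^ S n) (ap hh (N n)) = one K.
Proof.
move=> [Hf [H0 HS]]; have hR i : ap hh (N i) ∈ RK by apply: (ap_in Hf); exact: nat_omega.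
have H2 i : nm 2 (ap hh (N i)) = ap hh (N i) ⊕ ap hh (N i) by rewrite /= opl0.
split=> //; elim: n => [|n IH].
  by rewrite (H2 0) -(app_ap Hf empty_omega).
rewrite Nat.pow_succ_r' Nat.mul_comm nm_mulnA // H2; pose proof (nat_omega (M := M) n) as no; pose proof (succ_omega no) as sno.
by generalize (HS _ no); rewrite (app_ap Hf no) (app_ap Hf sno) => ->.
Qed.
Lemma half_powers_exist : exists hh, half_powers K hh.
Proof.
have [|y [Hy Ey]] := mulV (opl_in o0 o0).
  move=> E; case: (one_neq0 (r := K)); apply: (@le_antisym _ K); nin.
  by rewrite -E -{1}(add0 o0); apply: le_add.
have yy : y ⊕ y = one K by rewrite -Ey (mulC _ Hy) ?mulD ?(mulC Hy) ?mul1 //; nin.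
have HF : mul K ∈ funs (prod RK RK) RK by apply/funsE; exact: mul_fun.
have mE x : x ∈ RK -> x ⊗ y = ap (mul K) (opair x y) by move=> Hx; have P : opair x y ∈ prod RK RK by [apply/pair_prod]; exact: (app_ap HF P).
have [||hh [Hh [h0 hS]]] := nat_rec_fun (F := fun n x => ap (mul K) (opair x y)) _ Hy; first by df.
  by move=> n _ x Hx; rewrite -mE //; nin.
exists hh; split=> //; rewrite (app_ap Hh empty_omega) h0; split=> // n no; pose proof (succ_omega no) as sno.
pose proof (ap_in Hh no) as nR; rewrite (app_ap Hh no) (app_ap Hh sno) hS // -mE //.
by rewrite -mulD // yy mulC // mul1.
Qed.
End Dyadic.

(** * Comparison of an arbitrary Lebesgue measure with the constructed one *)

Section Uniqueness.
Context {M : structure} {HM : ZFCw M}.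
Notation N n := (nat_in M n).
Notation w := (omega M).
Hint Resolve DT_cone : df.
(** If [1 ≤ 0], then [-1] is nonnegative, and so is its square, which is 1. *)
Lemma one_ge0 (K : real_field M) : opair (zero K) (one K) ∈ le K.
Proof.
pose proof (zero_in K) as z0; pose proof (one_in K) as o0; case: (le_total z0 o0) => // L.
have [v [Hv Ev]] := addN o0; pose proof (le_add o0 z0 Hv L) as L'; rewrite Ev add0 // in L'.
pose proof (oml_in Hv Hv) as Hvv; generalize (le_mul Hv Hv L' L'); suff -> : app2 (mul K) v v = one K by [].
apply: (opl_cancel (K := K) (z := v)) => //; rewrite Ev addC //.
by rewrite -{1}(mul1 Hv) (mulC o0 Hv) -mulD // Ev oml0.
Qed.
Lemma range_appE S X x : S ∈ funs w X -> (x ∈ setof (fun x : M => ∃ n ∈ w, x = app S n) <-> exists n, x = ap S (N n)).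
Proof.
move=> HS; have -> : setof (fun x => ∃ n ∈ w, x = app S n) = img w (ap S).
  by congr setof; apply: pred_ext => z; split=> -[n [no ->]]; exists n; rewrite (app_ap HS no).
rewrite imgE; last by df.
by split=> [[n' [/omegaE [n ->] ->]]|[n ->]]; [exists n|exists (N n); split=> //; exact: nat_omega].
Qed.

Variables (K : real_field M) (mu : M).
Hypothesis LM : lebesgue_measure K mu.
Notation "x ⊕ y" := (app2 (add K) x y) (at level 50, left associativity).
Notation "x ⊑ y" := (opair x y ∈ le K) (at level 70).
Implicit Types (A B C F x y : M).
Lemma mu_in B : B ∈ borel M -> app mu B ∈ R K.
Proof. by move=> HB; pose proof (mu_fun LM) as HF; rewrite (app_ap HF HB); exact: (ap_in HF HB). Qed.
Lemma mu_series F : F ∈ funs w (borel M) -> disjoint_seq F -> exists T, T ∈ funs w (R K) /\ ap T (N 0) = zero K /\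
  (forall n, ap T (N (S n)) = ap T (N n) ⊕ app mu (ap F (N n))) /\ (forall n, ap T (N n) ⊑ app mu (seq_union F)) /\
  forall c, c ∈ R K -> (forall n, ap T (N n) ⊑ c) -> app mu (seq_union F) ⊑ c.
Proof.
move=> HF dis; have [T [HS [S0 [SE [[_ L1] L2]]]]] := mu_additive LM HF dis; exists T; split=> //.
split; first by rewrite -(app_ap HS empty_omega).
split=> [n|].
  pose proof (nat_omega (M := M) n) as no; generalize (SE _ no); pose proof (succ_omega no) as sno.
  by rewrite (app_ap HS no) (app_ap HS sno) (app_ap HF no).
split=> [n|c cR Hc]; first by apply: L1; apply/(range_appE _ HS); exists n.
by apply: L2 => // x /(range_appE _ HS) [n ->].
Qed.
Lemma mu_cup A B : A ∈ borel M -> B ∈ borel M -> (forall x, ~ (x ∈ A /\ x ∈ B)) -> app mu (cup A B) = app mu A ⊕ app mu B.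
Proof.
(* Finite additivity is obtained from the countable one by padding with empty sets; the partial sums
   are constant from the second on. *)
move=> HA HB dis; pose G n : M := ite (n = N 0) A (ite (n = N 1) B (empty M)).
have DG : DT (k := 1) (fun t : tup M 1 => G (hd t)) by rewrite /G; df.
have n10 k : N (S k) <> N 0 by move/nat_inj.
have G0 : G (N 0) = A by rewrite /G iteT.
have G1 : G (N 1) = B by rewrite /G iteF ?iteT.
have G2 k : G (N (S (S k))) = empty M by rewrite /G iteF ?iteF // => /nat_inj.
have GB n : G (N n) ∈ borel M by case: n => [|[|n]]; rewrite ?G0 ?G1 ?G2 //; exact: borel_empty.
have HF : lam w G ∈ funs w (borel M) by apply: lam_fun => // n' /omegaE [n ->].
have FE n : ap (lam w G) (N n) = G (N n) by rewrite ap_lam //; exact: nat_omega.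
have dG m n x : m < n -> ~ (x ∈ G (N m) /\ x ∈ G (N n)).
  case: n => [|[|n]] mn [H1]; rewrite ?G2 ?emptyE //; first lia.
  by have E : m = 0 by [lia]; subst m; rewrite G0 in H1; rewrite G1 => H2; apply: (dis x).
have DF : disjoint_seq (lam w G).
  move=> m' mo n' no mn x; rewrite (app_ap HF mo) (app_ap HF no); generalize (mo); move=> /omegaE [m Em]; generalize (no); move=> /omegaE [n En]; subst m' n'.
  rewrite !FE => -[H1 H2]; have [L|[L|E]] : m < n \/ n < m \/ m = n by lia.
      exact: (dG m n x L).
    exact: (dG n m x L).
  by apply: mn; rewrite E.
have UE : seq_union (lam w G) = cup A B.
  apply: ext => x; rewrite (seq_unionE _ HF) cupE; split=> [[n' [/omegaE [n ->]]]|[H|H]].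
      by rewrite FE; case: n => [|[|n]]; rewrite ?G0 ?G1 ?G2 ?emptyE; tauto.
    by exists (N 0); rewrite FE G0; split=> //; exact: nat_omega.
  by exists (N 1); rewrite FE G1; split=> //; exact: nat_omega.
have [T [HS [S0 [SE [L1 L2]]]]] := mu_series HF DF; rewrite UE in L1 L2; pose proof (mu_in HA) as mA; pose proof (mu_in HB) as mB.
have S1 : ap T (N 1) = app mu A by rewrite SE S0 FE G0 add0.
have S2 k : ap T (N (S (S k))) = app mu A ⊕ app mu B.
  elim: k => [|k IH]; first by rewrite SE S1 FE G1.
  by rewrite SE IH FE G2 (mu_empty LM) opl0 //; exact: opl_in.
apply: (@le_antisym _ K); [apply: mu_in; exact: borel_cup|exact: opl_in| |by rewrite -(S2 0)].
pose proof (mu_ge0 LM HB) as B0; pose proof (zero_in K) as z0.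
have AA : app mu A ⊑ app mu A ⊕ app mu B by rewrite -{1}(opl0 mA); apply: ole_add2 => //; exact: ole_refl.
apply: L2 => [|[|[|n]]]; first exact: opl_in.
- rewrite S0; apply: (@le_trans _ K _ _ (app mu A)) => //; [exact: opl_in|exact: (mu_ge0 LM HA)].
- by rewrite S1.
- by rewrite S2; apply: ole_refl; exact: opl_in.
Qed.
Lemma mu_mono A B : A ∈ borel M -> B ∈ borel M -> A ⊆ B -> app mu A ⊑ app mu B.
Proof.
move=> HA HB AB; pose proof (borel_diff HB HA) as HD; pose proof (mu_in HA) as mA.
have -> : B = cup A (diff B A).
  by apply: ext => x; rewrite cupE diffE; split=> [H|[/AB|[]]] //; case: (classic (x ∈ A)); tauto.
rewrite mu_cup //; last by move=> x; rewrite diffE; tauto.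
by rewrite -{1}(opl0 mA); apply: ole_add2 => //; [exact: zero_in|exact: mu_in|exact: ole_refl|exact: (mu_ge0 LM HD)].
Qed.
(** Every Lebesgue measure has on a cone a product of half powers as value. This is dyadic, so its
    value does not depend on the field. *)
Lemma mu_cone_dy s : s ∈ FS -> dy K (app mu (cone s)) (wt s).
Proof.
move=> sF; have [hh Hhh] := half_powers_exist (one_ge0 K); generalize (sF); move=> /FSE [n Hs].
pose proof (nat_omega (M := M) n) as no; have [p [Hp [p0 [pS <-]]]] := mu_cone LM Hhh (conj no Hs).
rewrite (app_ap Hp no) (wtE Hs); have : forall m, m <= n -> dy K (ap p (N m)) (wtn s m); last by apply.
elim=> [|m IH] mn; first by rewrite -(app_ap Hp empty_omega) p0; exact: dy_one.
have mi : N m ∈ N n by apply/nat_lt.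
generalize (ap_in Hs mi); move=> /omegaE [k Ek]; pose proof (nat_omega (M := M) m) as mo; pose proof (succ_omega mo) as smo; pose proof (nat_omega (M := M) k) as ko.
generalize (pS _ mi); rewrite (app_ap Hp mo) (app_ap Hp smo) (app_ap Hs mi) Ek (app_ap (proj1 Hhh) ko) => E.
rewrite [N _]/(succ (N m)) E /= (dgE Ek); have [hR hE] := half_powers_nm k Hhh.
by apply: (dy_half_oml _ hR hE); apply: IH; lia.
Qed.
Lemma mu_baire : app mu (baire M) = one K.
Proof.
have [hh Hhh] := half_powers_exist (one_ge0 K).
have e0 : fin_seq (empty M) (empty M).
  by split; [exact: empty_omega|apply/funsE; split=> [z /emptyE|x /emptyE]].
by have [p [Hp [p0 [_ E]]]] := mu_cone LM Hhh e0; rewrite -baire_cone -E.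
Qed.

Variables (K0 : real_field M) (phi : M -> Re).
Hypothesis EM : real_embedding K0 phi.
Variables (u h SS mS : M).
Hypotheses (Hu : bij u w FS) (Hh : h ∈ funs w (R K0)) (hE : forall n, phi (ap h (N n)) = hf (S n)).
Hypothesis SSP : ∀ c ∈ powerset w, ap SS c ∈ funs w (R K0) /\ forall n, phi (ap (ap SS c) (N n)) = psum (fc u c) n.
Hypothesis mSP : ∀ A ∈ powerset (baire M), lub (R K0) (le K0) (Low K0 u SS A) (ap mS A).
Notation om := (om phi mS).

(* If [om B] were positive, a cover of the complement of [B] of total weight less than 1 would give [mu B] a positive value. *)
Lemma null_om B : B ∈ borel M -> app mu B = zero K -> om B = 0%R.
Proof.
move=> HB mB; pose proof (borel_sub HB) as BB; pose proof (borel_compl HB) as Bc; pose proof (borel_sub Bc) as BcB.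
apply: Rle_antisym; last exact: (om_ge0 EM SSP mSP).
apply: Rnot_lt_le => P.
have oB : om (baire M) = 1%R by rewrite -baire_cone (om_cone EM Hu Hh hE SSP mSP e0F) wt0.
have oBc : (om (diff (baire M) B) < 1 - om B / 2)%R.
  have [_ /(_ (baire M) (fun x H => H))] := borel_meas EM Hu Hh hE SSP mSP HB.
  have -> : cap (baire M) B = B by apply: ext => x; rewrite capE; split=> [[]|H] //; split=> //; exact: BB.
  by rewrite oB; lra.
have [c [[cw Hc] Tc]] := om_near EM SSP mSP BcB oBc.
(* The totals of the cover stay below [1 - om B / 2], hence below [1 - hf m]; this leaves room for
   the positive dyadic [e] with value [hf (S m)]. *)
have [m Hm] := @hf_small (om B / 2) ltac:(lra).
pose U n : M := sep (cone (ap u n)) (fun _ => n ∈ c).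
have DU : DT (k := 1) (fun t : tup M 1 => U (hd t)) by rewrite /U; df.
have UE n x : x ∈ U n <-> x ∈ cone (ap u n) /\ n ∈ c by rewrite sepE; df.
have cB n : cone (ap u (N n)) ∈ borel M by apply: borel_open; apply: cone_open; exact: (uF Hu).
have Uin n : N n ∈ c -> U (N n) = cone (ap u (N n)) by move=> H; apply: ext => x; rewrite UE; tauto.
have Uout n : ~ N n ∈ c -> U (N n) = empty M by move=> H; apply: ext => x; rewrite UE emptyE; tauto.
have Ub n : U (N n) ∈ borel M by case: (classic (N n ∈ c)) => H; [rewrite Uin|rewrite Uout //; exact: borel_empty].
have Gb n : Gs U (N n) ∈ borel M.
  elim: n => [|n IH]; last by rewrite (GsS DU); apply: borel_cup.
  have -> : Gs U (N 0) = empty M by apply: ext => x; rewrite (GsE DU) emptyE; split=> // -[i [/emptyE]].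
  exact: borel_empty.
have DD : DT (k := 1) (fun t : tup M 1 => Ds U (hd t)) by rewrite /Ds /Gs; df.
have Db n : Ds U (N n) ∈ borel M by apply: borel_diff.
have HF : lam w (Ds U) ∈ funs w (borel M) by apply: lam_fun => // n' /omegaE [n ->].
have FE n : ap (lam w (Ds U)) (N n) = Ds U (N n) by rewrite ap_lam //; exact: nat_omega.
have dD i j x : i < j -> ~ (x ∈ Ds U (N i) /\ x ∈ Ds U (N j)).
  move=> ij [/diffE [H1 _] /diffE [_ H2]]; apply: H2; apply/(GsE DU); exists (N i); split=> //; exact/nat_lt.
have dis : disjoint_seq (lam w (Ds U)).
  move=> i' io j' jo ij x; rewrite (app_ap HF io) (app_ap HF jo); generalize (io); move=> /omegaE [i Ei]; generalize (jo); move=> /omegaE [j Ej]; subst i' j'.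
  rewrite !FE => -[H1 H2]; have [L|[L|E]] : i < j \/ j < i \/ i = j by lia.
      exact: (dD i j x L).
    exact: (dD j i x L).
  by apply: ij; rewrite E.
have [T [HS [S0 [SE [_ L2]]]]] := mu_series HF dis.
pose proof (borel_seq HF) as VB; set V := seq_union _ in VB L2.
have BV : diff (baire M) B ⊆ V.
  move=> x H; have [i' [ic ix]] := Hc x H; generalize (cw i' ic); move=> /omegaE [i Ei]; subst i'.
  have xU : x ∈ Gs U w by apply/(GsE DU); exists (N i); split; [exact: nat_omega|apply/UE; split=> //; apply/coneE; split=> //; exact: BcB].
  have [n Hn] := Ds_cover DU xU; apply/(seq_unionE _ HF); exists (N n); split; first exact: nat_omega.
  by rewrite FE.
have bound n : exists d, dy K d (psum (fc u c) n) /\ ap T (N n) ⊑ d.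
  elim: n => [|n [d [Hd L]]]; first by exists (zero K); rewrite S0; split; [exact: dy_zero|apply: ole_refl; exact: zero_in].
  pose proof (ap_in HS (nat_omega (M := M) n)) as SR; pose proof (mu_in (Db n)) as DR; rewrite SE FE /=.
  have dU : app mu (Ds U (N n)) ⊑ app mu (U (N n)) by apply: mu_mono => // x /diffE [].
  case: (classic (N n ∈ c)) => H.
    exists (d ⊕ app mu (cone (ap u (N n)))); rewrite (fc_in _ H); split; first by apply: dy_opl => //; apply: mu_cone_dy; exact: (uF Hu).
    by rewrite -(Uin n H); apply: ole_add2 => //; [case: Hd|exact: mu_in].
  exists d; rewrite (fc_out _ H) Rplus_0_r; split=> //; rewrite (Uout n H) (mu_empty LM) in dU.
  have dR : d ∈ R K by case: Hd.
  by rewrite -(opl0 dR); apply: ole_add2 => //; exact: zero_in.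
have [hh Hhh] := half_powers_exist (one_ge0 K); have [hR hE'] := half_powers_nm m Hhh; set e := ap hh (N m) in hR hE'.
have dye : dy K e (hf (S m)) by split=> //; exists 1, (S m); split; [rewrite hE' /= opl0 //; exact: one_in|rewrite /=; lra].
have [v [Hv Ev]] := addN hR; pose proof (one_in K) as o0; pose proof (zero_in K) as z0.
have Vle : app mu V ⊑ one K ⊕ v.
  apply: L2 => [|n]; first exact: opl_in.
  have [d [Hd L]] := bound n; have dR : d ∈ R K by case: Hd.
  pose proof (ap_in HS (nat_omega (M := M) n)) as SR; apply: (@le_trans _ K _ _ d) => //; first exact: opl_in.
  generalize (dy_le (one_ge0 K) (dy_opl Hd dye) (dy_one K)); generalize (Tc n); generalize (hfS m); have := hf_pos m => P1 P2 P3 /(_ ltac:(lra)).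
  by move=> /(le_add (opl_in dR hR) o0 Hv); rewrite -addA // Ev opl0.
(* The complement of [B] has measure 1 and lies in [V], whose measure is at most [1 - e]. So [e] is
   at most 0, although a multiple of it equals 1. *)
have oV : one K ⊑ one K ⊕ v.
  pose proof (mu_in VB) as Vin; apply: (@le_trans _ K _ _ (app mu V)) => //; first exact: opl_in.
  have -> : one K = app mu (diff (baire M) B); last exact: mu_mono.
  have E : cup B (diff (baire M) B) = baire M.
    by apply: ext => x; rewrite cupE diffE; split=> [[/BB|[]]|H] //; case: (classic (x ∈ B)); tauto.
  by rewrite -mu_baire -{1}E mu_cup //; [rewrite mB add0 //; exact: mu_in|move=> x; rewrite diffE; tauto].
generalize (le_add o0 (opl_in o0 Hv) hR oV); rewrite -addA // (addC Hv hR) Ev opl0 // => oe.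
have e0 : e = zero K.
  apply: (@le_antisym _ K) => //; last by apply: (dy_le (one_ge0 K) (dy_zero K) dye); apply: Rlt_le; exact: hf_pos.
  have [y [Hy Ey]] := addN o0; generalize (le_add (opl_in o0 hR) o0 Hy oe).
  by rewrite (addC o0 hR) -addA // Ey opl0.
by move: hE'; rewrite e0 nm_zero => E; case: (one_neq0 (r := K)).
Qed.
End Uniqueness.

(** * A Luzin sequence for the null ideal *)

Section NullLuzin.
Context {M : structure} {HM : ZFCw M}.
Notation N n := (nat_in M n).
Notation w := (omega M).
Notation o := (o1 M).
Hint Resolve DT_cone : df.
Implicit Types (A B F x : M).
Lemma sing_borel x : x ∈ baire M -> sing x ∈ borel M.
Proof.
move=> xB; have -> : sing x = diff (baire M) (diff (baire M) (sing x)).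
  by apply: ext => y; rewrite !diffE singE; split=> [->|[yB H]]; [tauto|apply: NNPP => E; apply: H].
apply: borel_compl; apply: borel_open; apply/openE; split=> [y /diffE []|y /diffE [yB yx]] //.
have [n Hn] : exists n, ap y (N n) <> ap x (N n).
  apply: NNPP => H; apply: yx; apply/singE; apply: (fun_ext yB xB) => i /omegaE [n ->].
  by apply: NNPP => K; apply: H; exists n.
have [H1 H2] := res_x (S n) yB; exists (lam (N (S n)) (ap y)); split; first by apply/FSE; exists (S n).
split=> // z /coneE [zB Hz]; apply/diffE; split=> // /singE E; apply: Hn; subst z.
have nn : N n ∈ N (S n) by apply/nat_lt.
by have [_ <-] := proj1 (fsub H1 xB) Hz; [rewrite ap_lam //; df|].
Qed.

Lemma luzin_N : CH M -> luzin_ideal (M := M) idealN.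
Proof.
move=> ch; have [K [phi EM]] := reals_exist (M := M); have [u Hu] := FS_enum (M := M); have [h [Hh hE]] := halves EM.
have [wf Hwf] := weight_fun EM Hh hE; have [SS SSP] := sums_fun EM Hu Hwf; have [mS mSP] := measure_fun EM Hu SSP.
pose null0 A := A ⊆ baire M /\ om phi mS A = 0%R.
have ge0 A : A ⊆ baire M -> (om phi mS A <= 0)%R -> null0 A.
  by move=> AB L; split=> //; apply: Rle_antisym => //; exact: (om_ge0 EM SSP mSP).
have null_U (F : M -> M) : DT (k := 1) (fun t : tup M 1 => F (hd t)) -> (∀ n ∈ w, null0 (F n)) -> null0 (union (img w F)).
  move=> D H; apply: ge0; first by move=> x /unionE [y []]; rewrite imgE // => -[n [/H [+ _] ->]]; apply.
  apply: (om_union EM Hh hE SSP mSP D) => [n /H [] //|n]; rewrite (psum_ext (g := fun _ => 0%R)) ?psum0; first lra.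
  by move=> i _; have [] := H _ (nat_omega i).
have null_e : null0 (empty M) by split=> [x /emptyE|] //; exact: (om_empty EM SSP mSP).
have null_1 x : x ∈ baire M -> null0 (sing x).
  move=> xB; have sB : sing x ⊆ baire M by move=> y /singE ->.
  apply: ge0 => //; apply: le_small => n; have [H1 H2] := res_x n xB; have sF : lam (N n) (ap x) ∈ FS by apply/FSE; exists n.
  generalize (om_cone_le EM Hu SSP mSP sF); rewrite (wtE H1); generalize (wtn_pos (lam (N n) (ap x)) n).
  suff : (om phi mS (sing x) <= om phi mS (cone (lam (N n) (ap x))))%R by lra.
  by apply: (om_mono EM SSP mSP); [move=> y /singE ->; apply/coneE|exact: cone_sub].
have zE A : A ⊆ baire M -> (ap mS A = zero K <-> om phi mS A = 0%R).
  move=> AB; have [_ AR] := mS_lub mSP AB; split=> [E|E]; first by rewrite /om E (phi_zero EM).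
  by apply: (emb_inj EM AR (zero_in K)); rewrite (phi_zero EM).
split=> [A AB cA|].
  have [F [HF [E H]]] := ctbl_seq AB cA.
  have Fb n : n ∈ w -> ap F n ∈ borel M.
    by move=> /H [x [xB [_ [->|->]]]]; [exact: borel_empty|exact: sing_borel].
  pose proof (fun_codom HF Fb) as HF'; have Ab : A ∈ borel M by rewrite E; apply: (borel_seq HF').
  exists K, (mu0 mS); split; first exact: (mu0_lebesgue EM Hu Hh hE SSP mSP).
  exists A; split=> //; split=> [x|] //; rewrite (mu0E mSP Ab); apply/zE => //; rewrite E (seq_unionU HF).
  by apply: (proj2 (null_U (ap F) _ _)) => [|n /H [x [xB [_ [->|->]]]]]; [df|exact: null_e|exact: null_1].
(* [c] codes the intersection over [n] of the unions of the cones numbered by [ap c n]; [CC] keeps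
   the codes of null sets. By CH there are at most ω1 codes. *)
pose G c := sep (baire M) (fun x => ∀ n ∈ w, ∃ i ∈ ap c n, ap u i ⊆ x).
have DG : DT (k := 1) (fun t : tup M 1 => G (hd t)) by rewrite /G; df.
have GE c x : x ∈ G c <-> x ∈ baire M /\ ∀ n ∈ w, ∃ i ∈ ap c n, ap u i ⊆ x by rewrite sepE; df.
have GB c : G c ⊆ baire M by move=> x /GE [].
pose CC := sep (funs w (powerset w)) (fun c => ap mS (G c) = zero K).
have CE c : c ∈ CC <-> c ∈ funs w (powerset w) /\ null0 (G c).
  by rewrite sepE; [rewrite zE //; split=> -[? H]; split=> //; case: H|df].
have [||||||y [Hy HJ]] := luzin_sequence (J := null0) (T := img CC G).
- move=> S cS HS; case: (classic (ne S)) => [nS|/ne_not E]; last first.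
    have -> : union S = empty M; last exact: null_e.
    by apply: ext => x; rewrite unionE E emptyE; split=> // -[z [/emptyE]].
  have [v [Hv vs]] := surj_of_lec nS cS.
  have -> : union S = union (img w (ap v)).
    apply: ext => x; rewrite !unionE; split=> [[z [/vs [n [no <-]] H]]|[z []]].
      by exists (ap v n); split=> //; rewrite imgE; [exists n|df].
    by rewrite imgE; [move=> [n [no ->]] H; exists (ap v n); split=> //; exact: (ap_in Hv)|df].
  by apply: null_U => [|n no]; [df|apply: HS; exact: (ap_in Hv)].
- exact: null_1.
- move=> X [XB X0] BX; have E : X = baire M by apply: ext => x; split=> [/XB|/BX].
  by move: X0; rewrite E -baire_cone (om_cone EM Hu Hh hE SSP mSP e0F) wt0; lra.
- exists (G (lam w (fun _ => empty M))); rewrite imgE //; exists (lam w (fun _ => empty M)); split=> //; apply/CE.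
  split; first by apply: lam_fun => [|n _]; [df|apply/powersetE => z /emptyE].
  have -> : G (lam w (fun _ => empty M)) = empty M; last exact: null_e.
  apply: ext => x; rewrite GE emptyE; split=> // -[_ /(_ _ empty_omega) [i []]].
  by rewrite ap_lam ?emptyE //; [df|exact: empty_omega].
- apply: (lec_trans (lec_img _ DG)); apply: (lec_trans (b := funs w (powerset w))); first by apply: lec_sub => c /CE [].
  by apply: lec_trans ch; apply: (lec_funs_powk inf_omega); exact: lec_refl.
- by move=> X; rewrite imgE // => -[c [/CE [_ H] ->]].
- exists y; split=> // A [K' [mu [LM [B [HB [AB muB]]]]]]; apply: HJ; pose proof (borel_sub HB) as BB.
  pose proof (null_om LM EM Hu Hh hE SSP mSP HB muB) as oB.
  have hR n : ap h (N n) ∈ R K by apply: (ap_in Hh); exact: nat_omega.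
  have [||C HC] := choice_fam (a := w) (Y := fun n => sep (powerset w) (fun c => covers u c B /\ upper K SS c (ap h n))).
      by rewrite /covers /upper; df.
    move=> n' /omegaE [n ->]; have [|c [Hc Tc]] := om_near EM SSP mSP (r := hf (S n)) BB; first by rewrite oB; exact: hf_pos.
    exists c; rewrite sepE; last by rewrite /covers /upper; df.
    split; first by apply/powersetE; case: Hc.
    by split=> //; apply/(upperE EM SSP _ (hR n)); [case: Hc|rewrite hE].
  have CnE n : n ∈ w -> ap C n ∈ powerset w /\ covers u (ap C n) B /\ upper K SS (ap C n) (ap h n).
    by move=> /HC; rewrite sepE //; rewrite /covers /upper; df.
  have Hc : lam w (ap C) ∈ funs w (powerset w) by apply: lam_fun; [df|move=> n /CnE []].
  exists (G (lam w (ap C))); split; last first.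
    move=> x /AB xB; apply/GE; split; first exact: BB.
    by move=> n no; rewrite ap_lam //; [have [_ [[_ H] _]] := CnE n no; exact: H|df].
  rewrite imgE //; exists (lam w (ap C)); split=> //; apply/CE; split=> //; apply: ge0 => //.
  apply: le_small => n; pose proof (nat_omega (M := M) n) as no; have [Pn [[cw Hcov] Hup]] := CnE _ no.
  pose proof (proj1 (upperE EM SSP cw (hR n)) Hup) as T; rewrite hE hfS in T.
  apply: (Rle_trans _ (hf n / 2)); last by generalize (hf_pos n); lra.
  apply: (om_cover EM SSP mSP (c := ap C (N n))) => //; split=> // x /GE [_ /(_ _ no)]; by rewrite ap_lam //; df.
Qed.
End NullLuzin.
Lemma luzin_ideals {M : structure} {HM : ZFCw M} : CH M -> forall I, luzin_ideal (M := M) I.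
Proof. by move=> ch I; case: I; [exact: luzin_N|apply: luzin_MK|apply: luzin_MK]. Qed.

(** One statement for all items: [K] is either a regular cardinal or the one-element ordinal. *)
Lemma extension_numbers (V : structure) (K L : V) (I : ideal_name) : countable_transitive_model V -> GCH V ->
  ordinal K -> regular_cardinal L -> aleph2 V ∈ L -> K ⊆ L -> empty V ∈ K ->
  exists W : forcing_extension V, ZFCw W /\
   (forall x y, x ∈ y -> incl W x ∈ incl W y) /\
   (succ_card (continuum W) = incl W (aleph2 V) /\ exp2 (continuum W) = incl W L) /\
   (forall r, r <> inStar -> dnum W r I = incl W L) /\
   (regular_cardinal K -> aleph2 V ∈ K -> (forall r, r <> inStar -> bnum W r I = incl W K) /\
     (K = L -> bnum W inStar I = incl W K)) /\
   (K = sing (empty V) -> bnum W neqStar I = succ_card (continuum W)).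
Proof.
move=> C gch HK rL o2L KL K0; pose proof (ctm_ZFCw C) as HV.
have tr X : ordinal X -> aleph2 V ∈ X -> o1 V ∈ X by move=> HX o2X; apply: (ord_tr HX o2X); apply: succ_card_gt; exact: ord_o1.
pose proof (tr _ (inf_ord (proj1 rL)) o2L) as oL.
have [W [[HW ch] [[E2 FL] [[cK im] [c [Hc [hs [H1 H2]]]]]]]] := extension_facts C gch HK rL oL KL K0.
exists W; pose proof (luzin_ideals (M := W) ch I) as LI; pose proof (cK _ rL oL) as CL.
split=> //; split=> //; rewrite (continuum_o1 ch).
split; first by split=> //; rewrite -(continuum_o1 ch); apply: exp2_continuum => //; apply: (hit_RF ch LI Hc).
split; first by move=> r Nr; apply: (dnum_eq ch LI Hc).
split=> [rK o2K|EK].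
  pose proof (tr _ HK o2K) as oK; have [cs hf] := H1 rK oK; pose proof (cK _ rK oK) as CK.
  split=> [r Nr|E]; first by apply: bnum_eq => //; apply: (hit_unbounded ch LI Hc).
  (* The escaping family does not apply to slaloms. The set of all functions is unbounded and has
     size at most [L], which gives the upper bound when [K = L]. *)
  apply: bnum_eq => //; exists (funs (baire W) (baire W)); split; first exact: full_unbounded.
  by rewrite E; apply: lec_trans FL; exact: (proj1 (lec_RF ch)).
have o2 : is_cardinal (succ_card (o1 W)) by apply: succ_card_cardinal; exact: ord_o1.
(* With one row the lower bound comes from CH alone, and the first ℵ2 generic functions give the
   upper bound. *)
apply: bnum_eq => //; first exact: cap_o2.
rewrite E2; apply: (hit_unbounded ch LI Hc) => //; apply: H2 => // x; exact: (ord_tr (inf_ord (proj1 rL)) o2L).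
Qed.

Theorem theorem1p4 (V : structure) (V_ctm : countable_transitive_model V)
  (V_GCH : GCH V) (kappa lambda : V)
  (kappa_regular : regular_cardinal kappa)
  (lambda_regular : regular_cardinal lambda)
  (aleph2_lt_kappa : aleph2 V ≺ kappa) (kappa_le_lambda : kappa ≼ lambda)
  (I : ideal_name) :
  (exists W : forcing_extension V,
     let c := continuum W in let k := incl W kappa in
     succ_card c = bnum W neqStar I /\ bnum W neqStar I ≺ dnum W neqStar I /\
     dnum W neqStar I = k /\ k = exp2 c)
  /\
  (exists W : forcing_extension V,
     let c := continuum W in let k := incl W kappa in
     succ_card c ≺ bnum W leStar I /\ bnum W leStar I = dnum W neqStar I /\
     dnum W neqStar I = k /\ k = exp2 c)
  /\
  (kappa ≺ lambda ->
   exists W : forcing_extension V,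
     let c := continuum W in let k := incl W kappa in let l := incl W lambda in
     succ_card c ≺ bnum W leStar I /\ bnum W leStar I = k /\
     k ≺ dnum W leStar I /\ dnum W leStar I = l /\ l = exp2 c)
  /\
  (exists W : forcing_extension V,
     let c := continuum W in let k := incl W kappa in
     succ_card c ≺ bnum W inStar I /\ bnum W inStar I = k /\ k = exp2 c).
Proof.
pose proof (ctm_ZFCw V_ctm) as HV.
pose proof (inf_ord (proj1 kappa_regular)) as Ok.
have kl : kappa ⊆ lambda by apply/(ord_sub Ok (inf_ord (proj1 lambda_regular))).
have k0 : empty V ∈ kappa by apply: (inf_omega_sub (proj1 kappa_regular)); exact: empty_omega.
split; last split; last split.
- have O1 : ordinal (sing (empty V)) by split=> [x /singE ->|x /singE ->] y /emptyE.
  have [||W [HW [im [[E2 E] [Hd [_ Hb]]]]]] := extension_numbers I V_ctm V_GCH O1 kappa_regular aleph2_lt_kappa.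
      by move=> x /singE ->.
    exact/singE.
  by exists W => /=; rewrite E Hd // Hb // E2; split=> //; split=> //; apply: im.
- have [|W [HW [im [[E2 E] [Hd [Hb _]]]]]] := extension_numbers I V_ctm V_GCH Ok kappa_regular aleph2_lt_kappa _ k0.
    by move=> x.
  by have [Hb1 _] := Hb kappa_regular aleph2_lt_kappa; exists W => /=; rewrite E Hd // Hb1 // E2; split=> //; apply: im.
- move=> k_lt_l; have a2l : aleph2 V ∈ lambda by apply: kl.
  have [W [HW [im [[E2 E] [Hd [Hb _]]]]]] := extension_numbers I V_ctm V_GCH Ok lambda_regular a2l kl k0.
  have [Hb1 _] := Hb kappa_regular aleph2_lt_kappa; exists W => /=; rewrite E Hd // Hb1 // E2.
  by split; [apply: im|split=> //; split; [apply: im|]].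
- have [|W [HW [im [[E2 E] [Hd [Hb _]]]]]] := extension_numbers I V_ctm V_GCH Ok kappa_regular aleph2_lt_kappa _ k0.
    by move=> x.
  by have [_ Hb1] := Hb kappa_regular aleph2_lt_kappa; exists W => /=; rewrite Hb1 // E2 E; split=> //; apply: im.
Qed.
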